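(* Consider the controlled finite-dimensional system, the objective $J$, the cost $K$, the bound $\bar K>0$ and the constant $q=\hat X/\mathbb{E}[Y_n]$ (which, with $W=0$, equals $\hat Q/(\underline{Q}+\mathbb{E}[Y_n])>0$) described in the context. Consider the problem of minimizing $J$ over all couples $(\rho,u)\in\mathbb{R}^2$ satisfying $\rho>0$, $\rho>u$, the cost constraint $K\le \bar K$, and the constraint $\frac{\rho}{\rho-u}=q$. For $h>0$ let $J(h)$ denote the value of $J$ at the unique couple with $\rho-u=h$ and $\rho/(\rho-u)=q$, that is $(\rho,u)=(qh,(q-1)h)$, and let $J(0)=\lim_{h\to+0}J(h)$. Then: (a) If $q=1$, then $\min J=\mathrm{Var}[Y_n]$, and the minimizing couples $(\rho,u)$ are those with $u=0$ and arbitrary $\rho>0$. (b) If $q>1$, then $\inf_{h=\rho-u}J(h)=J(0)=\mathrm{Var}[Y_n]$. A minimizing couple does not exist, but $\lim_{h\to+0}J(h)=\mathrm{Var}[Y_n]$. (c) If $0<q<1$, then $\inf_{h=\rho-u}J(h)=J(\bar h)$, where $\bar h>0$ is the unique positive solution of $$(1-q)^2\,\mathrm{Var}[Y_n]\left(\sum_{i=1}^n\frac{c_i}{r_i}\right)^{-1}\bar h^2\sum_{i=1}^n\frac{c_i}{r_i}\frac{r_iD}{r_iD+\bar h}=\bar K .$$ The minimizing couple $(\rho,u)$ satisfies $q=\frac{\rho}{\rho-u}$ and $\rho-u=\bar h$, and the minimum of $J$ is achieved by $(\rho,u)=(q\bar h,-(1-q)\bar h)$.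
   Context: Parameters: $n\in\mathbb{N}$; $0<r_1<\dots<r_n$; $c_1,\dots,c_n>0$ with $\sum_{i=1}^n c_i=1$; $A>0$, $B\ge 0$; $\underline{Q}\ge 0$; a nonzero Lévy measure $\nu$ concentrated on $(0,+\infty)$ with $\int_{(0,+\infty)}\min\{1,z\}\,\nu(dz)<+\infty$ and $M_k=\int_{(0,+\infty)}z^k\nu(dz)<+\infty$ for $k=1,2$; it is assumed that $BM_1<1$, and $D=1-BM_1\in(0,1]$. Inflow: $\mu_1,\dots,\mu_n$ are mutually independent Poisson random measures with compensator $dw\times\nu(dz)\times dt$ on (mark, jump size, time) with time in $\mathbb{R}$, and $Y^{(r_i)}$ is the stationary càdlàg solution of $$dY_t^{(r_i)}=-r_iY_t^{(r_i)}dt+\int_0^{c_iA+r_iBY_{t-}^{(r_i)}}\int_0^\infty z\,\mu_i(dw,dz,dt),\quad t\in\mathbb{R},\ 1\le i\le n.$$ Put $Y_{n,t}=\sum_{i=1}^nY_t^{(r_i)}$. Its stationary mean and variance are denoted $\mathbb{E}[Y_n]$ and $\mathrm{Var}[Y_n]$; they are $\mathbb{E}[Y_n]=\frac{AM_1}{D}\sum_{i=1}^n\frac{c_i}{r_i}$ and $\mathrm{Var}[Y_n]=\frac{AM_2}{2D^2}\sum_{i=1}^n\frac{c_i}{r_i}$. Controlled discharge: for real $\rho,u,W$ with $\rho>0$, $\rho>u$, the discharge is $Q_t=C_t+\underline{Q}+Y_{n,t}$ with control $C_t=u\int_{-\infty}^te^{-\rho(t-s)}(Q_s+W)\,ds$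 (stationary regime); here $W=0$. The shifted process $X_t=Q_t-\frac{\rho}{\rho-u}\left(\underline{Q}+\frac{uW}{\rho}\right)$ satisfies $X_t=u\int_{-\infty}^te^{-\rho(t-s)}X_s\,ds+Y_{n,t}$ and $dX_t=c_t\,dt+dY_{n,t}$ with control rate $c_t=-(\rho-u)X_t+\rho Y_{n,t}$. Objective and cost: for a target discharge $\hat Q>0$, $$J=\limsup_{T\to+\infty}\frac1T\mathbb{E}\left[\int_0^T(Q_t-\hat Q)^2dt\right]=\limsup_{T\to+\infty}\frac1T\mathbb{E}\left[\int_0^T(X_t-\hat X)^2dt\right],\quad K=\limsup_{T\to+\infty}\frac1T\mathbb{E}\left[\int_0^Tc_t^2dt\right],$$ where $\hat X=\hat Q-\frac{\rho}{\rho-u}\left(\underline{Q}+\frac{uW}{\rho}\right)$. The target discharge is required in the mean, $\mathbb{E}[Q_t]=\hat Q$, equivalently $\mathbb{E}[X_t]=\hat X=\frac{\rho}{\rho-u}\mathbb{E}[Y_n]$, i.e. $\frac{\rho}{\rho-u}=q:=\hat X/\mathbb{E}[Y_n]$. *)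

(* Defs.v *)
From HB Require Import structures.
From mathcomp Require Import all_boot all_order all_algebra.
From mathcomp Require Import all_classical all_reals all_analysis.
From mathcomp Require Import measurable_realfun.

Set Implicit Arguments.
Unset Strict Implicit.
Unset Printing Implicit Defensive.

Import Order.TTheory GRing.Theory Num.Theory.
Import numFieldNormedType.Exports.

Local Open Scope classical_set_scope.
Local Open Scope ring_scope.

Section Processes.
Context {d : measure_display} {T : measurableType d} {R : realType}.

Definition cadlag (x : R -> R) : Prop :=
  forall t, x s @[s --> t^'+] --> x t /\ cvg (x s @[s --> t^'-]).

(* Equality on finite-dimensional cylinders with measurable sides determines
   all finite-dimensional distributions. *)
Definition stationary_process (P : probability T R) (X : R -> {RV P >-> R}) :
    Prop :=
  forall (k : nat) (t : 'I_k -> R) (S : 'I_k -> set R) (h : R),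
    (forall j, measurable (S j)) ->
    P (\bigcap_j (X (t j + h) @^-1` S j)) = P (\bigcap_j (X (t j) @^-1` S j)).

Definition mutually_independent (P : probability T R) (I : finType)
    (F : I -> set (set T)) : Prop :=
  forall (J : {set I}) (E : I -> set T),
    (forall i, i \in J -> F i (E i)) ->
    P (\bigcap_(i in [set` J]) E i) = (\prod_(i in J) P (E i))%E.

End Processes.

Section RandomMeasures.
Context {d d' : measure_display} {T : measurableType d} {U : measurableType d'}
  {R : realType}.

(* The Poisson weights are written out because [poisson_pmf 0] is constantly 1,
   whereas the convention 0 ^+ 0 = 1 gives the Dirac mass at 0. *)
Definition poisson_random_measure (P : probability T R)
    (mu : T -> {measure set U -> \bar R}) (Lambda : set U -> \bar R) : Prop :=
  [/\ forall A, measurable A -> measurable_fun setT (fun w => mu w A),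
      forall A (k : nat), measurable A -> (Lambda A < +oo)%E ->
        P [set w | mu w A = k%:R%:E] =
        (expR (- fine (Lambda A)) * fine (Lambda A) ^+ k / k`!%:R)%:E,
      forall A, measurable A -> Lambda A = +oo%E ->
        P [set w | mu w A = +oo%E] = 1%E
    & forall (k : nat) (A : 'I_k -> set U),
        (forall j, measurable (A j)) -> trivIset setT A ->
        mutually_independent P (fun j =>
          [set (fun w => mu w (A j)) @^-1` S | S in measurable])].

Definition random_measure_sigma (mu : T -> {measure set U -> \bar R})
    (region : set U) : set (set T) :=
  <<s [set E | exists (A : set U) (S : set (\bar R)),
         [/\ measurable A, A `<=` region, measurable S
           & E = (fun w => mu w A) @^-1` S]] >>.

End RandomMeasures.

Section Model.
Context {d : measure_display} {T : measurableType d} {R : realType}.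
Local Notation leb := (@lebesgue_measure R).

(* A point ((w, z), t) consists of a mark w > 0, a jump size z and a time t; the
   intensity is dw x nu(dz) x dt. A measure on (0, +oo) that integrates min(1, z)
   is automatically sigma-finite, which the product construction needs. *)
Definition jump_intensity (nu : {sigma_finite_measure set R -> \bar R})
    (S : set (R * R * R)) : \bar R :=
  ((leb \x nu) \x leb)%E (S `&` [set x | 0 < x.1.1]).

Definition moment (nu : {sigma_finite_measure set R -> \bar R}) (k : nat) : R :=
  \int[nu]_(z in `]0, +oo[) z ^+ k.

Definition jump_region (r c A B : R) (y : R -> R) (s t : R) :
    set (R * R * R) :=
  [set x | [/\ 0 < x.1.1 <= c * A + r * B * lim (y v @[v --> (x.2)^'-]),
               0 < x.1.2 & s < x.2 <= t]].

(* [Y^(r)] : a stationary cadlag process, adapted to the P-completed past of the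
   driving measure, satisfying
   Y_t - Y_s = - r int_s^t Y_v dv
               + int_s^t int_0^(c A + r B Y_(v-)) int_0^oo z mu(dw, dz, dv). *)
Definition inflow_solution (P : probability T R)
    (mu : T -> {measure set (R * R * R) -> \bar R}) (r c A B : R)
    (Y : R -> {RV P >-> R}) : Prop :=
  [/\ stationary_process Y,
      forall w, cadlag (fun t => Y t w),
      forall t (S : set R), measurable S ->
        exists2 E, random_measure_sigma mu [set x | x.2 <= t] E
          & P.-negligible ((Y t @^-1` S) `+` E)
    & {ae P, forall w, forall s t : R, s <= t ->
        (Y t w - Y s w + r * \int[leb]_(v in `[s, t]) Y v w)%:E =
        (\int[mu w]_(x in jump_region r c A B (fun v => Y v w) s t)
           (x.1.2)%:E)%E}].

Definition total_inflow (P : probability T R) (n : nat)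
    (Y : 'I_n -> R -> {RV P >-> R}) (t : R) (w : T) : R :=
  \sum_(i < n) Y i t w.

(* Q = C + Qlow + Yn with C_t = u int_(-oo)^t e^(-rho (t - s)) (Q_s + W) ds, in
   the stationary regime: for u > 0 the integral equation alone also admits the
   solutions Q_t + k e^(-(rho - u) t). *)
Definition controlled_discharge (P : probability T R) (Yn : R -> T -> R)
    (Qlow W rho u : R) (Q : R -> {RV P >-> R}) : Prop :=
  [/\ stationary_process Q,
      forall w, cadlag (fun t => Q t w)
    & {ae P, forall w, forall t : R,
        leb.-integrable `]-oo, t]
          (fun s => (expR (- rho * (t - s)) * (Q s w + W))%:E) /\
        Q t w =
          u * (\int[leb]_(s in `]-oo, t]) (expR (- rho * (t - s)) * (Q s w + W)))
          + Qlow + Yn t w}].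

Definition discharge_shift (Qlow W rho u : R) : R :=
  rho / (rho - u) * (Qlow + u * W / rho).

Definition shifted_discharge (Qlow W rho u : R) (Q : R -> T -> R) (t : R)
    (w : T) : R :=
  Q t w - discharge_shift Qlow W rho u.

Definition control_rate (Yn : R -> T -> R) (Qlow W rho u : R) (Q : R -> T -> R)
    (t : R) (w : T) : R :=
  - (rho - u) * shifted_discharge Qlow W rho u Q t w + rho * Yn t w.

Definition long_run_mean (P : probability T R) (f : R -> T -> R) : \bar R :=
  limf_esup (fun H : R =>
    ((H^-1)%:E * \int[P]_w \int[leb]_(t in `[0%R, H]) (f t w)%:E)%E) +oo%R.

Definition objective (P : probability T R) (Qhat : R) (Q : R -> T -> R) :
    \bar R :=
  long_run_mean P (fun t w => (Q t w - Qhat) ^+ 2).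

Definition control_cost (P : probability T R) (Yn : R -> T -> R)
    (Qlow W rho u : R) (Q : R -> T -> R) : \bar R :=
  long_run_mean P (fun t w => control_rate Yn Qlow W rho u Q t w ^+ 2).

End Model.

Section Optimization.
Context {R : realType}.

Definition feasible_couples (K : R -> R -> \bar R) (Kbar q : R) : set (R * R) :=
  [set p | [/\ 0 < p.1, p.2 < p.1, (K p.1 p.2 <= Kbar%:E)%E
             & p.1 / (p.1 - p.2) = q]].

Definition minimizing_couple (J : R -> R -> \bar R) (F : set (R * R))
    (p : R * R) : Prop :=
  F p /\ forall p', F p' -> (J p.1 p.2 <= J p'.1 p'.2)%E.

(* With W = 0, the constant Qhat / (Qlow + EY) is the ratio Xhat / EY, where
   Xhat := Qhat - discharge_shift Qlow 0 rho u, for exactly those couples that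
   satisfy the constraint in the mean. *)
Lemma target_ratioE (Qhat Qlow EY rho u : R) :
  0 <= Qlow -> 0 < EY -> 0 < rho -> u < rho ->
  (rho / (rho - u) = (Qhat - discharge_shift Qlow 0 rho u) / EY) <->
  (rho / (rho - u) = Qhat / (Qlow + EY)).
Proof.
move=> Q0 E0 rho0 urho; rewrite /discharge_shift mulr0 mul0r addr0.
have EN : EY != 0 by rewrite gt_eqF.
have SN : Qlow + EY != 0 by rewrite gt_eqF// ltr_wpDl.
set a := rho / (rho - u); split=> h.
- apply: (canRL (mulfK SN)); move/(canLR (divfK EN)): h => h.
  by rewrite mulrDr h addrC subrK.
- apply: (canRL (mulfK EN)); move/(canLR (divfK SN)): h => <-.
  by rewrite mulrDr addrAC subrr add0r.
Qed.

End Optimization.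

(* Main.v *)
(* Campbell's formula, extended from deterministic boxes to predictable regions
   by a lambda-system argument, turns the inflow equation into
   E[Z Y_t] = e^(-rD(t-s)) E[Z Y_s] + m (1 - e^(-rD(t-s))) E[Z] for Z in the past
   of s; this gives the mean m and the autocovariance V e^(-rD|t-s|). The variance
   V comes from the stationary Laplace transform: over one Euler step the jump
   level is frozen, so that E[Y e^(-lY)] r (l - B psi(l)) = c A psi(l) E[e^(-lY)],
   and a second-order expansion at l = 0 yields E[Y^2].
   Stationarity rules out the homogeneous solutions of the control equation, so
   that C_t = u int_(-oo)^t e^(-h(t-v)) (Qlow + Y_v) dv almost surely, h = rho - u.
   With a_i = r_i D this makes both long-run means explicit:
   J = sum V_i (1 + (q^2 - 1) h / (h + a_i)),
   K = (q - 1)^2 h^2 sum V_i a_i / (a_i + h).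
   J is monotone in h according to the sign of q - 1, and K increases from 0 to
   infinity. *)
Require Import Defs.
From HB Require Import structures.
From mathcomp Require Import all_boot all_order all_algebra.
From mathcomp Require Import all_classical all_reals all_analysis.
From mathcomp Require Import measurable_realfun ring lra.
Import Order.TTheory GRing.Theory Num.Theory.
Import numFieldNormedType.Exports.
Local Open Scope classical_set_scope.
Local Open Scope ring_scope.

Set Implicit Arguments.
Unset Strict Implicit.
Unset Printing Implicit Defensive.

(** Neither nonnegativity nor any moment of [Y] or [Q] is part of the hypotheses, and this shapes
    the proof. Nonnegativity comes from the pathwise bound Y_t >= e^(-r(t-s)) Y_s and stationarity
    in the remote past; it holds almost surely only, so moments are stated for |Y|, whose integrals
    make sense without finiteness. Finiteness of the mean needs two truncations: stopping at a
    level, with a Gronwall bound free of that level, propagates integrability forward, and starting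
    from {|Y_0| <= N} the conditional mean forgets N after a long time. For the second moment an
    argument on Y^2 would presuppose what it is to show; the Laplace transform is bounded, and one
    Euler step of length h has mean error O(h^2), which survives division by h. Freezing the level
    needs a constant, hence a partition of the values of Y_0 into cells of width h. [Q] comes with
    no moment either, so its homogeneous part is killed in probability, through the bounded gauge 1
    - e^(-|x|). Adaptedness holds up to null sets, so independence is carried through null
    completions. *)

(** * Independence through lambda-systems and null completions *)

Section pi_lambda_independence.
Context d (T : measurableType d) (R : realType) (P : probability T R).
Implicit Types (G : set (set T)) (E F H : set T).

Lemma probability_setD (A B : set T) : measurable A -> measurable B ->
  P (A `\` B) = (P A - P (A `&` B))%E.
Proof.
by move=> mA mB; apply: measureD; rewrite // (le_lt_trans (probability_le1 P mA)) ?ltry.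
Qed.

(** Holding [H] fixed makes this family a lambda-system. A sigma-algebra is independent of a random
    variable as soon as it lies in this family for every preimage [H]. *)
Definition indep_of (H : set T) : set (set T) :=
  [set E | measurable E /\ P (E `&` H) = (P E * P H)%E].

Lemma lambda_system_indep_of H : measurable H -> lambda_system setT (indep_of H).
Proof.
move=> mH; split => //.
- split; first exact: measurableT.
  by rewrite setTI probability_setT mul1e.
- move=> A B BA [mA PA] [mB PB]; split; first exact: measurableD.
  have -> : (A `\` B) `&` H = (A `&` H) `\` (B `&` H).
    apply/seteqP; split => x /=; first by move=> [[Ax nBx] Hx]; split => // -[].
    by move=> [[Ax Hx] nBH]; split => //; split => // Bx; exact: nBH.
  have mAH := measurableI _ _ mA mH; have mBH := measurableI _ _ mB mH.
  rewrite probability_setD // probability_setD //.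
  have -> : (A `&` H) `&` (B `&` H) = B `&` H.
    by rewrite setIACA setIid (setIidr BA).
  rewrite (setIidr BA) PA PB muleBl//.
    by rewrite fin_num_measure.
  by rewrite fin_num_adde_defl// fin_numN fin_num_measure.
- move=> F ndF FP; split.
    by apply: bigcup_measurable => k _; have [] := FP k.
  have mF k : measurable (F k) by have [] := FP k.
  have c1 : P (F n `&` H) @[n --> \oo] --> P (\bigcup_n F n `&` H).
    rewrite setI_bigcupl; apply: nondecreasing_cvg_mu.
    + by move=> k; exact: measurableI.
    + by apply: bigcup_measurable => k _; exact: measurableI.
    + by move=> m n mn; apply/subsetPset; apply: setSI; apply/subsetPset; exact: ndF.
  have c2 : (P (F n) * P H)%E @[n --> \oo] --> (P (\bigcup_n F n) * P H)%E.
    apply: cvgeZr; first by rewrite fin_num_measure.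
    apply: nondecreasing_cvg_mu => //; exact: bigcup_measurable.
  have e : (fun n => P (F n `&` H)) = (fun n => (P (F n) * P H)%E).
    by apply/funext => k; have [] := FP k.
  rewrite e in c1.
  exact: (cvg_unique _ c1 c2).
Qed.

Lemma indep_of_sigma H G : measurable H -> setI_closed G ->
  G `<=` indep_of H -> <<s G >> `<=` indep_of H.
Proof.
by move=> mH IG GH; apply: lambda_system_subset => //; exact: lambda_system_indep_of.
Qed.

(** The completion is taken inside the measurable sets of [T], so that [P] still applies to its
    members. Solutions are adapted to the past only up to null sets, hence histories have this
    form. *)
Definition null_completion (G : set (set T)) : set (set T) :=
  [set F | measurable F /\ exists2 E, G E & P.-negligible (F `+` E)].

Lemma negligible_symdiffE (A B : set T) : measurable A -> measurable B ->
  P.-negligible (A `+` B) -> P A = P B.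
Proof.
have hlp (X Y : set T) : measurable X -> measurable Y ->
    P.-negligible (X `+` Y) -> (P X <= P Y)%E.
  move=> mX mY XY; apply: (@le_trans _ _ (P (Y `|` (X `+` Y)))).
    apply: le_measure; rewrite ?inE//.
      by apply: measurableU => //; apply: measurableU; exact: measurableD.
    by move=> x Xx; case: (pselect (Y x)) => [|nY]; [left|right; left].
  rewrite measureU0 //; first by apply: measurableU; exact: measurableD.
  by apply/negligibleP => //; apply: measurableU; exact: measurableD.
move=> mA mB AB; apply/eqP; rewrite eq_le; apply/andP; split; apply: hlp => //.
by rewrite setYC.
Qed.

(** Changing an event on a null set alters neither side of the product formula. *)
Lemma indep_of_completion H G : measurable H -> G `<=` indep_of H ->
  null_completion G `<=` indep_of H.
Proof.
move=> mH GH F [mF [E GE FE]]; have [mE PE] := GH _ GE; split => //.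
rewrite (negligible_symdiffE mF mE FE) -PE.
apply: negligible_symdiffE; [exact: measurableI|exact: measurableI|].
apply: negligibleS FE => x /= [[[Fx Hx] nEH]|[[Ex Hx] nFH]].
  by left; split => // Ex; exact: nEH.
by right; split => // Fx; exact: nFH.
Qed.

Lemma sub_null_completion G : G `<=` measurable -> G `<=` null_completion G.
Proof.
move=> Gm E GE; split; first exact: Gm.
by exists E => //; rewrite setYK; exact: negligible_set0.
Qed.

Lemma null_completionS G G' : G `<=` G' -> null_completion G `<=` null_completion G'.
Proof. by move=> GG' F [mF [E /GG' GE FE]]; split => //; exists E. Qed.

Lemma sigma_algebra_null_completion G : sigma_algebra setT G ->
  sigma_algebra setT (null_completion G).
Proof.
move=> [G0 GC GU]; split.
- split; first exact: measurable0.
  by exists set0 => //; rewrite setYK; exact: negligible_set0.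
- move=> A [mA [E GE AE]]; split; first by rewrite setTD; exact: measurableC.
  exists (setT `\` E); first exact: GC.
  apply: negligibleS AE => x /= [[[_ nA]]|[[_ nE]]].
    move/not_andP => [//|/contrapT Ex]; right => //.
  by move/not_andP => [//|/contrapT Ax]; left.
- move=> A GA; split; first by apply: bigcup_measurable => k _; have [] := GA k.
  have [E /all_and2[GE AE]] : {E : nat -> set T & forall k,
      G (E k) /\ P.-negligible (A k `+` E k)}.
    apply: (@choice _ _ (fun k e => G e /\ P.-negligible (A k `+` e))) => k.
    by have [_ [e Ge Ae]] := GA k; exists e.
  exists (\bigcup_k E k); first exact: GU.
  have : P.-negligible (\bigcup_k (A k `+` E k)) by exact: negligible_bigcup.
  apply: negligibleS => x /= [[[k _ Ak] nE]|[[k _ Ek] nA]]; exists k => //.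
    by left; split => // Ek; apply: nE; exists k.
  by right; split => // Ak; apply: nA; exists k.
Qed.

End pi_lambda_independence.

(** * Induction on nonnegative measurable functions *)

Section monotone_class_functions.
Import HBNNSimple.
Local Open Scope ereal_scope.
Context d (X : measurableType d) (R : realType).

(** Such a function is the increasing limit of simple functions, and each of these is a finite sum
    of multiples of indicators. The lemma serves every identity below that is linear and monotonely
    continuous in one function. *)
Lemma ge0_measurable_fun_ind (Pr : (X -> \bar R) -> Prop) :
  (forall A, measurable A -> Pr (fun x => (\1_A x)%:E)) ->
  (forall (k : R) (f : X -> \bar R), (0 <= k)%R -> measurable_fun setT f -> (forall x, 0 <= f x) ->
     Pr f -> Pr (fun x => k%:E * f x)) ->
  (forall f g : X -> \bar R, measurable_fun setT f -> (forall x, 0 <= f x) ->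
     measurable_fun setT g -> (forall x, 0 <= g x) ->
     Pr f -> Pr g -> Pr (fun x => f x + g x)) ->
  (forall (f : nat -> X -> \bar R) (g : X -> \bar R), (forall n, measurable_fun setT (f n)) ->
     (forall n x, 0 <= f n x) -> (forall x, nondecreasing_seq (f ^~ x)) ->
     (forall x, f n x @[n --> \oo] --> g x) ->
     (forall n, Pr (f n)) -> Pr g) ->
  forall f : X -> \bar R, measurable_fun setT f -> (forall x, 0 <= f x) -> Pr f.
Proof.
move=> PI PZ PD PL f mf f0.
have mT := @measurableT _ X.
pose h := nnsfun_approx mT mf.
refine (PL (fun n x => (h n x)%:E) f _ _ _ _ _) => [n|n x|x m n mn|x|n].
- exact/measurable_EFinP/measurable_funP.
- by rewrite lee_fin.
- by rewrite lee_fin; exact/lefP/nd_nnsfun_approx.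
- exact: (cvg_nnsfun_approx mT mf (fun x _ => f0 x)).
pose u := h n.
(* Measurability and sign of the partial sums travel with [Pr], because the closure under addition
   asks for both. *)
have Pu (s : seq R) : (forall r, r \in s -> (0 <= r)%R) ->
    Pr (fun x => \sum_(r <- s) (r%:E * (\1_(u @^-1` [set r]) x)%:E)) /\
    measurable_fun setT (fun x => \sum_(r <- s) (r%:E * (\1_(u @^-1` [set r]) x)%:E)) /\
    forall x, 0 <= \sum_(r <- s) (r%:E * (\1_(u @^-1` [set r]) x)%:E).
  elim: s => [|r s IH] sr.
    (* The empty sum is presented as 0 times the indicator of the empty set, the form covered by the
       closure properties. *)
    have -> : (fun x : X => \sum_(r <- [::]) (r%:E * (\1_(u @^-1` [set r]) x)%:E)) =
              (fun x => 0%R%:E * (\1_(@set0 X) x)%:E).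
      by apply/funext => x; rewrite big_nil mul0e.
    split; last split.
    - by apply: PZ => //; [exact/measurable_EFinP/measurable_indic|exact: PI].
    - by apply: emeasurable_funM => //; exact/measurable_EFinP/measurable_indic.
    - by move=> x; rewrite big_nil.
  have [Ps [ms s0]] : _ := IH (fun q qs => sr q (@mem_behead _ (r :: s) q qs)).
  have r0 : (0 <= r)%R by apply: sr; rewrite mem_head.
  have -> : (fun x : X => \sum_(q <- r :: s) (q%:E * (\1_(u @^-1` [set q]) x)%:E)) =
     (fun x => r%:E * (\1_(u @^-1` [set r]) x)%:E +
               \sum_(q <- s) (q%:E * (\1_(u @^-1` [set q]) x)%:E)).
    by apply/funext => x; rewrite big_cons.
  have mi : measurable_fun setT (fun x : X => (\1_(u @^-1` [set r]) x)%:E : \bar R).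
    exact/measurable_EFinP/measurable_indic.
  have mri : measurable_fun setT (fun x : X => r%:E * (\1_(u @^-1` [set r]) x)%:E).
    exact: emeasurable_funM.
  have ri0 x : 0 <= r%:E * (\1_(u @^-1` [set r]) x)%:E by rewrite mule_ge0.
  split; last split.
  - by apply: PD => //; apply: PZ => //; exact: PI.
  - exact: emeasurable_funD.
  - by move=> x; rewrite big_cons adde_ge0.
have -> : (fun x => (h n x)%:E) =
    (fun x => \sum_(r <- finmap.enum_fset (fset_set (range u))) (r%:E * (\1_(u @^-1` [set r]) x)%:E)).
  apply/funext => x; have := fimfunE u x.
  rewrite fsbig_finite//= => ->; rewrite -sumEFin.
  by apply: eq_bigr => r _; rewrite EFinM.
apply: (Pu _ _).1 => r; rewrite in_fset_set// inE => -[x _ <-].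
by [].
Qed.

End monotone_class_functions.

(** * Factorisation of integrals under independence *)

Section independent_products.
Local Open Scope ereal_scope.
Context d (T : measurableType d) (R : realType) (P : probability T R).

(** Multiplication by [+oo] is not continuous at 0, but monotonicity saves the limit: either some
    term is positive and the products are eventually [+oo], or all terms vanish. *)
Lemma nd_cvg_mule (a l : \bar R) (u : nat -> \bar R) : 0 <= a ->
  (forall n, 0 <= u n) -> nondecreasing_seq u -> u n @[n --> \oo] --> l ->
  a * u n @[n --> \oo] --> a * l.
Proof.
move=> a0 u0 ndu ul; case: a a0 => [r| |] // a0; first exact: cvgeZl.
have ule n : u n <= l.
  have -> : l = ereal_sup (range u).
    exact: (cvg_unique _ ul (ereal_nondecreasing_cvgn ndu)).
  by apply: ereal_sup_ubound; exists n.
case: (pselect (exists n, 0 < u n)) => [[n un]|un].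
  have -> : +oo * l = +oo :> \bar R by rewrite gt0_mulye// (lt_le_trans un).
  apply: cvg_near_cst; exists n => // m /= nm.
  by rewrite gt0_mulye// (lt_le_trans un)//; exact: ndu.
have uE : u = cst 0.
  apply/funext => n; apply/eqP; rewrite eq_le u0 andbT leNgt; apply/negP => un0.
  by apply: un; exists n.
have -> : l = 0 by rewrite -(cvg_lim _ ul)// uE; exact: lim_cst.
by rewrite mule0 uE; under eq_fun do rewrite /= mule0; exact: cvg_cst.
Qed.

Lemma measurable_fun_sub_sigma d' (V : measurableType d') (G : set (set T))
    (f : T -> V) : <<s G >> `<=` measurable ->
  measurable_fun setT (f : g_sigma_algebraType G -> V) -> measurable_fun setT f.
Proof. by move=> Gm mf _ S mS; apply: Gm; exact: (mf measurableT). Qed.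

Lemma ge0_integral_indep_event (G : set (set T)) (H : set T) (Z : T -> \bar R) :
  measurable H -> <<s G >> `<=` indep_of P H ->
  measurable_fun setT (Z : g_sigma_algebraType G -> \bar R) -> (forall w, 0 <= Z w) ->
  \int[P]_w (Z w * (\1_H w)%:E) = P H * \int[P]_w Z w.
Proof.
move=> mH GH mZ Z0.
have Gm : <<s G >> `<=` (@measurable _ T) by move=> E /GH[].
have mI : measurable_fun setT (fun w => (\1_H w)%:E : \bar R).
  exact/measurable_EFinP/measurable_indic.
have sub (f : T -> \bar R) : measurable_fun setT (f : g_sigma_algebraType G -> \bar R) ->
    measurable_fun setT f by exact: measurable_fun_sub_sigma.
move: Z mZ Z0; apply: (@ge0_measurable_fun_ind _ (g_sigma_algebraType G)).
- move=> A mA; have [mA' PA] := GH _ mA.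
  rewrite (_ : (fun w => _) = fun w => (\1_(A `&` H) w)%:E); last first.
    by apply/funext => w; rewrite indicI EFinM.
  by rewrite integral_indic ?setIT ?integral_indic ?setIT ?PA 1?muleC//; exact: measurableI.
- move=> k f k0 mf f0 IH; have mf' := sub _ mf.
  under eq_integral do rewrite -muleA.
  rewrite ge0_integralZl_EFin//; first last.
  + exact: emeasurable_funM.
  + by move=> w _; rewrite mule_ge0// lee_fin.
  by rewrite IH ge0_integralZl_EFin// muleCA.
- move=> f g mf f0 mg g0 IHf IHg; have mf' := sub _ mf; have mg' := sub _ mg.
  under eq_integral do rewrite ge0_muleDl//.
  rewrite ge0_integralD//; [|by move=> w _; rewrite mule_ge0// lee_fin|exact: emeasurable_funM|
     by move=> w _; rewrite mule_ge0// lee_fin|exact: emeasurable_funM].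
  by rewrite IHf IHg ge0_integralD// [RHS]ge0_muleDr ?integral_ge0.
- move=> f g mf f0 ndf fg IH; have mf' n := sub _ (mf n).
  have c1 : \int[P]_w (f n w * (\1_H w)%:E) @[n --> \oo] --> \int[P]_w (g w * (\1_H w)%:E).
    have -> : (fun w => g w * (\1_H w)%:E) = (fun w => limn (fun n => f n w * (\1_H w)%:E)).
      apply/funext => w; apply/esym/cvg_lim => //.
      by apply: cvgeZr => //; exact: fg.
    apply: cvg_monotone_convergence => //.
    + by move=> n; exact: emeasurable_funM.
    + by move=> n w _; rewrite mule_ge0// lee_fin.
    + by move=> w _ m n mn; rewrite lee_wpmul2r ?lee_fin//; exact: ndf.
  have c2 : P H * \int[P]_w f n w @[n --> \oo] --> P H * \int[P]_w g w.
    apply: cvgeZl; first by rewrite fin_num_measure.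
    have -> : g = (fun w => limn (f ^~ w)).
      by apply/funext => w; apply/esym/cvg_lim => //; exact: fg.
    exact: cvg_monotone_convergence.
  move: c1; under eq_cvg do rewrite IH.
  by move=> c1; exact: (cvg_unique _ c1 c2).
Qed.

(** Two monotone class arguments in a row: the first, in [Z], has an event in place of [g (X w)];
    the second is in [g]. Both factors may have infinite integral, so limits of products go through
    [nd_cvg_mule]. *)
Lemma ge0_integralM_indep (G : set (set T)) d' (V : measurableType d') (X : T -> V)
    (Z : T -> \bar R) (g : V -> \bar R) :
  measurable_fun setT X ->
  (forall S, measurable S -> <<s G >> `<=` indep_of P (X @^-1` S)) ->
  measurable_fun setT (Z : g_sigma_algebraType G -> \bar R) -> (forall w, 0 <= Z w) ->
  measurable_fun setT g -> (forall v, 0 <= g v) ->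
  \int[P]_w (Z w * g (X w)) = \int[P]_w Z w * \int[P]_w g (X w).
Proof.
move=> mX GX mZ Z0.
have Gm : <<s G >> `<=` (@measurable _ T).
  by move=> E /(GX _ measurableT)[].
have mZ' := @measurable_fun_sub_sigma _ _ G _ Gm mZ.
have mc (f : V -> \bar R) : measurable_fun setT f -> measurable_fun setT (f \o X).
  by move=> mf; exact: measurableT_comp.
move: g; apply: ge0_measurable_fun_ind.
- move=> A mA.
  have mXA : measurable (X @^-1` A) by rewrite -[_ @^-1` _]setTI; exact: mX.
  rewrite (ge0_integral_indep_event mXA (GX _ mA) mZ Z0).
  by rewrite integral_indic// setIT muleC.
- move=> k f k0 mf f0 IH; have mf' := mc _ mf.
  under eq_integral do rewrite muleCA.
  rewrite ge0_integralZl_EFin//; first last.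
  + exact: emeasurable_funM.
  + by move=> w _; rewrite mule_ge0.
  by rewrite IH ge0_integralZl_EFin// muleCA.
- move=> f g mf f0 mg g0 IHf IHg; have mf' := mc _ mf; have mg' := mc _ mg.
  under eq_integral do rewrite ge0_muleDr//.
  rewrite ge0_integralD//; [|by move=> w _; rewrite mule_ge0|exact: emeasurable_funM|
     by move=> w _; rewrite mule_ge0|exact: emeasurable_funM].
  by rewrite IHf IHg ge0_integralD// [RHS]ge0_muleDr ?integral_ge0.
- move=> f g mf f0 ndf fg IH; have mf' n := mc _ (mf n).
  have c1 : \int[P]_w (Z w * f n (X w)) @[n --> \oo] --> \int[P]_w (Z w * g (X w)).
    have -> : (fun w => Z w * g (X w)) = (fun w => limn (fun n => Z w * f n (X w))).
      apply/funext => w; apply/esym/cvg_lim => //.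
      exact: nd_cvg_mule.
    apply: cvg_monotone_convergence => //.
    + by move=> n; exact: (emeasurable_funM mZ' (mf' n)).
    + by move=> n w _; apply: mule_ge0; [exact: Z0|exact: f0].
    + by move=> w _ m n mn; apply: lee_wpmul2l => //; exact: ndf.
  have c2 : \int[P]_w Z w * \int[P]_w f n (X w) @[n --> \oo] --> \int[P]_w Z w * \int[P]_w g (X w).
    have cf : \int[P]_w f n (X w) @[n --> \oo] --> \int[P]_w g (X w).
      have -> : (fun w => g (X w)) = (fun w => limn (fun n => f n (X w))).
        by apply/funext => w; apply/esym/cvg_lim => //; exact: fg.
      exact: cvg_monotone_convergence.
    apply: nd_cvg_mule cf.
    + by apply: integral_ge0 => w _; exact: Z0.
    + by move=> n; apply: integral_ge0 => w _; exact: f0.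
    + move=> m n mn; apply: ge0_le_integral => //; [exact: mf'|exact: mf'|].
      by move=> w _; exact: ndf.
  move: c1; under eq_cvg do rewrite IH.
  by move=> c1; exact: (cvg_unique _ c1 c2).
Qed.

End independent_products.

(** * Independence of a Poisson measure over disjoint regions *)

Section poisson_independence.
Context d d' (T : measurableType d) (U : measurableType d') (R : realType).
Variables (P : probability T R) (mu : T -> {measure set U -> \bar R}).
Variable Lambda : set U -> \bar R.
Hypothesis muP : poisson_random_measure P mu Lambda.

Lemma prm_measurable_fun A : measurable A -> measurable_fun setT (fun w => mu w A).
Proof. by case: muP => + _ _ _; exact. Qed.

Lemma prm_measurable A S : measurable A -> measurable S ->
  measurable ((fun w => mu w A) @^-1` S).
Proof. by move=> mA mS; rewrite -[_ @^-1` _]setTI; exact: prm_measurable_fun. Qed.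

Lemma random_measure_sigma_measurable V : random_measure_sigma mu V `<=` measurable.
Proof.
apply: smallest_sub; first exact: sigma_algebra_measurable.
by move=> _ [A [S [mA _ mS ->]]]; exact: prm_measurable.
Qed.

(* The disjoint family consists of the atoms of the A j, the atom outside of
   every A j being replaced by C. *)
Lemma prm_indep_fin (C : set U) (H : set (\bar R)) (m : nat) (A : nat -> set U)
    (S : nat -> set (\bar R)) :
  measurable C -> measurable H ->
  (forall j, [/\ measurable (A j), A j `&` C = set0 & measurable (S j)]) ->
  indep_of P ((fun w => mu w C) @^-1` H) (\bigcap_(j < m) ((fun w => mu w (A j)) @^-1` S j)).
Proof.
move=> mC mH AS.
pose pat (x : U) : {set 'I_m} := [set j : 'I_m | `[< A j x >]]%SET.
pose b (I : {set 'I_m}) : set U := if I == finset.set0 then C else [set x | pat x = I].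
have mb I : measurable (b I).
  rewrite /b; case: ifPn => // _.
  rewrite (_ : [set x | _] = \bigcap_(j in [set: 'I_m])
      (if j \in I then A j else ~` A j)).
    apply: fin_bigcap_measurable; first exact: finite_finset.
    by move=> j _; have [mA _ _] := AS j; case: ifPn => // _; exact: measurableC.
  apply/seteqP; split => [x /= <- j _|x /= h].
    by case: ifPn; rewrite inE => /asboolP.
  apply/setP => j; rewrite inE; have := h j Logic.I.
  by case: ifPn => jI /= Ajx; apply/asboolP.
have tb : trivIset setT b.
  move=> I J _ _ [x [bI bJ]].
  have key K : K != finset.set0 -> b K x -> ~ C x.
    move=> K0; rewrite /b (negbTE K0) => /= xK Cx.
    move: K0; rewrite -xK => /set0Pn[j]; rewrite inE => /asboolP Ajx.
    have [_ AC _] := AS j; suff : set0 x by [].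
    by rewrite -AC.
  have [I0|I0] := eqVneq I finset.set0; have [J0|J0] := eqVneq J finset.set0.
  - by rewrite I0 J0.
  - by exfalso; apply: (key J) => //; move: bI; rewrite /b I0 eqxx.
  - by exfalso; apply: (key I) => //; move: bJ; rewrite /b J0 eqxx.
  - by move: bI bJ; rewrite /b (negbTE I0) (negbTE J0) => /= <- <-.
pose n := #|{: {set 'I_m}}|.
pose b' (k : 'I_n) := b (enum_val k).
pose k0 : 'I_n := enum_rank (finset.set0 : {set 'I_m}).
have b'k0 : b' k0 = C by rewrite /b' enum_rankK /b eqxx.
have tb' : trivIset setT b'.
  by move=> i j _ _ /(tb _ _ Logic.I Logic.I) /enum_val_inj.
case: muP => _ _ _ /(_ n b' (fun k => mb _) tb') ind.
pose Hs := (fun w => mu w C) @^-1` H.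
have mHs : measurable Hs by exact: prm_measurable.
(* Cylinders that leave the coordinate of [C] free; they form a pi-system. *)
pose G := [set E | exists V : 'I_n -> set (\bar R), [/\ forall k, measurable (V k),
   V k0 = setT & E = \bigcap_k ((fun w => mu w (b' k)) @^-1` V k)]].
have IG : setI_closed G.
  move=> _ _ [V [mV V0 ->]] [W [mW W0 ->]].
  exists (fun k => V k `&` W k); split => //.
  - by move=> k; exact: measurableI.
  - by rewrite V0 W0 setTI.
  - by rewrite -bigcapI.
have sE (J : {set 'I_n}) (E : 'I_n -> set T) : (forall k, k \notin J -> E k = setT) ->
    \bigcap_(k in [set` J]) E k = \bigcap_k E k.
  move=> EJ; apply/seteqP; split => x /= h k; last by move=> _; exact: h.
  by move=> _; case: (boolP (k \in J)) => [kJ|/EJ -> //]; exact: h.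
have GH : G `<=` indep_of P Hs.
  move=> _ [V [mV V0 ->]]; split.
    apply: fin_bigcap_measurable; first exact: finite_finset.
    by move=> k _; apply: prm_measurable => //; exact: mb.
  pose E k := (fun w => mu w (b' k)) @^-1` V k.
  (* Putting [Hs] at the free coordinate and applying mutual independence to both families reduces
     the claim to a comparison of two products factor by factor. *)
  pose E' k := if k == k0 then Hs else E k.
  have Ek0 : E k0 = setT by rewrite /E V0.
  have -> : \bigcap_k E k `&` Hs = \bigcap_(k in [set` [set: 'I_n]%SET]) E' k.
    rewrite sE; last by move=> k; rewrite inE.
    apply/seteqP; split => [x [EH Hx] k _|x h].
      by rewrite /E'; case: eqP => // _; exact: EH.
    split; last by have := h k0 Logic.I; rewrite /E' eqxx.
    move=> k _; have := h k Logic.I; rewrite /E'; case: eqP => [->|//].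
    by rewrite Ek0.
  rewrite ind; last first.
    move=> k _; rewrite /E'; case: eqP => [->|_]; last by exists (V k).
    by exists H => //; rewrite b'k0.
  have -> : \bigcap_k E k = \bigcap_(k in [set` ([set: 'I_n] :\ k0)%SET]) E k.
    by rewrite sE// => k; rewrite !inE andbT negbK => /eqP ->.
  rewrite ind; last by move=> k _; exists (V k).
  rewrite (big_setD1 k0) ?inE//= /E' eqxx muleC; congr (_ * _)%E.
  by apply: eq_bigr => k; rewrite !inE andbT => /negbTE ->.
have sG := indep_of_sigma mHs IG GH.
apply: sG.
pose f (I : {set 'I_m}) := fun w => mu w (b I).
have mf I : I != finset.set0 -> measurable_fun setT (f I : g_sigma_algebraType G -> \bar R).
  move=> I0 _ V mV; rewrite setTI; apply: sub_sigma_algebra.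
  exists (fun k => if k == enum_rank I then V else setT); split.
  - by move=> k; case: ifP.
  - by rewrite (inj_eq enum_rank_inj) eq_sym (negbTE I0).
  - apply/seteqP; split => [w /= Vw k _ /=|w /= /(_ (enum_rank I) Logic.I)].
      by case: eqP => // ->; rewrite /b' enum_rankK.
    by rewrite eqxx /b' enum_rankK.
have mA (j : 'I_m) : measurable_fun setT ((fun w => mu w (A j)) : g_sigma_algebraType G -> \bar R).
  pose h (I : {set 'I_m}) := if j \in I then f I else cst 0%E.
  have mh I : measurable_fun setT (h I : g_sigma_algebraType G -> \bar R).
    rewrite /h; case: ifPn => [jI|_]; last exact: measurable_cst.
    by apply: mf; apply/set0Pn; exists j.
  rewrite (_ : (fun w => _) =
      (fun w => \sum_(I \in [set I : {set 'I_m} | j \in I]) h I w)%E).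
    by apply: emeasurable_fsum => //; exact: finite_finset.
  apply/funext => w.
  (* [A j] is the disjoint union of the atoms whose pattern contains [j]. The atom replaced by [C]
     has empty pattern and is never among them. *)
  rewrite (_ : A j = \bigcup_(I in [set I : {set 'I_m} | j \in I]) b I); last first.
    apply/seteqP; split => x.
      move=> Ajx; exists (pat x); first by rewrite /= inE; apply/asboolP.
      rewrite /b ifN//; apply/set0Pn; exists j; by rewrite inE; apply/asboolP.
    move=> [I /= jI]; rewrite /b ifN; last by apply/set0Pn; exists j.
    by move=> /= xI; move: jI; rewrite -xI inE => /asboolP.
  rewrite measure_fin_bigcup; last 3 first.
  - exact: finite_finset.
  - by move=> I J _ _; exact: tb.
  - by move=> I _; exact: mb.
  by apply: eq_fsbigr => I; rewrite inE /= /h => ->.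
rewrite (_ : \bigcap_(j < m) _ =
    \bigcap_(j in [set: 'I_m]) ((fun w => mu w (A j)) @^-1` S j)); last first.
  apply/seteqP; split => x h j; first by move=> _; exact: (h j (ltn_ord j)).
  by move=> jm; exact: (h (Ordinal jm)).
have : (measurable : set (set (g_sigma_algebraType G)))
    (\bigcap_(j in [set: 'I_m]) ((fun w => mu w (A j)) @^-1` S j)).
  apply: fin_bigcap_measurable; first exact: finite_finset.
  move=> j _; have [_ _ mS] := AS j.
  by rewrite -[X in measurable X]setTI; exact: mA.
by [].
Qed.

(** The counts of sets inside [V] overlap, so they are handled through finite intersections of count
    events, a pi-system generating the sigma-algebra of [V]; the completion is added last. *)
Lemma prm_indep_sigma (V C : set U) (H : set (\bar R)) :
  measurable C -> V `&` C = set0 -> measurable H ->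
  <<s null_completion P (random_measure_sigma mu V) >> `<=`
    indep_of P ((fun w => mu w C) @^-1` H).
Proof.
move=> mC VC mH.
have mHs : measurable ((fun w => mu w C) @^-1` H) by exact: prm_measurable.
(* The completion of a sigma-algebra is a sigma-algebra already, so the outer generation
   disappears. *)
rewrite sigma_algebra_id; last first.
  exact/sigma_algebra_null_completion/smallest_sigma_algebra.
apply: indep_of_completion => //.
pose G := [set E | exists (m : nat) (A : nat -> set U) (S : nat -> set (\bar R)),
  (forall j, [/\ measurable (A j), A j `<=` V & measurable (S j)]) /\
  E = \bigcap_(j < m) ((fun w => mu w (A j)) @^-1` S j)].
have IG : setI_closed G.
  move=> _ _ [m [A [S [AS ->]]]] [m' [A' [S' [AS' ->]]]].
  exists (m + m')%N, (fun j => if (j < m)%N then A j else A' (j - m)%N),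
    (fun j => if (j < m)%N then S j else S' (j - m)%N); split.
    by move=> j; case: ifPn.
  apply/seteqP; split => [x [h h'] j /= jm|x h].
    by case: ifPn => [/h//|]; rewrite -leqNgt => mj; apply: h'; rewrite /= ltn_subLR.
  split=> j /= jm.
    by have := h j; rewrite /= jm; apply; rewrite ltn_addr.
  have := h (m + j)%N; rewrite /= ltn_add2l => /(_ jm).
  by rewrite ltnNge leq_addr /= addKn.
have GH : G `<=` indep_of P ((fun w => mu w C) @^-1` H).
  move=> _ [m [A [S [AS ->]]]]; apply: prm_indep_fin => // j.
  have [mA AV mS] := AS j; split => //.
  by apply/seteqP; split => // x [/AV Vx Cx]; rewrite -VC.
have sG := indep_of_sigma mHs IG GH.
apply: subset_trans sG; apply: sub_sigma_algebra2.
move=> _ [A [S [mA AV mS ->]]].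
exists 1%N, (fun=> A), (fun=> S); split => //.
by apply/seteqP; split => [x /= h j|x h]; [|exact: (h 0%N)].
Qed.

End poisson_independence.

(** * Series of the Poisson law *)

Section poisson_expectations.
Local Open Scope ereal_scope.
Context (R : realType).

Lemma exp_nneseries (a : R) : (0 <= a)%R ->
  \sum_(k <oo) (a ^+ k / k`!%:R)%:E = (expR a)%:E.
Proof.
move=> a0; rewrite expRE -EFin_lim; last first.
  rewrite /pseries/=; under eq_fun do rewrite mulrC.
  exact: is_cvg_series_exp_coeff.
apply/congr_lim/funext => n/=; rewrite /pseries/= /series/= -sumEFin//.
by under eq_bigr do rewrite mulrC.
Qed.

(** The term of index 0 vanishes and k / k! = 1 / (k-1)!, so a shift of the index gives a times the
    exponential series. *)
Lemma exp_nneseries_mean (a : R) : (0 <= a)%R ->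
  \sum_(k <oo) (k%:R * (expR (- a) * a ^+ k / k`!%:R))%:E = a%:E.
Proof.
move=> a0.
have t0 k : (0 <= k%:R * (expR (- a) * a ^+ k / k`!%:R))%R.
  by rewrite mulr_ge0// divr_ge0// mulr_ge0 ?expR_ge0// exprn_ge0.
rewrite (@nneseries_split _ _ 0%N 1%N)//; last by move=> k _; rewrite lee_fin.
rewrite add0n big_nat1 mul0r add0e.
have -> : a%:E = (expR (- a) * a)%:E * (expR a)%:E.
  by rewrite -EFinM mulrAC expRN mulVf ?mul1r// gt_eqF// expR_gt0.
transitivity (\sum_(k <oo) ((expR (- a) * a)%:E * (a ^+ k / k`!%:R)%:E)).
  rewrite -(@nneseries_addn _ (fun k => (k%:R * (expR (- a) * a ^+ k / k`!%:R))%:E) 1%N);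
    last by move=> k; rewrite lee_fin.
  apply: eq_eseriesr => k _; rewrite -EFinM; congr _%:E.
  rewrite addn1 factS exprS natrM.
  have kN0 : (k.+1%:R != 0 :> R)%R by rewrite pnatr_eq0.
  have fN0 : (k`!%:R != 0 :> R)%R by rewrite pnatr_eq0 -lt0n fact_gt0.
  move: kN0 fN0; move: (k.+1%:R : R) (k`!%:R : R) => K f K0 f0.
  by field; rewrite K0 f0.
rewrite nneseriesZl//; last by move=> k _; rewrite lee_fin divr_ge0// exprn_ge0.
by rewrite exp_nneseries.
Qed.

End poisson_expectations.

(** * Expectations of a count weighted by an independent past *)

Section poisson_thinning.
Local Open Scope ereal_scope.
Context d d' (T : measurableType d) (U : measurableType d') (R : realType).
Variables (P : probability T R) (mu : T -> {measure set U -> \bar R}).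
Variable Lambda : set U -> \bar R.
Hypothesis muP : poisson_random_measure P mu Lambda.
Hypothesis Lambda0 : forall A, 0 <= Lambda A.

Let pmf (a : R) (k : nat) : R := (expR (- a) * a ^+ k / k`!%:R)%R.

(** The events [mu w C = k] are disjoint and their Poisson masses sum to 1. Hence the count is
    almost surely a natural number and the integral splits along these events. *)
Lemma prm_integral (C : set U) (g : \bar R -> \bar R) :
  measurable C -> Lambda C < +oo -> measurable_fun setT g -> (forall v, 0 <= g v) ->
  \int[P]_w g (mu w C) = \sum_(k <oo) (g k%:R%:E * (pmf (fine (Lambda C)) k)%:E).
Proof.
move=> mC LC mg g0; set a := fine (Lambda C).
have a0 : (0 <= a)%R by rewrite fine_ge0.
have pmf0 k : (0 <= pmf a k)%R.
  by rewrite divr_ge0// mulr_ge0 ?expR_ge0// exprn_ge0.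
pose E k := [set w | mu w C = k%:R%:E].
have mE k : measurable (E k).
  have -> : E k = (fun w => mu w C) @^-1` [set k%:R%:E] by [].
  exact: (prm_measurable muP).
have PE k : P (E k) = (pmf a k)%:E by case: muP => _ /(_ C k mC LC).
have tE : trivIset setT E.
  move=> i j _ _ [w []]; rewrite /E /= => -> /eqP.
  by rewrite eqe eqr_nat => /eqP.
have PU : P (\bigcup_k E k) = 1.
  rewrite measure_bigcup//= (eq_eseriesl (Q := xpredT)); last by move=> i; rewrite in_setT.
  under eq_eseriesr do rewrite PE.
  rewrite /pmf; under eq_eseriesr do rewrite -mulrA EFinM.
  rewrite nneseriesZl; last by move=> k _; rewrite lee_fin divr_ge0// exprn_ge0.
  by rewrite exp_nneseries// -EFinM expRN mulVf// gt_eqF// expR_gt0.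
have mU : measurable (\bigcup_k E k) by exact: bigcup_measurable.
have mgm : measurable_fun setT (fun w => g (mu w C)).
  exact: (measurableT_comp mg (prm_measurable_fun muP mC)).
transitivity (\int[P]_(w in \bigcup_k E k) g (mu w C)).
  rewrite -[in LHS](setUv (\bigcup_k E k)) ge0_integral_setU//; last 3 first.
  - exact: measurableC.
  - by rewrite setUv.
  - exact/disj_setPCl.
  rewrite [X in _ + X](_ : _ = 0) ?adde0//.
  apply: null_set_integral => //; first exact: measurableC.
    by apply: measurable_funTS.
  by have := probability_setC P mU; rewrite PU subee.
rewrite ge0_integral_bigcup//; last by apply: measurable_funTS.
apply: eq_eseriesr => k _.
rewrite (_ : \int[P]_(w in E k) g (mu w C) = \int[P]_(w in E k) cst (g k%:R%:E) w); last first.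
  by apply: eq_integral => w /set_mem /= ->.
by rewrite integral_cst//; congr (_ * _); exact: PE.
Qed.

Variables (V C : set U) (Z : T -> \bar R).
Let F := null_completion P (random_measure_sigma mu V).
Hypothesis mZ : measurable_fun setT (Z : g_sigma_algebraType F -> \bar R).
Hypothesis Z0 : forall w, 0 <= Z w.
Hypothesis mC : measurable C.
Hypothesis VC : V `&` C = set0.
Hypothesis LC : Lambda C < +oo.

Lemma prm_indep_integral (g : \bar R -> \bar R) :
  measurable_fun setT g -> (forall v, 0 <= g v) ->
  \int[P]_w (Z w * g (mu w C)) =
  \int[P]_w Z w * \sum_(k <oo) (g k%:R%:E * (pmf (fine (Lambda C)) k)%:E).
Proof.
move=> mg g0; rewrite -prm_integral//.
apply: (@ge0_integralM_indep _ _ _ _ F) => //.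
- exact: (prm_measurable_fun muP).
- by move=> S mS; exact: (prm_indep_sigma muP).
Qed.

Lemma prm_indep_mean : \int[P]_w (Z w * mu w C) = \int[P]_w Z w * Lambda C.
Proof.
have a0 : (0 <= fine (Lambda C))%R by rewrite fine_ge0.
transitivity (\int[P]_w (Z w * `|mu w C|)).
  by apply: eq_integral => w _; rewrite gee0_abs.
rewrite (@prm_indep_integral (fun x => `|x|))//; last exact: abse_measurable.
congr (_ * _).
under eq_eseriesr do rewrite gee0_abs ?lee_fin// -EFinM.
by rewrite exp_nneseries_mean// fineK// ge0_fin_numE.
Qed.

(** The factor e^(-sk) is absorbed in the k-th power, which leaves the exponential series at
    [fine (Lambda C)] times e^(-s). *)
Lemma prm_indep_laplace (s : R) : (0 <= s)%R ->
  \int[P]_w (Z w * (expR (- (s * fine (mu w C))))%:E) =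
  \int[P]_w Z w * (expR (- (fine (Lambda C) * (1 - expR (- s)))))%:E.
Proof.
move=> s0; have a0 : (0 <= fine (Lambda C))%R by rewrite fine_ge0.
rewrite (@prm_indep_integral (fun x => (expR (- (s * fine x)))%:E)); last 2 first.
- apply/measurable_EFinP; apply: measurableT_comp => //.
  by apply: measurableT_comp => //; apply: measurable_funM.
- by move=> v; rewrite lee_fin expR_ge0.
congr (_ * _).
have eE k : (expR (- (s * fine (k%:R%:E : \bar R))))%:E * (pmf (fine (Lambda C)) k)%:E =
   (expR (- fine (Lambda C)))%:E * ((fine (Lambda C) * expR (- s)) ^+ k / k`!%:R)%:E.
  rewrite -!EFinM /pmf /= exprMn; congr _%:E.
  have -> : (- (s * k%:R) = k%:R * (- s))%R by ring.
  by rewrite expRM_natl; ring.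
under eq_eseriesr do rewrite eE.
rewrite nneseriesZl; last first.
  by move=> k _; rewrite lee_fin divr_ge0// exprn_ge0// mulr_ge0// expR_ge0.
rewrite exp_nneseries; last by rewrite mulr_ge0// expR_ge0.
by rewrite -EFinM -expRD; congr (expR _)%:E; ring.
Qed.

End poisson_thinning.

(** * Campbell's formula *)

Section campbell.
Local Open Scope ereal_scope.
Import HBNNSimple.
Context d d' (T : measurableType d) (U : measurableType d') (R : realType).
Variables (P : probability T R) (mu : T -> {measure set U -> \bar R}).
Variable Lambda : {measure set U -> \bar R}.
Hypothesis muP : poisson_random_measure P mu Lambda.

Let F V := null_completion P (random_measure_sigma mu V).

Lemma null_completion_sub_measurable V : <<s F V >> `<=` measurable.
Proof.
apply: smallest_sub; first exact: sigma_algebra_measurable.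
by move=> E [].
Qed.

(** When [Lambda C] is infinite the count is almost surely [+oo], and both sides are the integral of
    [Z] multiplied by [+oo], with the convention 0 times infinity = 0. *)
Lemma prm_indep_mean_gen (V C : set U) (Z : T -> \bar R) :
  measurable_fun setT (Z : g_sigma_algebraType (F V) -> \bar R) -> (forall w, 0 <= Z w) ->
  measurable C -> V `&` C = set0 ->
  \int[P]_w (Z w * mu w C) = \int[P]_w Z w * Lambda C.
Proof.
move=> mZ Z0 mC VC.
have mZ' := measurable_fun_sub_sigma (@null_completion_sub_measurable V) mZ.
have [LC|] := ltP (Lambda C) +oo; first by apply: (prm_indep_mean muP _ mZ _ mC VC LC); first exact: (fun A => measure_ge0 Lambda A).
rewrite leye_eq => /eqP LC; rewrite LC -ge0_integralZr//.
apply: ae_eq_integral => //.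
- by apply: emeasurable_funM => //; exact: (prm_measurable_fun muP).
- exact: emeasurable_funM.
case: muP => _ _ /(_ C mC LC) PC _.
have mE : measurable [set w | mu w C = +oo].
  by have := prm_measurable muP mC (emeasurable_set1 +oo).
exists (~` [set w | mu w C = +oo]); split; first exact: measurableC.
  by have := probability_setC P mE; rewrite PC subee.
by move=> w /= h Cw; apply: h; rewrite Cw.
Qed.

Lemma campbell_measurable (D : set U) (f : U -> \bar R) :
  measurable D -> measurable_fun setT f -> (forall x, 0 <= f x) ->
  measurable_fun setT (fun w => \int[mu w]_(x in D) f x).
Proof.
move=> mD; move: f; apply: ge0_measurable_fun_ind.
- move=> A mA; under eq_fun do rewrite integral_indic//.
  by apply: (prm_measurable_fun muP); exact: measurableI.
- move=> k f k0 mf f0 IH.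
  have mf' : measurable_fun D f := measurable_funTS mf.
  under eq_fun do rewrite ge0_integralZl_EFin//.
  exact: emeasurable_funM.
- move=> f g mf f0 mg g0 IHf IHg.
  have mf' : measurable_fun D f := measurable_funTS mf.
  have mg' : measurable_fun D g := measurable_funTS mg.
  under eq_fun do rewrite ge0_integralD//.
  exact: emeasurable_funD.
- move=> f g mf f0 ndf fg IH.
  apply: (emeasurable_fun_cvg (fun n w => \int[mu w]_(x in D) f n x)) => // w _.
  rewrite (_ : g = (fun x => limn (f ^~ x))); last first.
    by apply/funext => x; apply/esym/cvg_lim => //; exact: fg.
  apply: cvg_monotone_convergence => //.
  by move=> n; exact: measurable_funTS.
Qed.

(** Both sides are linear and monotonely continuous in [f], and for an indicator the claim is the
    mean count of a subset of [D], again disjoint from [V]. The weight [Z] makes this a formula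
    conditional on the points in [V]. *)
Lemma campbell (V D : set U) (Z : T -> \bar R) (f : U -> \bar R) :
  measurable_fun setT (Z : g_sigma_algebraType (F V) -> \bar R) -> (forall w, 0 <= Z w) ->
  measurable D -> V `&` D = set0 ->
  measurable_fun setT f -> (forall x, 0 <= f x) ->
  \int[P]_w (Z w * \int[mu w]_(x in D) f x) = \int[P]_w Z w * \int[Lambda]_(x in D) f x.
Proof.
move=> mZ Z0 mD VD.
have mZ' := measurable_fun_sub_sigma (@null_completion_sub_measurable V) mZ.
move: f; apply: ge0_measurable_fun_ind.
- move=> A mA.
  rewrite (_ : (fun w => _) = (fun w => Z w * mu w (A `&` D))); last first.
    by apply/funext => w; rewrite integral_indic.
  rewrite integral_indic//; apply: (prm_indep_mean_gen mZ) => //.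
    exact: measurableI.
  by apply/seteqP; split => // x [Vx [_ Dx]]; rewrite -VD.
- move=> k f k0 mf f0 IH; have mf' : measurable_fun D f := measurable_funTS mf.
  have mI := campbell_measurable mD mf f0.
  rewrite (_ : (fun w => _) = (fun w => k%:E * (Z w * \int[mu w]_(x in D) f x))); last first.
    by apply/funext => w; rewrite ge0_integralZl_EFin// muleCA.
  rewrite ge0_integralZl_EFin//; last 2 first.
  + by move=> w _; rewrite mule_ge0// integral_ge0.
  + exact: emeasurable_funM.
  by rewrite IH ge0_integralZl_EFin// muleCA.
- move=> f g mf f0 mg g0 IHf IHg.
  have mf' : measurable_fun D f := measurable_funTS mf.
  have mg' : measurable_fun D g := measurable_funTS mg.
  have mIf := campbell_measurable mD mf f0.
  have mIg := campbell_measurable mD mg g0.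
  rewrite (_ : (fun w => _) = (fun w => Z w * \int[mu w]_(x in D) f x +
      Z w * \int[mu w]_(x in D) g x)); last first.
    by apply/funext => w; rewrite ge0_integralD// ge0_muleDr ?integral_ge0.
  have ZI0 (h : U -> \bar R) : (forall x, 0 <= h x) ->
      forall w, 0 <= Z w * \int[mu w]_(x in D) h x.
    by move=> h0 w; rewrite mule_ge0// integral_ge0.
  have mZIf := emeasurable_funM mZ' mIf; have mZIg := emeasurable_funM mZ' mIg.
  rewrite [LHS]ge0_integralD//; [|by move=> w _; exact: ZI0|by move=> w _; exact: ZI0].
  by rewrite IHf IHg ge0_integralD// [RHS]ge0_muleDr ?integral_ge0.
- move=> f g mf f0 ndf fg IH.
  have gE : g = (fun x => limn (f ^~ x)).
    by apply/funext => x; apply/esym/cvg_lim => //; exact: fg.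
  have mf' n : measurable_fun D (f n) := measurable_funTS (mf n).
  have c1 (m : {measure set U -> \bar R}) :
      \int[m]_(x in D) f n x @[n --> \oo] --> \int[m]_(x in D) g x.
    by rewrite gE; exact: cvg_monotone_convergence.
  have nd1 (m : {measure set U -> \bar R}) :
      nondecreasing_seq (fun n => \int[m]_(x in D) f n x).
    by move=> p q pq; apply: ge0_le_integral => // x _; exact: ndf.
  have mI n := campbell_measurable mD (mf n) (f0 n).
  have c2 : \int[P]_w (Z w * \int[mu w]_(x in D) f n x) @[n --> \oo] -->
            \int[P]_w (Z w * \int[mu w]_(x in D) g x).
    rewrite (_ : (fun w => Z w * \int[mu w]_(x in D) g x) =
        (fun w => limn (fun n => Z w * \int[mu w]_(x in D) f n x))); last first.
      apply/funext => w; apply/esym/cvg_lim => //.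
      apply: nd_cvg_mule => //.
      by move=> n; exact: integral_ge0.
    apply: cvg_monotone_convergence => //.
    + by move=> n; exact: (emeasurable_funM mZ' (mI n)).
    + by move=> n w _; rewrite mule_ge0// integral_ge0.
    + by move=> w _ p q pq; rewrite lee_wpmul2l//; exact: nd1.
  have c3 : \int[P]_w Z w * \int[Lambda]_(x in D) f n x @[n --> \oo] -->
            \int[P]_w Z w * \int[Lambda]_(x in D) g x.
    apply: nd_cvg_mule => //; first exact: integral_ge0.
    by move=> n; exact: integral_ge0.
  move: c2; under eq_cvg do rewrite IH.
  by move=> c2; exact: (cvg_unique _ c2 c3).
Qed.

End campbell.

(** * Level sets of simple functions *)

Section nnsfun_levels.
Import HBNNSimple.
Context d' (U : measurableType d') (R : realType).

(** The value 0 is dropped: its level set may have infinite measure, and it contributes nothing to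
    an integral of [phi (h x)] when phi 0 = 0. *)
Definition nnsfun_values (h : {nnsfun U >-> R}) : seq R :=
  [seq y <- finmap.enum_fset (fset_set (range h)) | y != 0].

Lemma nnsfun_values_gt0 (h : {nnsfun U >-> R}) y : y \in nnsfun_values h -> 0 < y.
Proof.
rewrite mem_filter => /andP[y0]; rewrite in_fset_set// inE => -[x _ hx].
by rewrite lt_neqAle eq_sym y0/= -hx.
Qed.

Lemma uniq_nnsfun_values (h : {nnsfun U >-> R}) : uniq (nnsfun_values h).
Proof. by rewrite filter_uniq// finmap.fset_uniq. Qed.

Lemma nnsfun_comp_sum (phi : R -> R) (h : {nnsfun U >-> R}) x : phi 0 = 0 ->
  phi (h x) = \sum_(y <- nnsfun_values h) phi y * \1_(h @^-1` [set y]) x.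
Proof.
move=> phi0; have [h0|h0] := eqVneq (h x) 0.
  rewrite h0 phi0 big1_seq// => y /andP[_ yh].
  rewrite indicE memNset ?mulr0//= h0 => y0.
  by have := nnsfun_values_gt0 yh; rewrite -y0 ltxx.
have xh : h x \in nnsfun_values h.
  by rewrite mem_filter h0/= in_fset_set// inE; exists x.
rewrite (big_rem _ xh)/= indicE mem_set//= mulr1 big1_seq ?addr0// => y /andP[_].
rewrite (mem_rem_uniq _ (uniq_nnsfun_values h)) inE => /andP[/eqP yh _].
by rewrite indicE memNset ?mulr0//= => hy; apply: yh.
Qed.

Lemma integral_nnsfun_comp (m : {measure set U -> \bar R}) (D : set U) (phi : R -> R)
    (h : {nnsfun U >-> R}) : measurable D -> phi 0 = 0 -> (forall y, 0 <= y -> 0 <= phi y) ->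
  (\int[m]_(x in D) (phi (h x))%:E =
   \sum_(y <- nnsfun_values h) (phi y)%:E * m (h @^-1` [set y] `&` D))%E.
Proof.
move=> mD phi0 phi_ge0.
under eq_integral do rewrite nnsfun_comp_sum// -sumEFin.
have mI y : measurable_fun D (fun x => (phi y * \1_(h @^-1` [set y]) x)%:E).
  by apply/measurable_EFinP; apply: measurable_funM => //; exact: measurable_funTS.
pose s := nnsfun_values h.
have s0 y : y \in s -> 0 <= y by move=> /nnsfun_values_gt0/ltW.
rewrite -/s; elim: s s0 => [|y s IH] s0.
  by rewrite big_nil; under eq_integral do rewrite big_nil; rewrite integral0.
have y0 : 0 <= y by rewrite s0// mem_head.
have ss z : z \in s -> 0 <= z by move=> zs; rewrite s0// in_cons zs orbT.
under eq_integral do rewrite big_cons.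
rewrite big_cons ge0_integralD//; last 3 first.
- by move=> x _; rewrite lee_fin mulr_ge0// phi_ge0.
- move=> x _; rewrite big_seq; apply: sume_ge0 => z zs.
  by rewrite lee_fin mulr_ge0// phi_ge0// ss.
- exact: emeasurable_sum.
rewrite IH//; congr (_ + _)%E.
under eq_integral do rewrite EFinM.
rewrite ge0_integralZl_EFin//; [|exact/measurable_EFinP/measurable_funTS|exact: phi_ge0].
by rewrite integral_indic.
Qed.

End nnsfun_levels.

Lemma cvg_expRN (R : realType) (I : Type) (F : set_system I) (FF : Filter F) (u : I -> R) (l : R) :
  u x @[x --> F] --> l -> expR (- u x) @[x --> F] --> expR (- l).
Proof.
by move=> ul; exact: (continuous_cvg FF (@continuous_expR R (- l)) (cvgN ul)).
Qed.

(** * Laplace functional of a Poisson measure, weighted by the past *)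

Section laplace_functional.
Local Open Scope ereal_scope.
Import HBNNSimple.
Context d d' (T : measurableType d) (U : measurableType d') (R : realType).
Variables (P : probability T R) (mu : T -> {measure set U -> \bar R}).
Variable Lambda : {measure set U -> \bar R}.
Hypothesis muP : poisson_random_measure P mu Lambda.

Let F V := null_completion P (random_measure_sigma mu V).

Lemma sub_completed_sigma V V' : V `<=` V' -> <<s F V >> `<=` <<s F V' >>.
Proof.
move=> VV'; apply: sub_sigma_algebra2; apply: null_completionS.
apply: sub_sigma_algebra2 => _ [A [S [mA AV mS ->]]].
by exists A, S; split => //; exact: subset_trans VV'.
Qed.

Lemma measurable_completed_sub d1 (X : measurableType d1) V V' (f : T -> X) :
  V `<=` V' -> measurable_fun setT (f : g_sigma_algebraType (F V) -> X) ->
  measurable_fun setT (f : g_sigma_algebraType (F V') -> X).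
Proof.
by move=> VV' mf _ S mS; apply: (sub_completed_sigma VV'); exact: (mf measurableT).
Qed.

Lemma measurable_completed_count V C : measurable C -> C `<=` V ->
  measurable_fun setT ((fun w => mu w C) : g_sigma_algebraType (F V) -> \bar R).
Proof.
move=> mC CV _ S mS; rewrite setTI; apply: sub_sigma_algebra.
apply: sub_null_completion; first exact: (random_measure_sigma_measurable muP).
by apply: sub_sigma_algebra; exists C, S.
Qed.

(** Induction on the list: the exponential factors of the remaining cells join the weight, which is
    then measurable for the enlarged region [V'], still disjoint from the cell [C y] under
    treatment. *)
Lemma laplace_finite_sum (V : set U) (Z : T -> \bar R) (s : seq R) (C : R -> set U) :
  measurable_fun setT (Z : g_sigma_algebraType (F V) -> \bar R) -> (forall w, 0 <= Z w) ->
  uniq s -> (forall y, y \in s -> (0 <= y)%R) ->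
  (forall y, measurable (C y)) -> trivIset setT C ->
  (forall y, V `&` C y = set0) -> (forall y, y \in s -> Lambda (C y) < +oo) ->
  \int[P]_w (Z w * (expR (- \sum_(y <- s) y * fine (mu w (C y))))%:E) =
  \int[P]_w Z w * (expR (- \sum_(y <- s) fine (Lambda (C y)) * (1 - expR (- y))))%:E.
Proof.
move=> mZ Z0; elim: s => [|y s IH] us s0 mC tC VC LC.
  rewrite big_nil oppr0 expR0 mule1; apply: eq_integral => w _.
  by rewrite big_nil oppr0 expR0 mule1.
move: us => /= /andP[ys us].
pose V' := V `|` \bigcup_(x in [set x | x != y]) C x.
pose Z' w := Z w * (expR (- \sum_(x <- s) x * fine (mu w (C x))))%:E.
have mZ' : measurable_fun setT (Z' : g_sigma_algebraType (F V') -> \bar R).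
  apply: emeasurable_funM.
    by apply: (measurable_completed_sub _ mZ) => x; left.
  apply/measurable_EFinP; apply: measurableT_comp => //; apply: measurableT_comp => //.
  (* As [y] is not in [s], the filter removes nothing; it makes visible that every cell that occurs
     is part of [V']. *)
  rewrite (_ : (fun w => _) = (fun w => \sum_(x <- s | x != y) x * fine (mu w (C x)))%R).
    rewrite -[X in measurable_fun _ X](_ : (fun w => \sum_(x <- [seq x <- s | x != y])
        x * fine (mu w (C x)))%R = _); last by apply/funext => w; rewrite big_filter.
    pose g x w := if x == y then 0%R else (x * fine (mu w (C x)))%R.
    rewrite (_ : (fun w => _) = (fun w => \sum_(x <- [seq x <- s | x != y]) g x w)%R).
      apply: measurable_sum => x; rewrite /g; case: (eqVneq x y) => [_|xy]; first exact: measurable_cst.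
      apply: measurable_funM => //; apply: measurableT_comp => //.
      by apply: measurable_completed_count => // u Cu; right; exists x.
    apply/funext => w; rewrite !big_filter; apply: eq_bigr => x xy.
    by rewrite /g (negbTE xy).
  apply/funext => w; rewrite [LHS]big_seq_cond [RHS]big_seq_cond; apply: eq_bigl => x.
  by case xs : (x \in s) => //=; apply/esym/eqP => xy; move: ys; rewrite -xy xs.
have Z'0 w : 0 <= Z' w by rewrite mule_ge0// lee_fin expR_ge0.
have V'C : V' `&` C y = set0.
  apply/seteqP; split => // u [[Vu|[x /= xy Cx]] Cy]; first by rewrite -(VC y).
  by move: xy; rewrite (tC x y Logic.I Logic.I) ?eqxx//; exists u.
rewrite (_ : (fun w => _) = (fun w => Z' w * (expR (- (y * fine (mu w (C y)))))%:E)); last first.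
  apply/funext => w; rewrite /Z' -muleA -EFinM -expRD big_cons; congr (_ * (expR _)%:E).
  by rewrite opprD addrC.
have LCy : Lambda (C y) < +oo by rewrite LC// mem_head.
have y0 : (0 <= y)%R by rewrite s0// mem_head.
rewrite (prm_indep_laplace muP (fun A => measure_ge0 Lambda A) mZ' Z'0 (mC y) V'C LCy y0).
rewrite IH//; last 2 first.
- by move=> x xs; rewrite s0// in_cons xs orbT.
- by move=> x xs; rewrite LC// in_cons xs orbT.
rewrite -muleA -EFinM -expRD big_cons; congr (_ * (expR _)%:E).
by rewrite opprD addrC.
Qed.


(** Markov's inequality at level [y]. *)
Lemma fin_num_nnsfun_level (m : {measure set U -> \bar R}) (D : set U) (f : U -> R)
    (h : {nnsfun U >-> R}) (y : R) : measurable D -> measurable_fun setT f ->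
  (forall x, h x <= f x)%R -> \int[m]_(x in D) (f x)%:E < +oo -> (0 < y)%R ->
  m (h @^-1` [set y] `&` D) < +oo.
Proof.
move=> mD mf hf If y0.
have mh : measurable (h @^-1` [set y]) by [].
have f0 x : (0 <= f x)%R by exact: le_trans (hf x).
suff : y%:E * m (h @^-1` [set y] `&` D) <= \int[m]_(x in D) (f x)%:E.
  move=> /le_lt_trans/(_ If); rewrite !ltey; apply: contra => /eqP ->.
  by rewrite gt0_muley.
rewrite -(integral_indic _ mD mh) -ge0_integralZl_EFin//; last 2 first.
- exact/measurable_EFinP/measurable_funTS.
- exact: ltW.
apply: ge0_le_integral => //.
- by move=> x _; rewrite -EFinM lee_fin mulr_ge0// ltW.
- apply/measurable_EFinP/measurable_funTS; exact: measurable_funM.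
- exact/measurable_EFinP/measurable_funTS.
- move=> x _; rewrite -EFinM lee_fin indicE.
  by case: (boolP (x \in _)) => [|_]; rewrite ?mulr1 ?mulr0// inE /= => <-.
Qed.

(** The level sets of [h] at nonzero values are disjoint. Domination by the integrable [f] makes
    their intensity finite and their counts almost surely finite, which the finite-sum formula and
    the passage through [fine] require. *)
Lemma laplace_nnsfun (V D : set U) (Z : T -> \bar R) (f : U -> R) (h : {nnsfun U >-> R}) :
  measurable_fun setT (Z : g_sigma_algebraType (F V) -> \bar R) -> (forall w, 0 <= Z w) ->
  measurable D -> V `&` D = set0 -> measurable_fun setT f ->
  (forall x, h x <= f x)%R ->
  \int[Lambda]_(x in D) (f x)%:E < +oo ->
  {ae P, forall w, \int[mu w]_(x in D) (f x)%:E < +oo} ->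
  \int[P]_w (Z w * (expR (- fine (\int[mu w]_(x in D) (h x)%:E)))%:E) =
  \int[P]_w Z w * (expR (- fine (\int[Lambda]_(x in D) (1 - expR (- h x))%:E)))%:E.
Proof.
move=> mZ Z0 mD VD mf hf Lf muf.
have mZ' := measurable_fun_sub_sigma (@null_completion_sub_measurable _ _ _ _ _ P mu V) mZ.
pose C y := h @^-1` [set y] `&` D.
have mC y : measurable (C y) by apply: measurableI.
have LC y : y \in nnsfun_values h -> Lambda (C y) < +oo.
  by move=> /nnsfun_values_gt0; exact: (fin_num_nnsfun_level mD mf hf Lf).
have := @laplace_finite_sum V Z (nnsfun_values h) C mZ Z0 (uniq_nnsfun_values h).
move=> /(_ _ mC _ _ LC) E.
have <- : \int[P]_w (Z w * (expR (- \sum_(y <- nnsfun_values h) y * fine (mu w (C y))))%:E) =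
    \int[P]_w (Z w * (expR (- fine (\int[mu w]_(x in D) (h x)%:E)))%:E).
  have mmu y : measurable_fun setT (fun w => mu w (C y)) by exact: (prm_measurable_fun muP).
  apply: ae_eq_integral => //.
  - apply: emeasurable_funM => //; apply/measurable_EFinP; apply: measurableT_comp => //.
    apply: measurableT_comp => //; apply: measurable_sum => y; apply: measurable_funM => //.
    exact: measurableT_comp.
  - apply: emeasurable_funM => //; apply/measurable_EFinP; apply: measurableT_comp => //.
    apply: measurableT_comp => //; apply: measurableT_comp => //.
    by apply: (campbell_measurable muP) => //; [exact/measurable_EFinP|move=> x; rewrite lee_fin].
  apply: filterS muf => w fw _; congr (_ * (expR (- _))%:E).
  rewrite (@integral_nnsfun_comp _ _ _ (mu w) D id h)// [in RHS]big_seq.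
  under [in RHS]eq_bigr => y ys.
    have LCy : mu w (C y) < +oo.
      by apply: (fin_num_nnsfun_level mD mf hf fw); exact: nnsfun_values_gt0 ys.
    have -> : mu w (h @^-1` [set y] `&` D) = (fine (mu w (C y)))%:E.
      by rewrite fineK// ge0_fin_numE.
    rewrite -EFinM; over.
  by rewrite sumEFin/= -big_seq.
rewrite E; last 3 first.
- by move=> y /nnsfun_values_gt0/ltW.
- by move=> x y _ _ [u [[/= <- _] [/= <- _]]].
- by move=> y; apply/seteqP; split => // u [Vu [_ Du]]; rewrite -VD.
congr (_ * (expR (- _))%:E).
rewrite (@integral_nnsfun_comp _ _ _ Lambda D (fun y => 1 - expR (- y))%R h)//; last 2 first.
- by rewrite oppr0 expR0 subrr.
- by move=> y y0; rewrite subr_ge0 -expR0 ler_expR oppr_le0.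
rewrite [in RHS]big_seq.
under [in RHS]eq_bigr => y ys.
  have -> : Lambda (h @^-1` [set y] `&` D) = (fine (Lambda (C y)))%:E.
    by rewrite fineK// ge0_fin_numE// LC.
  rewrite -EFinM; over.
by rewrite sumEFin/= -big_seq; apply: eq_bigr => y _; rewrite mulrC.
Qed.

(** Simple functions increase to [f]; the left side converges by domination by [Z], the right side
    by monotone convergence of 1 - e^(-h_n). Campbell's formula makes the integral of [f] against
    [mu w] almost surely finite, so that [fine] loses nothing. *)
Lemma laplace_functional (V D : set U) (Z : T -> \bar R) (f : U -> R) :
  measurable_fun setT (Z : g_sigma_algebraType (F V) -> \bar R) -> (forall w, 0 <= Z w) ->
  \int[P]_w Z w < +oo ->
  measurable D -> V `&` D = set0 -> measurable_fun setT f -> (forall x, 0 <= f x)%R ->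
  \int[Lambda]_(x in D) (f x)%:E < +oo ->
  \int[P]_w (Z w * (expR (- fine (\int[mu w]_(x in D) (f x)%:E)))%:E) =
  \int[P]_w Z w * (expR (- fine (\int[Lambda]_(x in D) (1 - expR (- f x))%:E)))%:E.
Proof.
move=> mZ Z0 IZ mD VD mf f0 Lf.
have mZ' := measurable_fun_sub_sigma (@null_completion_sub_measurable _ _ _ _ _ P mu V) mZ.
have mEf : measurable_fun setT (EFin \o f) by exact/measurable_EFinP.
have f0' x : 0 <= (f x)%:E by rewrite lee_fin.
have muf : {ae P, forall w, \int[mu w]_(x in D) (f x)%:E < +oo}.
  have EI : \int[P]_w \int[mu w]_(x in D) (f x)%:E = \int[Lambda]_(x in D) (f x)%:E.
    have := @campbell _ _ _ _ _ _ _ Lambda muP V D (cst 1) (EFin \o f)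
      (@measurable_cst _ _ _ _ _ _) (fun=> lee01) mD VD mEf f0'.
    have -> : \int[P]_w cst 1 w = 1.
      by rewrite integral_cst// mul1e; exact: probability_setT.
    rewrite mul1e => <-.
    by apply: eq_integral => w _; rewrite mul1e.
  have mI := campbell_measurable muP mD mEf f0'.
  have : P.-integrable setT (fun w => \int[mu w]_(x in D) (f x)%:E).
    apply/integrableP; split => //.
    under eq_integral do rewrite gee0_abs ?integral_ge0//.
    by rewrite EI.
  move=> /(integrable_ae measurableT); apply: filterS => w /(_ Logic.I).
  by rewrite ge0_fin_numE// integral_ge0.
have mT := @measurableT _ U.
pose h := nnsfun_approx mT mEf.
have ndh x : nondecreasing_seq (fun n => (h n x)%:E).
  by move=> p q pq; rewrite lee_fin; exact/lefP/nd_nnsfun_approx.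
have ch x : (h n x)%:E @[n --> \oo] --> (f x)%:E.
  exact: (cvg_nnsfun_approx mT mEf (fun x _ => f0' x)).
have hf n x : (h n x <= f x)%R.
  rewrite -lee_fin /h nnsfun_approxE.
  exact: (@le_approx _ _ _ setT (EFin \o f) n x (fun y _ => f0' y) Logic.I).
have cI (m : {measure set U -> \bar R}) :
    \int[m]_(x in D) (h n x)%:E @[n --> \oo] --> \int[m]_(x in D) (f x)%:E.
  rewrite (_ : (fun x => (f x)%:E) = (fun x => limn (fun n => (h n x)%:E))); last first.
    by apply/funext => x; apply/esym/cvg_lim => //; exact: ch.
  apply: cvg_monotone_convergence => //.
  - by move=> n; exact/measurable_EFinP/measurable_funTS.
  - by move=> n x _; rewrite lee_fin.
have c1 : \int[P]_w (Z w * (expR (- fine (\int[mu w]_(x in D) (h n x)%:E)))%:E) @[n --> \oo] -->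
          \int[P]_w (Z w * (expR (- fine (\int[mu w]_(x in D) (f x)%:E)))%:E).
  have mg (g : U -> R) : measurable_fun setT g -> (forall x, (0 <= g x)%R) ->
     measurable_fun setT (fun w => Z w * (expR (- fine (\int[mu w]_(x in D) (g x)%:E)))%:E).
    move=> mg g0.
    apply: emeasurable_funM => //; apply/measurable_EFinP; apply: measurableT_comp => //.
    apply: measurableT_comp => //; apply: measurableT_comp => //.
    by apply: (campbell_measurable muP) => //; exact/measurable_EFinP.
  have iZ : P.-integrable setT Z.
    by apply/integrableP; split => //; under eq_integral do rewrite gee0_abs//.
  have := @dominated_convergence _ _ _ P setT measurableT
    (fun n w => Z w * (expR (- fine (\int[mu w]_(x in D) (h n x)%:E)))%:E)
    (fun w => Z w * (expR (- fine (\int[mu w]_(x in D) (f x)%:E)))%:E) Z.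
  case => //.
  - by move=> n; apply: mg.
  - exact: mg.
  - have : {ae P, forall w, Z w \is a fin_num}.
      by apply: filterS (integrable_ae measurableT iZ) => w; exact.
    apply: filterS2 muf => w fw Zw _.
    apply: cvgeZl => //; apply: cvg_EFin; first exact: nearW.
    have : fine (\int[mu w]_(x in D) (h n x)%:E) @[n --> \oo] --> fine (\int[mu w]_(x in D) (f x)%:E).
      apply: fine_cvg; rewrite fineK//; last by rewrite ge0_fin_numE// integral_ge0.
    exact: cvg_expRN.
  - apply: aeW => w n _; rewrite abseM gee0_abs// -[leRHS]mule1 lee_wpmul2l//=.
    rewrite lee_fin ger0_norm ?expR_ge0// -expR0 ler_expR oppr_le0.
    by rewrite fine_ge0// integral_ge0// => x _; rewrite lee_fin.
have c2 : \int[P]_w Z w * (expR (- fine (\int[Lambda]_(x in D) (1 - expR (- h n x))%:E)))%:E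
    @[n --> \oo] -->
    \int[P]_w Z w * (expR (- fine (\int[Lambda]_(x in D) (1 - expR (- f x))%:E)))%:E.
  apply: cvgeZl; first by rewrite ge0_fin_numE// integral_ge0.
  apply: cvg_EFin; first exact: nearW.
  apply: cvg_expRN; apply: fine_cvg.
  have phi0 y : (0 <= y)%R -> (0 <= 1 - expR (- y))%R.
    by move=> y0; rewrite subr_ge0 -expR0 ler_expR oppr_le0.
  have mphi (g : U -> R) : measurable_fun setT g ->
      measurable_fun setT (fun x => (1 - expR (- g x))%:E).
    move=> mg; apply/measurable_EFinP; apply: measurable_funB => //.
    by apply: measurableT_comp => //; exact: measurableT_comp.
  rewrite fineK; last first.
    rewrite ge0_fin_numE; last by apply: integral_ge0 => x _; rewrite lee_fin phi0.
    apply: le_lt_trans Lf; apply: ge0_le_integral => //.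
    - by move=> x _; rewrite lee_fin phi0.
    - exact: measurable_funTS (mphi _ mf).
    - exact: measurable_funTS mEf.
    - move=> x _; rewrite lee_fin lerBlDr -lerBlDl.
      by have := expR_ge1Dx (- f x); rewrite addrC; lra.
  rewrite (_ : (fun x => (1 - expR (- f x))%:E) =
      (fun x => limn (fun n => (1 - expR (- h n x))%:E))); last first.
    apply/funext => x; apply/esym/cvg_lim => //.
    apply: cvg_EFin; first exact: nearW.
    apply: cvgB; first exact: cvg_cst.
    by apply: cvg_expRN; exact: (fine_cvg (ch x)).
  apply: cvg_monotone_convergence => //.
  - by move=> n; exact: measurable_funTS (mphi _ _).
  - by move=> n x _; rewrite lee_fin phi0.
  - by move=> x _ p q pq; rewrite lee_fin lerB// ler_expR lerN2 -lee_fin; exact: (ndh x).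
move: c1; under eq_cvg => n do rewrite (laplace_nnsfun mZ Z0 mD VD mf (hf n) Lf muf).
by move=> c1; exact: (cvg_unique _ c1 c2).
Qed.

End laplace_functional.

(** * Cadlag paths and their approximation on grids *)

Section cadlag_paths.
Context {R : realType}.
Implicit Types (y : R -> R).

Definition left_lim (y : R -> R) (t : R) : R := lim (y v @[v --> t^'-]).

(** The first point of the grid of mesh 1/(n+1) strictly to the right of [v]. One-sided limits are
    punctured, so the approximating points must avoid [v] itself. *)
Definition grid_floor (n : nat) (v : R) : R := (Num.floor (v * n.+1%:R) + 1)%:~R / n.+1%:R.

(** The last grid point strictly to the left of [v]. A process read there depends only on the time
    before [v], which is what makes left limits predictable. *)
Definition grid_ceil (n : nat) (v : R) : R := (Num.ceil (v * n.+1%:R) - 1)%:~R / n.+1%:R.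

Lemma grid_floor_gt n v : v < grid_floor n v.
Proof. by rewrite ltr_pdivlMr// floorD1_gt. Qed.

Lemma grid_floor_le n v : grid_floor n v <= v + n.+1%:R^-1.
Proof.
rewrite ler_pdivrMr// mulrDl mulVf ?gt_eqF// intrD lerD2r.
exact: floor_le.
Qed.

Lemma grid_ceil_lt n v : grid_ceil n v < v.
Proof.
by rewrite ltr_pdivrMr// intrB ltrBlDr; have /andP[] := ceil_itv (v * n.+1%:R); lra.
Qed.

Lemma grid_ceil_ge n v : v - n.+1%:R^-1 <= grid_ceil n v.
Proof.
rewrite ler_pdivlMr// mulrBl mulVf ?gt_eqF// intrB lerD2r.
exact: ceil_ge.
Qed.

Lemma cvg_grid_floor v : grid_floor n v @[n --> \oo] --> v.
Proof.
apply: (@squeeze_cvgr _ _ _ _ (fun=> v) (fun n => v + n.+1%:R^-1)).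
- by apply: nearW => n; rewrite ltW ?grid_floor_gt// grid_floor_le.
- exact: cvg_cst.
- by rewrite -[X in _ --> X]addr0; apply: cvgD; [exact: cvg_cst|exact: cvg_harmonic].
Qed.

Lemma cvg_grid_ceil v : grid_ceil n v @[n --> \oo] --> v.
Proof.
apply: (@squeeze_cvgr _ _ _ _ (fun n => v - n.+1%:R^-1) (fun=> v)).
- by apply: nearW => n; rewrite (ltW (grid_ceil_lt _ _)) grid_ceil_ge.
- by rewrite -[X in _ --> X]subr0; apply: cvgB; [exact: cvg_cst|exact: cvg_harmonic].
- exact: cvg_cst.
Qed.

Lemma cadlag_grid_floor y v : cadlag y -> y (grid_floor n v) @[n --> \oo] --> y v.
Proof.
move=> /(_ v)[/cvg_at_rightP + _]; apply; split; last exact: cvg_grid_floor.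
by move=> n; exact: grid_floor_gt.
Qed.

Lemma cadlag_grid_ceil y v : cadlag y -> y (grid_ceil n v) @[n --> \oo] --> left_lim y v.
Proof.
move=> /(_ v)[_ /cvg_at_leftP]; apply; split; last exact: cvg_grid_ceil.
by move=> n; exact: grid_ceil_lt.
Qed.

Lemma measurable_grid_floor_eq n (k : int) :
  measurable [set v : R | grid_floor n v = (k + 1)%:~R / n.+1%:R].
Proof.
rewrite (_ : [set v | _] = `[k%:~R / n.+1%:R, (k + 1)%:~R / n.+1%:R[%classic)//.
apply/seteqP; split => v /=; rewrite in_itv/= ler_pdivrMr// ltr_pdivlMr//.
  rewrite /grid_floor => /(congr1 ( *%R^~ n.+1%:R)); rewrite !divfK ?gt_eqF//.
  by move=> /intr_inj/addIr <-; exact: floor_itv.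
by move=> /floor_def; rewrite /grid_floor => ->.
Qed.

(** Near each point the value and the two one-sided limits give a local bound, and compactness of
    the interval makes it uniform. *)
Lemma cadlag_bounded y (s t : R) : cadlag y ->
  exists M : R, forall v, s <= v <= t -> `|y v| <= M.
Proof.
move=> cy.
have := @segment_compact _ s t => /compact_near_coveringP.
move=> /(_ R (pinfty_nbhs R) (fun M v => `|y v| <= M) _) H.
have : \forall M \near +oo, `[s, t]%classic `<=` (fun v => `|y v| <= M).
  apply: H => v _.
  have [cr /cvg_ex[l cl]] := cy v.
  have hr : \forall x \near v^'+, `|y x| <= `|y v| + 1.
    move/cvgrPdist_le : cr => /(_ 1 ltr01); apply: filterS => x /= h.
    by rewrite -(subrK (y v) (y x)) (le_trans (ler_normD _ _))// addrC lerD2l distrC.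
  have hl : \forall x \near v^'-, `|y x| <= `|l| + 1.
    move/cvgrPdist_le : cl => /(_ 1 ltr01); apply: filterS => x /= h.
    by rewrite -(subrK l (y x)) (le_trans (ler_normD _ _))// addrC lerD2l distrC.
  pose B := `|y v| + `|l| + 1.
  have hB : \forall x \near v, `|y x| <= B.
    have hl' : \forall x \near v, x < v -> `|y x| <= `|l| + 1 by exact: hl.
    have hr' : \forall x \near v, v < x -> `|y x| <= `|y v| + 1 by exact: hr.
    apply: filterS2 hl' hr' => x /= h1 h2.
    have n1 := normr_ge0 (y v); have n2 := normr_ge0 l; rewrite /B.
    have [xv|vx|->] := ltgtP x v; last lra.
      by apply: (le_trans (h1 xv)); lra.
    by apply: (le_trans (h2 vx)); lra.
  exists ([set x | `|y x| <= B], [set M | B <= M]) => /=.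
    by split => //; apply: nbhs_pinfty_ge; exact: num_real.
  by move=> [x M] /= [h1 h2]; exact: le_trans h2.
move=> /pinfty_ex_gt0[M _ HM]; exists M => v /andP[sv vt]; apply: HM.
by rewrite /= in_itv/= sv vt.
Qed.

Lemma measurable_grid_ceil_eq n (k : int) :
  measurable [set v : R | grid_ceil n v = (k - 1)%:~R / n.+1%:R].
Proof.
rewrite (_ : [set v | _] = `](k - 1)%:~R / n.+1%:R, k%:~R / n.+1%:R]%classic)//.
apply/seteqP; split => v /=; rewrite in_itv/= ltr_pdivrMr// ler_pdivlMr//.
  rewrite /grid_ceil => /(congr1 ( *%R^~ n.+1%:R)); rewrite !divfK ?gt_eqF//.
  by move=> /intr_inj/addIr <-; exact: ceil_itv.
by move=> /ceil_def; rewrite /grid_ceil => ->.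
Qed.

Lemma preimage_grid_floor (S : Type) (X : R -> S) (A : set S) n :
  (fun v => X (grid_floor n v)) @^-1` A =
  \bigcup_(k : int) ([set v | grid_floor n v = (k + 1)%:~R / n.+1%:R] `&`
                     [set v | A (X ((k + 1)%:~R / n.+1%:R))]).
Proof.
apply/seteqP; split => v /=.
  by move=> Av; exists (Num.floor (v * n.+1%:R)).
by move=> [k _ /= [-> ]].
Qed.

End cadlag_paths.

Section cadlag_processes.
Context d (T : measurableType d) (R : realType).

Lemma measurable_cadlag_process (X : R -> T -> R) :
  (forall t, measurable_fun setT (X t)) -> (forall w, cadlag (X ^~ w)) ->
  measurable_fun setT (fun p : T * R => X p.2 p.1).
Proof.
move=> mX cX.
apply: (measurable_fun_cvg (h := fun n (p : T * R) => X (grid_floor n p.2) p.1)); last first.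
  by move=> p _; exact: (@cadlag_grid_floor _ (X ^~ p.1)).
move=> n _ S mS; rewrite setTI.
rewrite (_ : _ @^-1` _ = \bigcup_(k : int)
    ((X ((k + 1)%:~R / n.+1%:R) @^-1` S) `*` [set v | grid_floor n v = (k + 1)%:~R / n.+1%:R])).
  apply: countable_bigcupT_measurable; first exact: countableP.
  move=> k; apply: measurableX; last exact: measurable_grid_floor_eq.
  by rewrite -[_ @^-1` _]setTI; exact: mX.
apply/seteqP; split => [[w v]/= Sv|[w v]/= [k _ [/= Sv gk]]]; last by rewrite gk.
exists (Num.floor (v * n.+1%:R)) => //.
Qed.

Lemma measurable_cadlag (y : R -> R) : cadlag y -> measurable_fun setT y.
Proof.
move=> cy.
apply: (measurable_fun_cvg (h := fun n v => y (grid_floor n v))); last first.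
  by move=> v _; exact: cadlag_grid_floor.
move=> n _ S mS; rewrite setTI preimage_grid_floor.
apply: countable_bigcupT_measurable; first exact: countableP.
move=> k; apply: measurableI; first exact: measurable_grid_floor_eq.
case: (pselect (S (y ((k + 1)%:~R / n.+1%:R)))) => [h|h].
  by rewrite (_ : [set _ | _] = setT)//; apply/seteqP; split.
by rewrite (_ : [set _ | _] = set0)//; apply/seteqP; split.
Qed.

End cadlag_processes.

(** * Exponential kernels and the resolvent of a Volterra equation *)

Section exponential_convolution.
Context {R : realType}.
Local Notation leb := (@lebesgue_measure R).
Implicit Types (y M : R -> R) (a h rho u s t : R).

Definition exp_conv (a : R) (y : R -> R) (s t : R) : R :=
  \int[leb]_(v in `[s, t]) (expR (- a * (t - v)) * y v).

Lemma bounded_integrable_itv y s t B : measurable_fun setT y ->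
  (forall v, s <= v <= t -> `|y v| <= B) -> leb.-integrable `[s, t] (EFin \o y).
Proof.
move=> my yB; apply: measurable_bounded_integrable => //.
- by apply: compact_finite_measure; exact: segment_compact.
- exact: measurable_funTS.
- exists B; split; first exact: num_real.
  by move=> z Bz v /=; rewrite in_itv/= => sv; rewrite (le_trans (yB v sv))// ltW.
Qed.

Lemma expR_bound a s t v : s <= v <= t -> expR (- a * (t - v)) <= expR (`|a| * (t - s)).
Proof.
move=> /andP[sv vt]; rewrite ler_expR; apply: (@le_trans _ _ (`|a| * (t - v))).
  by rewrite ler_wpM2r ?subr_ge0// -normrN ler_norm.
by rewrite ler_wpM2l// lerB.
Qed.

Lemma measurable_expRN a t : measurable_fun setT (fun v : R => expR (- a * (t - v))).
Proof.
by apply: measurableT_comp => //; apply: measurable_funM => //; exact: measurable_funB.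
Qed.

Lemma exp_conv_integrable a y s t B : measurable_fun setT y ->
  (forall v, s <= v <= t -> `|y v| <= B) ->
  leb.-integrable `[s, t] (EFin \o (fun v => expR (- a * (t - v)) * y v)).
Proof.
move=> my yB; apply: (@bounded_integrable_itv _ _ _ (expR (`|a| * (t - s)) * B)).
  by apply: measurable_funM => //; exact: measurable_expRN.
move=> v sv; rewrite normrM ger0_norm ?expR_ge0// ler_pM ?expR_ge0// ?yB//.
exact: expR_bound.
Qed.

(** The exponents add up to -u v plus a constant, so the integrand is an exact derivative. Keeping
    the factor [u] inside avoids a division and covers u = 0. *)
Lemma integral_exp_difference h rho u (w t : R) : w <= t -> h = rho - u ->
  \int[leb]_(v in `[w, t]) (u * (expR (- h * (t - v)) * expR (- rho * (v - w)))) =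
  expR (- h * (t - w)) - expR (- rho * (t - w)).
Proof.
rewrite le_eqVlt => /predU1P[-> _|wt hE].
  by rewrite set_itv1 Rintegral_set1 subrr !mulr0 subrr.
pose F (v : R) := - expR ((- u) * v + (rho * w - h * t)).
have dF (v : R) : is_derive v 1 F (u * (expR (- h * (t - v)) * expR (- rho * (v - w)))).
  rewrite /F -expRD (_ : - h * (t - v) + - rho * (v - w) = - u * v + (rho * w - h * t)); last first.
    by rewrite hE; ring.
  apply: is_derive_eq.
  rewrite /GRing.scale /=; ring.
have cf : continuous (fun v : R => u * (expR (- h * (t - v)) * expR (- rho * (v - w)))).
  move=> v; apply: cvgM; first exact: cvg_cst.
  have c (a b : R) : expR (a * x + b) @[x --> v] --> expR (a * v + b).
    apply: (@continuous_comp _ _ _ (fun x : R => a * x + b) expR); last exact: continuous_expR.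
    apply: cvgD; last exact: cvg_cst.
    by apply: cvgM; [exact: cvg_cst|exact: cvg_id].
  apply: cvgM.
    rewrite (_ : (fun x => expR (- h * (t - x))) = (fun x => expR (h * x + - h * t))).
      rewrite (_ : - h * (t - v) = h * v + - h * t); last by ring.
      exact: c.
    by apply/funext => x; congr expR; ring.
  rewrite (_ : (fun x => expR (- rho * (x - w))) = (fun x => expR (- rho * x + rho * w))).
    rewrite (_ : - rho * (v - w) = - rho * v + rho * w); last by ring.
    exact: c.
  by apply/funext => x; congr expR; ring.
have cF : continuous F.
  by move=> v; apply/differentiable_continuous/derivable1_diffP; have [] := dF v.
rewrite /Rintegral (@continuous_FTC2 _ _ F)//.
- rewrite /= /F.
  rewrite (_ : - u * t + (rho * w - h * t) = - rho * (t - w)); last by rewrite hE; ring.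
  rewrite (_ : - u * w + (rho * w - h * t) = - h * (t - w)); last by rewrite hE; ring.
  by ring.
- exact: continuous_subspaceT.
- split.
  + by move=> v _; have [] := dF v.
  + by apply: cvg_at_right_filter; exact: cF.
  + by apply: cvg_at_left_filter; exact: cF.
- by move=> v _; rewrite derive1E; apply: derive_val; exact: dF.
Qed.

Lemma Rintegral_exchange (f : R * R -> R) :
  (leb \x leb)%E.-integrable setT (EFin \o f) ->
  \int[leb]_x (\int[leb]_y f (x, y)) = \int[leb]_y (\int[leb]_x f (x, y)).
Proof.
move=> fi; rewrite /Rintegral; congr fine.
transitivity (\int[leb]_x \int[leb]_y (f (x, y))%:E)%E.
  apply: ae_eq_integral => //.
  - apply/measurable_EFinP; apply: measurableT_comp => //.
    exact: (measurable_fubini_F fi).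
  - exact: (measurable_fubini_F fi).
  - apply: filterS (ae_integrable1 fi) => x xi _.
    by rewrite fineK//; exact: integrable_fin_num.
have -> := Fubini fi.
apply: ae_eq_integral => //.
- exact: (measurable_fubini_G fi).
- apply/measurable_EFinP; apply: measurableT_comp => //.
  exact: (measurable_fubini_G fi).
- apply: filterS (ae_integrable2 fi) => x xi _.
  by rewrite fineK//; exact: integrable_fin_num.
Qed.

(** The kernel u e^(-rho x) has resolvent u e^(-(rho-u) x): insert the equation for [y] into the
    convolution at rate rho - u and exchange the integrals over a triangle. Measurability of [M] is
    not given, so integrability of its convolution is part of the conclusion. With rho = 0 this
    lemma also yields the Gronwall bound and the solution of linear equations. *)
Lemma resolvent y M rho u s t B : s <= t -> measurable_fun setT y ->
  (forall v, s <= v <= t -> `|y v| <= B) ->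
  (forall v, s <= v <= t -> y v = M v + u * exp_conv rho y s v) ->
  leb.-integrable `[s, t] (EFin \o (fun v => expR (- (rho - u) * (t - v)) * M v)) /\
  y t = M t + u * exp_conv (rho - u) M s t.
Proof.
move=> st my yB yE; set h := rho - u.
have B0 : 0 <= B by apply: le_trans (yB s _); rewrite ?lexx.
(* The triangle of pairs (v, w) with s <= w <= v <= t. *)
pose A := [set p : R * R | [/\ s <= p.2, p.2 <= p.1 & p.1 <= t]].
pose g (p : R * R) := u * (expR (- h * (t - p.1)) * expR (- rho * (p.1 - p.2))) * y p.2.
pose f (p : R * R) := \1_A p * g p.
have mA : measurable A.
  rewrite (_ : A = [set p : R * R | s <= p.2] `&` [set p | p.2 <= p.1] `&` [set p | p.1 <= t]).
    have ml (f1 f2 : R * R -> R) : measurable_fun setT f1 -> measurable_fun setT f2 ->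
        measurable [set p | f1 p <= f2 p].
      by move=> m1 m2; rewrite -[X in measurable X]setTI; exact: measurable_fun_le.
    apply: measurableI; last exact: ml.
    by apply: measurableI; exact: ml.
  by apply/seteqP; split => [p []|p [[]]].
have mg : measurable_fun setT g.
  apply: measurable_funM; last exact: measurableT_comp.
  apply: measurable_funM => //; apply: measurable_funM.
    apply: measurableT_comp => //; apply: measurable_funM => //; exact: measurable_funB.
  apply: measurableT_comp => //; apply: measurable_funM => //; exact: measurable_funB.
have fi : (leb \x leb)%E.-integrable setT (EFin \o f).
  pose C := `|u| * (expR (`|h| * (t - s)) * expR (`|rho| * (t - s))) * B.
  pose Sq := `[s, t]%classic `*` `[s, t]%classic : set (R * R).
  have mSq : measurable Sq by apply: measurableX.
  have ig : (leb \x leb)%E.-integrable setT (fun p => C%:E * (\1_Sq p)%:E)%E.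
    apply: integrableZl => //; apply/integrableP; split; first exact/measurable_EFinP.
    under eq_integral do rewrite gee0_abs ?lee_fin//.
    rewrite integral_indic//.
    rewrite setIT /= product_measure1E//; apply: lte_mul_pinfty => //.
      by rewrite ge0_fin_numE//; apply: compact_finite_measure; exact: segment_compact.
    by apply: compact_finite_measure; exact: segment_compact.
  apply: le_integrable ig => //.
  - by apply/measurable_EFinP; apply: measurable_funM.
  - move=> p _; rewrite /= lee_fin /f normrM.
    have C0 : 0 <= C by rewrite !mulr_ge0// expR_ge0.
    have [pA|pA] := boolP (p \in A); last first.
      by rewrite indicE (negbTE pA) normr0 mul0r.
    have [s2 p21 pt] := set_mem pA.
    have pS : p \in Sq.
      by rewrite inE; split => /=; rewrite in_itv/= ?(le_trans s2)// ?s2 ?(le_trans p21).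
    rewrite !indicE pA pS normr1 mul1r mulr1 (ger0_norm C0) /g !normrM.
    rewrite ler_pM//; last by apply: yB; rewrite s2 (le_trans p21).
    rewrite ler_pM// ler_pM// ger0_norm ?expR_ge0//.
      by apply: expR_bound; rewrite (le_trans s2).
    apply: (@le_trans _ _ (expR (`|rho| * (p.1 - p.2)))).
      by apply: expR_bound; rewrite lexx.
    by rewrite ler_expR ler_wpM2l// lerB.
have fE v : s <= v <= t -> (fun w => f (v, w)) =
    (fun w => u * expR (- h * (t - v)) * (expR (- rho * (v - w)) * y w)) \_ `[s, v].
  move=> /andP[sv vt]; apply/funext => w; rewrite /f /g patchE /= indicE.
  have -> : ((v, w) \in A) = (w \in `[s, v]%classic).
    apply/idP/idP; rewrite !inE /A /= in_itv/=; first by move=> [-> -> _].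
    by move=> /andP[].
  by case: ifP => _; rewrite ?mul0r ?mul1r// !mulrA.
have yi v : s <= v <= t ->
    leb.-integrable `[s, v] (EFin \o (fun w => expR (- rho * (v - w)) * y w)).
  move=> /andP[sv vt]; apply: (@exp_conv_integrable _ _ _ _ B) => // w /andP[sw wv].
  by apply: yB; rewrite sw (le_trans wv).
have E1 v : s <= v <= t ->
    \int[leb]_w f (v, w) = u * (expR (- h * (t - v)) * exp_conv rho y s v).
  move=> sv; rewrite fE// -Rintegral_mkcond mulrA /exp_conv -RintegralZl//.
  exact: yi.
have E1' v : ~~ (s <= v <= t) -> \int[leb]_w f (v, w) = 0.
  move=> sv; rewrite (_ : (fun w => f (v, w)) = cst 0).
    by rewrite /Rintegral integral0.
  apply/funext => w; rewrite /f indicE memNset ?mul0r// => -[/= s2 p21 pt].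
  by move: sv; rewrite pt (le_trans s2).
have E2 w : \int[leb]_v f (v, w) =
    (if s <= w <= t then (expR (- h * (t - w)) - expR (- rho * (t - w))) * y w else 0).
  case: ifPn => [/andP[sw wt]|sw].
    rewrite -(@integral_exp_difference h rho u w t)// -RintegralZr//; last first.
      apply: (@bounded_integrable_itv _ _ _ (`|u| * (expR (`|h| * (t - w)) * expR (`|rho| * (t - w))))).
        apply: measurable_funM => //; apply: measurable_funM; first exact: measurable_expRN.
        by apply: measurableT_comp => //; apply: measurable_funM => //; exact: measurable_funB.
      move=> v /andP[wv vt]; rewrite !normrM ler_wpM2l// ler_pM//.
        by rewrite ger0_norm ?expR_ge0//; apply: expR_bound; rewrite wv.
      rewrite ger0_norm ?expR_ge0//; apply: (@le_trans _ _ (expR (`|rho| * (v - w)))).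
        by apply: expR_bound; rewrite lexx.
      by rewrite ler_expR ler_wpM2l// lerB.
    rewrite [RHS]Rintegral_mkcond; apply: eq_Rintegral => v _.
    rewrite /f /g patchE /= indicE.
    have -> : ((v, w) \in A) = (v \in `[w, t]%classic).
      apply/idP/idP; rewrite !inE /A /= in_itv/=; first by move=> [_ -> ->].
      by move=> /andP[].
    by case: ifP => _; rewrite ?mul0r ?mul1r.
  rewrite (_ : (fun v => f (v, w)) = cst 0).
    by rewrite /Rintegral integral0.
  apply/funext => v; rewrite /f indicE memNset ?mul0r// => -[/= s2 p21 pt].
  by move: sw; rewrite s2 (le_trans p21).
(* Two iterated integrals of [f]: integrating out [w] first gives the convolution of [y] at rate
   rho, integrating out [v] first gives the difference of the two exponential kernels. *)
have key : \int[leb]_(v in `[s, t]) (u * (expR (- h * (t - v)) * exp_conv rho y s v)) =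
    exp_conv h y s t - exp_conv rho y s t.
  transitivity (\int[leb]_v \int[leb]_w f (v, w)).
    rewrite Rintegral_mkcond; apply: eq_Rintegral => v _; rewrite patchE mem_setE in_itv/=.
    by case: ifPn => sv; [rewrite E1|rewrite E1'].
  rewrite Rintegral_exchange// /exp_conv -RintegralB//; last 2 first.
  - exact: (exp_conv_integrable h my yB).
  - exact: (exp_conv_integrable rho my yB).
  rewrite [RHS]Rintegral_mkcond; apply: eq_Rintegral => w _; rewrite E2 patchE mem_setE in_itv/=.
  by case: ifP => // _; rewrite mulrBl.
have ffin (v : R) : s <= v <= t -> (\int[leb]_w (f (v, w))%:E)%E \is a fin_num.
  move=> sv; apply: integrable_fin_num => //.
  rewrite (_ : (fun w => (f (v, w))%:E) = EFin \o (fun w => f (v, w)))// fE//.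
  have H := @integrableZl _ _ _ leb _ (measurable_itv `[s, v]) (u * expR (- h * (t - v))) _ (yi v sv).
  have H2 := (@integrable_mkcond _ _ _ leb _ _ (measurable_itv `[s, v])).1 H.
  by rewrite restrict_EFin in H2.
have ci : leb.-integrable `[s, t]
    (EFin \o (fun v => u * (expR (- h * (t - v)) * exp_conv rho y s v))).
  have Fi : leb.-integrable `[s, t] (fun v => \int[leb]_w (f (v, w))%:E)%E.
    by apply: (integrableS measurableT) => //; exact: (integrable_fubini_F fi).
  apply: eq_integrable Fi => //.
  move=> v; rewrite inE/= in_itv/= => sv; rewrite -E1// /Rintegral fineK//.
  exact: ffin.
have ME : {in `[s, t]%classic, (fun v => expR (- h * (t - v)) * y v -
    u * (expR (- h * (t - v)) * exp_conv rho y s v)) =1 (fun v => expR (- h * (t - v)) * M v)}.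
  by move=> v; rewrite inE/= in_itv/= => sv; rewrite (yE v sv); ring.
split.
  have := @integrableB _ _ _ leb _ (measurable_itv `[s, t]) _ _ (exp_conv_integrable h my yB) ci.
  by apply: eq_integrable => // v sv /=; rewrite -ME.
rewrite [LHS]yE ?st ?lexx//; congr (_ + u * _).
rewrite [RHS](_ : _ = \int[leb]_(v in `[s, t]) (expR (- h * (t - v)) * y v -
    u * (expR (- h * (t - v)) * exp_conv rho y s v))); last first.
  by apply: eq_Rintegral => v sv; rewrite ME.
rewrite RintegralB//; last exact: (exp_conv_integrable h my yB).
by rewrite key /exp_conv; ring.
Qed.

End exponential_convolution.

(** * Paths that decay at rate r and jump upwards *)

Section dissipative_paths.
Context {R : realType}.
Local Notation leb := (@lebesgue_measure R).
Implicit Types (y : R -> R) (r s t : R).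

Lemma eq_ler (a b : R) : a = b -> a <= b.
Proof. by move=> ->. Qed.

Lemma cadlag_integrable y s t : cadlag y -> leb.-integrable `[s, t] (EFin \o y).
Proof.
move=> cy; have [B yB] := cadlag_bounded s t cy.
exact: bounded_integrable_itv (measurable_cadlag cy) yB.
Qed.

Lemma exp_conv0 y s t : exp_conv 0 y s t = \int[leb]_(v in `[s, t]) y v.
Proof. by apply: eq_Rintegral => v _; rewrite oppr0 mul0r expR0 mul1r. Qed.

Lemma Rintegral_cadlag_split y s v t : cadlag y -> s <= v -> v <= t ->
  \int[leb]_(x in `[s, t]) y x = \int[leb]_(x in `[s, v]) y x + \int[leb]_(x in `[v, t]) y x.
Proof.
move=> cy sv vt.
have := @Rintegral_itvB R y (BLeft s) (BRight t) v (cadlag_integrable s t cy).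
rewrite /= !bnd_simp => /(_ sv vt) E.
rewrite -(@Rintegral_itv_obnd_cbnd _ v (BRight t)); last first.
  apply: (integrableS _ _ _ (cadlag_integrable v t cy)) => //.
  by move=> x /=; rewrite !in_itv/= => /andP[/ltW -> ->].
by rewrite -E; ring.
Qed.

Section lower_bound.
Variables (y : R -> R) (r : R).
Hypothesis cy : cadlag y.
Hypothesis r0 : 0 < r.
Hypothesis yr : forall u v, u <= v -> 0 <= y v - y u + r * \int[leb]_(x in `[u, v]) y x.

Let M s v := y v + r * \int[leb]_(x in `[s, v]) y x.

Let M_homo s u v : s <= u -> u <= v -> M s u <= M s v.
Proof.
move=> su uv; rewrite /M (Rintegral_cadlag_split cy su uv) mulrDr -subr_ge0.
by apply: le_trans (yr uv) _; apply: eq_ler; ring.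
Qed.

(** [M s] is nondecreasing. The resolvent with rho = 0 and u = -r writes y_t as M_t - r int
    e^(-r(t-v)) M_v dv; bounding M_v by M_t leaves e^(-r(t-s)) M_t, which is at least e^(-r(t-s))
    M_s, and M_s = y_s. No sign of [y] enters, so the bound can later prove positivity. *)
Lemma dissipative_lower_bound s t : s <= t -> expR (- r * (t - s)) * y s <= y t.
Proof.
move=> st; have [B yB] := cadlag_bounded s t cy.
have yM v : s <= v <= t -> y v = M s v + (- r) * exp_conv 0 y s v.
  by move=> _; rewrite exp_conv0 /M; ring.
have [] := resolvent st (measurable_cadlag cy) yB yM.
rewrite sub0r opprK => iM ->.
have Ms : M s s = y s by rewrite /M set_itv1 Rintegral_set1 mulr0 addr0.
have I1 := @integral_exp_difference R r 0 (- r) s t st _.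
rewrite sub0r opprK in I1; have {}I1 := I1 erefl.
have ie : leb.-integrable `[s, t] (EFin \o (fun v => expR (- r * (t - v)) * M s t)).
  have := @exp_conv_integrable R r (cst (M s t)) s t `|M s t| (@measurable_cst _ _ _ _ _ _).
  by apply.
have le1 : exp_conv r (M s) s t <= \int[leb]_(v in `[s, t]) (expR (- r * (t - v)) * M s t).
  apply: le_Rintegral => // v /=; rewrite in_itv/= => /andP[sv vt].
  by rewrite ler_wpM2l ?expR_ge0// M_homo.
have le2 : r * \int[leb]_(v in `[s, t]) (expR (- r * (t - v)) * M s t) =
    M s t * (1 - expR (- r * (t - s))).
  have ie1 : leb.-integrable `[s, t] (EFin \o (fun v => expR (- r * (t - v)))).
    apply: (@bounded_integrable_itv _ _ _ _ (expR (`|r| * (t - s)))).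
      exact: measurable_expRN.
    by move=> v sv; rewrite ger0_norm ?expR_ge0//; exact: expR_bound.
  have I2 : r * \int[leb]_(v in `[s, t]) expR (- r * (t - v)) = 1 - expR (- r * (t - s)).
    have i1 := @integrableZl _ _ _ leb _ (measurable_itv `[s, t]) (- r) _ ie1.
    transitivity (- 1 * \int[leb]_(v in `[s, t]) (- r * expR (- r * (t - v)))).
      by rewrite RintegralZl//; ring.
    rewrite (_ : \int[leb]_(v in _) _ = expR (- r * (t - s)) - expR (- 0 * (t - s))).
      by rewrite oppr0 mul0r expR0; ring.
    by rewrite -I1; apply: eq_Rintegral => v _; rewrite oppr0 mul0r expR0 mulr1.
  by rewrite RintegralZr// mulrA I2 mulrC.
have : M s t - r * exp_conv r (M s) s t >= M s t * expR (- r * (t - s)).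
  rewrite lerBrDr -lerBrDl.
  apply: (@le_trans _ _ (r * \int[leb]_(v in `[s, t]) (expR (- r * (t - v)) * M s t))).
    by rewrite ler_pM2l.
  by rewrite le2; apply: eq_ler; ring.
have -> : M s t + - r * exp_conv (- - r) (M s) s t = M s t - r * exp_conv r (M s) s t.
  by rewrite opprK mulNr.
move=> h; apply: le_trans h.
by rewrite mulrC ler_wpM2r ?expR_ge0// -Ms M_homo.
Qed.

(** Adding the continuous function r int y turns [y] into a nondecreasing function with the same
    jumps, and a monotone function has countably many. *)
Lemma left_lim_neq_negligible : leb.-negligible [set v | left_lim y v != y v].
Proof.
suff H (n : nat) : countable [set v | v \in (`](- n%:R), n%:R[) /\ left_lim y v != y v].
  have cA : countable [set v | left_lim y v != y v].
    apply: (@sub_countable _ _ _ (\bigcup_n [set v | v \in (`](- n%:R), n%:R[) /\ left_lim y v != y v])).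
      apply: subset_card_le => v /= vy; have [n vn] : exists n : nat, `|v| < n%:R.
        by exists (Num.truncn `|v|).+1; exact: truncnS_gt.
      by exists n => //; split => //; rewrite in_itv/= -ltr_norml.
    by apply: bigcup_countable => // n _; exact: H.
  exists [set v | left_lim y v != y v]; split => //.
    by apply: countable_measurable.
  exact: countable_lebesgue_measure0.
set a := - n%:R : R; set b := n%:R : R.
have ndF : {in `[a, b] &, nondecreasing_fun (M a)}.
  by move=> u v; rewrite !in_itv/= => /andP[au _] _ uv; exact: M_homo.
apply: sub_countable (discontinuity_countable ndF); apply: subset_card_le => v /= [vab vy].
split => //.
have [av vb] : a < v /\ v < b by move: vab; rewrite in_itv/= => /andP[].
have cI : {for v, continuous (fun x => \int[leb]_(z in `[a, x]) y z)}.
  have ab : a < b by exact: lt_trans vb.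
  have := parameterized_integral_continuous (ltW ab) (cadlag_integrable a b cy).
  move/(continuous_within_itvP _ ab) => -[+ _ _].
  by apply; rewrite in_itv/= av vb.
have cl : M a x @[x --> v^'-] --> left_lim y v + r * \int[leb]_(z in `[a, v]) y z.
  apply: cvgD; first by have [_] := cy v.
  by apply: cvgM; [exact: cvg_cst|apply: cvg_at_left_filter; exact: cI].
have cr : M a x @[x --> v^'+] --> y v + r * \int[leb]_(z in `[a, v]) y z.
  apply: cvgD; first by have [] := cy v.
  by apply: cvgM; [exact: cvg_cst|apply: cvg_at_right_filter; exact: cI].
split.
- by apply/cvg_ex; eexists; exact: cl.
- by apply/cvg_ex; eexists; exact: cr.
- by rewrite (cvg_lim _ cl)// (cvg_lim _ cr)// (inj_eq (addIr _)).
Qed.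

End lower_bound.

End dissipative_paths.

(** * A Dynkin argument for kernels on a product space *)

Section random_measures_agreeing.
Local Open Scope ereal_scope.
Context d d' (T : measurableType d) (V : measurableType d') (R : realType).
Variables (P : probability T R) (k1 k2 : T -> {measure set V -> \bar R}).
Variables (U : set V) (Z : T -> \bar R).
Hypothesis mU : measurable U.
Hypothesis k1U : forall w, k1 w U < +oo.
Hypothesis k2U : forall w, k2 w U < +oo.
Hypothesis mZ : measurable_fun setT Z.
Hypothesis Z0 : forall w, 0 <= Z w.

(** [k1] will be the random measure of jumps and [k2] its compensator. Cutting with the window [U],
    of finite mass for both, keeps set differences meaningful; measurability in [w] is carried along
    because it too spreads only through the Dynkin argument. *)
Definition sections_agree (S : set (T * V)) : Prop :=
  [/\ forall w, measurable (xsection S w),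
      measurable_fun setT (fun w => k1 w (xsection S w `&` U)),
      measurable_fun setT (fun w => k2 w (xsection S w `&` U))
    & \int[P]_w (Z w * k1 w (xsection S w `&` U)) =
      \int[P]_w (Z w * k2 w (xsection S w `&` U))].

Hypothesis agreeT : sections_agree setT.
Hypothesis ZkU : \int[P]_w (Z w * k1 w U) < +oo.

Let xsectionT (w : T) : xsection [set: T * V] w = setT.
Proof. by apply/seteqP; split => x // _; rewrite /xsection/= inE. Qed.

Let in_xsection (S : set (T * V)) w v : xsection S w v <-> S (w, v).
Proof. by rewrite /xsection/= inE. Qed.

Lemma sections_agree_setD A B : B `<=` A -> sections_agree A -> sections_agree B ->
  sections_agree (A `\` B).
Proof.
move=> BA [mA mA1 mA2 eA] [mB mB1 mB2 eB].
have xD w : xsection (A `\` B) w `&` U = (xsection A w `&` U) `\` (xsection B w `&` U).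
  apply/seteqP; split => v /=.
    move=> [/in_xsection[Av nBv] Uv]; split.
      by split => //; apply/in_xsection.
    by move=> [/in_xsection].
  move=> [[/in_xsection Av Uv] nB]; split => //; apply/in_xsection; split => //.
  by move=> Bv; apply: nB; split => //; apply/in_xsection.
have mAU w : measurable (xsection A w `&` U) by exact: measurableI.
have mBU w : measurable (xsection B w `&` U) by exact: measurableI.
have sBA w : xsection B w `&` U `<=` xsection A w `&` U.
  by move=> v [/in_xsection Bv Uv]; split => //; apply/in_xsection; exact: BA.
have kD (k : T -> {measure set V -> \bar R}) (kU : forall w, k w U < +oo) w :
    k w (xsection (A `\` B) w `&` U) = k w (xsection A w `&` U) - k w (xsection B w `&` U).
  rewrite xD measureD//; first by rewrite (setIidr (sBA w)).
  by apply: le_lt_trans (kU w); apply: le_measure; rewrite ?inE//; exact: subIsetr.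
have kA (k : T -> {measure set V -> \bar R}) w :
    k w (xsection A w `&` U) = k w (xsection (A `\` B) w `&` U) + k w (xsection B w `&` U).
  rewrite xD -measureU//; [|exact: measurableD|by rewrite setDKI].
  by rewrite setUC setDUK.
have m1 : measurable_fun setT (fun w => k1 w (xsection (A `\` B) w `&` U)).
  by under eq_fun do rewrite kD//; exact: emeasurable_funB.
have m2 : measurable_fun setT (fun w => k2 w (xsection (A `\` B) w `&` U)).
  by under eq_fun do rewrite kD//; exact: emeasurable_funB.
split => //.
  by move=> w; have := measurableD (mA w) (mB w); congr measurable;
    apply/seteqP; split => v /=; rewrite !in_xsection.
have ID (k : T -> {measure set V -> \bar R}) :
    measurable_fun setT (fun w => k w (xsection (A `\` B) w `&` U)) ->
    measurable_fun setT (fun w => k w (xsection B w `&` U)) ->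
    \int[P]_w (Z w * k w (xsection A w `&` U)) =
    \int[P]_w (Z w * k w (xsection (A `\` B) w `&` U)) +
    \int[P]_w (Z w * k w (xsection B w `&` U)).
  move=> mkD mkB; rewrite -ge0_integralD//; last 4 first.
  - by move=> w _; rewrite mule_ge0.
  - exact: emeasurable_funM.
  - by move=> w _; rewrite mule_ge0.
  - exact: emeasurable_funM.
  by apply: eq_integral => w _; rewrite kA ge0_muleDr.
have := ID k1 m1 mB1; rewrite eA (ID k2 m2 mB2) -eB.
(* Finiteness of the smaller term allows it to be cancelled from an equality of extended reals. *)
have fB : \int[P]_w (Z w * k1 w (xsection B w `&` U)) \is a fin_num.
  rewrite ge0_fin_numE; last by apply: integral_ge0 => w _; rewrite mule_ge0.
  apply: le_lt_trans ZkU; have [_ mT1 _ _] := agreeT.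
  apply: ge0_le_integral => //.
  - by move=> w _; rewrite mule_ge0.
  - exact: emeasurable_funM.
  - apply: emeasurable_funM => //; move: mT1; congr measurable_fun.
    by apply/funext => w; rewrite xsectionT setTI.
  - move=> w _; rewrite lee_wpmul2l//; apply: le_measure; rewrite ?inE//; exact: subIsetr.
move=> /(congr1 (fun x => x - \int[P]_w (Z w * k1 w (xsection B w `&` U)))).
by rewrite !addeK// => ->.
Qed.

Lemma sections_agree_nd : ndseq_closed sections_agree.
Proof.
move=> F ndF FA.
have mF n w : measurable (xsection (F n) w) by have [] := FA n.
have xU w : xsection (\bigcup_n F n) w `&` U = \bigcup_n (xsection (F n) w `&` U).
  by rewrite -setI_bigcupl xsection_bigcup.
have ndU w : nondecreasing_seq (fun n => xsection (F n) w `&` U).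
  move=> m n mn; apply/subsetPset; apply: setSI => v.
  by move=> /in_xsection Fv; apply/in_xsection; have /subsetPset := ndF _ _ mn; apply.
have cvk (k : T -> {measure set V -> \bar R}) w :
    k w (xsection (F n) w `&` U) @[n --> \oo] --> k w (xsection (\bigcup_n F n) w `&` U).
  rewrite xU; apply: nondecreasing_cvg_mu => //.
  - by move=> n; exact: measurableI.
  - by apply: bigcup_measurable => n _; exact: measurableI.
have mk (k : T -> {measure set V -> \bar R}) :
    (forall n, measurable_fun setT (fun w => k w (xsection (F n) w `&` U))) ->
    measurable_fun setT (fun w => k w (xsection (\bigcup_n F n) w `&` U)).
  by move=> mk; apply: (emeasurable_fun_cvg _ _ mk) => w _; exact: cvk.
have ndk (k : T -> {measure set V -> \bar R}) w :
    nondecreasing_seq (fun n => k w (xsection (F n) w `&` U)).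
  move=> m n mn; apply: le_measure; rewrite ?inE; [exact: measurableI|exact: measurableI|].
  by have /subsetPset := ndU w _ _ mn.
have cI (k : T -> {measure set V -> \bar R}) :
    (forall n, measurable_fun setT (fun w => k w (xsection (F n) w `&` U))) ->
    \int[P]_w (Z w * k w (xsection (F n) w `&` U)) @[n --> \oo] -->
    \int[P]_w (Z w * k w (xsection (\bigcup_n F n) w `&` U)).
  move=> mk'.
  rewrite (_ : (fun w => Z w * k w (xsection (\bigcup_n F n) w `&` U)) =
      (fun w => limn (fun n => Z w * k w (xsection (F n) w `&` U)))); last first.
    apply/funext => w; apply/esym/cvg_lim => //; apply: nd_cvg_mule => //.
  apply: cvg_monotone_convergence => //.
  - by move=> n; exact: (emeasurable_funM mZ (mk' n)).
  - by move=> n w _; rewrite mule_ge0.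
  - by move=> w _ m n mn; rewrite lee_wpmul2l//; exact: ndk.
have m1 n : measurable_fun setT (fun w => k1 w (xsection (F n) w `&` U)) by have [] := FA n.
have m2 n : measurable_fun setT (fun w => k2 w (xsection (F n) w `&` U)) by have [] := FA n.
split; [|exact: mk|exact: mk|].
  by move=> w; rewrite xsection_bigcup; apply: bigcup_measurable.
have c2 := cI k2 m2; have c1 := cI k1 m1.
rewrite (_ : (fun n => _) = (fun n => \int[P]_w (Z w * k2 w (xsection (F n) w `&` U)))) in c1.
  exact: (cvg_unique _ c1 c2).
by apply/funext => n; have [] := FA n.
Qed.

Lemma sections_agree_sigma (G : set (set (T * V))) : setI_closed G ->
  G `<=` sections_agree -> <<s G >> `<=` sections_agree.
Proof.
move=> IG GA; apply: lambda_system_subset => //; split => //.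
- by move=> A B BA aA aB; exact: sections_agree_setD.
- exact: sections_agree_nd.
Qed.

End random_measures_agreeing.

(** * Jump sizes as a measure on the plane of times and marks *)

Section shot_measure.
Local Open Scope ereal_scope.
Context {R : realType}.
Local Notation leb := (@lebesgue_measure R).

(* Points of the plane are pairs (time, mark). *)
Definition shot_region (A : set (R * R)) : set (R * R * R) :=
  [set x | [/\ A (x.2, x.1.1), 0 < x.1.1 & 0 < x.1.2]%R].

Lemma measurable_shot_region A : measurable A -> measurable (shot_region A).
Proof.
move=> mA.
have m1 : measurable_fun setT (fun x : R * R * R => (x.2, x.1.1)).
  apply: measurable_fun_pair; first exact: measurable_snd.
  exact: (measurableT_comp measurable_fst measurable_fst).
have mpos (f : R * R * R -> R) : measurable_fun setT f -> measurable [set x | (0 < f x)%R].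
  move=> mf; rewrite (_ : [set x | _] = f @^-1` `]0%R, +oo[%classic).
    by rewrite -[_ @^-1` _]setTI; apply: mf => //; exact: measurable_itv.
  by apply/seteqP; split => x /=; rewrite in_itv/= andbT.
rewrite (_ : shot_region A = (fun x : R * R * R => (x.2, x.1.1)) @^-1` A `&`
   [set x | (0 < x.1.1)%R] `&` [set x | (0 < x.1.2)%R]); last first.
  by apply/seteqP; split => [x []|x [[]]].
apply: measurableI; first apply: measurableI.
- by rewrite -[_ @^-1` _]setTI; exact: m1.
- by apply: mpos; exact: (measurableT_comp measurable_fst measurable_fst).
- by apply: mpos; exact: (measurableT_comp measurable_snd measurable_fst).
Qed.

Lemma measurable_jump_size : measurable_fun setT (fun x : R * R * R => `|x.1.2|%:E).
Proof.
apply/measurable_EFinP; apply: measurableT_comp => //.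
exact: (measurableT_comp measurable_snd measurable_fst).
Qed.

Variable m : {measure set (R * R * R) -> \bar R}.

(** Total size of the jumps with time and mark in [A]. The absolute value makes the integrand
    nonnegative everywhere and changes nothing on the region, where sizes are positive. *)
Definition shot (A : set (R * R)) : \bar R := \int[m]_(x in shot_region A) `|x.1.2|%:E.

Let shot0 : shot set0 = 0.
Proof.
rewrite /shot (_ : shot_region set0 = set0) ?integral_set0//.
by apply/seteqP; split => // x [].
Qed.

Let shot_ge0 A : 0 <= shot A.
Proof. by apply: integral_ge0 => x _; rewrite lee_fin. Qed.

Let shot_sigma_additive : semi_sigma_additive shot.
Proof.
move=> F mF tF mUF.
have tF' : trivIset setT (fun i => shot_region (F i)).
  move=> i j _ _ [x [[Fi _ _] [Fj _ _]]]; apply: tF => //.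
  by exists (x.2, x.1.1).
have mF' i : measurable (shot_region (F i)) by exact: measurable_shot_region.
have -> : shot (\bigcup_n F n) = \sum_(n <oo) shot (F n).
  rewrite /shot (_ : shot_region _ = \bigcup_n shot_region (F n)).
    rewrite ge0_integral_bigcup//.
    by apply: measurable_funTS; exact: measurable_jump_size.
  apply/seteqP; split => [x [[i _ Fi] h1 h2]|x [i _ [Fi h1 h2]]]; first by exists i.
  by split => //; exists i.
by apply: is_cvg_nneseries => n _ _.
Qed.

HB.instance Definition _ := isMeasure.Build _ _ _ shot shot0 shot_ge0 shot_sigma_additive.

End shot_measure.

(** * Transport of Lebesgue measure to the plain line *)

Section lebesgue_transport.
Local Open Scope ereal_scope.
Context {R : realType}.
Local Notation leb := (@lebesgue_measure R).

(* The library's Lebesgue measure lives on a copy of R that carries another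
   measure display; lebR is the same set function on R itself. *)
Definition lebR (A : set R) : \bar R := leb A.

Let lebR0 : lebR set0 = 0. Proof. exact: measure0. Qed.

Let lebR_ge0 A : 0 <= lebR A. Proof. exact: measure_ge0. Qed.

Let lebR_sigma_additive : semi_sigma_additive lebR.
Proof. exact: (@measure_semi_sigma_additive _ _ _ leb). Qed.

HB.instance Definition _ := isMeasure.Build _ _ _ lebR lebR0 lebR_ge0 lebR_sigma_additive.

Let lebR_sigma_finite : sigma_finite setT lebR.
Proof. by have := @sigma_finiteT _ _ _ leb. Qed.

HB.instance Definition _ := Measure_isSigmaFinite.Build _ _ _ lebR lebR_sigma_finite.

Lemma lebRE A : lebR A = leb A. Proof. by []. Qed.

(** Change of variables along the identity map between the two copies of the line. *)
Lemma ge0_integral_lebR (D : set R) (f : R -> \bar R) : measurable D ->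
  measurable_fun D f -> (forall x, D x -> 0 <= f x) ->
  \int[lebR]_(x in D) f x = \int[leb]_(x in D) f x.
Proof.
move=> mD mf f0.
have mid : measurable_fun setT (id : measurableTypeR R -> R) by move=> _ S mS; rewrite setTI.
have := @ge0_integral_pushforward _ _ (measurableTypeR R) R R id mid leb D f mD mf.
rewrite preimage_id => /(_ _) <-; last by move=> x /set_mem; exact: f0.
reflexivity.
Qed.

End lebesgue_transport.

(** * The jump intensity as a measure *)

Section jump_measure.
Local Open Scope ereal_scope.
Context {R : realType}.
Local Notation leb := (@lebesgue_measure R).
Variable nu : {sigma_finite_measure set R -> \bar R}.

Lemma measurable_positive_mark : measurable [set x : R * R * R | (0 < x.1.1)%R].
Proof.
rewrite (_ : [set x | _] = (fun x : R * R * R => x.1.1) @^-1` `]0%R, +oo[%classic).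
  rewrite -[_ @^-1` _]setTI.
  by apply: (measurableT_comp measurable_fst measurable_fst) => //; exact: measurable_itv.
by apply/seteqP; split => x /=; rewrite in_itv/= andbT.
Qed.

Let jump0 : jump_intensity nu set0 = 0.
Proof. by rewrite /jump_intensity set0I measure0. Qed.

Let jump_ge0 A : 0 <= jump_intensity nu A.
Proof. exact: measure_ge0. Qed.

Let jump_sigma_additive : semi_sigma_additive (jump_intensity nu).
Proof.
exact: (@measure_semi_sigma_additive _ _ _
  (mrestr ((leb \x nu) \x leb) (measurable_positive_mark : measurable _))).
Qed.

HB.instance Definition _ :=
  isMeasure.Build _ _ _ (jump_intensity nu) jump0 jump_ge0 jump_sigma_additive.

(** Since [al] is nonnegative the box has positive marks only, so the restriction built into
    [jump_intensity] is invisible and the product formula gives the case of indicators. *)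
Lemma integral_jump_box (a b al be : R) (k : R -> \bar R) : (0 <= al)%R ->
  measurable_fun setT k -> (forall z, 0 <= k z) ->
  \int[jump_intensity nu]_(x in shot_region (`]a, b]%classic `*` `]al, be]%classic)) k x.1.2 =
  leb `]a, b] * leb `]al, be] * \int[nu]_(z in `]0%R, +oo[) k z.
Proof.
move=> al0; set D := shot_region _.
have mD : measurable D by apply: measurable_shot_region; exact: measurableX.
have mz : measurable_fun setT (fun x : R * R * R => x.1.2).
  exact: (measurableT_comp measurable_snd measurable_fst).
have mk (f : R -> \bar R) : measurable_fun setT f -> measurable_fun D (fun x => f x.1.2).
  by move=> mf; apply: measurable_funTS; exact: (measurableT_comp mf mz).
have mk' (f : R -> \bar R) : measurable_fun setT f ->
      measurable_fun (`]0%R, +oo[%classic : set R) f.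
  exact: measurable_funTS.
move: k; apply: ge0_measurable_fun_ind.
- move=> C mC.
  have mC' : measurable [set x : R * R * R | C x.1.2].
    by rewrite -[X in measurable X]setTI; exact: mz.
  rewrite (_ : (fun x => _) = (fun x => (\1_[set x : R * R * R | C x.1.2] x)%:E))//.
  rewrite !integral_indic//.
  have E : jump_intensity nu ([set x : R * R * R | C x.1.2] `&` D) = ((leb \x nu) \x leb)
      ((`]al, be]%classic `*` (C `&` `]0%R, +oo[%classic)) `*` `]a, b]%classic).
    rewrite /jump_intensity; congr (((leb \x nu) \x leb) _).
    apply/seteqP; split => [[[x z] v]/= [[Cz [[vab xab] x0 z0]] _]|[[x z] v]/= [[xab [Cz z0]] vab]].
      by split => //; split => //; split => //; rewrite in_itv/= z0.
    have x0 : (0 < x)%R by move: xab; rewrite in_itv/= => /andP[/(le_lt_trans al0)].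
    by split => //; split => //; split => //; move: z0; rewrite in_itv/= andbT.
  apply: (etrans E).
  have mCz : measurable (C `&` `]0%R, +oo[%classic) by exact: measurableI.
  have E1 : (leb \x nu) (`]al, be]%classic `*` (C `&` `]0%R, +oo[%classic)) =
      leb `]al, be] * nu (C `&` `]0%R, +oo[%classic).
    exact: product_measure1E.
  have E2 := @product_measure1E _ _ _ _ R (leb \x nu) leb
    (`]al, be]%classic `*` (C `&` `]0%R, +oo[%classic)) `]a, b]%classic
    (measurableX (measurable_itv _) mCz) (measurable_itv _).
  apply: (etrans E2); apply: (etrans (congr1 (fun x => x * leb `]a, b]) E1)).
  by rewrite muleC muleA.
- move=> c f c0 mf f0 IH.
  rewrite ge0_integralZl_EFin//; last exact: mk.
  by rewrite IH ge0_integralZl_EFin//; [rewrite muleCA|exact: mk'].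
- move=> f g mf f0 mg g0 IHf IHg.
  rewrite ge0_integralD//; [|exact: mk|exact: mk].
  rewrite IHf IHg ge0_integralD//; [|exact: mk'|exact: mk'].
  by rewrite [RHS]ge0_muleDr ?integral_ge0.
- move=> f g mf f0 ndf fg IH.
  have gE : g = (fun x => limn (f ^~ x)).
    by apply/funext => x; apply/esym/cvg_lim => //; exact: fg.
  have c1 : \int[jump_intensity nu]_(x in D) f n x.1.2 @[n --> \oo] -->
      \int[jump_intensity nu]_(x in D) g x.1.2.
    rewrite (_ : (fun x => g x.1.2) = (fun x => limn (fun n => f n x.1.2))).
      apply: cvg_monotone_convergence => //.
      by move=> n; exact: mk.
    by apply/funext => x; rewrite gE.
  have c2 : leb `]a, b] * leb `]al, be] * \int[nu]_(z in `]0%R, +oo[) f n z @[n --> \oo] -->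
      leb `]a, b] * leb `]al, be] * \int[nu]_(z in `]0%R, +oo[) g z.
    apply: nd_cvg_mule; first by rewrite mule_ge0.
    - by move=> n; exact: integral_ge0.
    - by move=> m n mn; apply: ge0_le_integral => //; [exact: mk'|exact: mk'|move=> z _; exact: ndf].
    - rewrite gE; apply: cvg_monotone_convergence => //.
      by move=> n; exact: mk'.
  move: c1; under eq_cvg do rewrite IH.
  by move=> c1; exact: (cvg_unique _ c1 c2).
Qed.

End jump_measure.

(** * Compensator of the jumps over predictable sets *)

Section predictable_compensation.
Local Open Scope ereal_scope.
Context d (T : measurableType d) (R : realType) (P : probability T R).
Local Notation leb := (@lebesgue_measure R).
Variable nu : {sigma_finite_measure set R -> \bar R}.
Variable mu : T -> {measure set (R * R * R) -> \bar R}.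
Hypothesis muP : poisson_random_measure P mu (jump_intensity nu).
Hypothesis nu_mom1 : \int[nu]_(z in `]0%R, +oo[) (z ^+ 1)%:E < +oo.
Local Notation M1 := (moment nu 1).

Definition past (t : R) : set (R * R * R) := [set x | (x.2 <= t)%R].

Definition history (t : R) : set (set T) :=
  null_completion P (random_measure_sigma mu (past t)).

(* Predictable rectangles: the event depends on the driving measure only up to
   the left end point of the time interval. *)
Definition predictable_rectangles : set (set (T * (R * R))) :=
  [set S | exists (a b al be : R) (E : set T),
     history a E /\ S = E `*` (`]a, b]%classic `*` `]al, be]%classic)].

Lemma history_le s t : (s <= t)%R -> history s `<=` history t.
Proof.
move=> st; apply: null_completionS; apply: sub_sigma_algebra2.
move=> _ [A [S [mA As mS ->]]]; exists A, S; split => //.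
by move=> x /As /= h; exact: le_trans st.
Qed.

Lemma history_sigma_algebra t : sigma_algebra setT (history t).
Proof. exact/sigma_algebra_null_completion/smallest_sigma_algebra. Qed.

Lemma history_setI t : setI_closed (history t).
Proof.
move=> A B FA FB.
have E := sigma_algebra_id (history_sigma_algebra t).
have : (measurable : set (set (g_sigma_algebraType (history t)))) (A `&` B).
  by apply: measurableI; exact: sub_sigma_algebra.
by rewrite /measurable/= E.
Qed.

(** The intersection starts at the later of the two left end points, whose history contains both
    events. *)
Lemma predictable_rectangles_setI : setI_closed predictable_rectangles.
Proof.
move=> _ _ [a [b [al [be [E [FE ->]]]]]] [a' [b' [al' [be' [E' [FE' ->]]]]]].
exists (Num.max a a'), (Num.min b b'), (Num.max al al'), (Num.min be be'), (E `&` E'); split.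
  by apply: history_setI; [apply: history_le FE|apply: history_le FE']; rewrite le_max lexx ?orbT.
apply/seteqP; split => [[w [v x]]/=|[w [v x]]/=]; rewrite !in_itv/= !gt_max !le_min.
  by move=> [[Ew [/andP[-> ->] /andP[-> ->]]] [Ew' [/andP[-> ->] /andP[-> ->]]]].
by move=> [[Ew Ew'] [/andP[/andP[-> ->] /andP[-> ->]] /andP[/andP[-> ->] /andP[-> ->]]]].
Qed.

Lemma moment1_ge0 : (0 <= M1)%R.
Proof.
rewrite /moment; apply: Rintegral_ge0 => z /=; rewrite in_itv/= andbT => z0.
by rewrite expr1 ltW.
Qed.

Lemma mean_jump : \int[nu]_(z in `]0%R, +oo[) `|z|%:E = M1%:E.
Proof.
rewrite /moment /Rintegral fineK; last first.
  rewrite ge0_fin_numE//; apply: integral_ge0 => z /=; rewrite in_itv/= andbT => z0.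
  by rewrite lee_fin expr1 ltW.
apply: eq_integral => z; rewrite inE/= in_itv/= andbT => z0.
by rewrite expr1 gtr0_norm.
Qed.

Lemma shot_measurable_fun A : measurable A ->
  measurable_fun setT (fun w => shot (mu w) A).
Proof.
move=> mA; apply: (campbell_measurable muP) => //.
  exact: measurable_shot_region.
exact: measurable_jump_size.
Qed.

Lemma history_measurable_sub s t (Z : T -> \bar R) : (s <= t)%R ->
  measurable_fun setT (Z : g_sigma_algebraType (history s) -> \bar R) ->
  measurable_fun setT (Z : g_sigma_algebraType (history t) -> \bar R).
Proof.
move=> st mZ; apply: (@measurable_completed_sub _ _ _ _ _ P mu _ _ (past s) (past t)) mZ.
by move=> x /= h; exact: le_trans st.
Qed.

Lemma history_measurableT d' (X : measurableType d') s (Z : T -> X) :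
  measurable_fun setT (Z : g_sigma_algebraType (history s) -> X) ->
  measurable_fun setT Z.
Proof. exact/measurable_fun_sub_sigma/null_completion_sub_measurable. Qed.

(** The box lies strictly after time [s], hence is disjoint from the region that determines [Z], and
    Campbell's formula applies. *)
Lemma shot_box_mean (Z : T -> \bar R) (s a b al be : R) :
  measurable_fun setT (Z : g_sigma_algebraType (history s) -> \bar R) ->
  (forall w, 0 <= Z w) -> (s <= a)%R -> (0 <= al)%R ->
  \int[P]_w (Z w * shot (mu w) (`]a, b]%classic `*` `]al, be]%classic)) =
  \int[P]_w Z w * (M1%:E * (lebR \x lebR) (`]a, b]%classic `*` `]al, be]%classic)).
Proof.
move=> mZ Z0 sa al0.
rewrite (campbell (Lambda := jump_intensity nu) muP mZ Z0); last 4 first.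
- by apply: measurable_shot_region; exact: measurableX.
- apply/seteqP; split => // x [/= xs [[/= + _] _ _]].
  by rewrite in_itv/= => /andP[/(le_lt_trans sa)/lt_le_trans/(_ xs)]; rewrite ltxx.
- exact: measurable_jump_size.
- by move=> x; rewrite lee_fin.
have mabs : measurable_fun setT (fun z : R => `|z|%:E).
  by apply/measurable_EFinP; exact: normr_measurable.
have -> := @integral_jump_box _ nu a b al be (fun z => `|z|%:E) al0 mabs (fun=> normr_ge0 _).
by rewrite mean_jump product_measure1E//; congr (_ * _); rewrite muleC.
Qed.

Lemma product_lebR_lty (a b al be : R) :
  (lebR \x lebR) (`]a, b]%classic `*` `]al, be]%classic) < +oo.
Proof.
have h (x y : R) : lebR `]x, y]%classic < +oo.
  by rewrite lebRE lebesgue_measure_itv/=; case: ifP => _; rewrite ?ltry// -EFinB ltry.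
by rewrite product_measure1E//; apply: lte_mul_pinfty; rewrite ?ge0_fin_numE//; exact: h.
Qed.

Section fixed_interval.
Variables (s t : R).

Definition window (N : nat) : set (R * R) := `]s, t]%classic `*` `]0%R, N%:R]%classic.

Definition strip : set (R * R) := `]s, t]%classic `*` `]0%R, +oo[%classic.

Definition locally_finite : set T := [set w | forall N, shot (mu w) (window N) < +oo].

Let mwindow N : measurable (window N). Proof. exact: measurableX. Qed.

Lemma measurable_locally_finite : measurable locally_finite.
Proof.
rewrite (_ : locally_finite = \bigcap_N [set w | shot (mu w) (window N) < +oo]); last first.
  by apply/seteqP; split => [w h N _|w h N]; [exact: h|exact: (h N)].
apply: bigcapT_measurable => N.
rewrite (_ : [set w | _] = ~` ((fun w => shot (mu w) (window N)) @^-1` [set +oo])).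
  apply: measurableC; rewrite -[_ @^-1` _]setTI.
  by apply: (shot_measurable_fun (mwindow N)) => //; exact: emeasurable_set1.
by apply/seteqP; split => w /=; rewrite ltey; [move/eqP|move=> h; apply/eqP].
Qed.

Lemma locally_finite_ae : {ae P, forall w, locally_finite w}.
Proof.
apply: ae_foralln => N.
have : P.-integrable setT (fun w => shot (mu w) (window N)).
  apply/integrableP; split; first exact: shot_measurable_fun.
  under eq_integral do rewrite gee0_abs//.
  have E := @shot_box_mean (cst 1) s s t 0%R N%:R (@measurable_cst _ _ _ _ _ _) (fun=> lee01)
    (lexx s) (lexx 0%R).
  have P1 : \int[P]_w cst 1 w = 1.
    by rewrite integral_cst// mul1e; exact: probability_setT.
  rewrite P1 mul1e in E.
  rewrite (_ : \int[P]_w _ = \int[P]_w (cst 1 w * shot (mu w) (window N))); last first.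
    by apply: eq_integral => w _; rewrite mul1e.
  rewrite E.
  by rewrite lte_mul_pinfty// ?lee_fin ?moment1_ge0//; exact: product_lebR_lty.
move/(integrable_ae measurableT); apply: filterS => w /(_ Logic.I).
by rewrite ge0_fin_numE.
Qed.

(** On the null event where some window carries infinite mass the kernel is set to zero, since the
    Dynkin argument asks for finite mass at every [w]. *)
Let k1 (w : T) : {measure set (R * R) -> \bar R} :=
  if `[< locally_finite w >] then (shot (mu w) : {measure set (R * R) -> \bar R}) else mzero.

Let M1nng : {nonneg R} := NngNum moment1_ge0.

Let k2 (w : T) : {measure set (R * R) -> \bar R} := mscale M1nng (lebR \x lebR).

Let k1_shot : {ae P, forall w, forall A, k1 w A = shot (mu w) A}.
Proof. by apply: filterS locally_finite_ae => w h A; rewrite /k1 asboolT. Qed.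

Let mk1 A : measurable A -> measurable_fun setT (fun w => k1 w A).
Proof.
move=> mA.
rewrite (_ : (fun w => _) = (fun w => (\1_locally_finite w)%:E * shot (mu w) A)).
  apply: emeasurable_funM; last exact: shot_measurable_fun.
  by apply/measurable_EFinP; apply: measurable_indic; exact: measurable_locally_finite.
apply/funext => w; rewrite /k1; case: asboolP => h.
  by rewrite indicE mem_set// mul1e.
by rewrite indicE memNset// mul0e.
Qed.

Variable Z : T -> \bar R.
Hypothesis mZ : measurable_fun setT (Z : g_sigma_algebraType (history s) -> \bar R).
Hypothesis Z0 : forall w, 0 <= Z w.
Hypothesis Zoo : \int[P]_w Z w < +oo.

Let mZT : measurable_fun setT Z. Proof. exact: history_measurableT mZ. Qed.

(** The event of the rectangle belongs to the history at its left end [a], so its indicator joins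
    the weight [Z] at time max(s, a). The box cut by the window is again a box, and it starts
    exactly there. *)
Let rectangle_agree N : predictable_rectangles `<=` sections_agree P k1 k2 (window N) Z.
Proof.
move=> _ [a [b [al [be [E [FE ->]]]]]].
set B := `]a, b]%classic `*` `]al, be]%classic.
have mE : measurable E by case: FE.
have mB : measurable B by exact: measurableX.
have xE w : xsection (E `*` B) w = if w \in E then B else set0.
  by case: ifPn => wE; [rewrite in_xsectionX|rewrite notin_xsectionX].
have kE (k : T -> {measure set (R * R) -> \bar R}) w :
    k w (xsection (E `*` B) w `&` window N) = (\1_E w)%:E * k w (B `&` window N).
  by rewrite xE indicE; case: ifP => _; rewrite ?mul1e// set0I measure0 mul0e.
have mBN : measurable (B `&` window N) by exact: measurableI.
have mIE : measurable_fun setT (fun w => (\1_E w)%:E : \bar R).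
  by apply/measurable_EFinP; exact: measurable_indic.
split.
- by move=> w; rewrite xE; case: ifP.
- under eq_fun do rewrite kE; apply: emeasurable_funM => //; exact: mk1.
- by under eq_fun do rewrite kE; exact: emeasurable_funM.
- under eq_integral do rewrite kE muleA.
  under [RHS]eq_integral do rewrite kE muleA.
  set s' := Num.max s a.
  have BE : B `&` window N = `]s', Num.min b t]%classic `*` `]Num.max 0%R al, Num.min be N%:R]%classic.
    rewrite /B /window; apply/seteqP; split => [[v x]/=|[v x]/=]; rewrite !in_itv/= !gt_max !le_min.
      by move=> [[/andP[-> ->] /andP[-> ->]] [/andP[-> ->] /andP[-> ->]]].
    by move=> [/andP[/andP[-> ->] /andP[-> ->]] /andP[/andP[-> ->] /andP[-> ->]]].
  have mZE : measurable_fun setT ((fun w => Z w * (\1_E w)%:E) :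
      g_sigma_algebraType (history s') -> \bar R).
    apply: emeasurable_funM.
      by apply: history_measurable_sub mZ; rewrite le_max lexx.
    apply/measurable_EFinP; apply: measurable_indic.
    by apply: sub_sigma_algebra; apply: history_le FE; rewrite le_max lexx orbT.
  have ZE0 w : 0 <= Z w * (\1_E w)%:E by rewrite mule_ge0// lee_fin.
  have mZE' := history_measurableT mZE.
  transitivity (\int[P]_w (Z w * (\1_E w)%:E * shot (mu w) (B `&` window N))).
    apply: ae_eq_integral => //.
    + by apply: emeasurable_funM => //; exact: mk1.
    + by apply: emeasurable_funM => //; exact: shot_measurable_fun.
    + by apply: filterS k1_shot => w h _; rewrite h.
  rewrite [in LHS]BE (shot_box_mean _ _ mZE ZE0)//; last by rewrite le_max lexx.
  by rewrite -BE -ge0_integralZr// mule_ge0// lee_fin moment1_ge0.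
Qed.

(** Agreement on predictable rectangles spreads to the sigma-algebra within each window, and the
    windows increase to the strip. The function [g] is a version, built from the corrected kernel
    [k1], whose measurability in [w] the Dynkin argument supplies. *)
Lemma shot_predictable (S : set (T * (R * R))) : <<s predictable_rectangles >> S ->
  [/\ forall w, measurable (xsection S w),
      measurable_fun setT (fun w => (lebR \x lebR) (xsection S w `&` strip))
    & exists g : T -> \bar R, [/\ measurable_fun setT g, forall w, 0 <= g w,
        {ae P, forall w, g w = shot (mu w) (xsection S w `&` strip)}
      & \int[P]_w (Z w * g w) =
        M1%:E * \int[P]_w (Z w * (lebR \x lebR) (xsection S w `&` strip))]].
Proof.
move=> pS.
have agN N : sections_agree P k1 k2 (window N) Z S.
  have k1W w : k1 w (window N) < +oo.
    by rewrite /k1; case: asboolP => h; [exact: (h N)|rewrite /mzero ltry].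
  have k2W w : k2 w (window N) < +oo.
    by rewrite /k2/= /mscale lte_mul_pinfty// ?lee_fin//; exact: product_lebR_lty.
  (* Inside the window the whole space has the same sections as this predictable rectangle, which
     provides the full set needed to start the Dynkin argument. *)
  pose S0 : set (T * (R * R)) := [set: T] `*` (`]s, t]%classic `*` `](0:R)%R, N%:R]%classic).
  have pS0 : predictable_rectangles S0.
    by exists s, t, 0%R, N%:R, setT; split => //; have [F0 FC _] := history_sigma_algebra s;
      rewrite -(setD0 setT); exact: FC.
  have xS0 w : xsection [set: T * (R * R)] w `&` window N = xsection S0 w `&` window N.
    rewrite (in_xsectionX _ (_ : w \in setT)) ?inE// setIid.
    by apply/seteqP; split => [p []//|p]; split => //; rewrite /xsection/= inE.
  have xS0' w : xsection S0 w `&` window N = window N.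
    by rewrite (in_xsectionX _ (_ : w \in setT)) ?inE// setIid.
  have [_ a2 a3 a4] := rectangle_agree N pS0.
  apply: (sections_agree_sigma (mwindow N) k1W k2W mZT Z0 _ _ predictable_rectangles_setI
    (@rectangle_agree N) pS).
    split.
    - by move=> w; rewrite (_ : xsection _ w = setT)//; apply/seteqP; split => // p _;
        rewrite /xsection/= inE.
    - by under eq_fun do rewrite xS0.
    - by under eq_fun do rewrite xS0.
    - by under eq_integral do rewrite xS0; under [RHS]eq_integral do rewrite xS0.
  rewrite (_ : \int[P]_w _ = \int[P]_w (Z w * k2 w (xsection S0 w `&` window N))).
    under eq_integral do rewrite xS0'.
    rewrite ge0_integralZr//.
    have IZ0 : 0 <= \int[P]_w Z w by exact: integral_ge0.
    by apply: lte_mul_pinfty; [|rewrite ge0_fin_numE|exact: (k2W point)].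
  by rewrite -a4; apply: eq_integral => w _; rewrite xS0'.
have mS w : measurable (xsection S w) by have [] := agN 0%N.
have mSW w N : measurable (xsection S w `&` window N) by exact: measurableI.
have WU : strip = \bigcup_N window N.
  rewrite /strip /window; apply/seteqP; split => [[v x] [/= vs]|[v x] [N _ [/= vs]]];
    rewrite !in_itv/=.
    rewrite andbT => x0; exists (Num.truncn x).+1 => //; split => //=.
    by rewrite in_itv/= x0 ltW// truncnS_gt.
  by move=> /andP[-> _].
have ndW w : nondecreasing_seq (fun N => xsection S w `&` window N).
  move=> m N mN; apply/subsetPset; apply: setIS => -[v x] [/= vs].
  rewrite !in_itv/= => /andP[x0 xm]; split => //=; rewrite in_itv/= x0.
  by rewrite (le_trans xm)// ler_nat.
have cvk (k : T -> {measure set (R * R) -> \bar R}) w :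
    k w (xsection S w `&` window N) @[N --> \oo] --> k w (xsection S w `&` strip).
  rewrite WU setI_bigcupr; apply: nondecreasing_cvg_mu => //.
  by apply: bigcup_measurable => N _.
have ndk (k : T -> {measure set (R * R) -> \bar R}) w :
    nondecreasing_seq (fun N => k w (xsection S w `&` window N)).
  move=> m N mN; apply: le_measure; rewrite ?inE//.
  by have /subsetPset := ndW w _ _ mN.
have mk1W N : measurable_fun setT (fun w => k1 w (xsection S w `&` window N)).
  by have [] := agN N.
have mk2W N : measurable_fun setT (fun w => k2 w (xsection S w `&` window N)).
  by have [] := agN N.
have mk (k : T -> {measure set (R * R) -> \bar R}) :
    (forall N, measurable_fun setT (fun w => k w (xsection S w `&` window N))) ->
    measurable_fun setT (fun w => k w (xsection S w `&` strip)).
  by move=> h; apply: (emeasurable_fun_cvg _ _ h) => w _; exact: cvk.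
have cI (k : T -> {measure set (R * R) -> \bar R}) :
    (forall N, measurable_fun setT (fun w => k w (xsection S w `&` window N))) ->
    \int[P]_w (Z w * k w (xsection S w `&` window N)) @[N --> \oo] -->
    \int[P]_w (Z w * k w (xsection S w `&` strip)).
  move=> h.
  rewrite (_ : (fun w => Z w * k w (xsection S w `&` strip)) =
      (fun w => limn (fun N => Z w * k w (xsection S w `&` window N)))); last first.
    apply/funext => w; apply/esym/cvg_lim => //; apply: nd_cvg_mule => //.
  apply: cvg_monotone_convergence => //.
  - by move=> N; exact: (emeasurable_funM mZT (h N)).
  - by move=> N w _; rewrite mule_ge0.
  - by move=> w _ m N mN; rewrite lee_wpmul2l//; exact: ndk.
have Eint : \int[P]_w (Z w * k1 w (xsection S w `&` strip)) =
    \int[P]_w (Z w * k2 w (xsection S w `&` strip)).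
  have c2 := cI k2 mk2W; have c1 := cI k1 mk1W.
  rewrite (_ : (fun N => _) = (fun N => \int[P]_w (Z w * k2 w (xsection S w `&` window N)))) in c1.
    exact: (cvg_unique _ c1 c2).
  by apply/funext => N; have [] := agN N.
have marea : measurable_fun setT (fun w => (lebR \x lebR) (xsection S w `&` strip)).
  have marea_pair (A : set (T * (R * R))) : measurable A ->
      measurable_fun setT (fun w => (lebR \x lebR) (xsection A w)).
    move=> mA.
    (* Reassociating the product turns the area of a section into two successive integrals in one
       variable, each measurable in its parameter. *)
    pose A' := [set p : T * R * R | A (p.1.1, (p.1.2, p.2))].
    have mA' : measurable A'.
      have mf : measurable_fun setT (fun p : T * R * R => (p.1.1, (p.1.2, p.2))).
        apply: measurable_fun_pair; first exact: (measurableT_comp measurable_fst measurable_fst).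
        by apply: measurable_fun_pair => //; exact: (measurableT_comp measurable_snd measurable_fst).
      by rewrite -[A']setTI; exact: mf.
    have m1 := @lebesgue_integral_fubini.measurable_fun_xsection _ _ (T * R)%type R R (@lebR R) A' mA'.
    have m2 := @measurable_fun_fubini_tonelli_F _ _ T R R (@lebR R)
      (fun p => lebR (xsection A' p)) m1 (fun=> measure_ge0 _ _).
    move: m2; congr measurable_fun; apply/funext => w.
    rewrite /fubini_F /product_measure1; apply: eq_integral => v _ /=; congr lebR.
    by apply/seteqP; split => x; rewrite /xsection/= !inE/= inE.
  have mSp : measurable S.
    have : <<s predictable_rectangles >> `<=` (@measurable _ (T * (R * R))%type).
      apply: smallest_sub; first exact: sigma_algebra_measurable.
      move=> _ [a [b [al [be [E [[mE _] ->]]]]]].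
      by apply: measurableX => //; exact: measurableX.
    exact.
  have mstrip : measurable strip by exact: measurableX.
  have := marea_pair _ (measurableI _ _ mSp (measurableX (@measurableT _ T) mstrip)).
  congr measurable_fun; apply/funext => w; congr ((lebR \x lebR) _).
  by apply/seteqP; split => p; rewrite /xsection/= !inE/=; tauto.
split => //.
exists (fun w => k1 w (xsection S w `&` strip)); split => //.
- exact: mk.
- by apply: filterS k1_shot => w h.
- rewrite Eint -ge0_integralZl//; last 3 first.
  + exact: emeasurable_funM.
  + by move=> w _; rewrite mule_ge0.
  + by rewrite lee_fin moment1_ge0.
  by apply: eq_integral => w _; rewrite /k2/= /mscale/= muleCA.
Qed.

End fixed_interval.

End predictable_compensation.

(** * Predictability of the mark and of left limits *)

Section predictable_functions.
Context d (T : measurableType d) (R : realType) (P : probability T R).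
Variable mu : T -> {measure set (R * R * R) -> \bar R}.

Local Notation PT := (g_sigma_algebraType (predictable_rectangles P mu)).

Lemma measurable_predictable_band (E : set T) (a b al be : R) : history P mu a E ->
  measurable (E `*` (`]a, b]%classic `*` `]al, be]%classic) : set PT).
Proof. by move=> FE; apply: sub_sigma_algebra; exists a, b, al, be, E. Qed.

Lemma history_setT a : history P mu a [set: T].
Proof.
have [F0 FC _] := history_sigma_algebra P mu a.
by rewrite -(setD0 setT); exact: FC.
Qed.

Lemma predictable_mark : measurable_fun setT (fun p : PT => p.2.2).
Proof.
apply: (measurability _ (RGenOInfty.measurableE R)) => // _ [_ [x ->] <-].
(* Predictable rectangles are bounded, so the half-space of marks above [x] is exhausted by bounded
   bands in time and mark. *)
rewrite setTI (_ : _ @^-1` _ = \bigcup_(k : nat)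
  (setT `*` (`]- k%:R, k%:R]%classic `*` `]x, k%:R]%classic) : set PT)).
  by apply: bigcupT_measurable => k; apply: measurable_predictable_band; exact: history_setT.
apply/seteqP; split => [[w [v y]]|[w [v y]] [k _ [_ [_]]]] /=; rewrite !in_itv/= ?andbT; last first.
  by move=> /andP[].
move=> xy; exists (Num.truncn (`|v| + `|y|)).+1 => //; split => //.
have := truncnS_gt (`|v| + `|y|); set k := _.+1 => h.
have n1 := normr_ge0 v; have n2 := normr_ge0 y.
have := ler_norm y; have := ler_norm v; have := ler_norm (- v); rewrite normrN => h1 h2 h3.
by split => /=; rewrite in_itv/=; apply/andP; split => //; lra.
Qed.

Section left_limit.
Variable Y : R -> {RV P >-> R}.
Hypothesis Yad : forall t (S : set R), measurable S -> history P mu t (Y t @^-1` S).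
Hypothesis cY : forall w, cadlag (fun t => Y t w).

(** For v in ((k-1)/(n+1), k/(n+1)] the grid approximation is the value of [Y] at the left end point
    of that cell, an event of the history there. Each preimage is thus a countable union of
    predictable rectangles. *)
Lemma predictable_left_lim : measurable_fun setT (fun p : PT => left_lim (fun t => Y t p.1) p.2.1).
Proof.
apply: (measurable_fun_cvg (h := fun n (p : PT) => Y (grid_ceil n p.2.1) p.1)); last first.
  by move=> p _; exact: cadlag_grid_ceil (cY p.1).
move=> n _ S mS; rewrite setTI.
rewrite (_ : _ @^-1` _ = \bigcup_(k : int) \bigcup_(N : nat)
  ((Y ((k - 1)%:~R / n.+1%:R) @^-1` S) `*`
   (`](k - 1)%:~R / n.+1%:R, k%:~R / n.+1%:R]%classic `*` `]- N%:R, N%:R]%classic) : set PT)).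
  apply: countable_bigcupT_measurable; first exact: countableP.
  move=> k; apply: bigcupT_measurable => N; apply: measurable_predictable_band.
  exact: Yad.
apply/seteqP; split => [[w [v y]]/= Sv|[w [v y]]/= [k _ [N _ [/= Sv [/= + _]]]]].
  exists (Num.ceil (v * n.+1%:R)) => //; exists (Num.truncn `|y|).+1 => //; split => //=.
  split => /=; rewrite in_itv/=.
    by rewrite ltr_pdivrMr// ler_pdivlMr//; exact: ceil_itv.
  have := truncnS_gt `|y|; have := ler_norm y; have := ler_norm (- y); rewrite normrN.
  by move=> h1 h2 h3; apply/andP; split; lra.
rewrite in_itv/= ltr_pdivrMr// ler_pdivlMr// => /ceil_def kE.
by rewrite /grid_ceil kE.
Qed.

End left_limit.

End predictable_functions.

(** * Regions between two levels and their compensation *)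

Section level_regions.
Local Open Scope ereal_scope.
Context {R : realType}.
Local Notation leb := (@lebesgue_measure R).

Definition level_region (s t : R) (al be : R -> R) : set (R * R) :=
  [set p | [/\ s < p.1 <= t & al p.1 < p.2 <= be p.1]%R].

Lemma level_region_area s t (al be : R -> R) : (forall v, 0 <= al v)%R ->
  (lebR \x lebR) (level_region s t al be) =
  \int[lebR]_(v in `]s, t]) (Num.max 0 (be v - al v))%:E.
Proof.
move=> al0; rewrite /product_measure1 [RHS]integral_mkcond.
apply: eq_integral => v _; rewrite patchE /= lebRE.
case: ifPn => vs.
  rewrite (_ : xsection _ _ = `]al v, be v]%classic).
    rewrite lebesgue_measure_itv/= lte_fin; case: ltP => ab.
      by rewrite -EFinB max_r// subr_ge0 ltW.
    by rewrite max_l// subr_le0.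
  apply/seteqP; split => x; rewrite /xsection/= inE in_itv/=; first by case.
  by move=> h; split => //; move: vs; rewrite inE/= in_itv.
rewrite (_ : xsection _ _ = set0) ?measure0//.
apply/seteqP; split => // x; rewrite /xsection/= inE => -[/= vs' _].
by move: vs; rewrite notin_setE/= in_itv/= vs'.
Qed.

End level_regions.

Section compensation.
Local Open Scope ereal_scope.
Context d (T : measurableType d) (R : realType) (P : probability T R).
Local Notation leb := (@lebesgue_measure R).
Variable nu : {sigma_finite_measure set R -> \bar R}.
Variable mu : T -> {measure set (R * R * R) -> \bar R}.
Hypothesis muP : poisson_random_measure P mu (jump_intensity nu).
Hypothesis nu_mom1 : \int[nu]_(z in `]0%R, +oo[) (z ^+ 1)%:E < +oo.
Local Notation M1 := (moment nu 1).
Local Notation PT := (g_sigma_algebraType (predictable_rectangles P mu)).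

(** A region between predictable levels is the section of a predictable set, and nonnegativity of
    [al] keeps it in the strip of positive marks. Its area is the time integral of the distance of
    the levels. *)
Lemma compensation (s t : R) (Z : T -> \bar R) (al be : T -> R -> R) :
  measurable_fun setT (Z : g_sigma_algebraType (history P mu s) -> \bar R) ->
  (forall w, 0 <= Z w) -> \int[P]_w Z w < +oo ->
  measurable_fun setT (fun p : PT => al p.1 p.2.1) ->
  measurable_fun setT (fun p : PT => be p.1 p.2.1) ->
  (forall w v, 0 <= al w v)%R ->
  exists g : T -> \bar R, [/\ measurable_fun setT g, forall w, 0 <= g w,
    {ae P, forall w, g w = shot (mu w) (level_region s t (al w) (be w))}
  & \int[P]_w (Z w * g w) =
    M1%:E * \int[P]_w (Z w * \int[lebR]_(v in `]s, t]) (Num.max 0 (be w v - al w v))%:E)].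
Proof.
move=> mZ Z0 Zoo mal mbe al0.
pose S : set PT := [set p | (al p.1 p.2.1 < p.2.2)%R && (p.2.2 <= be p.1 p.2.1)%R].
have mS : measurable S.
  have m1 := measurable_fun_ltr mal (@predictable_mark _ _ _ P mu).
  have m2 := measurable_fun_ler (@predictable_mark _ _ _ P mu) mbe.
  have := measurable_and m1 m2 measurableT (_ : measurable [set true]).
  by rewrite setTI; apply.
have E w : xsection S w `&` strip s t = level_region s t (al w) (be w).
  apply/seteqP; split => [[v x]|[v x]]; rewrite /xsection/= inE/=.
    by move=> [/andP[h1 h2] [/=]]; rewrite in_itv/= => h _; split => //=; rewrite h1.
  move=> [/= h /andP[h1 h2]]; split; first by rewrite /S/= h1.
  by split => /=; rewrite in_itv/= ?andbT//; exact: le_lt_trans h1.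
have [_ _ [g [mg g0 gE Eg]]] := shot_predictable muP nu_mom1 t mZ Z0 Zoo mS.
exists g; split => //.
  by apply: filterS gE => w ->; rewrite E.
by rewrite Eg; congr (_ * _); apply: eq_integral => w _; rewrite E level_region_area.
Qed.

End compensation.

(** * Stationarity and nonnegativity of the inflow *)

Section stationary_marginals.
Context d (T : measurableType d) (R : realType) (P : probability T R).
Variable X : R -> {RV P >-> R}.
Hypothesis stX : stationary_process X.

Lemma stationary_preimage t S : measurable S -> P (X t @^-1` S) = P (X 0 @^-1` S).
Proof.
move=> mS.
have cap1 (F : 'I_1 -> set T) : \bigcap_j F j = F ord0.
  by apply/seteqP; split => [w Fw|w Fw j _]; [exact: Fw|rewrite (ord1 j)].
have := @stX 1 (fun=> 0) (fun=> S) t (fun=> mS).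
by rewrite !cap1 add0r.
Qed.

Lemma stationary_mean (f : R -> \bar R) t : measurable_fun setT f ->
  (forall x, 0%R <= f x)%E -> (\int[P]_w f (X t w) = \int[P]_w f (X 0 w))%E.
Proof.
move=> mf f0.
rewrite -(ge0_integral_pushforward (measurable_funPT (X t)) P measurableT)//.
rewrite -(ge0_integral_pushforward (measurable_funPT (X 0)) P measurableT)//.
by apply: eq_measure_integral => S mS _; exact: stationary_preimage.
Qed.

End stationary_marginals.

Section inflow_paths.
Context d (T : measurableType d) (R : realType) (P : probability T R).
Local Notation leb := (@lebesgue_measure R).
Variables (mu : T -> {measure set (R * R * R) -> \bar R}) (r c A B : R).
Variable Y : R -> {RV P >-> R}.
Hypothesis r_gt0 : 0 < r.
Hypothesis Ysol : inflow_solution mu r c A B Y.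

Definition jump_level (w : T) (v : R) : R := c * A + r * B * left_lim (fun t => Y t w) v.

Lemma inflow_cadlag w : cadlag (fun t => Y t w).
Proof. by case: Ysol. Qed.

Lemma inflow_adapted t S : measurable S -> history P mu t (Y t @^-1` S).
Proof.
move=> mS; split; last by case: Ysol => _ _ + _; apply.
by rewrite -[_ @^-1` _]setTI; exact: measurable_funPT.
Qed.

Lemma inflow_equation : {ae P, forall w, forall s t : R, s <= t ->
  (Y t w - Y s w + r * \int[leb]_(v in `[s, t]) Y v w)%:E =
  shot (mu w) (level_region s t (fun=> 0) (jump_level w))}.
Proof.
case: Ysol => _ _ _; apply: filterS => w H s t st; rewrite H//.
rewrite /shot (_ : jump_region _ _ _ _ _ _ _ =
  shot_region (level_region s t (fun=> 0) (jump_level w))).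
  by apply: eq_integral => x; rewrite inE => -[_ _ z0]; rewrite gtr0_norm.
apply/seteqP; split => [x [/andP[h1 h2] h3 h4]|x [[h1 /andP[h2 h3]] _ h4]].
  by split => //; split => //=; rewrite h1.
by split => //; rewrite h2.
Qed.

Lemma inflow_dissipative : {ae P, forall w, forall s t : R, s <= t ->
  expR (- r * (t - s)) * Y s w <= Y t w}.
Proof.
apply: filterS inflow_equation => w H s t st.
apply: (@dissipative_lower_bound _ (fun v => Y v w) r (inflow_cadlag w) r_gt0) => //.
by move=> u v uv; rewrite -lee_fin H.
Qed.

(** If Y_n < -e then Y_0 < -e e^(rn) by the pathwise lower bound. By stationarity P(Y_0 < -e) =
    P(Y_n < -e), which is at most P(Y_0 < -e e^(rn)), and this tends to 0. *)
Lemma inflow_negative_tail (e : R) : 0 < e -> P [set w | Y 0 w < - e] = 0%E.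
Proof.
move=> e0.
have mlt (x : R) t : measurable [set w | Y t w < x].
  rewrite (_ : [set w | _] = Y t @^-1` `]-oo, x[%classic).
    by rewrite -[_ @^-1` _]setTI; apply: measurable_funPT => //; exact: measurable_itv.
  by apply/seteqP; split => w /=; rewrite in_itv.
pose F n := [set w | Y 0 w < - (e * expR (r * n%:R))].
have decF : nonincreasing_seq F.
  move=> m n mn; apply/subsetPset => w; rewrite /F/= => /lt_le_trans; apply.
  by rewrite lerN2 ler_pM2l// ler_expR ler_pM2l// ler_nat.
have F0 : \bigcap_n F n = set0.
  (* This [n] exceeds |Y_0| / (e r); as e^(rn) >= 1 + rn, the bound -e e^(rn) is then below
     -|Y_0|. *)
  apply/seteqP; split => // w Fw; pose n := (Num.truncn (`|Y 0 w| / (e * r))).+1.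
  have := Fw n Logic.I; rewrite /F/= ltrNr.
  have h : `|Y 0 w| / (e * r) < n%:R by exact: truncnS_gt.
  rewrite ltr_pdivrMr ?mulr_gt0// in h.
  have := expR_ge1Dx (r * n%:R); rewrite -(ler_pM2l e0) => h2 h3.
  have := ler_norm (- Y 0 w); rewrite normrN => h4.
  have : e * (1 + r * n%:R) < n%:R * (e * r) by apply: (le_lt_trans h2); lra.
  by rewrite mulrDr mulr1 mulrCA (mulrC n%:R) mulrA mulrAC => h5; nra.
have cF : (P (F n) @[n --> \oo] --> 0)%E.
  rewrite -(measure0 P) -F0; apply: nonincreasing_cvg_mu => //.
  - by rewrite (le_lt_trans (probability_le1 P _))// ?ltry//; exact: mlt.
  - by move=> n; exact: mlt.
  - by apply: bigcapT_measurable => n; exact: mlt.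
apply/eqP; rewrite eq_le measure_ge0 andbT.
have -> : 0%E = limn (P \o F) :> \bar R by apply/esym/cvg_lim.
apply: lime_ge; first by apply/cvg_ex; exists 0%E.
apply: nearW => n /=.
have [st _ _ _] := Ysol.
have S1 : P [set w | Y n%:R w < - e] = P [set w | Y 0 w < - e].
  rewrite (_ : [set w | Y n%:R w < - e] = Y n%:R @^-1` `]-oo, - e[%classic); last first.
    by apply/seteqP; split => w /=; rewrite in_itv.
  rewrite (stationary_preimage st); last exact: measurable_itv.
  by congr (P _); apply/seteqP; split => w /=; rewrite in_itv.
rewrite -S1.
have [N [mN N0 hN]] := inflow_dissipative.
rewrite (_ : P (F n) = P (F n `|` N)); last first.
  apply/esym/measureU0 => //; exact: mlt.
apply: le_measure; rewrite ?inE; [exact: mlt|by apply: measurableU => //; exact: mlt|].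
move=> w /= Yw; case: (pselect (N w)) => [|nN]; [by right|left].
have /(_ 0 n%:R (ler0n _ n)) : forall s t : R, s <= t -> expR (- r * (t - s)) * Y s w <= Y t w.
  by apply: contrapT => h; apply: nN; apply: hN.
rewrite subr0 mulNr expRN => /le_lt_trans/(_ Yw).
by rewrite ltr_pdivrMl ?expR_gt0// mulrN /F/= mulrC.
Qed.

(** Nonnegativity holds almost surely at the countably many times -n, and the lower bound carries it
    from some -n to any later time, for all times on one event. *)
Lemma inflow_ge0 : {ae P, forall w, forall t, 0 <= Y t w}.
Proof.
have [st _ _ _] := Ysol.
have H (n k : nat) : {ae P, forall w, - k.+1%:R^-1 <= Y (- n%:R) w}.
  have k0 : 0 < k.+1%:R^-1 :> R by [].
  have E : [set w | Y (- n%:R) w < - k.+1%:R^-1] = Y (- n%:R) @^-1` `]-oo, - k.+1%:R^-1[%classic.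
    by apply/seteqP; split => w /=; rewrite in_itv.
  exists [set w | Y (- n%:R) w < - k.+1%:R^-1]; split.
  - by rewrite E -[_ @^-1` _]setTI; apply: measurable_funPT => //; exact: measurable_itv.
  - rewrite E (stationary_preimage st); last exact: measurable_itv.
    rewrite (_ : Y 0 @^-1` _ = [set w | Y 0 w < - k.+1%:R^-1]).
      exact: inflow_negative_tail.
    by apply/seteqP; split => w /=; rewrite in_itv.
  - by move=> w /= /negP; rewrite -ltNge.
have H0 : {ae P, forall w, forall n : nat, forall k : nat, - k.+1%:R^-1 <= Y (- n%:R) w}.
  by apply: ae_foralln => n; apply: ae_foralln => k; exact: H.
apply: filterS2 H0 inflow_dissipative => w H1 H2 t.
pose n := (Num.truncn `|t|).+1.
have nt : - n%:R <= t.
  have := truncnS_gt `|t|; have := ler_norm (- t); rewrite normrN => h1 h2.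
  by rewrite lerNl (le_trans h1)// ltW.
apply: le_trans (H2 _ _ nt); rewrite mulr_ge0 ?expR_ge0//.
rewrite leNgt; apply/negP => Yn; pose k := Num.truncn (`|Y (- n%:R) w|^-1).
have := H1 n k; apply/negP; rewrite -ltNge ltrNr -(ltr0_norm Yn).
by rewrite invf_plt ?posrE ?normr_gt0 ?lt_eqF//; exact: truncnS_gt.
Qed.

End inflow_paths.

(** * Exchange of expectation and time integral *)

Section tonelli_time.
Local Open Scope ereal_scope.
Context d (T : measurableType d) (R : realType) (P : probability T R).
Local Notation leb := (@lebesgue_measure R).

Lemma tonelli_time (D : set R) (f : T -> R -> \bar R) : measurable D ->
  measurable_fun setT (fun p : T * R => f p.1 p.2) -> (forall w v, 0 <= f w v) ->
  [/\ measurable_fun setT (fun v => \int[P]_w f w v),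
      measurable_fun setT (fun w => \int[leb]_(v in D) f w v) &
      \int[P]_w \int[leb]_(v in D) f w v = \int[leb]_(v in D) \int[P]_w f w v].
Proof.
move=> mD mf f0.
have mfv w : measurable_fun setT (f w).
  exact: (measurableT_comp mf (measurable_pair1 w)).
have mG0 : measurable_fun setT (fun v => \int[P]_w f w v).
  exact: (@measurable_fun_fubini_tonelli_G _ _ T R R P _ mf (fun p => f0 p.1 p.2)).
pose fD (p : T * R) := f p.1 p.2 * (\1_D p.2)%:E.
have mfD : measurable_fun setT fD.
  apply: emeasurable_funM => //; apply/measurable_EFinP.
  by apply: measurableT_comp => //; exact: measurable_indic.
have fD0 p : 0 <= fD p by rewrite mule_ge0// lee_fin.
have E w : \int[lebR]_v fD (w, v) = \int[leb]_(v in D) f w v.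
  rewrite -(ge0_integral_lebR mD)//; last exact: measurable_funTS.
  rewrite [RHS]integral_mkcond; apply: eq_integral => v _.
  by rewrite /fD/= epatch_indic.
have mF := @measurable_fun_fubini_tonelli_F _ _ T R R (@lebR R) _ mfD fD0.
split => //.
  by move: mF; congr measurable_fun; apply/funext => w; exact: E.
have := @fubini_tonelli _ _ T R R P (@lebR R) _ mfD fD0.
rewrite (_ : \int[P]_x _ = \int[P]_w \int[leb]_(v in D) f w v); last first.
  by apply: eq_integral => w _; exact: E.
move=> ->; rewrite -(ge0_integral_lebR mD)//; last 2 first.
- exact: measurable_funTS.
- by move=> v _; exact: integral_ge0.
rewrite [RHS]integral_mkcond; apply: eq_integral => v _.
rewrite epatch_indic /fD/= ge0_integralZr// ?lee_fin//.
exact: (measurableT_comp mf (measurable_pair2 v)).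
Qed.

End tonelli_time.

(** * Linear integral equations and inequalities *)

Section linear_equations.
Context {R : realType}.
Local Notation leb := (@lebesgue_measure R).

Lemma integral_expRN a s t : s <= t ->
  a * \int[leb]_(v in `[s, t]) expR (- a * (v - s)) = 1 - expR (- a * (t - s)).
Proof.
move=> st; have := @integral_exp_difference R 0 a a s t st (esym (subrr a)).
rewrite oppr0 mul0r expR0 => <-.
rewrite -RintegralZl//; last first.
  apply: (@bounded_integrable_itv _ _ _ _ (expR (`|a| * (t - s)))).
    by apply: measurableT_comp => //; apply: measurable_funM => //; exact: measurable_funB.
  move=> v /andP[sv vt]; rewrite ger0_norm ?expR_ge0// ler_expR.
  apply: (@le_trans _ _ (`|a| * (v - s))).
    by rewrite ler_wpM2r ?subr_ge0// -normrN ler_norm.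
  by rewrite ler_wpM2l// lerB.
by apply: eq_Rintegral => v _; rewrite mul0r expR0 mul1r.
Qed.

(** The resolvent with rho = 0 and u = L, applied to F = M + L int F: by hypothesis M is at most K,
    and the resolvent kernel is positive. *)
Lemma gronwall (F : R -> R) (K L B s t : R) : s <= t -> 0 <= L ->
  measurable_fun setT F -> (forall v, s <= v <= t -> `|F v| <= B) ->
  (forall v, s <= v <= t -> F v <= K + L * \int[leb]_(u in `[s, v]) F u) ->
  F t <= K + L * \int[leb]_(v in `[s, t]) (expR (L * (t - v)) * K).
Proof.
move=> st L0 mF FB FL.
pose M v := F v - L * \int[leb]_(u in `[s, v]) F u.
have FM v : s <= v <= t -> F v = M v + L * exp_conv 0 F s v.
  by move=> _; rewrite exp_conv0 /M subrK.
have [] := resolvent st mF FB FM.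
rewrite sub0r opprK => iM ->; apply: lerD.
  by rewrite lerBlDr FL// st lexx.
rewrite ler_wpM2l//.
rewrite /exp_conv opprK; apply: le_Rintegral => //.
  have := @exp_conv_integrable R (- L) (cst K) s t `|K| (@measurable_cst _ _ _ _ _ _).
  by rewrite opprK; apply.
move=> v /=; rewrite in_itv/= => /andP[sv vt].
by rewrite ler_wpM2l ?expR_ge0// lerBlDr FL// sv.
Qed.

(** The difference between [G] and the explicit solution satisfies the equation with zero forcing,
    which the resolvent turns into zero. *)
Lemma linear_equation (G : R -> R) (a k B s t : R) : s <= t ->
  measurable_fun setT G -> (forall v, s <= v <= t -> `|G v| <= B) ->
  (forall v, s <= v <= t ->
    G v = G s + a * k * (v - s) - a * \int[leb]_(u in `[s, v]) G u) ->
  G t = expR (- a * (t - s)) * G s + (1 - expR (- a * (t - s))) * k.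
Proof.
move=> st mG GB GE.
pose H v := G v - (expR (- a * (v - s)) * (G s - k) + k).
have me : measurable_fun setT (fun v : R => expR (- a * (v - s))).
  by apply: measurableT_comp => //; apply: measurable_funM => //; exact: measurable_funB.
have eB v : s <= v <= t -> `|expR (- a * (v - s))| <= expR (`|a| * (t - s)).
  move=> /andP[sv vt]; rewrite ger0_norm ?expR_ge0// ler_expR.
  apply: (@le_trans _ _ (`|a| * (v - s))).
    by rewrite ler_wpM2r ?subr_ge0// -normrN ler_norm.
  by rewrite ler_wpM2l// lerB.
have mH : measurable_fun setT H.
  apply: measurable_funB => //; apply: measurable_funD => //.
  exact: measurable_funM.
have HB v : s <= v <= t -> `|H v| <= B + (expR (`|a| * (t - s)) * `|G s - k| + `|k|).
  move=> sv; apply: (le_trans (ler_normB _ _)); apply: lerD; first exact: GB.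
  apply: (le_trans (ler_normD _ _)); rewrite lerD2r normrM.
  by rewrite ler_wpM2r//; exact: eB.
have HE v : s <= v <= t -> H v = (cst 0 : R -> R) v + (- a) * exp_conv 0 H s v.
  move=> /andP[sv vt]; rewrite exp_conv0 /H/= add0r.
  have iG : leb.-integrable `[s, v] (EFin \o G).
    apply: (@bounded_integrable_itv _ _ _ _ B) => // u /andP[su uv].
    by apply: GB; rewrite su (le_trans uv).
  have ie : leb.-integrable `[s, v] (EFin \o (fun u => expR (- a * (u - s)))).
    apply: (@bounded_integrable_itv _ _ _ _ (expR (`|a| * (t - s)))) => // u /andP[su uv].
    by apply: eB; rewrite su (le_trans uv).
  have iek : leb.-integrable `[s, v] (EFin \o (fun u => expR (- a * (u - s)) * (G s - k))).
    exact: (@integrableZr _ _ _ leb _ (measurable_itv `[s, v]) (G s - k) _ ie).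
  have ik : leb.-integrable `[s, v] (EFin \o (cst k)).
    by apply: (@bounded_integrable_itv _ _ _ _ `|k|).
  rewrite RintegralB//; last exact: (@integrableD _ _ _ leb _ (measurable_itv `[s, v]) _ _ iek ik).
  rewrite RintegralD// RintegralZr// Rintegral_cst//= lebesgue_measure_itv/= lte_fin.
  have -> : fine (if s < v then (v%:E - s%:E)%E else 0%E) = v - s.
    by move: sv; rewrite le_eqVlt => /predU1P[->|->]//; rewrite ltxx subrr.
  rewrite GE ?sv//.
  have := integral_expRN a sv; set I := \int[leb]_(u in _) expR _ => hI.
  have -> : expR (- a * (v - s)) = 1 - a * I by rewrite hI; ring.
  ring.
have [_] := resolvent st mH HB HE.
rewrite /exp_conv; under eq_Rintegral do rewrite mulr0.
rewrite Rintegral_cst//= mul0r mulr0 addr0 => /eqP.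
by rewrite subr_eq0 => /eqP ->; ring.
Qed.

End linear_equations.

(** * Localisation at the first passage over a level *)

Section localisation.
Context {R : realType}.
Local Notation leb := (@lebesgue_measure R).
Implicit Types (y : R -> R).

Lemma left_lim_ge0 y : cadlag y -> (forall t, 0 <= y t) -> forall t, 0 <= left_lim y t.
Proof. by move=> cy y0 t; apply: limr_ge; [exact: (cy t).2|exact: nearW]. Qed.

Lemma measurable_left_lim y : cadlag y -> measurable_fun setT (left_lim y).
Proof.
move=> cy; apply: (measurable_fun_cvg (h := fun n v => y (grid_ceil n v))); last first.
  by move=> v _; exact: cadlag_grid_ceil.
move=> n _ S mS; rewrite setTI.
rewrite (_ : _ @^-1` _ = \bigcup_(k : int) ([set v | grid_ceil n v = (k - 1)%:~R / n.+1%:R] `&`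
    [set v | S (y ((k - 1)%:~R / n.+1%:R))])).
  apply: countable_bigcupT_measurable; first exact: countableP.
  move=> k; apply: measurableI; first exact: measurable_grid_ceil_eq.
  case: (pselect (S (y ((k - 1)%:~R / n.+1%:R)))) => [h|h].
    by rewrite (_ : [set _ | _] = setT)//; apply/seteqP; split.
  by rewrite (_ : [set _ | _] = set0)//; apply/seteqP; split.
apply/seteqP; split => v /=; last by move=> [k _ /= [-> ]].
by move=> Sv; exists (Num.ceil (v * n.+1%:R)).
Qed.

Lemma measurable_level_region s t (al be : R -> R) : measurable_fun setT al ->
  measurable_fun setT be -> measurable (level_region s t al be).
Proof.
move=> mal mbe.
have mf1 : measurable_fun setT (fun p : R * R => al p.1) by exact: measurableT_comp.
have mf2 : measurable_fun setT (fun p : R * R => be p.1) by exact: measurableT_comp.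
have m1 := measurable_and (measurable_fun_ltr mf1 measurable_snd)
  (measurable_fun_ler measurable_snd mf2).
rewrite (_ : level_region _ _ _ _ = (`]s, t]%classic `*` setT) `&`
  [set p : R * R | (al p.1 < p.2) && (p.2 <= be p.1)]).
  apply: measurableI; first exact: measurableX.
  by have := m1 measurableT [set true] (_ : measurable [set true]); rewrite setTI; apply.
by apply/seteqP; split => [p [h1 h2]|p [[h1 _] h2]]; [|]; (do ?split) => //=; rewrite in_itv.
Qed.

Variables (y : R -> R) (r k0 k1 : R) (m : {measure set (R * R) -> \bar R}).
Hypotheses (cy : cadlag y) (y0 : forall t, 0 <= y t) (r0 : 0 <= r).
Hypothesis eqn : forall s t, s <= t ->
  (y t - y s + r * \int[leb]_(v in `[s, t]) y v)%:E =
  m (level_region s t (fun=> 0) (fun v => k0 + k1 * left_lim y v)).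

(** Before the first passage of [y] above [N] all left limits are at most [N], so the truncation in
    the level is invisible; at that time [y] is at least [N] by right continuity. The decay term is
    dropped, being nonnegative, and the region is enlarged up to [v]. The right side only involves a
    bounded level, hence has finite mean without any moment of [y] after time [s]. *)
Lemma localisation N s v : measurable_fun setT (left_lim y) -> s <= v ->
  ((Num.min (y v) N)%:E <= (y s)%:E +
   m (level_region s v (fun=> 0%R) (fun u => k0 + k1 * Num.min (left_lim y u) N)%R))%E.
Proof.
move=> mll sv.
have mlev t : measurable (level_region s t (fun=> 0) (fun u => k0 + k1 * Num.min (left_lim y u) N)).
  apply: measurable_level_region => //; apply: measurable_funD => //.
  by apply: measurable_funM => //; exact: measurable_minr.
have bound t : s <= t -> (forall u, s < u <= t -> left_lim y u <= N) ->
    ((y t)%:E <= (y s)%:E +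
      m (level_region s t (fun=> 0%R) (fun u => k0 + k1 * Num.min (left_lim y u) N)%R))%E.
  move=> st ht; rewrite (_ : level_region _ _ _ _ =
      level_region s t (fun=> 0) (fun u => k0 + k1 * left_lim y u)).
    rewrite -eqn// -EFinD lee_fin.
    have : 0 <= r * \int[leb]_(u in `[s, t]) y u.
      by rewrite mulr_ge0//; apply: Rintegral_ge0 => u _; exact: y0.
    by set I := r * _; lra.
  by apply/seteqP; split => -[u x] [/= hu hx]; split => //=; move: hx; rewrite (min_idPl (ht u hu)).
have [big|small] := pselect (exists2 x, s <= x <= v & N < y x); last first.
  apply: (@le_trans _ _ (y v)%:E); first by rewrite lee_fin ge_min lexx.
  apply: bound => // u /andP[su uv].
  apply: limr_le; first exact: (cy u).2.
  near=> x; rewrite leNgt; apply/negP => Nx; apply: small; exists x => //.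
  apply/andP; split; first by near: x; apply: filterS (nbhs_left_gt su) => z /ltW.
  by rewrite (le_trans _ uv)// ltW//; near: x; exact: nbhs_left_lt.
(* The passage time is the infimum of [E]; it need not belong to [E], since [y] may equal [N]
   there. *)
pose E := [set x | s <= x <= v /\ N < y x].
have E0 : E !=set0 by have [x hx Nx] := big; exists x.
have lbE : lbound E s by move=> x [/andP[]].
have hE : has_inf E by split => //; exists s.
pose t := inf E.
have st : s <= t by exact: lb_le_inf.
have tv : t <= v.
  have [x [xs Nx]] := E0; apply: (le_trans _ (andP xs).2).
  by apply: ge_inf => //; exists s.
have below x : s <= x -> x < t -> y x <= N.
  move=> sx xt; rewrite leNgt; apply/negP => Nx.
  have : t <= x by apply: ge_inf; [exists s|split => //; rewrite sx (le_trans (ltW xt))].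
  by rewrite leNgt xt.
have Nt : N <= y t.
  rewrite leNgt; apply/negP => yN.
  have /cvgrPdist_lt /(_ (N - y t)) := (cy t).1; rewrite subr_gt0 => /(_ yN).
  move=> /nbhs_ballP[e /= e0 he].
  have [x [/andP[sx xv] Nx] xe] := inf_adherent e0 hE.
  have : t <= x by apply: ge_inf; [exists s|split => //; rewrite sx].
  rewrite le_eqVlt => /predU1P[tx|tx]; first by move: Nx; rewrite -tx ltNge ltW.
  have := he x _ tx; rewrite /ball/= distrC ger0_norm ?subr_ge0 ?ltW// ltrBlDl => /(_ xe).
  by have := ler_norm (- (y t - y x)); rewrite normrN; lra.
apply: (@le_trans _ _ (y t)%:E); first by rewrite lee_fin ge_min Nt orbT.
apply: (le_trans (bound t st _)).
  move=> u /andP[su ut]; apply: limr_le; first exact: (cy u).2.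
  near=> x; apply: below; first by near: x; apply: filterS (nbhs_left_gt su) => z /ltW.
  by rewrite (lt_le_trans _ ut)//; near: x; exact: nbhs_left_lt.
rewrite leeD2l//; apply: le_measure; rewrite ?inE//.
by move=> [u x] [/= /andP[su ut] hx]; split => //=; rewrite su (le_trans ut).
Unshelve. all: by end_near.
Qed.

End localisation.

(** * Mean number of jumps below a level driven by the inflow *)

Section conditional_mean.
Local Open Scope ereal_scope.
Context d (T : measurableType d) (R : realType) (P : probability T R).
Local Notation leb := (@lebesgue_measure R).
Variable nu : {sigma_finite_measure set R -> \bar R}.
Variables (mu : T -> {measure set (R * R * R) -> \bar R}) (r c A B : R).
Variable Y : R -> {RV P >-> R}.
Hypothesis muP : poisson_random_measure P mu (jump_intensity nu).
Hypothesis nu_mom1 : \int[nu]_(z in `]0%R, +oo[) (z ^+ 1)%:E < +oo.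
Hypotheses (r_gt0 : (0 < r)%R) (c_ge0 : (0 <= c)%R) (A_ge0 : (0 <= A)%R) (B_ge0 : (0 <= B)%R).
Hypothesis Ysol : inflow_solution mu r c A B Y.
Local Notation M1 := (moment nu 1).
Local Notation PT := (g_sigma_algebraType (predictable_rectangles P mu)).

Let cY := inflow_cadlag Ysol.

Let mYv v : measurable_fun setT (Y v). Proof. exact: measurable_funPT. Qed.

Let mY : measurable_fun setT (fun p : T * R => Y p.2 p.1).
Proof. exact: (measurable_cadlag_process mYv cY). Qed.

Lemma predictable_inflow : measurable_fun setT
  (fun p : PT => left_lim (fun v => Y v p.1) p.2.1).
Proof. exact: (predictable_left_lim (inflow_adapted Ysol) cY). Qed.

Lemma measurable_inflow_left_lim : measurable_fun setT
  (fun p : T * R => left_lim (fun v => Y v p.1) p.2).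
Proof.
have H : <<s predictable_rectangles P mu >> `<=` (@measurable _ (T * (R * R))%type).
  apply: smallest_sub; first exact: sigma_algebra_measurable.
  move=> _ [a [b [al [be [E [[mE _] ->]]]]]].
  by apply: measurableX => //; exact: measurableX.
have := measurable_fun_sub_sigma H predictable_inflow.
move=> /measurableT_comp/(_ (_ : measurable_fun setT (fun p : T * R => (p.1, (p.2, (0 : R)%R))))).
by apply; apply: measurable_fun_pair => //; exact: measurable_fun_pair.
Qed.

Lemma inflow_left_lim_ae : {ae P, forall w,
  leb.-negligible [set v | left_lim (fun v => Y v w) v != Y v w]}.
Proof.
apply: filterS (inflow_equation Ysol) => w H.
have h := @left_lim_neq_negligible _ (fun v => Y v w) r (cY w).
apply: h => u v uv.
by rewrite -lee_fin H.
Qed.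

Section weight.
Variables (s t : R) (Z : T -> \bar R).
Hypothesis mZ : measurable_fun setT (Z : g_sigma_algebraType (history P mu s) -> \bar R).
Hypothesis Z0 : forall w, 0 <= Z w.
Hypothesis Zoo : \int[P]_w Z w < +oo.

Let mZT : measurable_fun setT Z. Proof. exact: history_measurableT mZ. Qed.

(** The compensator sees left limits on ]s, t]. They differ from the values of [Y] at negligible
    times only, so the formula is stated with [Y v] and, adding one point, on [s, t]. *)
Lemma compensated_levels (ka kb : R -> R) : measurable_fun setT ka -> measurable_fun setT kb ->
  (forall x, 0 <= ka x)%R -> (forall x, ka x <= kb x)%R ->
  exists g : T -> \bar R, [/\ measurable_fun setT g, forall w, 0 <= g w,
    {ae P, forall w, g w = shot (mu w)
      (level_region s t (fun v => ka (left_lim (fun v => Y v w) v))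
        (fun v => kb (left_lim (fun v => Y v w) v)))}
  & \int[P]_w (Z w * g w) =
    M1%:E * \int[leb]_(v in `[s, t]) \int[P]_w (Z w * (kb (Y v w) - ka (Y v w))%:E)].
Proof.
move=> mka mkb ka0 kab.
have [|||g [mg g0 gE Eg]] := @compensation _ _ _ P nu mu muP nu_mom1 s t Z
  (fun w v => ka (left_lim (fun v => Y v w) v))
  (fun w v => kb (left_lim (fun v => Y v w) v)) mZ Z0 Zoo.
- exact: measurableT_comp mka predictable_inflow.
- exact: measurableT_comp mkb predictable_inflow.
- by [].
exists g; split => //; rewrite Eg; congr (_ * _).
have [k kE] : exists k : R -> R, k = (fun x => kb x - ka x)%R by exists (fun x => kb x - ka x)%R.
have mk : measurable_fun setT k by rewrite kE; exact: measurable_funB.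
have k0 x : (0 <= k x)%R by rewrite kE subr_ge0.
have kxE x : (kb x - ka x)%R = k x by rewrite kE.
transitivity (\int[leb]_(v in `[s, t]) \int[P]_w (Z w * (k (Y v w))%:E)); last first.
  by apply: eq_integral => v _; apply: eq_integral => w _; rewrite kxE.
have mf (X : T -> R -> R) : measurable_fun setT (fun p : T * R => X p.1 p.2) ->
    measurable_fun setT (fun p : T * R => Z p.1 * (k (X p.1 p.2))%:E).
  move=> mX; apply: emeasurable_funM; first exact: measurableT_comp.
  by apply/measurable_EFinP; exact: measurableT_comp.
have f0 (X : T -> R -> R) w v : 0 <= Z w * (k (X w v))%:E by rewrite mule_ge0 ?lee_fin.
have mS (D : set R) (X : T -> R -> R) w : measurable_fun setT (fun p : T * R => X p.1 p.2) ->
    measurable_fun D (fun v => (k (X w v))%:E).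
  move=> mX; apply: measurable_funTS; apply/measurable_EFinP; apply: measurableT_comp => //.
  exact: (measurableT_comp mX (measurable_pair1 w)).
pose LL w v := left_lim (fun v => Y v w) v.
have [_ m2 <-] := tonelli_time P (measurable_itv `[s, t]) (mf (fun w v => Y v w) mY)
  (f0 (fun w v => Y v w)).
have [_ m1 _] := tonelli_time P (measurable_itv `]s, t]) (mf LL measurable_inflow_left_lim) (f0 LL).
transitivity (\int[P]_w \int[leb]_(v in `]s, t]) (Z w * (k (LL w v))%:E)).
  apply: eq_integral => w _.
  have -> := @ge0_integralZl _ _ _ leb _ (measurable_itv `]s, t]) _
    (mS _ LL w measurable_inflow_left_lim) (Z w) (fun v _ => k0 _) (Z0 w).
  congr (_ * _); rewrite ge0_integral_lebR//.
  - by apply: eq_integral => v _; rewrite kxE max_r.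
  - have := mS `]s, t]%classic LL w measurable_inflow_left_lim.
    by congr measurable_fun; apply/funext => v; rewrite kxE max_r.
  - by move=> v _; rewrite lee_fin le_max lexx.
have h0 (X : T -> R -> R) D w : 0 <= \int[leb]_(v in D) (Z w * (k (X w v))%:E).
  by apply: integral_ge0 => v _; exact: f0.
apply: (@ge0_ae_eq_integral _ _ _ P _ _ _ measurableT m1 m2) => //.
  by move=> w _; exact: (h0 (fun w v => Y v w)).
apply: filterS inflow_left_lim_ae => w Hw _.
transitivity (\int[leb]_(v in `]s, t]) (Z w * (k (Y v w))%:E)).
  apply: ge0_ae_eq_integral => //.
  - exact: (measurable_funTS (measurableT_comp (mf LL measurable_inflow_left_lim) (measurable_pair1 w))).
  - exact: (measurable_funTS (measurableT_comp (mf (fun w v => Y v w) mY) (measurable_pair1 w))).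
  - by move=> v _; exact: (f0 (fun w v => Y v w)).
  - apply: (negligibleS _ Hw) => v /= /not_implyP[_ hv].
    by apply/eqP => LE; apply: hv; rewrite /LL LE.
rewrite integral_itv_obnd_cbnd//.
exact: (measurable_funTS (measurableT_comp (mf (fun w v => Y v w) mY) (measurable_pair1 w))).
Qed.

Lemma compensated_level (k : R -> R) : measurable_fun setT k -> (forall x, 0 <= k x)%R ->
  exists g : T -> \bar R, [/\ measurable_fun setT g, forall w, 0 <= g w,
    {ae P, forall w, g w = shot (mu w)
      (level_region s t (fun=> 0%R) (fun v => k (left_lim (fun v => Y v w) v)))}
  & \int[P]_w (Z w * g w) =
    M1%:E * \int[leb]_(v in `[s, t]) \int[P]_w (Z w * (k (Y v w))%:E)].
Proof.
move=> mk k0.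
have [g [mg g0 gE Eg]] := @compensated_levels (cst 0%R) k (@measurable_cst _ _ _ _ _ _) mk
  (fun=> lexx _) k0.
have E : (fun v => \int[P]_w (Z w * (k (Y v w) - cst 0%R (Y v w))%:E)) =
    (fun v => \int[P]_w (Z w * (k (Y v w))%:E)).
  by apply/funext => v; apply: eq_integral => w _; rewrite subr0.
rewrite E in Eg; exists g; split; [exact: mg|exact: g0|exact: gE|exact: Eg].
Qed.

End weight.

End conditional_mean.

(** * Finite integrals over an interval *)

Section real_integrals.
Context {R : realType}.
Local Notation leb := (@lebesgue_measure R).

Lemma EFin_Rintegral (h : R -> R) B s t : measurable_fun setT h ->
  (forall v, s <= v <= t -> `|h v| <= B) ->
  (\int[leb]_(v in `[s, t]) (h v)%:E)%E = (\int[leb]_(v in `[s, t]) h v)%:E.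
Proof.
move=> mh hB; rewrite /Rintegral fineK//; apply: integrable_fin_num => //.
exact: bounded_integrable_itv hB.
Qed.

Lemma Rintegral_cst_itv (k : R) s t : s <= t -> \int[leb]_(v in `[s, t]) k = k * (t - s).
Proof.
move=> st; rewrite (@Rintegral_cst _ _ _ leb _ (measurable_itv `[s, t]))//= lebesgue_measure_itv/= lte_fin.
by move: st; rewrite le_eqVlt => /predU1P[->|->]//; rewrite ltxx subrr.
Qed.

Lemma gronwall_bound (F : R -> R) (K L B s t : R) : 0 <= L -> 0 <= K ->
  measurable_fun setT F -> (forall v, s <= v <= t -> `|F v| <= B) ->
  (forall v, s <= v <= t -> F v <= K + L * \int[leb]_(u in `[s, v]) F u) ->
  forall v, s <= v <= t -> F v <= K + L * (expR (L * (t - s)) * K * (t - s)).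
Proof.
move=> L0 K0 mF FB FL v /andP[sv vt].
have sub u : s <= u <= v -> s <= u <= t by move=> /andP[-> uv]; rewrite (le_trans uv).
have := gronwall sv L0 mF (fun u h => FB u (sub u h)) (fun u h => FL u (sub u h)).
move/le_trans; apply; rewrite lerD2l ler_wpM2l//.
apply: (@le_trans _ _ (\int[leb]_(u in `[s, v]) (expR (L * (t - s)) * K))); last first.
  by rewrite Rintegral_cst_itv// ler_wpM2l ?mulr_ge0 ?expR_ge0// lerD2r.
apply: le_Rintegral => //.
- have := @exp_conv_integrable R (- L) (cst K) s v `|K| (@measurable_cst _ _ _ _ _ _).
  by rewrite opprK; apply.
- by apply: (@bounded_integrable_itv _ _ _ _ `|expR (L * (t - s)) * K|).
- move=> u /=; rewrite in_itv/= => /andP[su uv].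
  by rewrite ler_wpM2r// ler_expR ler_wpM2l// lerB.
Qed.

End real_integrals.

(** * Exponential relaxation of the conditional mean *)

Section conditional_mean_formula.
Local Open Scope ereal_scope.
Context d (T : measurableType d) (R : realType) (P : probability T R).
Local Notation leb := (@lebesgue_measure R).
Variable nu : {sigma_finite_measure set R -> \bar R}.
Variables (mu : T -> {measure set (R * R * R) -> \bar R}) (r c A B : R).
Variable Y : R -> {RV P >-> R}.
Hypothesis muP : poisson_random_measure P mu (jump_intensity nu).
Hypothesis nu_mom1 : \int[nu]_(z in `]0%R, +oo[) (z ^+ 1)%:E < +oo.
Hypotheses (r_gt0 : (0 < r)%R) (c_ge0 : (0 <= c)%R) (A_ge0 : (0 <= A)%R) (B_ge0 : (0 <= B)%R).
Hypothesis Ysol : inflow_solution mu r c A B Y.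
Local Notation M1 := (moment nu 1).

Let cY := inflow_cadlag Ysol.

Let mYv v : measurable_fun setT (Y v). Proof. exact: measurable_funPT. Qed.

Let mY : measurable_fun setT (fun p : T * R => Y p.2 p.1).
Proof. exact: (measurable_cadlag_process mYv cY). Qed.

Let M1_ge0 : (0 <= M1)%R. Proof. exact: moment1_ge0. Qed.

Variables (s : R) (Z : T -> \bar R).
Hypothesis mZ : measurable_fun setT (Z : g_sigma_algebraType (history P mu s) -> \bar R).
Hypothesis Z0 : forall w, 0 <= Z w.
Hypothesis Zoo : \int[P]_w Z w < +oo.

Let mZT : measurable_fun setT Z. Proof. exact: history_measurableT mZ. Qed.

Local Notation EZ := (fine (\int[P]_w Z w)).

Let EZ_ge0 : (0 <= EZ)%R.
Proof. by apply: fine_ge0; exact: integral_ge0. Qed.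

Let EZE : \int[P]_w Z w = EZ%:E.
Proof. by rewrite fineK// ge0_fin_numE//; exact: integral_ge0. Qed.

Let mZk (k : R -> R) v : measurable_fun setT k ->
  measurable_fun setT (fun w => Z w * (k (Y v w))%:E).
Proof.
move=> mk; apply: emeasurable_funM => //.
by apply/measurable_EFinP; exact: measurableT_comp.
Qed.

Let mZkp (k : R -> R) : measurable_fun setT k ->
  measurable_fun setT (fun p : T * R => Z p.1 * (k (Y p.2 p.1))%:E).
Proof.
move=> mk; apply: emeasurable_funM; first exact: measurableT_comp.
by apply/measurable_EFinP; exact: (measurableT_comp mk mY).
Qed.

Let wmean (k : R -> R) v : \bar R := \int[P]_w (Z w * (k (Y v w))%:E).

Let wmean_ge0 k v : (forall x, 0 <= k x)%R -> 0 <= wmean k v.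
Proof. by move=> k0; apply: integral_ge0 => w _; rewrite mule_ge0 ?lee_fin. Qed.

Let wmean_affine (k : R -> R) (k0 k1 v : R) : measurable_fun setT k ->
  (forall x, 0 <= k x)%R -> (0 <= k0)%R -> (0 <= k1)%R ->
  wmean (fun x => k0 + k1 * k x)%R v = k0%:E * EZ%:E + k1%:E * wmean k v.
Proof.
move=> mk kge0 k00 k10.
transitivity (\int[P]_w (k0%:E * Z w + k1%:E * (Z w * (k (Y v w))%:E))).
  apply: eq_integral => w _; rewrite EFinD EFinM ge0_muleDr ?lee_fin ?mulr_ge0//.
  by congr (_ + _); [exact: muleC|exact: muleCA].
rewrite ge0_integralD//.
- by rewrite ge0_integralZl_EFin// EZE ge0_integralZl_EFin//; [move=> w _; rewrite mule_ge0 ?lee_fin|exact: mZk].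
- by move=> w _; rewrite mule_ge0 ?lee_fin.
- exact: measurable_funeM.
- by move=> w _; rewrite !mule_ge0 ?lee_fin.
- by apply: measurable_funeM; exact: mZk.
Qed.

Let measurable_wmean (k : R -> R) : measurable_fun setT k -> (forall x, 0 <= k x)%R ->
  measurable_fun setT (wmean k).
Proof.
move=> mk k0.
have [] // := @tonelli_time _ _ _ P _ (fun w v => Z w * (k (Y v w))%:E)
  (measurable_itv `[s, s]) (mZkp mk) _.
by move=> w v; rewrite mule_ge0 ?lee_fin.
Qed.

Hypothesis ZYs : \int[P]_w (Z w * `|Y s w|%:E) < +oo.

(** Bounded, so that its weighted mean is finite while that of |Y_v| is still unknown. *)
Let trunc (N : nat) (x : R) : R := Num.min `|x|%R N%:R.

Let mtrunc N : measurable_fun setT (trunc N).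
Proof. by apply: measurable_minr => //; exact: normr_measurable. Qed.

Let trunc_ge0 N x : (0 <= trunc N x)%R.
Proof. by rewrite le_min normr_ge0/=. Qed.

Let trunc_fin N v : wmean (trunc N) v \is a fin_num.
Proof.
rewrite ge0_fin_numE; last exact/wmean_ge0/trunc_ge0.
apply: (@le_lt_trans _ _ (\int[P]_w (N%:R%:E * Z w))).
  apply: ge0_le_integral => //.
  - by move=> w _; rewrite mule_ge0 ?lee_fin//; exact: trunc_ge0.
  - apply: mZk; exact: mtrunc.
  - exact: measurable_funeM.
  - by move=> w _; rewrite muleC lee_wpmul2r// lee_fin ge_min lexx orbT.
by rewrite ge0_integralZl_EFin// EZE -EFinM ltry.
Qed.

(** The localised inequality, integrated against [Z] and compensated. The truncated mean reappears
    on the right, which prepares a Gronwall argument. *)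
Lemma truncated_mean_le N v : (s <= v)%R ->
  wmean (trunc N) v <= wmean Num.norm s + M1%:E *
    \int[leb]_(u in `[s, v]) wmean (fun x => c * A + r * B * trunc N x)%R u.
Proof.
move=> sv.
have mk : measurable_fun setT (fun x : R => c * A + r * B * trunc N x)%R.
  by apply: measurable_funD => //; exact: measurable_funM.
have k0 x : (0 <= c * A + r * B * trunc N x)%R.
  apply: addr_ge0; first exact: mulr_ge0.
  by apply: mulr_ge0; [apply: mulr_ge0 => //; exact: ltW|exact: trunc_ge0].
have [g [mg g0 gE Eg]] := compensated_level muP nu_mom1 Ysol v mZ Z0 Zoo mk k0.
have mnorm := mZk s (@normr_measurable R setT).
rewrite -/(wmean _) in mnorm *.
apply: (@le_trans _ _ (\int[P]_w (Z w * `|Y s w|%:E + Z w * g w))); last first.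
  rewrite ge0_integralD//.
  - by rewrite Eg.
  - by move=> w _; rewrite mule_ge0 ?lee_fin.
  - by move=> w _; rewrite mule_ge0 ?lee_fin.
  - exact: emeasurable_funM.
apply: ae_ge0_le_integral => //.
- by move=> w _; rewrite mule_ge0 ?lee_fin//; exact: trunc_ge0.
- apply: mZk; exact: mtrunc.
- by move=> w _; rewrite adde_ge0// mule_ge0 ?lee_fin.
- by apply: emeasurable_funD => //; exact: emeasurable_funM.
have mu0 := inflow_ge0 r_gt0 Ysol.
have eqn := inflow_equation Ysol.
apply: filterS3 gE mu0 eqn => w gE mu0 eqn _.
rewrite -ge0_muleDr ?lee_fin// lee_wpmul2l// gE.
have := @localisation R (fun v => Y v w) r (c * A)%R (r * B)%R (shot (mu w)) (cY w) mu0 (ltW r_gt0)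
  eqn N%:R s v (measurable_left_lim (cY w)) sv.
rewrite /trunc !ger0_norm//.
rewrite (_ : level_region s v (fun=> 0%R) (fun u => c * A + r * B * Num.min (left_lim (Y^~ w) u) N%:R)%R =
  level_region s v (fun=> 0%R) (fun u => c * A + r * B * Num.min `|left_lim (Y^~ w) u| N%:R)%R)//.
by congr level_region; apply/funext => u; rewrite ger0_norm// left_lim_ge0.
Qed.

Let affine_integral (k F : R -> R) (k0 k1 C v : R) : (s <= v)%R ->
  measurable_fun setT k -> (forall x, 0 <= k x)%R -> (0 <= k0)%R -> (0 <= k1)%R ->
  measurable_fun setT F -> (forall u, s <= u <= v -> `|F u| <= C)%R ->
  (forall u, (s <= u <= v)%R -> wmean k u = (F u)%:E) ->
  \int[leb]_(u in `[s, v]) wmean (fun x => k0 + k1 * k x)%R u =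
  (k0 * EZ * (v - s) + k1 * \int[leb]_(u in `[s, v]) F u)%:E.
Proof.
move=> sv mk kge0 k00 k10 mF FC kF.
have iF : leb.-integrable `[s, v] (EFin \o F) by exact: bounded_integrable_itv FC.
have ikF := @integrableZl _ _ _ leb _ (measurable_itv `[s, v]) k1 _ iF.
have ic : leb.-integrable `[s, v] (EFin \o cst (k0 * EZ)%R).
  by apply: (@bounded_integrable_itv _ _ _ _ `|k0 * EZ|%R).
transitivity (\int[leb]_(u in `[s, v]) (k0 * EZ + k1 * F u)%:E).
  apply: eq_integral => u; rewrite inE/= in_itv/= => hu.
  by rewrite wmean_affine// kF// -!EFinM -EFinD.
rewrite (@EFin_Rintegral _ _ (`|k0 * EZ| + `|k1| * C)%R).
- by rewrite RintegralD// Rintegral_cst_itv// RintegralZl.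
- by apply: measurable_funD => //; exact: measurable_funM.
- move=> u hu; apply: (le_trans (ler_normD _ _)); rewrite lerD2l normrM.
  by rewrite ler_wpM2l// FC.
Qed.

Let K (t : R) : R := fine (wmean Num.norm s) + M1 * (c * A * EZ * (t - s)).

Let wmean_s : wmean Num.norm s = (fine (wmean Num.norm s))%:E.
Proof. by rewrite fineK// ge0_fin_numE//; exact: wmean_ge0. Qed.

Let k1_ge0 : (0 <= r * B)%R. Proof. by rewrite mulr_ge0// ltW. Qed.

(** The a priori bound on the truncated mean depends on [N] but only serves to make Gronwall
    applicable; the resulting bound is free of [N]. *)
Let truncated_mean_bound (N : nat) (t v : R) : (s <= v <= t)%R ->
  wmean (trunc N) v <= (K t + M1 * (r * B) *
    (expR (M1 * (r * B) * (t - s)) * K t * (t - s)))%:E.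
Proof.
move=> svt; rewrite -(fineK (trunc_fin N v)) lee_fin.
pose F u : R := fine (wmean (trunc N) u).
have F0 u : (0 <= F u)%R by apply: fine_ge0; exact/wmean_ge0/trunc_ge0.
have FE u : wmean (trunc N) u = (F u)%:E by rewrite /F fineK//; exact: trunc_fin.
have mF : measurable_fun setT F.
  apply: (measurableT_comp (@fine_measurable R setT measurableT)).
  by apply: measurable_wmean; [exact: mtrunc|exact: trunc_ge0].
have FB u : (`|F u| <= N%:R * EZ)%R.
  rewrite ger0_norm// -lee_fin -FE EFinM -EZE -ge0_integralZl_EFin//.
  apply: ge0_le_integral => //.
  - by move=> w _; rewrite mule_ge0 ?lee_fin//; exact: trunc_ge0.
  - by apply: mZk; exact: mtrunc.
  - exact: measurable_funeM.
  - by move=> w _; rewrite muleC lee_wpmul2r// lee_fin ge_min lexx orbT.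
have sv : (s <= t)%R by case/andP: svt => /le_trans; apply.
have K0 : (0 <= K t)%R.
  rewrite addr_ge0 ?fine_ge0 ?wmean_ge0// mulr_ge0//.
  by rewrite !mulr_ge0// subr_ge0.
apply: (@gronwall_bound R F (K t) (M1 * (r * B))%R (N%:R * EZ)%R s t) => //.
- exact: mulr_ge0.
- move=> u /andP[su ut].
  have := truncated_mean_le N su.
  rewrite (affine_integral su (mtrunc N) (trunc_ge0 N) (mulr_ge0 c_ge0 A_ge0) k1_ge0 mF
    (fun u _ => FB u) (fun u _ => FE u)).
  rewrite FE wmean_s -EFinM -EFinD lee_fin => /le_trans; apply.
  have : (M1 * (c * A * EZ * (u - s)) <= M1 * (c * A * EZ * (t - s)))%R.
    by rewrite ler_wpM2l// ler_wpM2l ?lerD2r// !mulr_ge0.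
  by rewrite /K; set I := (\int[leb]_(_ in _) _)%R; lra.
Qed.

Let mean_bounded (t : R) : exists C : R, forall v, (s <= v <= t)%R -> wmean Num.norm v <= C%:E.
Proof.
(* The constant is the Gronwall bound of [truncated_mean_bound], which depends on [t] but neither on
   [v] nor on [N]. *)
eexists => v svt.
have cv : wmean (trunc N) v @[N --> \oo] --> wmean Num.norm v.
  rewrite /wmean (_ : (fun w => Z w * `|Y v w|%:E) =
      (fun w => limn (fun N => Z w * (trunc N (Y v w))%:E))); last first.
    apply/funext => w; apply/esym/cvg_lim => //.
    apply: nd_cvg_mule => //.
    - by move=> N; rewrite lee_fin; exact: trunc_ge0.
    - by move=> m N mN; rewrite lee_fin le_min ge_min lexx/= ge_min ler_nat mN orbT.
    - apply: cvg_near_cst; exists (Num.truncn `|Y v w|%R).+1 => // N /= hN.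
      rewrite /trunc; congr EFin; apply/min_idPl; apply: (le_trans (ltW (truncnS_gt _))).
      by rewrite ler_nat.
  apply: cvg_monotone_convergence => //.
  - by move=> N; apply: mZk; exact: mtrunc.
  - by move=> N w _; rewrite mule_ge0 ?lee_fin//; exact: trunc_ge0.
  - move=> w _ m N mN; rewrite lee_wpmul2l// lee_fin le_min ge_min lexx/=.
    by rewrite ge_min ler_nat mN orbT.
rewrite -(cvg_lim _ cv)//; apply: lime_le; first by apply/cvg_ex; exists (wmean Num.norm v).
by apply: nearW => N; exact: truncated_mean_bound svt.
Qed.

Let mnorm : measurable_fun setT (Num.norm : R -> R). Proof. exact: normr_measurable. Qed.

(** Expectation of the inflow equation against [Z], the jumps being replaced by their compensator.
    The decay term stands on the left so that both sides are sums of nonnegative terms. *)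
Lemma mean_equation v : (s <= v)%R ->
  wmean Num.norm v + r%:E * \int[leb]_(u in `[s, v]) wmean Num.norm u =
  wmean Num.norm s + M1%:E *
    \int[leb]_(u in `[s, v]) wmean (fun x => c * A + r * B * `|x|)%R u.
Proof.
move=> sv.
have mk : measurable_fun setT (fun x : R => c * A + r * B * `|x|)%R.
  by apply: measurable_funD => //; exact: measurable_funM.
have k0 (x : R) : (0 <= c * A + r * B * `|x|)%R.
  by apply: addr_ge0; apply: mulr_ge0.
have [g [mg g0 gE Eg]] := compensated_level muP nu_mom1 Ysol v mZ Z0 Zoo mk k0.
have Zn0 u w : 0 <= Z w * `|Y u w|%:E by rewrite mule_ge0 ?lee_fin.
have [_ mI <-] := @tonelli_time _ _ _ P _ (fun w u => Z w * `|Y u w|%:E)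
  (measurable_itv `[s, v]) (mZkp mnorm) (fun w u => Zn0 u w).
have I0 w : 0 <= \int[leb]_(u in `[s, v]) (Z w * `|Y u w|%:E) by apply: integral_ge0.
have r_ge0 : (0 <= r)%R by exact: ltW.
rewrite -Eg -ge0_integralZl_EFin//.
rewrite /wmean -ge0_integralD//; last 3 first.
- exact: mZk.
- by move=> w _; rewrite mule_ge0 ?lee_fin//.
- exact: measurable_funeM.
rewrite -ge0_integralD//; last 3 first.
- exact: mZk.
- by move=> w _; rewrite mule_ge0.
- exact: emeasurable_funM.
apply: ge0_ae_eq_integral => //.
- by apply: emeasurable_funD; [exact: mZk|exact: measurable_funeM].
- by apply: emeasurable_funD; [exact: mZk|exact: emeasurable_funM].
- by move=> w _; rewrite adde_ge0// mule_ge0 ?lee_fin//.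
- by move=> w _; rewrite adde_ge0// mule_ge0.
apply: filterS3 gE (inflow_ge0 r_gt0 Ysol) (inflow_equation Ysol) => w gE Yw0 eqn _.
have mYw : measurable_fun setT (fun u => Y u w) by exact: measurable_cadlag.
have [C YC] := cadlag_bounded s v (cY w).
have -> : \int[leb]_(u in `[s, v]) (Z w * `|Y u w|%:E) =
    Z w * (\int[leb]_(u in `[s, v]) Y u w)%:E.
  rewrite -(EFin_Rintegral mYw YC) -(@ge0_integralZl _ _ _ leb _ (measurable_itv `[s, v]))//.
  - by apply: eq_integral => u _; rewrite ger0_norm.
  - by apply: measurable_funTS; exact/measurable_EFinP.
  - by move=> u _; rewrite lee_fin.
have Iw : (0 <= \int[leb]_(u in `[s, v]) Y u w)%R by apply: Rintegral_ge0.
rewrite muleCA -EFinM -ge0_muleDr ?lee_fin ?mulr_ge0// -EFinD.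
rewrite -ge0_muleDr ?lee_fin//; congr (_ * _).
rewrite gE (_ : level_region _ _ _ _ = level_region s v (fun=> 0%R) (jump_level r c A B Y w)).
  by rewrite -(eqn _ _ sv) -EFinD !ger0_norm//; congr EFin; ring.
congr level_region; apply/funext => u; rewrite /jump_level ger0_norm//.
exact: left_lim_ge0.
Qed.

(** In the mean, decay at rate r meets a feedback of strength r B M1, which leaves a linear equation
    of rate a = r(1 - B M1) with equilibrium c A M1 / a. *)
Lemma conditional_mean t : (s <= t)%R -> (B * M1 < 1)%R ->
  let a := (r * (1 - B * M1))%R in
  \int[P]_w (Z w * `|Y t w|%:E) =
  (expR (- a * (t - s)) * fine (\int[P]_w (Z w * `|Y s w|%:E)) +
   (1 - expR (- a * (t - s))) * (c * A * M1 / a * EZ))%:E.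
Proof.
move=> st BM a; have a0 : (0 < a)%R by rewrite mulr_gt0// subr_gt0.
have [C YC] := mean_bounded t.
pose G v : R := fine (wmean Num.norm v).
have G0 v : (0 <= G v)%R by apply: fine_ge0; exact: wmean_ge0.
have GE v : (s <= v <= t)%R -> wmean Num.norm v = (G v)%:E.
  move=> h; rewrite /G fineK// ge0_fin_numE; last exact: wmean_ge0.
  by rewrite (le_lt_trans (YC _ h))// ltry.
have mG : measurable_fun setT G.
  apply: (measurableT_comp (@fine_measurable R setT measurableT)).
  exact: measurable_wmean.
have GC v : (s <= v <= t)%R -> (`|G v| <= C)%R.
  by move=> h; rewrite ger0_norm// -lee_fin -GE//; exact: YC.
rewrite -[LHS]/(wmean Num.norm t) GE ?st ?lexx//; congr EFin.
apply: (@linear_equation R G a _ C s t st mG GC) => v svt.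
have /andP[sv vt] := svt.
have sub u : (s <= u <= v)%R -> (s <= u <= t)%R by move=> /andP[-> uv]; rewrite (le_trans uv).
have GCv u : (s <= u <= v)%R -> (`|G u| <= C)%R by move/sub; exact: GC.
have GEv u : (s <= u <= v)%R -> wmean Num.norm u = (G u)%:E by move/sub; exact: GE.
have := mean_equation sv.
rewrite (@affine_integral Num.norm G _ _ C)//; last exact: mulr_ge0.
have -> : \int[leb]_(u in `[s, v]) wmean Num.norm u = (\int[leb]_(u in `[s, v]) G u)%:E.
  rewrite -(EFin_Rintegral mG GCv); apply: eq_integral => u; rewrite inE/= in_itv/=.
  exact: GEv.
rewrite GEv ?sv ?lexx// GEv ?sv ?lexx//.
rewrite -!EFinM -!EFinD => -[].
set I := (\int[leb]_(u in _) G u)%R => h.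
have -> : (a * (c * A * M1 / a * EZ) = c * A * M1 * EZ)%R by field; rewrite gt_eqF.
by rewrite /a; lra.
Qed.

End conditional_mean_formula.

Lemma cvg_expRN_nat (R : realType) (a : R) : 0 < a -> expR (- a * n%:R) @[n --> \oo] --> (0 : R).
Proof.
move=> a0; have c : geometric 1 (expR (- a)) n @[n --> \oo] --> (0 : R).
  by apply: cvg_geometric; rewrite ger0_norm ?expR_ge0// -[ltRHS]expR0 ltr_expR oppr_lt0.
rewrite (_ : (fun n : nat => expR (- a * n%:R)) = geometric 1 (expR (- a)))//.
by apply/funext => n; rewrite /geometric/= mul1r expRM_natr.
Qed.

(** * The stationary mean *)

Section inflow_mean.
Local Open Scope ereal_scope.
Context d (T : measurableType d) (R : realType) (P : probability T R).
Local Notation leb := (@lebesgue_measure R).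
Variable nu : {sigma_finite_measure set R -> \bar R}.
Variables (mu : T -> {measure set (R * R * R) -> \bar R}) (r c A B : R).
Variable Y : R -> {RV P >-> R}.
Hypothesis muP : poisson_random_measure P mu (jump_intensity nu).
Hypothesis nu_mom1 : \int[nu]_(z in `]0%R, +oo[) (z ^+ 1)%:E < +oo.
Hypotheses (r_gt0 : (0 < r)%R) (c_ge0 : (0 <= c)%R) (A_ge0 : (0 <= A)%R) (B_ge0 : (0 <= B)%R).
Hypothesis Ysol : inflow_solution mu r c A B Y.
Hypothesis BM : (B * moment nu 1 < 1)%R.
Local Notation M1 := (moment nu 1).

Let a : R := (r * (1 - B * M1))%R.
Let m : R := (c * A * M1 / a)%R.

Let a_gt0 : (0 < a)%R. Proof. by rewrite mulr_gt0// subr_gt0. Qed.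

Let m_ge0 : (0 <= m)%R.
Proof. by rewrite divr_ge0 ?(ltW a_gt0)// !mulr_ge0// moment1_ge0. Qed.

Let cY := inflow_cadlag Ysol.

Let stY : stationary_process Y. Proof. by case: Ysol. Qed.

Let mYv v : measurable_fun setT (Y v). Proof. exact: measurable_funPT. Qed.

Let mnY v : measurable_fun setT (fun w => `|Y v w|%R).
Proof. exact: measurableT_comp. Qed.

Lemma inflow_measurable_history t : measurable_fun setT (Y t : g_sigma_algebraType (history P mu t) -> R).
Proof.
move=> _ S mS; rewrite setTI; apply: sub_sigma_algebra.
exact: (inflow_adapted Ysol).
Qed.

Let tail (N : nat) := [set w | N%:R < `|Y 0 w|]%R.

Let mtail_history N : (measurable : set (set (g_sigma_algebraType (history P mu 0)))) (tail N).
Proof.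
have := measurable_fun_ltr (@measurable_cst _ _ (g_sigma_algebraType (history P mu 0)) R setT N%:R)
  (measurableT_comp (@normr_measurable R setT) (@inflow_measurable_history 0%R)).
by move=> /(_ measurableT [set true] (_ : measurable [set true])); rewrite setTI; apply.
Qed.

Let mtail N : measurable (tail N).
Proof.
have := measurable_fun_ltr (@measurable_cst _ _ T R setT N%:R) (mnY 0).
by move=> /(_ measurableT [set true] (_ : measurable [set true])); rewrite setTI; apply.
Qed.

Let cvg_tail : P (tail N) @[N --> \oo] --> 0.
Proof.
have -> : 0 = P (\bigcap_N tail N).
  rewrite (_ : \bigcap_N tail N = set0) ?measure0//; apply/seteqP; split => // w hw.
  have := hw (Num.truncn `|Y 0 w|%R).+1 Logic.I; rewrite /tail/= => /lt_trans/(_ (truncnS_gt _)).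
  by rewrite ltxx.
apply: nonincreasing_cvg_mu => //.
- by rewrite (le_lt_trans (probability_le1 P (mtail 0)))// ltry.
- exact: bigcapT_measurable.
- by move=> k N kN; apply/subsetPset => w; rewrite /tail/=; apply: le_lt_trans; rewrite ler_nat.
Qed.

Let trunc (K : nat) (x : R) : R := Num.min `|x|%R K%:R.

Let mtrunc K v : measurable_fun setT (fun w => trunc K (Y v w)).
Proof. by apply: measurable_minr => //; exact: mnY. Qed.

Let trunc_ge0 K x : (0 <= trunc K x)%R.
Proof. by rewrite le_min normr_ge0/=. Qed.

(** On {|Y_0| <= N} the start is integrable, and at time n the conditional mean has forgotten it up
    to e^(-an) N. The complement costs at most K times its probability, and stationarity moves the
    truncated mean from time n back to time 0. The limits are taken in n, then N, then K. *)
Let trunc_mean_le (K N n : nat) : \int[P]_w (trunc K (Y 0 w))%:E <=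
  (expR (- a * n%:R) * N%:R + m)%:E + K%:R%:E * P (tail N).
Proof.
pose Z w : \bar R := (\1_(~` tail N) w)%:E.
have mZ : measurable_fun setT (Z : g_sigma_algebraType (history P mu 0) -> \bar R).
  apply/measurable_EFinP; apply: measurable_indic; apply: measurableC; exact: mtail_history.
have mZT : measurable_fun setT Z.
  by apply/measurable_EFinP; apply: measurable_indic; exact: measurableC.
have Z0 w : 0 <= Z w by rewrite lee_fin.
have Z1 w : Z w <= 1 by rewrite lee_fin indicE; case: (_ \in _).
have IZ1 : \int[P]_w Z w <= 1.
  apply: (@le_trans _ _ (\int[P]_w cst 1 w)); first exact: ge0_le_integral.
  by rewrite integral_cst// mul1e; exact: probability_le1.
have Zoo : \int[P]_w Z w < +oo by rewrite (le_lt_trans IZ1)// ltry.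
have ZY0 w : Z w * `|Y 0 w|%:E <= N%:R%:E * Z w.
  rewrite /Z indicE in_setC; case: (boolP (w \in tail N)) => /= h.
    by rewrite mul0e mule0.
  rewrite mul1e mule1 lee_fin leNgt; apply: contra h => h; exact: mem_set.
have IZY : \int[P]_w (Z w * `|Y 0 w|%:E) <= N%:R%:E.
  apply: (@le_trans _ _ (\int[P]_w (N%:R%:E * Z w))).
    apply: ge0_le_integral => //.
    - by move=> w _; rewrite mule_ge0// lee_fin.
    - by apply: emeasurable_funM => //; exact/measurable_EFinP.
    - exact: measurable_funeM.
  by rewrite ge0_integralZl_EFin// -[leRHS]mule1 lee_wpmul2l// lee_fin.
have IZY0 : 0 <= \int[P]_w (Z w * `|Y 0 w|%:E).
  by apply: integral_ge0 => w _; rewrite mule_ge0// lee_fin.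
have ZYoo : \int[P]_w (Z w * `|Y 0 w|%:E) < +oo by rewrite (le_lt_trans IZY)// ltry.
have := conditional_mean muP nu_mom1 r_gt0 c_ge0 A_ge0 B_ge0 Ysol mZ Z0 Zoo ZYoo (ler0n R n) BM.
rewrite /= -/a subr0 -/m => E.
have <- : \int[P]_w (trunc K (Y n%:R w))%:E = \int[P]_w (trunc K (Y 0 w))%:E.
  apply: (stationary_mean stY (f := fun x => (trunc K x)%:E)).
    by apply/measurable_EFinP; apply: measurable_minr => //; exact: normr_measurable.
  by move=> x; rewrite lee_fin; exact: trunc_ge0.
apply: (@le_trans _ _ (\int[P]_w (Z w * `|Y n%:R w|%:E + K%:R%:E * (\1_(tail N) w)%:E))).
  apply: ge0_le_integral => //.
  - by move=> w _; rewrite lee_fin; exact: trunc_ge0.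
  - by apply/measurable_EFinP; exact: mtrunc.
  - apply: emeasurable_funD; first by apply: emeasurable_funM => //; exact/measurable_EFinP.
    by apply: measurable_funeM; apply/measurable_EFinP; exact: measurable_indic.
  - move=> w _; rewrite /Z !indicE in_setC; case: (boolP (w \in tail N)) => /= h.
      by rewrite mul0e add0e mule1 lee_fin ge_min lexx orbT.
    by rewrite mul1e mule0 adde0 lee_fin ge_min lexx.
have f1 w : setT w -> 0 <= Z w * `|Y n%:R w|%:E by rewrite mule_ge0// lee_fin.
have f2 w : setT w -> (0 : \bar R) <= K%:R%:E * (\1_(tail N) w)%:E by rewrite mule_ge0// lee_fin.
have mf1 : measurable_fun setT (fun w => Z w * `|Y n%:R w|%:E).
  by apply: emeasurable_funM => //; exact/measurable_EFinP.
have mf2 : measurable_fun setT (fun w : T => K%:R%:E * (\1_(tail N) w)%:E : \bar R).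
  by apply: emeasurable_funM => //; apply/measurable_EFinP; exact: measurable_indic.
rewrite (ge0_integralD _ measurableT f1 mf1 f2 mf2).
rewrite ge0_integralZl_EFin//; last first.
  by apply/measurable_EFinP; exact: measurable_indic.
rewrite integral_indic// setIT; apply: leeD => //.
rewrite E lee_fin; apply: lerD.
  rewrite ler_wpM2l ?expR_ge0//; rewrite -lee_fin fineK// ge0_fin_numE//.
have e1 : (0 <= 1 - expR (- a * n%:R) <= 1)%R.
  rewrite lerBlDr lerDl expR_ge0 andbT subr_ge0 -expR0 ler_expR mulNr oppr_le0.
  by rewrite mulr_ge0 ?(ltW a_gt0).
have e2 : (0 <= fine (\int[P]_w Z w) <= 1)%R.
  rewrite fine_ge0/= ?integral_ge0// -lee_fin fineK// ge0_fin_numE//; exact: integral_ge0.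
case/andP: e1 => e1 e1'; case/andP: e2 => e2 e2'.
rewrite -[leRHS]mul1r; apply: ler_pM => //; first exact: mulr_ge0.
by rewrite -[leRHS]mulr1; apply: ler_pM.
Qed.

Let trunc_mean_le_m (K : nat) : \int[P]_w (trunc K (Y 0 w))%:E <= m%:E.
Proof.
have H N : \int[P]_w (trunc K (Y 0 w))%:E <= m%:E + K%:R%:E * P (tail N).
  have c1 : (expR (- a * n%:R) * N%:R + m)%:E + K%:R%:E * P (tail N) @[n --> \oo] -->
      m%:E + K%:R%:E * P (tail N).
    apply: cvgeD; [|apply: cvg_EFin; first exact: nearW|exact: cvg_cst].
      by rewrite fin_num_adde_defr.
    rewrite -[X in _ --> X]add0r; apply: cvgD; last exact: cvg_cst.
    rewrite -[X in _ --> X](mul0r N%:R); apply: cvgM; last exact: cvg_cst.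
    exact: cvg_expRN_nat.
  rewrite -(cvg_lim _ c1)//; apply: lime_ge; first by apply/cvg_ex; eexists; exact: c1.
  by apply: nearW => n; exact: trunc_mean_le.
have c2 : m%:E + K%:R%:E * P (tail N) @[N --> \oo] --> m%:E.
  rewrite -[X in _ --> X]adde0; apply: cvgeD => //; [exact: cvg_cst|].
  by rewrite -(mule0 K%:R%:E); apply: (cvgeZl _ cvg_tail).
rewrite -(cvg_lim _ c2)//; apply: lime_ge; first by apply/cvg_ex; eexists; exact: c2.
by apply: nearW => N; exact: H.
Qed.

Let mean_le_m : \int[P]_w `|Y 0 w|%:E <= m%:E.
Proof.
have cv : \int[P]_w (trunc K (Y 0 w))%:E @[K --> \oo] --> \int[P]_w `|Y 0 w|%:E.
  rewrite (_ : (fun w => `|Y 0 w|%:E) = (fun w => limn (fun K => (trunc K (Y 0 w))%:E))); last first.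
    apply/funext => w; apply/esym/cvg_lim => //.
    apply: cvg_near_cst; exists (Num.truncn `|Y 0 w|%R).+1 => // N /= hN.
    rewrite /trunc; congr EFin; apply/min_idPl; apply: (le_trans (ltW (truncnS_gt _))).
    by rewrite ler_nat.
  apply: cvg_monotone_convergence => //.
  - by move=> N; apply/measurable_EFinP; exact: mtrunc.
  - by move=> N w _; rewrite lee_fin; exact: trunc_ge0.
  - move=> w _ k N kN; rewrite lee_fin le_min ge_min lexx/=.
    by rewrite ge_min ler_nat kN orbT.
rewrite -(cvg_lim _ cv)//; apply: lime_le; first by apply/cvg_ex; eexists; exact: cv.
by apply: nearW => K; exact: trunc_mean_le_m.
Qed.

Lemma inflow_mean t : \int[P]_w `|Y t w|%:E = m%:E.
Proof.
have st v : \int[P]_w `|Y v w|%:E = \int[P]_w `|Y 0 w|%:E.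
  by apply: (stationary_mean stY (f := fun x => `|x|%:E)) => //; exact/measurable_EFinP.
have fin : \int[P]_w (cst 1 w * `|Y 0 w|%:E) < +oo.
  under eq_integral do rewrite mul1e.
  by rewrite (le_lt_trans mean_le_m)// ltry.
have I1 : \int[P]_w cst 1 w = 1.
  by rewrite integral_cst// mul1e; exact: probability_setT.
have oo1 : \int[P]_w cst 1 w < +oo by rewrite I1 ltry.
have := conditional_mean muP nu_mom1 r_gt0 c_ge0 A_ge0 B_ge0 Ysol (@measurable_cst _ _ _ _ _ _)
  (fun=> lee01) oo1 fin ler01 BM.
rewrite /= -/a I1 /= mulr1 -/m st.
rewrite (_ : \int[P]_w (1 * `|Y 1 w|%:E) = \int[P]_w `|Y 0 w|%:E); last first.
  by rewrite -(st 1%R); apply: eq_integral => w _; rewrite mul1e.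
rewrite (_ : \int[P]_w (1 * `|Y 0 w|%:E) = \int[P]_w `|Y 0 w|%:E); last first.
  by apply: eq_integral => w _; rewrite mul1e.
rewrite -(fineK (_ : \int[P]_w `|Y 0 w|%:E \is a fin_num)); last first.
  rewrite ge0_fin_numE; first by rewrite (le_lt_trans mean_le_m)// ltry.
  by apply: integral_ge0 => w _; rewrite lee_fin.
(* Stationarity equates the means at times 0 and 1, so x = e x + (1 - e) m with e < 1. *)
move=> [h]; congr EFin; move: h; set x := fine _; set e := expR _ => h.
have e1 : (e < 1)%R by rewrite /e -[ltRHS]expR0 ltr_expR mulNr oppr_lt0 subr0 mulr1.
have : ((1 - e) * (x - m) = 0)%R by rewrite mulrBr mulrBl mul1r {1}h; ring.
by move/eqP; rewrite mulf_eq0 !subr_eq0 => /orP[/eqP e1'|/eqP//]; move: e1; rewrite -e1' ltxx.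
Qed.

End inflow_mean.

Lemma expRN_lipschitz (R : realType) (x y : R) : 0 <= x ->
  expR (- x) <= expR (- y) + `|x - y|.
Proof.
move=> x0; have [yx|xy] := leP y x.
  by rewrite ler_wpDr// ler_expR lerN2.
rewrite ltr0_norm ?subr_lt0// opprB.
have h := expR_ge1Dx (x - y).
have e1 : expR (- x) <= 1 by rewrite -[leRHS]expR0 ler_expR oppr_le0.
have -> : expR (- y) = expR (- x) * expR (x - y) by rewrite -expRD; congr expR; ring.
have e0 := expR_ge0 (- x).
have : expR (- x) * (1 + (x - y)) <= expR (- x) * expR (x - y) by rewrite ler_wpM2l.
have : expR (- x) * (y - x) <= 1 * (y - x) by rewrite ler_wpM2r// subr_ge0 ltW.
by lra.
Qed.

(** * Comparison with a frozen level *)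

Section shot_comparison.
Local Open Scope ereal_scope.
Context {R : realType}.
Variables (m : {measure set (R * R) -> \bar R}) (h l : R) (lvl : R -> R).
Hypothesis mlvl : measurable_fun setT lvl.

(** It contains the symmetric difference of the regions below [lvl] and below [l]. Adding its mass
    on either side replaces a subtraction of possibly infinite masses. *)
Let gap := level_region 0%R h (fun v => Num.min (lvl v) l) (fun v => Num.max (lvl v) l).

Let mgap : measurable gap.
Proof.
by apply: measurable_level_region; [apply: measurable_minr|apply: measurable_maxr].
Qed.

Let ml (al : R -> R) : measurable_fun setT al -> measurable (level_region 0%R h (fun=> 0%R) al).
Proof. by move=> mal; exact: measurable_level_region. Qed.

Let sub (al be : R -> R) : measurable_fun setT al -> measurable_fun setT be ->
  level_region 0%R h (fun=> 0%R) al `<=` level_region 0%R h (fun=> 0%R) be `|` gap ->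
  m (level_region 0%R h (fun=> 0%R) al) <= m (level_region 0%R h (fun=> 0%R) be) + m gap.
Proof.
move=> mal mbe H; apply: (@le_trans _ _ (m (level_region 0%R h (fun=> 0%R) be `|` gap))).
  by apply: le_measure => //; rewrite inE; [exact: ml|apply: measurableU => //; exact: ml].
by apply: measureU2 => //; exact: ml.
Qed.

Lemma shot_le_gapl : m (level_region 0%R h (fun=> 0%R) lvl) <=
  m (level_region 0%R h (fun=> 0%R) (fun=> l)) + m gap.
Proof.
apply: sub => // -[v x] [/= hv /andP[x0 xl]].
have [h1|h1] := leP x l; first by left; split => //=; rewrite x0.
right; split => //=; rewrite gt_min h1 orbT/=.
by rewrite le_max xl.
Qed.

Lemma shot_le_gapr : m (level_region 0%R h (fun=> 0%R) (fun=> l)) <=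
  m (level_region 0%R h (fun=> 0%R) lvl) + m gap.
Proof.
apply: sub => // -[v x] [/= hv /andP[x0 xl]].
have [h1|h1] := leP x (lvl v); first by left; split => //=; rewrite x0.
right; split => //=; rewrite gt_min h1/=.
by rewrite le_max xl orbT.
Qed.

End shot_comparison.

(** * The Laplace exponent of the jump sizes *)

Section laplace_exponent.
Local Open Scope ereal_scope.
Context {R : realType}.
Variable nu : {sigma_finite_measure set R -> \bar R}.
Hypothesis nu_mom1 : \int[nu]_(z in `]0%R, +oo[) (z ^+ 1)%:E < +oo.

(** The Laplace exponent of the driftless subordinator with Lévy measure [nu]; it is finite because
    1 - e^(-x) <= x and the first moment is finite. *)
Definition laplace_exponent (lam : R) : R :=
  (\int[nu]_(z in `]0, +oo[) (1 - expR (- (lam * z))))%R.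

Lemma laplace_exponent_int lam : (0 <= lam)%R ->
  \int[nu]_(z in `]0%R, +oo[) (1 - expR (- (lam * `|z|)))%:E = (laplace_exponent lam)%:E.
Proof.
move=> lam0; rewrite /laplace_exponent /Rintegral.
have I0 (z : R) : (0 <= 1 - expR (- (lam * `|z|)))%R.
  by rewrite subr_ge0 -[leRHS]expR0 ler_expR oppr_le0 mulr_ge0.
have mI : measurable_fun setT (fun z : R => 1 - expR (- (lam * `|z|)))%R.
  apply: measurable_funB => //; apply: measurableT_comp => //.
  by apply: measurableT_comp => //; apply: measurable_funM => //; exact: normr_measurable.
have fin : \int[nu]_(z in `]0%R, +oo[) (1 - expR (- (lam * `|z|)))%:E \is a fin_num; last first.
  rewrite (_ : \int[nu]_(z in `]0%R, +oo[) (1 - expR (- (lam * z)))%:E =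
    \int[nu]_(z in `]0%R, +oo[) (1 - expR (- (lam * `|z|)))%:E) ?fineK//.
  by apply: eq_integral => z; rewrite inE/= in_itv/= andbT => z0; rewrite gtr0_norm.
rewrite ge0_fin_numE; last by apply: integral_ge0 => z _; rewrite lee_fin.
apply: (@le_lt_trans _ _ (\int[nu]_(z in `]0%R, +oo[) (lam%:E * `|z|%:E))).
  apply: ge0_le_integral => //.
  - by move=> z _; rewrite lee_fin.
  - by apply: measurable_funTS; exact/measurable_EFinP.
  - apply: measurable_funTS; apply: measurable_funeM; apply/measurable_EFinP.
    exact: normr_measurable.
  - move=> z _; rewrite -EFinM lee_fin.
    have := expR_ge1Dx (- (lam * `|z|)); lra.
rewrite ge0_integralZl_EFin//.
  by rewrite (mean_jump nu_mom1) -EFinM ltry.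
by apply: measurable_funTS; apply/measurable_EFinP; exact: normr_measurable.
Qed.

End laplace_exponent.

(** * One Euler step of the Laplace transform *)

Section laplace_step.
Local Open Scope ereal_scope.
Context d (T : measurableType d) (R : realType) (P : probability T R).
Local Notation leb := (@lebesgue_measure R).
Variable nu : {sigma_finite_measure set R -> \bar R}.
Variables (mu : T -> {measure set (R * R * R) -> \bar R}) (r c A B : R).
Variable Y : R -> {RV P >-> R}.
Hypothesis muP : poisson_random_measure P mu (jump_intensity nu).
Hypothesis nu_mom1 : \int[nu]_(z in `]0%R, +oo[) (z ^+ 1)%:E < +oo.
Hypotheses (r_gt0 : (0 < r)%R) (c_ge0 : (0 <= c)%R) (A_ge0 : (0 <= A)%R) (B_ge0 : (0 <= B)%R).
Hypothesis Ysol : inflow_solution mu r c A B Y.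
Local Notation M1 := (moment nu 1).

Let cY := inflow_cadlag Ysol.

Let mYv v : measurable_fun setT (Y v). Proof. exact: measurable_funPT. Qed.

Let mY : measurable_fun setT (fun p : T * R => Y p.2 p.1).
Proof. exact: (measurable_cadlag_process mYv cY). Qed.

Variables (Z : T -> \bar R) (h l lam : R).
Hypothesis mZ : measurable_fun setT (Z : g_sigma_algebraType (history P mu 0) -> \bar R).
Hypothesis Z0 : forall w, 0 <= Z w.
Hypothesis Zoo : \int[P]_w Z w < +oo.
Hypotheses (h_ge0 : (0 <= h)%R) (rh : (r * h <= 1)%R) (l_ge0 : (0 <= l)%R) (lam_gt0 : (0 < lam)%R).

Let mZT : measurable_fun setT Z. Proof. exact: history_measurableT mZ. Qed.

Let lvl (x : R) : R := (c * A + r * B * `|x|)%R.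

Let mlvl : measurable_fun setT lvl.
Proof.
by apply: measurable_funD => //; apply: measurable_funM => //; exact: normr_measurable.
Qed.

Let lvl0 x : (0 <= lvl x)%R.
Proof. by apply: addr_ge0; rewrite !mulr_ge0// ltW. Qed.

(** The part of e^(-lam Y_h) that comes from the explicit Euler step Y_0 -> (1 - r h) Y_0 of the
    decay. *)
Let euler_mean (w : T) : \bar R := (expR (- (lam * ((1 - r * h) * `|Y 0 w|))))%:E.

Let meuler : measurable_fun setT (euler_mean : g_sigma_algebraType (history P mu 0) -> \bar R).
Proof.
apply/measurable_EFinP; apply: measurableT_comp => //; apply: measurableT_comp => //.
do 2 apply: measurable_funM => //; apply: measurableT_comp => //.
exact: (inflow_measurable_history Ysol).
Qed.

Let euler_ge0 w : 0 <= euler_mean w. Proof. by rewrite lee_fin expR_ge0. Qed.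

Let box := level_region (0 : R)%R h (fun=> 0%R) (fun=> l).

(** With a constant level the jumps are those of a deterministic box after time 0, independent of
    [Z] and of [euler_mean], and the Laplace functional evaluates them exactly. *)
Let laplace_box :
  \int[P]_w (Z w * euler_mean w * (expR (- fine (\int[mu w]_(x in shot_region box) (lam * `|x.1.2|)%:E)))%:E) =
  \int[P]_w (Z w * euler_mean w) * (expR (- (h * l * laplace_exponent nu lam)))%:E.
Proof.
have boxE : box = `]0%R, h]%classic `*` `]0%R, l]%classic.
  by apply/seteqP; split => -[v x] [/= h1 h2]; split => //=; rewrite ?in_itv// in h1 h2 *.
have mbox : measurable (shot_region box).
  by apply: measurable_shot_region; rewrite boxE; exact: measurableX.
have me := meuler.
have mf : measurable_fun setT (fun x : R * R * R => lam * `|x.1.2|)%R.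
  by apply: measurable_funM => //; apply/measurable_EFinP; exact: measurable_jump_size.
have leb_itv (b : R) : (0 <= b)%R -> leb `]0%R, b]%classic = b%:E.
  move=> b0; rewrite lebesgue_measure_itv/= lte_fin; move: b0; rewrite le_eqVlt.
  by move=> /predU1P[<-|->]; rewrite ?ltxx ?oppr0 ?adde0.
have int_box (k : R -> \bar R) : measurable_fun setT k -> (forall z, 0 <= k z) ->
    \int[jump_intensity nu]_(x in shot_region box) k x.1.2 =
    (h * l)%:E * \int[nu]_(z in `]0%R, +oo[) k z.
  by move=> mk k0; rewrite boxE integral_jump_box// !leb_itv// -EFinM.
rewrite (@laplace_functional _ _ _ _ _ P mu (jump_intensity nu) muP (past 0)
  (shot_region box) (fun w => Z w * euler_mean w) (fun x => lam * `|x.1.2|)%R)//.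
- congr (_ * (expR (- _))%:E).
  rewrite (int_box (fun z => (1 - expR (- (lam * `|z|)))%:E)).
  + by rewrite (laplace_exponent_int nu_mom1) ?ltW// -EFinM.
  + apply/measurable_EFinP; apply: measurable_funB => //; apply: measurableT_comp => //.
    by apply: measurableT_comp => //; apply: measurable_funM => //; exact: normr_measurable.
  + by move=> z; rewrite lee_fin subr_ge0 -[leRHS]expR0 ler_expR oppr_le0 mulr_ge0// ltW.
- exact: emeasurable_funM.
- by move=> w; rewrite mule_ge0.
- apply: le_lt_trans Zoo; apply: ge0_le_integral => //.
  + by move=> w _; rewrite mule_ge0.
  + by apply: emeasurable_funM => //; exact: history_measurableT me.
  + move=> w _; rewrite -[leRHS]mule1 lee_wpmul2l// lee_fin -[leRHS]expR0 ler_expR oppr_le0.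
    by rewrite !mulr_ge0 ?subr_ge0// ltW.
- apply/seteqP; split => // x [/= x0 [[/= /andP[x1 _] _] _ _]].
  by move: (lt_le_trans x1 x0); rewrite ltxx.
- by move=> x; rewrite mulr_ge0// ltW.
- rewrite (int_box (fun z => (lam * `|z|)%:E)).
  + under eq_integral do rewrite EFinM.
    rewrite ge0_integralZl_EFin ?ltW//.
      by rewrite (mean_jump nu_mom1) -!EFinM ltry.
    by apply: measurable_funTS; apply/measurable_EFinP; exact: normr_measurable.
  + by apply/measurable_EFinP; apply: measurable_funM => //; exact: normr_measurable.
  + by move=> z; rewrite lee_fin mulr_ge0// ltW.
Qed.

Let dist (w : T) : R := (\int[leb]_(v in `[0, h]) `| `|Y v w| - `|Y 0 w| |)%R.

(** Two replacements are made on each path: int Y by h Y_0, at the price of [dist], and the moving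
    level by [l], at the price of the jumps in the gap region. The map x -> e^(-x) is 1-Lipschitz on
    x >= 0, so the prices pass to the exponentials. *)
Let path_step : exists g : T -> \bar R, [/\ measurable_fun setT g, forall w, 0 <= g w,
    \int[P]_w (Z w * g w) =
      M1%:E * \int[leb]_(v in `[0%R, h]) \int[P]_w (Z w * `|lvl (Y v w) - l|%:E) &
    {ae P, forall w, let e1 := expR (- (lam * `|Y h w|)) in
      let e2 := (expR (- (lam * ((1 - r * h) * `|Y 0 w|))) *
        expR (- fine (\int[mu w]_(x in shot_region box) (lam * `|x.1.2|)%:E)))%R in
      let err := (lam * r * dist w)%:E + lam%:E * g w in
      e1%:E <= e2%:E + err /\ e2%:E <= e1%:E + err}].
Proof.
pose ka x := Num.min (lvl x) l; pose kb x := Num.max (lvl x) l.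
have mka : measurable_fun setT ka by exact: measurable_minr.
have mkb : measurable_fun setT kb by exact: measurable_maxr.
have ka0 x : (0 <= ka x)%R by rewrite le_min lvl0.
have kab x : (ka x <= kb x)%R by rewrite ge_min le_max lexx.
have [g [mg g0 gE Eg]] := compensated_levels muP nu_mom1 Ysol h mZ Z0 Zoo mka mkb ka0 kab.
have kbaE x : (kb x - ka x = `|lvl x - l|)%R.
  rewrite /ka /kb; have [h1|h1] := leP (lvl x) l.
    by rewrite ler0_norm ?subr_le0// opprB.
  by rewrite gtr0_norm// subr_gt0.
have E : (fun v => \int[P]_w (Z w * (kb (Y v w) - ka (Y v w))%:E)) =
    (fun v => \int[P]_w (Z w * `|lvl (Y v w) - l|%:E)).
  by apply/funext => v; apply: eq_integral => w _; rewrite kbaE.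
rewrite E in Eg; exists g; split; [exact: mg|exact: g0|exact: Eg|].
apply: filterS3 gE (inflow_ge0 r_gt0 Ysol) (inflow_equation Ysol) => w gE Yw0 eqn.
have Y0n v : `|Y v w|%R = Y v w by rewrite ger0_norm.
have ll0 := left_lim_ge0 (cY w) Yw0.
have mll : measurable_fun setT (fun v => lvl (left_lim (fun v => Y v w) v)).
  by apply: measurableT_comp => //; exact: (measurable_left_lim (cY w)).
have nE : shot (mu w) (level_region 0%R h (fun=> 0%R) (fun v => lvl (left_lim (fun v => Y v w) v))) =
    (Y h w - Y 0 w + r * \int[leb]_(v in `[0, h]) Y v w)%:E.
  rewrite eqn//; congr (shot _ (level_region _ _ _ _)); apply/funext => v.
  by rewrite /lvl /jump_level ger0_norm.
have le1 : (Y h w - Y 0 w + r * \int[leb]_(v in `[0, h]) Y v w)%:E <= shot (mu w) box + g w.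
  by rewrite -nE gE; exact: (shot_le_gapl (shot (mu w)) h l mll).
have le2 : shot (mu w) box <= (Y h w - Y 0 w + r * \int[leb]_(v in `[0, h]) Y v w)%:E + g w.
  by rewrite -nE gE; exact: (shot_le_gapr (shot (mu w)) h l mll).
(* If the gap term is infinite, both bounds are trivial because lam > 0. *)
have := g0 w; case: (g w) le1 le2 => [x|_ _ _|//]; last first.
  by rewrite gt0_muley ?lte_fin// !addey ?leey.
rewrite lee_fin => le1 le2 x0.
have mD : measurable (shot_region box).
  by apply: measurable_shot_region; exact: measurable_level_region.
have SE : \int[mu w]_(x in shot_region box) (lam * `|x.1.2|)%:E = lam%:E * shot (mu w) box.
  under eq_integral do rewrite EFinM.
  by rewrite ge0_integralZl_EFin ?ltW//; apply: measurable_funTS; exact: measurable_jump_size.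
have S0 : 0 <= shot (mu w) box by exact: measure_ge0.
case: (shot (mu w) box) S0 SE le1 le2 => [s| |]; [|by move=> _ _ _; rewrite -EFinD leye_eq|by []].
rewrite !lee_fin => s0 SE le1 le2.
rewrite SE/= -expRD.
set I := (\int[leb]_(v in _) _)%R in le1 le2.
have iY : leb.-integrable `[0%R, h] (EFin \o (fun v => Y v w)) by exact: cadlag_integrable.
have [C YC] := cadlag_bounded 0%R h (cY w).
have mYw : measurable_fun setT (fun v => Y v w) by exact: measurable_cadlag.
have ic : leb.-integrable `[0%R, h] (EFin \o cst (Y 0 w)).
  by apply: (@bounded_integrable_itv _ _ _ _ `|Y 0 w|%R).
have dI : (`|I - h * Y 0 w| <= dist w)%R.
  have -> : (I - h * Y 0 w = \int[leb]_(v in `[0, h]) (Y v w - Y 0 w))%R.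
    by rewrite RintegralB// Rintegral_cst_itv// subr0 mulrC.
  rewrite /dist; apply: (le_trans (le_normr_Rintegral _ _)) => //.
    exact: (@integrableB _ _ _ leb _ (measurable_itv `[0%R, h]) _ _ iY ic).
  by rewrite le_eqVlt; apply/orP; left; apply/eqP; apply: eq_Rintegral => v _; rewrite !Y0n.
rewrite !Y0n.
have key : (`|lam * Y h w - (lam * ((1 - r * h) * Y 0 w) + lam * s)| <=
    lam * r * dist w + lam * x)%R.
  rewrite (_ : (_ - _)%R = (lam * ((Y h w - Y 0 w + r * I - s) - r * (I - h * Y 0 w)))%R); last by ring.
  rewrite normrM gtr0_norm// -mulrA -mulrDr ler_pM2l//.
  apply: (le_trans (ler_normB _ _)); rewrite addrC; apply: lerD.
    by rewrite normrM gtr0_norm// ler_pM2l.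
  by rewrite ler_norml; lra.
have rh0 : (0 <= 1 - r * h)%R by rewrite subr_ge0.
have a1 : (0 <= lam * Y h w)%R by rewrite mulr_ge0// ltW.
have a2 : (0 <= lam * ((1 - r * h) * Y 0 w) + lam * s)%R.
  by rewrite addr_ge0// !mulr_ge0// ltW.
rewrite -opprD; split.
  by apply: (le_trans (expRN_lipschitz (lam * ((1 - r * h) * Y 0 w) + lam * s)%R a1)); rewrite lerD2l; exact: key.
by apply: (le_trans (expRN_lipschitz (lam * Y h w)%R a2)); rewrite lerD2l distrC; exact: key.
Qed.

Lemma laplace_step :
  let U := \int[P]_w (Z w * (expR (- (lam * `|Y h w|)))%:E) in
  let V := \int[P]_w (Z w * euler_mean w) * (expR (- (h * l * laplace_exponent nu lam)))%:E in
  let err := (lam * r)%:E * \int[leb]_(v in `[0%R, h]) \int[P]_w (Z w * `| `|Y v w| - `|Y 0 w| |%:E) +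
    (lam * M1)%:E * \int[leb]_(v in `[0%R, h]) \int[P]_w (Z w * `|lvl (Y v w) - l|%:E) in
  U <= V + err /\ V <= U + err.
Proof.
move=> U V err.
have [g [mg g0 Eg Hg]] := path_step.
pose D w v : \bar R := Z w * `| `|Y v w| - `|Y 0 w| |%:E.
have D0 w v : 0 <= D w v by rewrite mule_ge0// lee_fin.
have mD : measurable_fun setT (fun p : T * R => D p.1 p.2).
  apply: emeasurable_funM; first exact: measurableT_comp.
  apply/measurable_EFinP; apply: measurableT_comp; first exact: normr_measurable.
  apply: measurable_funB; apply: measurableT_comp; do ?exact: normr_measurable.
    exact: mY.
  exact: (measurableT_comp (mYv 0%R) measurable_fst).
have [_ mdist Ed] := @tonelli_time _ _ _ P _ D (measurable_itv `[0%R, h]) mD D0.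
have distE w : \int[leb]_(v in `[0%R, h]) D w v = Z w * (dist w)%:E.
  have mYw : measurable_fun setT (fun v => `| `|Y v w| - `|Y 0 w| |%R).
    apply: measurableT_comp; first exact: normr_measurable.
    apply: measurable_funB => //; apply: measurableT_comp; first exact: normr_measurable.
    exact: measurable_cadlag.
  have [C YC] := cadlag_bounded 0%R h (cY w).
  rewrite (@ge0_integralZl _ _ _ leb _ (measurable_itv `[0%R, h]))//.
  - rewrite (@EFin_Rintegral _ _ (C + `|Y 0 w|)%R)// => v hv.
    rewrite normr_id; apply: (le_trans (ler_normB _ _)); rewrite !normr_id lerD2r.
    exact: YC.
  - by apply: measurable_funTS; exact/measurable_EFinP.
pose e2 w := (expR (- fine (\int[mu w]_(x in shot_region box) (lam * `|x.1.2|)%:E)))%R.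
have me2 : measurable_fun setT e2.
  apply: measurableT_comp => //; apply: measurableT_comp => //.
  apply: (measurableT_comp (@fine_measurable R setT measurableT)).
  apply: (campbell_measurable muP).
  - by apply: measurable_shot_region; exact: measurable_level_region.
  - apply/measurable_EFinP; apply: measurable_funM => //.
    by apply/measurable_EFinP; exact: measurable_jump_size.
  - by move=> x; rewrite lee_fin mulr_ge0// ltW.
have meuler' : measurable_fun setT euler_mean by exact: history_measurableT meuler.
pose f1 w := Z w * (expR (- (lam * `|Y h w|)))%:E.
pose f2 w := Z w * euler_mean w * (e2 w)%:E.
pose f3 w := (lam * r)%:E * (\int[leb]_(v in `[0%R, h]) D w v) + lam%:E * (Z w * g w).
have f10 w : 0 <= f1 w by rewrite mule_ge0// lee_fin expR_ge0.
have f20 w : 0 <= f2 w by rewrite !mule_ge0// lee_fin expR_ge0.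
have lr0 : (0 <= lam * r)%R by rewrite mulr_ge0// ltW.
have ID0 w : 0 <= \int[leb]_(v in `[0%R, h]) D w v by exact: integral_ge0.
have f30 w : 0 <= f3 w.
  by rewrite adde_ge0// mule_ge0// ?lee_fin ?(ltW lam_gt0)// mule_ge0.
have mf1 : measurable_fun setT f1.
  apply: emeasurable_funM => //; apply/measurable_EFinP; apply: measurableT_comp => //.
  by apply: measurableT_comp => //; apply: measurable_funM => //; exact: measurableT_comp.
have mf2 : measurable_fun setT f2.
  by apply: emeasurable_funM; [exact: emeasurable_funM|exact/measurable_EFinP].
have mf3 : measurable_fun setT f3.
  apply: emeasurable_funD; first exact: measurable_funeM.
  by apply: measurable_funeM; exact: emeasurable_funM.
have VE : V = \int[P]_w f2 w by rewrite /V -laplace_box.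
have errE : err = \int[P]_w f3 w.
  have p1 w : setT w -> 0 <= (lam * r)%:E * \int[leb]_(v in `[0%R, h]) D w v.
    by move=> _; rewrite mule_ge0// lee_fin.
  have p2 w : setT w -> 0 <= lam%:E * (Z w * g w).
    by move=> _; rewrite !mule_ge0// lee_fin ltW.
  have mZg : measurable_fun setT (fun w => Z w * g w) by exact: emeasurable_funM.
  rewrite /err -Ed /f3 (ge0_integralD P measurableT p1 (measurable_funeM _ mdist) p2
    (measurable_funeM _ mZg)).
  rewrite (ge0_integralZl_EFin P measurableT (fun w _ => ID0 w) mdist lr0).
  rewrite (ge0_integralZl_EFin P measurableT (fun w _ => mule_ge0 (Z0 w) (g0 w)) mZg (ltW lam_gt0)).
  by rewrite Eg muleA EFinM.
have Zerr w : Z w * ((lam * r * dist w)%:E + lam%:E * g w) = f3 w.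
  rewrite /f3 distE ge0_muleDr ?lee_fin.
  - by rewrite EFinM muleCA; congr (_ + _); exact: muleCA.
  - by rewrite mulr_ge0//; apply: Rintegral_ge0.
  - by rewrite mule_ge0// lee_fin ltW.
have err0 w : 0 <= (lam * r * dist w)%:E + lam%:E * g w.
  rewrite adde_ge0//; first by rewrite lee_fin mulr_ge0//; apply: Rintegral_ge0.
  by rewrite mule_ge0// lee_fin ltW.
have le_int (p q : T -> \bar R) : (forall w, 0 <= p w) -> (forall w, 0 <= q w) ->
    measurable_fun setT p -> measurable_fun setT q ->
    {ae P, forall w, p w <= q w + f3 w} ->
    \int[P]_w p w <= \int[P]_w q w + \int[P]_w f3 w.
  move=> p0 q0 mp mq pq; rewrite -ge0_integralD//.
  apply: ae_ge0_le_integral => //.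
  - by move=> w _; rewrite adde_ge0.
  - exact: emeasurable_funD.
  - by apply: filterS pq => w.
rewrite VE errE; split; apply: le_int => //; apply: filterS Hg => w /= [h1 h2].
- rewrite -Zerr /f1 /f2 -muleA -ge0_muleDr// ?mule_ge0 ?lee_fin ?expR_ge0//.
  by rewrite lee_wpmul2l// -EFinM.
- rewrite -Zerr /f1 /f2 -muleA -ge0_muleDr// ?mule_ge0 ?lee_fin ?expR_ge0//.
  by rewrite lee_wpmul2l// -EFinM.
Qed.

End laplace_step.

(** * Comparison of integrals along a countable partition *)

Section partition_comparison.
Local Open Scope ereal_scope.
Context d (T : measurableType d) (R : realType) (P : probability T R).

Lemma le_integral_partition (E : nat -> set T) (p q : T -> \bar R) :
  (forall k, measurable (E k)) -> trivIset setT E -> \bigcup_k E k = setT ->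
  measurable_fun setT p -> measurable_fun setT q ->
  (forall w, 0 <= p w) -> (forall w, 0 <= q w) ->
  (forall k, \int[P]_w ((\1_(E k) w)%:E * p w) <= \int[P]_w ((\1_(E k) w)%:E * q w)) ->
  \int[P]_w p w <= \int[P]_w q w.
Proof.
move=> mE tE UE mp mq p0 q0 H.
have split (f : T -> \bar R) : measurable_fun setT f -> (forall w, 0 <= f w) ->
    \int[P]_w f w = \sum_(k <oo) \int[P]_w ((\1_(E k) w)%:E * f w).
  move=> mf f0; rewrite -{1}UE ge0_integral_bigcup//; last by rewrite UE.
  apply: eq_eseriesr => k _; rewrite integral_mkcond; apply: eq_integral => w _.
  by rewrite epatch_indic muleC.
rewrite !split//; apply: lee_nneseries => [k *|k *]; last exact: H.
by apply: integral_ge0 => w _; rewrite mule_ge0// lee_fin.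
Qed.

End partition_comparison.

(** * Quadratic error of the Euler step *)

Section euler_error.
Local Open Scope ereal_scope.
Context d (T : measurableType d) (R : realType) (P : probability T R).
Local Notation leb := (@lebesgue_measure R).
Variable nu : {sigma_finite_measure set R -> \bar R}.
Variables (mu : T -> {measure set (R * R * R) -> \bar R}) (r c A B : R).
Variable Y : R -> {RV P >-> R}.
Hypothesis muP : poisson_random_measure P mu (jump_intensity nu).
Hypothesis nu_mom1 : \int[nu]_(z in `]0%R, +oo[) (z ^+ 1)%:E < +oo.
Hypotheses (r_gt0 : (0 < r)%R) (c_ge0 : (0 <= c)%R) (A_ge0 : (0 <= A)%R) (B_ge0 : (0 <= B)%R).
Hypothesis Ysol : inflow_solution mu r c A B Y.
Hypothesis BM : (B * moment nu 1 < 1)%R.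
Local Notation M1 := (moment nu 1).

Let m : R := (c * A * M1 / (r * (1 - B * M1)))%R.

Let cY := inflow_cadlag Ysol.

Let mYv v : measurable_fun setT (Y v). Proof. exact: measurable_funPT. Qed.

Let mnY v : measurable_fun setT (fun w => `|Y v w|%R).
Proof. by apply: measurableT_comp => //; exact: normr_measurable. Qed.

Let mY : measurable_fun setT (fun p : T * R => Y p.2 p.1).
Proof. exact: (measurable_cadlag_process mYv cY). Qed.

Let mean v : \int[P]_w `|Y v w|%:E = m%:E.
Proof. exact: (inflow_mean muP nu_mom1 r_gt0 c_ge0 A_ge0 B_ge0 Ysol BM). Qed.

Let M1_ge0 : (0 <= M1)%R. Proof. exact: moment1_ge0. Qed.

Let m_ge0 : (0 <= m)%R.
Proof. by rewrite -lee_fin -(mean 0%R); apply: integral_ge0 => w _; rewrite lee_fin. Qed.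

(** Mean inflow against mean decay in equilibrium, the equation that determines [m]. *)
Let mean_balance : (M1 * (c * A + r * B * m) = r * m)%R.
Proof.
have D0 : (0 < 1 - B * M1)%R by rewrite subr_gt0.
by rewrite /m; field; rewrite !gt_eqF.
Qed.

Let I1 : \int[P]_w cst 1 w = 1 :> \bar R.
Proof. by rewrite integral_cst// mul1e; exact: probability_setT. Qed.

Let Icst (k : R) : \int[P]_w k%:E = k%:E.
Proof.
rewrite integral_cst//; transitivity (k%:E * 1); last by rewrite mule1.
by congr (_ * _); exact: probability_setT.
Qed.

(** The increment is jumps minus decay, both nonnegative. Each has mean r m v, the jumps by
    [mean_balance], whence the factor 2. *)
Lemma inflow_increment v : (0 <= v)%R ->
  \int[P]_w `| `|Y v w| - `|Y 0 w| |%:E <= (2 * r * m * v)%:E.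
Proof.
move=> v0; pose lvl (x : R) : R := (c * A + r * B * `|x|)%R.
have mlvl : measurable_fun setT lvl.
  by apply: measurable_funD => //; apply: measurable_funM => //; exact: normr_measurable.
have lvl0 x : (0 <= lvl x)%R by apply: addr_ge0; rewrite !mulr_ge0// ltW.
have oo1 : \int[P]_w cst 1 w < +oo :> \bar R by rewrite I1 ltry.
have m1 : measurable_fun setT (cst 1 : g_sigma_algebraType (history P mu 0%R) -> \bar R).
  exact: measurable_cst.
have [g [mg g0 gE Eg]] := compensated_level muP nu_mom1 Ysol v m1 (fun=> lee01) oo1 mlvl lvl0.
have leb_v (k : R) : \int[leb]_(u in `[0%R, v]) k%:E = (k * v)%:E.
  rewrite (@EFin_Rintegral _ (cst k) `|k|%R)//.
  by rewrite Rintegral_cst_itv// subr0.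
have Ig : \int[P]_w g w = (r * m * v)%:E.
  transitivity (\int[P]_w (cst 1 w * g w)); first by apply: eq_integral => w _; rewrite mul1e.
  rewrite Eg (_ : (fun u => _) = (fun=> (c * A + r * B * m)%:E)).
    by rewrite leb_v -EFinM mulrA mean_balance.
  apply/funext => u.
  transitivity (\int[P]_w ((c * A)%:E + (r * B)%:E * `|Y u w|%:E)).
    by apply: eq_integral => w _; rewrite mul1e.
  have p1 (w : T) : setT w -> 0 <= (c * A)%:E by rewrite lee_fin mulr_ge0.
  have p2 w : setT w -> 0 <= (r * B)%:E * `|Y u w|%:E.
    by rewrite mule_ge0// lee_fin mulr_ge0// ltW.
  have mE : measurable_fun setT (fun w => `|Y u w|%:E) by exact/measurable_EFinP.
  rewrite (@ge0_integralD _ _ _ P _ measurableT _ _ p1 (@measurable_cst _ _ _ _ _ _) p2 (measurable_funeM _ mE)).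
  rewrite Icst ge0_integralZl_EFin//; last by rewrite mulr_ge0// ltW.
  by rewrite mean -EFinM -EFinD.
have mYn : measurable_fun setT (fun x : T * R => `|Y x.2 x.1|%:E).
  by apply/measurable_EFinP; apply: (measurableT_comp _ mY); exact: normr_measurable.
have [|_ mI EI] := @tonelli_time _ _ _ P _ (fun w u => `|Y u w|%:E) (measurable_itv `[0%R, v]) mYn.
  by move=> w u; rewrite lee_fin.
have I0 w : 0 <= \int[leb]_(u in `[0%R, v]) `|Y u w|%:E.
  by apply: integral_ge0 => u _; rewrite lee_fin.
have IE : \int[P]_w \int[leb]_(u in `[0%R, v]) `|Y u w|%:E = (m * v)%:E.
  by rewrite EI (_ : (fun u => _) = (fun=> m%:E)) ?leb_v//; apply/funext => u; exact: mean.
apply: (@le_trans _ _ (\int[P]_w (r%:E * \int[leb]_(u in `[0%R, v]) `|Y u w|%:E + g w))); last first.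
  have r0 : (0 <= r)%R by exact: ltW.
  have p1 w : setT w -> 0 <= r%:E * \int[leb]_(u in `[0%R, v]) `|Y u w|%:E.
    by move=> _; rewrite mule_ge0.
  rewrite (@ge0_integralD _ _ _ P _ measurableT _ _ p1 (measurable_funeM _ mI) (fun w _ => g0 w) mg).
  rewrite Ig (ge0_integralZl_EFin P measurableT (fun w _ => I0 w) mI r0) IE -EFinM -EFinD lee_fin.
  by rewrite le_eqVlt; apply/orP; left; apply/eqP; ring.
apply: ae_ge0_le_integral => //.
- apply/measurable_EFinP; apply: measurableT_comp; first exact: normr_measurable.
  exact: measurable_funB.
- by move=> w _; rewrite adde_ge0// mule_ge0// lee_fin ltW.
- by apply: emeasurable_funD => //; exact: measurable_funeM.
apply: filterS3 gE (inflow_ge0 r_gt0 Ysol) (inflow_equation Ysol) => w gE Yw0 eqn _.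
have ll0 := left_lim_ge0 (cY w) Yw0.
have gE' : g w = (Y v w - Y 0 w + r * \int[leb]_(u in `[0, v]) Y u w)%:E.
  rewrite gE eqn//; congr (shot _ (level_region _ _ _ _)); apply/funext => u.
  by rewrite /lvl /jump_level ger0_norm.
have [C YC] := cadlag_bounded 0%R v (cY w).
have -> : \int[leb]_(u in `[0%R, v]) `|Y u w|%:E = (\int[leb]_(u in `[0, v]) Y u w)%:E.
  rewrite -(EFin_Rintegral (measurable_cadlag (cY w)) YC).
  by apply: eq_integral => u _; rewrite ger0_norm.
have := g0 w; rewrite gE' -EFinM -EFinD !lee_fin (ger0_norm (Yw0 v)) (ger0_norm (Yw0 0%R)).
have : (0 <= \int[leb]_(u in `[0, v]) Y u w)%R by apply: Rintegral_ge0.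
set I := (\int[leb]_(u in _) _)%R => I00 n0.
have rI : (0 <= r * I)%R by rewrite mulr_ge0// ltW.
by rewrite ler_norml; lra.
Qed.

Variables (h lam : R).
Hypotheses (h_gt0 : (0 < h)%R) (rh : (r * h <= 1)%R) (lam_gt0 : (0 < lam)%R).

Local Notation psi := (laplace_exponent nu lam).

Let cell (k : nat) : set T := [set w | Num.truncn (`|Y 0 w| / h) = k].

Definition euler_level (x : R) : R := (c * A + r * B * (h * (Num.truncn (x / h))%:R))%R.

Let cell_int k : cell k = (fun w => `|Y 0 w|%R) @^-1` `[(h * k%:R)%R, (h * k.+1%:R)%R[%classic.
Proof.
apply/seteqP; split => w /=; rewrite in_itv/= mulrC -ler_pdivlMr// (mulrC h) -ltr_pdivrMr//.
  by move=> <-; exact: truncn_itv (divr_ge0 (normr_ge0 _) (ltW h_gt0)).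
by move=> kx; rewrite /cell/=; apply: truncn_def.
Qed.

Let mcell_history k : (measurable : set (set (g_sigma_algebraType (history P mu 0)))) (cell k).
Proof.
rewrite cell_int -[X in measurable X]setTI.
apply: (measurableT_comp (@normr_measurable R setT) (@inflow_measurable_history _ _ _ _ _ _ _ _ _ _ Ysol 0%R)) => //.
Qed.

Let mcell k : measurable (cell k).
Proof. by rewrite cell_int -[X in measurable X]setTI; apply: mnY => //; exact: measurable_itv. Qed.

(** Increment plus cell width: a common bound for the error in the decay and, up to the factor r B,
    for the error in the level. *)
Let D (w : T) (v : R) : \bar R := (`| `|Y v w| - `|Y 0 w| | + h)%:E.

Let D0 w v : 0 <= D w v. Proof. by rewrite lee_fin addr_ge0// ltW. Qed.

Let mD : measurable_fun setT (fun p : T * R => D p.1 p.2).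
Proof.
apply/measurable_EFinP; apply: measurable_funD => //.
apply: measurableT_comp; first exact: normr_measurable.
apply: measurable_funB; apply: measurableT_comp; do ?exact: normr_measurable.
  exact: mY.
exact: (measurableT_comp (mYv 0%R) measurable_fst).
Qed.

Let G w := \int[leb]_(v in `[0%R, h]) D w v.

Let G0 w : 0 <= G w. Proof. exact: integral_ge0. Qed.

Let mG : measurable_fun setT G.
Proof. by have [] := tonelli_time P (measurable_itv `[0%R, h]) mD D0. Qed.

(** The mean increment is at most 2 r m h and the cell width is h; integration over a time interval
    of length h produces the square. *)
Let IG : \int[P]_w G w <= ((2 * r * m + 1) * h ^+ 2)%:E.
Proof.
have [m1 _ ->] := tonelli_time P (measurable_itv `[0%R, h]) mD D0.
have dm v : measurable_fun setT (fun w => `| `|Y v w| - `|Y 0 w| |%:E).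
  apply/measurable_EFinP; apply: measurableT_comp; first exact: normr_measurable.
  exact: measurable_funB.
have bd v : (0 <= v <= h)%R -> \int[P]_w D w v <= ((2 * r * m + 1) * h)%:E.
  move=> /andP[v0 vh].
  rewrite (_ : (fun w => D w v) = (fun w => `| `|Y v w| - `|Y 0 w| |%:E + h%:E))//.
  have p1 (w : T) : setT w -> 0 <= `| `|Y v w| - `|Y 0 w| |%:E by rewrite lee_fin.
  have p2 (w : T) : setT w -> 0 <= h%:E by rewrite lee_fin ltW.
  rewrite (@ge0_integralD _ _ _ P _ measurableT _ _ p1 (dm v) p2 (@measurable_cst _ _ _ _ _ _)).
  rewrite Icst mulrDl mul1r EFinD leeD2r//.
  apply: (le_trans (inflow_increment v0)); by rewrite lee_fin ler_wpM2l// mulr_ge0// mulr_ge0// ltW.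
apply: (@le_trans _ _ (\int[leb]_(v in `[0%R, h]) ((2 * r * m + 1) * h)%:E)).
  apply: ge0_le_integral => //.
  - by move=> v _; apply: integral_ge0 => w _; exact: D0.
  - exact: measurable_funTS.
rewrite (@EFin_Rintegral _ (cst ((2 * r * m + 1) * h)%R) `|(2 * r * m + 1) * h|%R)//.
by rewrite (Rintegral_cst_itv _ (ltW h_gt0)) subr0 lee_fin expr2 mulrA.
Qed.

Let p (w : T) : \bar R := (expR (- (lam * `|Y h w|)))%:E.

Let q (w : T) : \bar R :=
  (expR (- (lam * ((1 - r * h) * `|Y 0 w|) + h * euler_level `|Y 0 w| * psi)))%:E.

(** [lam * r] pays for the decay and [lam * M1 * (r * B)] for the jumps in the gap between the
    levels. *)
Let K : R := (lam * (r + M1 * (r * B)))%R.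

Let K_ge0 : (0 <= K)%R.
Proof. by rewrite mulr_ge0 ?(ltW lam_gt0)// addr_ge0 ?(ltW r_gt0)// !mulr_ge0// ltW. Qed.

Let mp : measurable_fun setT p.
Proof.
apply/measurable_EFinP; apply: measurableT_comp => //; apply: measurableT_comp => //.
exact: measurable_funM.
Qed.

Lemma measurable_euler_level : measurable_fun setT (fun w => euler_level `|Y 0 w|%R).
Proof.
move=> _ S mS; rewrite setTI.
rewrite (_ : _ @^-1` _ = \bigcup_k (cell k `&` [set w | S (c * A + r * B * (h * k%:R))%R])).
  apply: bigcupT_measurable => k; apply: measurableI => //.
  case: (pselect (S (c * A + r * B * (h * k%:R))%R)) => H.
    by rewrite (_ : [set _ | _] = setT)//; apply/seteqP; split.
  by rewrite (_ : [set _ | _] = set0)//; apply/seteqP; split.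
apply/seteqP; split => w /=; last by move=> [k _ [/= <-]].
by move=> Sw; exists (Num.truncn (`|Y 0 w| / h)%R).
Qed.

Let mlevel := measurable_euler_level.

Let mq : measurable_fun setT q.
Proof.
apply/measurable_EFinP; apply: measurableT_comp => //; apply: measurableT_comp => //.
apply: measurable_funD; first by apply: measurable_funM => //; exact: measurable_funM.
by apply: measurable_funM => //; exact: measurable_funM.
Qed.

(** The indicator of a cell is known at time 0, so it may serve as the weight in [laplace_step],
    with the level at the lower end of the cell. *)
Let cell_error k : let Z w : \bar R := (\1_(cell k) w)%:E in
  \int[P]_w (Z w * p w) <= \int[P]_w (Z w * (q w + K%:E * G w)) /\
  \int[P]_w (Z w * q w) <= \int[P]_w (Z w * (p w + K%:E * G w)).
Proof.
move=> Z.
have mZ : measurable_fun setT (Z : g_sigma_algebraType (history P mu 0) -> \bar R).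
  by apply/measurable_EFinP; apply: measurable_indic; exact: mcell_history.
have mZT : measurable_fun setT Z by exact: history_measurableT mZ.
have Z0 w : 0 <= Z w by rewrite lee_fin.
have Zoo : \int[P]_w Z w < +oo.
  apply: (@le_lt_trans _ _ (\int[P]_w cst 1 w)); last by rewrite I1 ltry.
  apply: ge0_le_integral => // w _; rewrite /Z indicE lee_fin; by case: (_ \in _).
pose l : R := (c * A + r * B * (h * k%:R))%R.
have l0 : (0 <= l)%R by rewrite addr_ge0// !mulr_ge0// ltW.
have Zcell (f1 f2 : T -> \bar R) : (forall w, cell k w -> f1 w = f2 w) ->
    forall w, Z w * f1 w = Z w * f2 w.
  move=> f12 w; rewrite /Z indicE; case: (boolP (w \in cell k)) => [|_]; last by rewrite !mul0e.
  by rewrite inE => /f12 ->.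
pose dv v : \bar R := \int[P]_w (Z w * `| `|Y v w| - `|Y 0 w| |%:E).
pose lv v : \bar R := \int[P]_w (Z w * `|c * A + r * B * `|Y v w| - l|%:E).
pose V := \int[P]_w (Z w * (expR (- (lam * ((1 - r * h) * `|Y 0 w|))))%:E) *
  (expR (- (h * l * psi)))%:E.
pose err := (lam * r)%:E * (\int[leb]_(v in `[0%R, h]) dv v) +
  (lam * M1)%:E * (\int[leb]_(v in `[0%R, h]) lv v).
have [hU hV] : \int[P]_w (Z w * p w) <= V + err /\ V <= \int[P]_w (Z w * p w) + err :=
  laplace_step muP nu_mom1 r_gt0 c_ge0 A_ge0 B_ge0 Ysol mZ Z0 Zoo (ltW h_gt0) rh l0 lam_gt0.
have mKG : measurable_fun setT (fun w => K%:E * G w) by exact: measurable_funeM.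
have KG0 w : 0 <= K%:E * G w by rewrite mule_ge0.
have VE : V = \int[P]_w (Z w * q w).
  rewrite /V -ge0_integralZr//.
  - apply: eq_integral => w _; rewrite -muleA; move: w; apply: Zcell => w kw.
    by rewrite -EFinM -expRD -opprD /q /euler_level kw.
  - apply: emeasurable_funM => //; apply/measurable_EFinP; apply: measurableT_comp => //.
    by apply: measurableT_comp => //; apply: measurable_funM => //; exact: measurable_funM.
  - by move=> w _; rewrite mule_ge0.
have mZD : measurable_fun setT (fun x : T * R => Z x.1 * D x.1 x.2).
  by apply: emeasurable_funM => //; exact: measurableT_comp.
have ZD0 w v : 0 <= Z w * D w v by rewrite mule_ge0.
have [mIE _ IE] := @tonelli_time _ _ _ P _ (fun w v => Z w * D w v) (measurable_itv `[0%R, h]) mZD ZD0.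
pose J := \int[leb]_(v in `[0%R, h]) \int[P]_w (Z w * D w v).
have JE : J = \int[P]_w (Z w * G w).
  rewrite /J -IE; apply: eq_integral => w _.
  rewrite (@ge0_integralZl _ _ _ leb _ (measurable_itv `[0%R, h]))//.
  exact: (measurable_funTS (measurableT_comp mD (measurable_pair1 w))).
have mX v (f : R -> R) : measurable_fun setT f -> measurable_fun setT (fun w => Z w * (f (Y v w))%:E).
  by move=> mf; apply: emeasurable_funM => //; apply/measurable_EFinP; exact: measurableT_comp.
have mdiff v : measurable_fun setT (fun w => Z w * `| `|Y v w| - `|Y 0 w| |%:E).
  apply: emeasurable_funM => //; apply/measurable_EFinP.
  by apply: measurableT_comp; [exact: normr_measurable|exact: measurable_funB].
have mZDv v : measurable_fun setT (fun w => Z w * D w v).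
  exact: (measurableT_comp mZD (measurable_pair2 v)).
(* On the cell, [l] differs from the level at Y_0 by at most r B h, and the level at Y_v differs
   from that by r B times the increment. *)
have lvle v : lv v <= (r * B)%:E * \int[P]_w (Z w * D w v).
  have rB : (0 <= r * B)%R by rewrite mulr_ge0// ltW.
  rewrite -ge0_integralZl_EFin//.
  apply: ge0_le_integral => //.
  - by move=> w _; rewrite mule_ge0// lee_fin.
  - apply: (mX v (fun x => `|c * A + r * B * `|x| - l|%R)); apply: measurableT_comp; first exact: normr_measurable.
    apply: measurable_funB => //; apply: measurable_funD => //.
    by apply: measurable_funM => //; exact: normr_measurable.
  - exact: measurable_funeM.
  - move=> w _; rewrite muleCA /Z indicE; case: (boolP (w \in cell k)); last by rewrite !mul0e.
    rewrite cell_int inE/= in_itv/= => /andP[w1 w2]; rewrite !mul1e lee_fin.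
    rewrite /l opprD addrACA subrr add0r -mulrBr normrM (ger0_norm rB) ler_wpM2l//.
    apply: (le_trans (ler_distD `|Y 0 w|%R _ _)); rewrite lerD2l.
    by rewrite ger0_norm ?subr_ge0//; move: w2; rewrite -natr1 mulrDr mulr1; lra.
have mdv : measurable_fun setT dv.
  have mZd : measurable_fun setT (fun x : T * R => Z x.1 * `| `|Y x.2 x.1| - `|Y 0 x.1| |%:E).
    apply: emeasurable_funM; first exact: measurableT_comp.
    apply/measurable_EFinP; apply: measurableT_comp; first exact: normr_measurable.
    apply: measurable_funB; apply: measurableT_comp; do ?exact: normr_measurable.
      exact: mY.
    exact: (measurableT_comp (mYv 0%R) measurable_fst).
  have [] // := @tonelli_time _ _ _ P _ (fun w v => Z w * `| `|Y v w| - `|Y 0 w| |%:E)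
    (measurable_itv `[0%R, h]) mZd.
  by move=> w v; rewrite mule_ge0.
have mlv : measurable_fun setT lv.
  have mZd : measurable_fun setT (fun x : T * R => Z x.1 * `|c * A + r * B * `|Y x.2 x.1| - l|%:E).
    apply: emeasurable_funM; first exact: measurableT_comp.
    apply/measurable_EFinP; apply: measurableT_comp; first exact: normr_measurable.
    apply: measurable_funB => //; apply: measurable_funD => //; apply: measurable_funM => //.
    by apply: measurableT_comp; [exact: normr_measurable|exact: mY].
  have [] // := @tonelli_time _ _ _ P _ (fun w v => Z w * `|c * A + r * B * `|Y v w| - l|%:E)
    (measurable_itv `[0%R, h]) mZd.
  by move=> w v; rewrite mule_ge0.
have dv0 v : 0 <= dv v by apply: integral_ge0 => w _; rewrite mule_ge0.
have lv0 v : 0 <= lv v by apply: integral_ge0 => w _; rewrite mule_ge0.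
have I0 v : 0 <= \int[P]_w (Z w * D w v) by exact: integral_ge0.
have lam_ge0 := ltW lam_gt0; have r_ge0 := ltW r_gt0.
have errle : err <= K%:E * J.
  have -> : K%:E * J = (lam * r)%:E * J + (lam * M1)%:E * ((r * B)%:E * J).
    rewrite muleA -EFinM -ge0_muleDl ?lee_fin ?mulr_ge0// -EFinD; congr (_%:E * _).
    by rewrite /K; ring.
  apply: leeD; rewrite lee_wpmul2l ?lee_fin ?mulr_ge0//.
    apply: ge0_le_integral => //.
    - exact: measurable_funTS.
    - exact: measurable_funTS.
    - move=> v _; apply: ge0_le_integral => //.
      + by move=> w _; rewrite mule_ge0.
      + by move=> w _; rewrite lee_wpmul2l// lee_fin lerDl ltW.
  rewrite /J -(@ge0_integralZl_EFin _ _ _ leb _ (measurable_itv `[0%R, h]))//; last 2 first.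
  - exact: measurable_funTS.
  - by rewrite mulr_ge0.
  apply: ge0_le_integral => //.
  - exact: measurable_funTS.
  - by apply: measurable_funTS; exact: measurable_funeM.
have final (f1 f2 : T -> \bar R) : measurable_fun setT f2 -> (forall w, 0 <= f2 w) ->
    \int[P]_w (Z w * f1 w) <= \int[P]_w (Z w * f2 w) + err ->
    \int[P]_w (Z w * f1 w) <= \int[P]_w (Z w * (f2 w + K%:E * G w)).
  move=> mf2 f20 /le_trans; apply.
  rewrite [leRHS](_ : _ = \int[P]_w (Z w * f2 w + K%:E * (Z w * G w))); last first.
    by apply: eq_integral => w _; rewrite ge0_muleDr// [in RHS]muleCA.
  have p1 w : setT w -> 0 <= Z w * f2 w by rewrite mule_ge0.
  have p2 w : setT w -> 0 <= K%:E * (Z w * G w) by rewrite !mule_ge0.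
  have m1 : measurable_fun setT (fun w => Z w * f2 w) by exact: emeasurable_funM.
  have m2 : measurable_fun setT (fun w => Z w * G w) by exact: emeasurable_funM.
  rewrite (ge0_integralD P measurableT p1 m1 p2 (measurable_funeM _ m2)) leeD2l//.
  rewrite (ge0_integralZl_EFin P measurableT (fun w _ => mule_ge0 (Z0 w) (G0 w)) m2 K_ge0).
  by rewrite -JE.
rewrite VE in hU hV; split.
- by apply: final => // w; rewrite lee_fin expR_ge0.
- by apply: final => // w; rewrite lee_fin expR_ge0.
Qed.

(** The errors of the cells add up to [K] times the integral of [G], and stationarity replaces Y_h
    by Y_0 in the exact transform. Both sides then depend on Y_0 alone. *)
Lemma euler_error :
  (`| (\int[P]_w expR (- (lam * `|Y 0 w|))) -
     (\int[P]_w expR (- (lam * ((1 - r * h) * `|Y 0 w|) + h * euler_level `|Y 0 w| * psi))) | <=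
  K * ((2 * r * m + 1) * h ^+ 2))%R.
Proof.
have p0 w : 0 <= p w by rewrite lee_fin expR_ge0.
have q0 w : 0 <= q w by rewrite lee_fin expR_ge0.
have psi0 : (0 <= psi)%R.
  apply: Rintegral_ge0 => z /=; rewrite in_itv/= andbT => z0.
  by rewrite subr_ge0 -[leRHS]expR0 ler_expR oppr_le0 mulr_ge0// ltW.
have mKG : measurable_fun setT (fun w => K%:E * G w) by exact: measurable_funeM.
have KG0 w : 0 <= K%:E * G w by rewrite mule_ge0.
have tr : trivIset setT cell by move=> i j _ _ [w [/= <- <-]].
have U : \bigcup_k cell k = setT.
  by apply/seteqP; split => // w _; exists (Num.truncn (`|Y 0 w| / h)%R).
have bound (f1 f2 : T -> \bar R) : measurable_fun setT f1 -> measurable_fun setT f2 ->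
    (forall w, 0 <= f1 w) -> (forall w, 0 <= f2 w) ->
    (forall k, \int[P]_w ((\1_(cell k) w)%:E * f1 w) <=
               \int[P]_w ((\1_(cell k) w)%:E * (f2 w + K%:E * G w))) ->
    \int[P]_w f1 w <= \int[P]_w f2 w + (K * ((2 * r * m + 1) * h ^+ 2))%:E.
  move=> mf1 mf2 f10 f20 H.
  have f20' w : 0 <= f2 w + K%:E * G w by rewrite adde_ge0.
  apply: (le_trans (le_integral_partition mcell tr U mf1 (emeasurable_funD mf2 mKG) f10 f20' H)).
  rewrite (ge0_integralD P measurableT (fun w _ => f20 w) mf2 (fun w _ => KG0 w) mKG) leeD2l//.
  rewrite (ge0_integralZl_EFin P measurableT (fun w _ => G0 w) mG K_ge0) [leRHS]EFinM.
  by apply: lee_wpmul2l; [rewrite lee_fin|exact: IG].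
have le1 (f : T -> R) : (forall w, 0 <= f w)%R -> measurable_fun setT f ->
    (\int[P]_w expR (- f w))%R%:E = \int[P]_w (expR (- f w))%:E.
  move=> f0 mf; rewrite /Rintegral fineK// ge0_fin_numE; last first.
    by apply: integral_ge0 => w _; rewrite lee_fin expR_ge0.
  apply: (@le_lt_trans _ _ (\int[P]_w cst 1 w)); last by rewrite I1 ltry.
  apply: ge0_le_integral => //.
  - by apply/measurable_EFinP; do 2 apply: measurableT_comp => //.
  - by move=> w _; rewrite lee_fin -[leRHS]expR0 ler_expR oppr_le0.
have rh0 : (0 <= 1 - r * h)%R by rewrite subr_ge0.
have lam_ge0 := ltW lam_gt0; have r_ge0 := ltW r_gt0; have h_ge0 := ltW h_gt0.
have e1 : (\int[P]_w expR (- (lam * `|Y 0 w|)))%R%:E = \int[P]_w p w.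
  rewrite le1; last 2 first.
  - by move=> w; rewrite mulr_ge0.
  - exact: measurable_funM.
  have st : stationary_process Y by case: Ysol.
  apply/esym; apply: (stationary_mean st (f := fun x => (expR (- (lam * `|x|)))%:E)).
    apply/measurable_EFinP; apply: measurableT_comp => //; apply: measurableT_comp => //.
    by apply: measurable_funM => //; exact: normr_measurable.
  by move=> x; rewrite lee_fin expR_ge0.
have e2 : (\int[P]_w expR (- (lam * ((1 - r * h) * `|Y 0 w|) + h * euler_level `|Y 0 w| * psi)))%R%:E =
    \int[P]_w q w.
  rewrite le1//.
  - by move=> w; rewrite addr_ge0 ?mulr_ge0// /euler_level addr_ge0 ?mulr_ge0.
  - apply: measurable_funD; first by apply: measurable_funM => //; exact: measurable_funM.
    by apply: measurable_funM => //; exact: measurable_funM.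
have b1 := bound _ _ mp mq p0 q0 (fun k => (cell_error k).1).
have b2 := bound _ _ mq mp q0 p0 (fun k => (cell_error k).2).
rewrite -e1 -e2 -EFinD lee_fin in b1; rewrite -e1 -e2 -EFinD lee_fin in b2.
by rewrite ler_norml; apply/andP; split; lra.
Qed.

End euler_error.

Lemma expR_le_inv1B (R : realType) (x : R) : x < 1 -> expR x <= (1 - x)^-1.
Proof.
move=> x1; have := expR_ge1Dx (- x); rewrite expRN => h.
by rewrite -[leLHS]invrK lef_pV2// ?posrE ?invr_gt0 ?expR_gt0 ?subr_gt0.
Qed.

(** * The stationary Laplace identity *)

Section laplace_identity.
Local Open Scope ereal_scope.
Context d (T : measurableType d) (R : realType) (P : probability T R).
Local Notation leb := (@lebesgue_measure R).
Variable nu : {sigma_finite_measure set R -> \bar R}.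
Variables (mu : T -> {measure set (R * R * R) -> \bar R}) (r c A B : R).
Variable Y : R -> {RV P >-> R}.
Hypothesis muP : poisson_random_measure P mu (jump_intensity nu).
Hypothesis nu_mom1 : \int[nu]_(z in `]0%R, +oo[) (z ^+ 1)%:E < +oo.
Hypotheses (r_gt0 : (0 < r)%R) (c_ge0 : (0 <= c)%R) (A_ge0 : (0 <= A)%R) (B_ge0 : (0 <= B)%R).
Hypothesis Ysol : inflow_solution mu r c A B Y.
Hypothesis BM : (B * moment nu 1 < 1)%R.
Variable lam : R.
Hypothesis lam_gt0 : (0 < lam)%R.
Local Notation M1 := (moment nu 1).
Local Notation psi := (laplace_exponent nu lam).

Let m : R := (c * A * M1 / (r * (1 - B * M1)))%R.

Let X (w : T) : R := `|Y 0%R w|%R.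

Let X0 w : (0 <= X w)%R. Proof. exact: normr_ge0. Qed.

Let mX : measurable_fun setT X.
Proof. by apply: measurableT_comp; [exact: normr_measurable|exact: measurable_funPT]. Qed.

Let meanX : \int[P]_w (X w)%:E = m%:E.
Proof. exact: (inflow_mean muP nu_mom1 r_gt0 c_ge0 A_ge0 B_ge0 Ysol BM). Qed.

Let psi_ge0 : (0 <= psi)%R.
Proof.
apply: Rintegral_ge0 => z /=; rewrite in_itv/= andbT => z0.
by rewrite subr_ge0 -[leRHS]expR0 ler_expR oppr_le0 mulr_ge0// ltW.
Qed.

Let iX : P.-integrable setT (EFin \o X).
Proof.
apply/integrableP; split; first exact/measurable_EFinP.
rewrite (_ : \int[P]_w _ = m%:E) ?ltry// -meanX; apply: eq_integral => w _ /=.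
by rewrite ger0_norm.
Qed.

Let bounded_integrable (f : T -> R) (k : R) : measurable_fun setT f ->
  (forall w, `|f w| <= k)%R -> P.-integrable setT (EFin \o f).
Proof.
move=> mf fk; apply: measurable_bounded_integrable => //.
  by rewrite (le_lt_trans (probability_le1 P measurableT))// ltry.
exists k; split; first exact: num_real.
by move=> x kx w _; apply: (le_trans (fk w)); exact: ltW.
Qed.

Let me : measurable_fun setT (fun w => expR (- (lam * X w))).
Proof. by do 2 apply: measurableT_comp => //; exact: measurable_funM. Qed.

Let e_le1 (x : R) : (0 <= x)%R -> (`|expR (- x)| <= 1)%R.
Proof. by move=> x0; rewrite ger0_norm ?expR_ge0// -[leRHS]expR0 ler_expR oppr_le0. Qed.

Let ie : P.-integrable setT (EFin \o (fun w => expR (- (lam * X w)))).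
Proof.
apply: (bounded_integrable (k := 1%R)) => // w; apply: e_le1.
by rewrite mulr_ge0// ltW.
Qed.

Let iXe : P.-integrable setT (EFin \o (fun w => X w * expR (- (lam * X w)))%R).
Proof.
apply: (le_integrable measurableT _ _ iX).
  by apply/measurable_EFinP; exact: measurable_funM.
move=> w _ /=; rewrite lee_fin normrM -[leRHS]mulr1 ler_wpM2l// e_le1//.
by rewrite mulr_ge0// ltW.
Qed.

(** The factor r + 1 forces r h <= 1 for every [n], as one Euler step requires. *)
Let h (n : nat) : R := ((r + 1) * n.+1%:R)^-1%R.

Let h_gt0 n : (0 < h n)%R.
Proof. by rewrite invr_gt0 mulr_gt0// addr_gt0. Qed.

Let rh n : (r * h n <= 1)%R.
Proof.
rewrite ler_pdivrMr ?mul1r ?mulr_gt0 ?addr_gt0//.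
have : (1 <= n.+1%:R :> R)%R by rewrite ler1n.
by have := r_gt0; nra.
Qed.

Let h_cvg : h n @[n --> \oo] --> (0 : R)%R.
Proof.
have := cvgM (@cvg_cst _ (r + 1)^-1%R _ \oo _) (@cvg_harmonic R); rewrite mulr0.
have -> : h = (fun n => (r + 1)^-1 * n.+1%:R^-1)%R by apply/funext => n; rewrite /h invfM.
exact.
Qed.

Let r_ge0 : (0 <= r)%R. Proof. exact: ltW. Qed.

Let rB_ge0 : (0 <= r * B)%R. Proof. by rewrite mulr_ge0. Qed.

Let h_ge0 n : (0 <= h n)%R. Proof. exact: ltW. Qed.

Let lam_ge0 : (0 <= lam)%R. Proof. exact: ltW. Qed.

Local Notation level := (euler_level r c A B).

Let level_le n x : (0 <= x)%R -> (level (h n) x <= c * A + r * B * x)%R.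
Proof.
move=> x0; rewrite /euler_level lerD2l ler_wpM2l//.
have /andP[+ _] := truncn_itv (divr_ge0 x0 (ltW (h_gt0 n))).
by rewrite ler_pdivlMr// mulrC.
Qed.

Let level_ge n x : (0 <= x)%R -> (c * A + r * B * (x - h n) <= level (h n) x)%R.
Proof.
move=> x0; rewrite /euler_level lerD2l ler_wpM2l// lerBlDr.
have /andP[_ +] := truncn_itv (divr_ge0 x0 (ltW (h_gt0 n))).
by rewrite ltr_pdivrMr// -natr1 mulrDl mul1r mulrC => /ltW.
Qed.

Let level_ge0 n x : (0 <= level (h n) x)%R.
Proof. by rewrite addr_ge0 ?mulr_ge0. Qed.

Let level_cvg x : (0 <= x)%R -> level (h n) x @[n --> \oo] --> (c * A + r * B * x)%R.
Proof.
move=> x0; apply: (@squeeze_cvgr _ _ _ _ (fun n => c * A + r * B * (x - h n))%R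
    (cst (c * A + r * B * x)%R)).
- by apply: nearW => n; rewrite level_ge//= level_le.
- apply: cvgD; first exact: cvg_cst.
  apply: cvgM; first exact: cvg_cst.
  by rewrite -[X in _ --> X]subr0; apply: cvgB; [exact: cvg_cst|exact: h_cvg].
- exact: cvg_cst.
Qed.

Let expo n x : R := (lam * ((1 - r * h n) * x) + h n * level (h n) x * psi)%R.

Let rate n x : R := (lam * r * x - level (h n) x * psi)%R.

Let expoE n x : (- expo n x = - (lam * x) + h n * rate n x)%R.
Proof. by rewrite /expo /rate; ring. Qed.

Let delta n (w : T) : R := ((expR (- expo n (X w)) - expR (- (lam * X w))) / h n)%R.

Let lim_rate x : R := (lam * r * x - (c * A + r * B * x) * psi)%R.

Let rate_cvg x : (0 <= x)%R -> rate n x @[n --> \oo] --> lim_rate x.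
Proof.
move=> x0; apply: cvgB; first exact: cvg_cst.
by apply: cvgM; [exact: level_cvg|exact: cvg_cst].
Qed.

Let delta_cvg w : delta n w @[n --> \oo] --> (expR (- (lam * X w)) * lim_rate (X w))%R.
Proof.
have hr : (h n * rate n (X w))%R @[n --> \oo] --> (0 : R)%R.
  by rewrite -[X in _ --> X](mul0r (lim_rate (X w))); apply: cvgM; [exact: h_cvg|exact: rate_cvg].
have dE n : delta n w = (expR (- (lam * X w)) * ((expR (h n * rate n (X w)) - 1) / h n))%R.
  by rewrite /delta expoE expRD; ring.
under eq_cvg do rewrite dE.
apply: cvgM; first exact: cvg_cst.
(* With x = h times the rate, x <= e^x - 1 <= x / (1 - x) as soon as x < 1. *)
apply: (@squeeze_cvgr _ _ _ _ (fun n => rate n (X w))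
  (fun n => rate n (X w) * (1 - h n * rate n (X w))^-1)%R).
- near=> n.
  have small : (h n * rate n (X w) < 1)%R.
    by near: n; apply: (cvgr_lt (0 : R)%R hr); exact: ltr01.
  rewrite (ler_pdivlMr _ _ (h_gt0 n)) (ler_pdivrMr _ _ (h_gt0 n)); apply/andP; split.
    by rewrite lerBrDl mulrC expR_ge1Dx.
  have pos : (0 < 1 - h n * rate n (X w))%R by rewrite subr_gt0.
  have := expR_le_inv1B small.
  rewrite lerBlDr => /le_trans; apply.
  rewrite le_eqVlt; apply/orP; left; apply/eqP; field.
  by rewrite gt_eqF.
- exact: rate_cvg.
- rewrite -[X in _ --> X]mulr1; apply: cvgM; first exact: rate_cvg.
  rewrite -[X in _ --> X]invr1; apply: cvgV; first exact: oner_neq0.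
  by rewrite -[X in _ --> X]subr0; apply: cvgB => //; exact: cvg_cst.
Unshelve. all: by end_near.
Qed.

Let expo_ge0 n w : (0 <= expo n (X w))%R.
Proof.
rewrite /expo addr_ge0 ?mulr_ge0 ?subr_ge0 ?(ltW lam_gt0) ?(ltW (h_gt0 n)) ?rh//.
Qed.

(** A bound linear in [X w], hence integrable now that the mean is finite; it dominates the
    difference quotients. *)
Let delta_le n w : (`|delta n w| <= lam * r * X w + (c * A + r * B * X w) * psi)%R.
Proof.
have lamX : (0 <= lam * X w)%R by rewrite mulr_ge0// ltW.
rewrite /delta normrM normfV (gtr0_norm (h_gt0 n)) ler_pdivrMr//.
have l1 := expRN_lipschitz (expo n (X w)) lamX.
have l2 := expRN_lipschitz (lam * X w) (expo_ge0 n w).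
have : (`|expo n (X w) - lam * X w| <= (lam * r * X w + (c * A + r * B * X w) * psi) * h n)%R.
  rewrite (_ : _ - _ = - (h n * rate n (X w)))%R; last by rewrite -[expo _ _]opprK expoE; ring.
  rewrite normrN normrM (gtr0_norm (h_gt0 n)) mulrC ler_pM2r//.
  apply: (le_trans (ler_normB _ _)); apply: lerD.
    by rewrite ger0_norm// !mulr_ge0 ?(ltW lam_gt0) ?(ltW r_gt0).
  by rewrite ger0_norm ?mulr_ge0// ler_wpM2r// level_le.
rewrite distrC in l1; move: l1 l2; set D := `|expo n (X w) - lam * X w|%R => l1 l2 key.
by rewrite ler_norml; lra.
Qed.

(** The mean of the difference quotient [delta] is O(h) by [euler_error], while its dominated limit
    is the mean of e^(-lam X) (lam r X - (c A + r B X) psi). That mean therefore vanishes, which is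
    the identity. *)
Lemma laplace_identity :
  (r * (lam - B * psi) * (\int[P]_w (X w * expR (- (lam * X w)))) =
   c * A * psi * (\int[P]_w expR (- (lam * X w))))%R.
Proof.
pose bd w : R := (lam * r * X w + (c * A + r * B * X w) * psi)%R.
have ibd : P.-integrable setT (EFin \o bd).
  have i1 := @integrableZl _ _ _ P _ measurableT (lam * r)%R _ iX.
  have i2 := @integrableZl _ _ _ P _ measurableT (r * B * psi)%R _ iX.
  have i3 : P.-integrable setT (EFin \o cst (c * A * psi)%R).
    exact: (bounded_integrable (k := `|c * A * psi|%R)).
  have := integrableD measurableT i1 (integrableD measurableT i3 i2).
  apply: eq_integrable => // w _; rewrite /bd /= -!EFinM -!EFinD; congr EFin; ring.
pose lim_delta w : R := (expR (- (lam * X w)) * lim_rate (X w))%R.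
have idelta n : P.-integrable setT (EFin \o (fun w => expR (- expo n (X w)))).
  apply: (bounded_integrable (k := 1%R)); last by move=> w; exact: e_le1.
  apply: measurableT_comp => //; apply: measurableT_comp => //.
  apply: measurable_funD; first by apply: measurable_funM => //; exact: measurable_funM.
  apply: measurable_funM => //; apply: measurable_funM => //.
  exact: (measurable_euler_level r c A B Y (h_gt0 n)).
have idel n : P.-integrable setT (EFin \o delta n).
  have := @integrableZr _ _ _ P _ measurableT (h n)^-1%R _ (integrableB measurableT (idelta n) ie).
  by apply: eq_integrable.
have mdel n : measurable_fun setT (fun w => (delta n w)%:E).
  by have /integrableP[] := idel n.
have mlim : measurable_fun setT (fun w => (lim_delta w)%:E).
  apply/measurable_EFinP; apply: (measurable_fun_cvg (h := delta)).
    by move=> n; exact/measurable_EFinP/mdel.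
  by move=> w _; exact: delta_cvg.
have cvE : {ae P, forall w, setT w -> (delta n w)%:E @[n --> \oo] --> (lim_delta w)%:E}.
  by apply: aeW => w _; apply: cvg_EFin; [exact: nearW|exact: delta_cvg].
have domE : {ae P, forall w n, setT w -> `|(delta n w)%:E| <= (bd w)%:E}.
  by apply: aeW => w n _; rewrite lee_fin; exact: delta_le.
have [ilim _ cI] := dominated_convergence measurableT mdel mlim cvE ibd domE.
have E1 n : \int[P]_w (delta n w)%:E = (\int[P]_w delta n w)%R%:E.
  by rewrite /Rintegral fineK//; exact: integrable_fin_num (idel n).
have E2 : \int[P]_w (lim_delta w)%:E = (\int[P]_w lim_delta w)%R%:E.
  by rewrite /Rintegral fineK//; exact: integrable_fin_num ilim.
have bdelta n : (`|\int[P]_w delta n w| <=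
    lam * (r + M1 * (r * B)) * (2 * r * m + 1) * h n)%R.
  have -> : (\int[P]_w delta n w = ((\int[P]_w expR (- expo n (X w))) -
      (\int[P]_w expR (- (lam * X w)))) / h n)%R.
    rewrite -RintegralB// -RintegralZr//; exact: (integrableB measurableT (idelta n) ie).
  rewrite normrM normfV (gtr0_norm (h_gt0 n)) ler_pdivrMr// distrC.
  have := euler_error muP nu_mom1 r_gt0 c_ge0 A_ge0 B_ge0 Ysol BM (h_gt0 n) (rh n) lam_gt0.
  by rewrite expr2 !mulrA.
have lim0 : (\int[P]_w lim_delta w = 0)%R.
  have c0 : (\int[P]_w delta n w)%R @[n --> \oo] --> (0 : R)%R.
    apply/cvgr0Pnorm_le => e e0.
    have hC : (lam * (r + M1 * (r * B)) * (2 * r * m + 1) * h n)%R @[n --> \oo] --> (0 : R)%R.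
      rewrite -[X in _ --> X](mulr0 (lam * (r + M1 * (r * B)) * (2 * r * m + 1))%R).
      by apply: cvgM; [exact: cvg_cst|exact: h_cvg].
    have near_e : \forall n \near \oo, (lam * (r + M1 * (r * B)) * (2 * r * m + 1) * h n <= e)%R.
      by apply: (cvgr_le (0 : R)%R hC); exact: e0.
    by apply: filterS near_e => n; exact: le_trans (bdelta n).
  have c1 : (\int[P]_w delta n w)%R%:E @[n --> \oo] --> (\int[P]_w lim_delta w)%R%:E.
    rewrite -E2 (_ : (fun n => _) = (fun n => \int[P]_w (delta n w)%:E)); first exact: cI.
    by apply/funext => n; rewrite E1.
  move/fine_cvg : c1 => /= c1.
  exact: (cvg_unique _ c1 c0).
have E3 : (\int[P]_w lim_delta w = (lam * r - r * B * psi) * (\int[P]_w (X w * expR (- (lam * X w)))) -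
    c * A * psi * (\int[P]_w expR (- (lam * X w))))%R.
  have i1 := @integrableZl _ _ _ P _ measurableT (lam * r - r * B * psi)%R _ iXe.
  have i2 := @integrableZl _ _ _ P _ measurableT (c * A * psi)%R _ ie.
  have e1 : (\int[P]_w ((lam * r - r * B * psi) * (X w * expR (- (lam * X w)))) =
      (lam * r - r * B * psi) * (\int[P]_w (X w * expR (- (lam * X w)))))%R.
    by rewrite RintegralZl.
  have e2 : (\int[P]_w (c * A * psi * expR (- (lam * X w))) =
      c * A * psi * (\int[P]_w expR (- (lam * X w))))%R.
    by rewrite RintegralZl.
  rewrite -e1 -e2 -RintegralB//; apply: eq_Rintegral => w _.
  by rewrite /lim_delta /lim_rate; ring.
by rewrite E3 in lim0; lra.
Qed.

End laplace_identity.

(** * Taylor bounds for the exponential *)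

Section exponential_bounds.
Context {R : realType}.

Lemma ge0_of_derive (F F' : R -> R) : (forall x : R, is_derive x (1 : R) F (F' x)) -> F 0 = 0 ->
  (forall x, 0 <= x -> 0 <= F' x) -> forall x, 0 <= x -> 0 <= F x.
Proof.
move=> dF F00 F'0 x; rewrite le_eqVlt => /predU1P[<-|x0]; first by rewrite F00.
have cF : {within `[0, x], continuous F}.
  apply: derivable_within_continuous => y _.
  by have := dF y => -[].
have [y /[!in_itv]/= /andP[y0 _]] := MVT x0 (fun y _ => dF y) cF.
by rewrite F00 !subr0 => ->; rewrite mulr_ge0 ?F'0// ltW.
Qed.

(** The difference of the two sides vanishes at 0 and has derivative e^(-x) - 1 + x. The next bound
    follows in the same way, its derivative being this one. *)
Lemma expRN_le2 (x : R) : 0 <= x -> expR (- x) - 1 + x <= x ^+ 2 / 2.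
Proof.
move=> x0; rewrite -subr_ge0; move: x x0.
apply: (@ge0_of_derive _ (fun x => x + expR (- x) - 1)).
- by move=> x; apply: is_derive_eq; rewrite /GRing.scale/=; field.
- by rewrite oppr0 expR0; ring.
- by move=> x x0; have := expR_ge1Dx (- x); lra.
Qed.

Lemma expRN_ge3 (x : R) : 0 <= x -> x ^+ 2 / 2 - x ^+ 3 / 6 <= expR (- x) - 1 + x.
Proof.
move=> x0; rewrite -subr_ge0; move: x x0.
apply: (@ge0_of_derive _ (fun x => x ^+ 2 / 2 - (expR (- x) - 1 + x))).
- by move=> x; apply: is_derive_eq; rewrite /GRing.scale/=; field.
- by rewrite oppr0 expR0; ring.
- by move=> x x0; rewrite subr_ge0 expRN_le2.
Qed.

End exponential_bounds.

(** * The second moment of the inflow *)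

Section second_moment.
Local Open Scope ereal_scope.
Context d (T : measurableType d) (R : realType) (P : probability T R).
Local Notation leb := (@lebesgue_measure R).
Variable nu : {sigma_finite_measure set R -> \bar R}.
Variables (mu : T -> {measure set (R * R * R) -> \bar R}) (r c A B : R).
Variable Y : R -> {RV P >-> R}.
Hypothesis muP : poisson_random_measure P mu (jump_intensity nu).
Hypothesis nu_mom1 : \int[nu]_(z in `]0%R, +oo[) (z ^+ 1)%:E < +oo.
Hypothesis nu_mom2 : \int[nu]_(z in `]0%R, +oo[) (z ^+ 2)%:E < +oo.
Hypotheses (r_gt0 : (0 < r)%R) (c_ge0 : (0 <= c)%R) (A_ge0 : (0 <= A)%R) (B_ge0 : (0 <= B)%R).
Hypothesis Ysol : inflow_solution mu r c A B Y.
Hypothesis BM : (B * moment nu 1 < 1)%R.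
Local Notation M1 := (moment nu 1).
Local Notation M2 := (moment nu 2).
Local Notation D := (1 - B * M1)%R.
Local Notation psi := (laplace_exponent nu).

Let m : R := (c * A * M1 / (r * D))%R.

Let D_gt0 : (0 < D)%R. Proof. by rewrite subr_gt0. Qed.

Let lam (n : nat) : R := n.+1%:R^-1%R.

Let lam_gt0 n : (0 < lam n)%R.
Proof. by rewrite invr_gt0 ltr0n. Qed.

Let lam_cvg : lam n @[n --> \oo] --> (0 : R)%R. Proof. exact: cvg_harmonic. Qed.

Let pos : set R := `]0%R, +oo[%classic.

Let mpos : measurable pos. Proof. exact: measurable_itv. Qed.

Let im1 : nu.-integrable pos (EFin \o (fun z => z)).
Proof.
apply/integrableP; split; first by apply: measurable_funTS; exact/measurable_EFinP.
rewrite (_ : \int[nu]_(x in pos) _ = M1%:E) ?ltry// -mean_jump//.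
Qed.

Let iz2 : nu.-integrable pos (EFin \o (fun z => z ^+ 2)%R).
Proof.
apply/integrableP; split; first by apply: measurable_funTS; apply/measurable_EFinP; exact: measurable_funX.
apply: le_lt_trans nu_mom2; rewrite le_eqVlt; apply/orP; left; apply/eqP.
by apply: eq_integral => z _ /=; rewrite ger0_norm// sqr_ge0.
Qed.

Let im2 : nu.-integrable pos (EFin \o (fun z => z ^+ 2 / 2)%R).
Proof. exact: (@integrableZr _ _ _ nu _ (measurable_itv `]0%R, +oo[) 2^-1%R _ iz2). Qed.

Let iexp n : nu.-integrable pos (EFin \o (fun z => 1 - expR (- (lam n * z)))%R).
Proof.
have i1 := @integrableZl _ _ _ nu _ (measurable_itv `]0%R, +oo[) (lam n) _ im1.
apply: (le_integrable (measurable_itv `]0%R, +oo[) _ _ i1).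
  apply: measurable_funTS; apply/measurable_EFinP; apply: measurable_funB => //.
  by do 2 apply: measurableT_comp => //; exact: measurable_funM.
move=> z; rewrite /= in_itv/= andbT => z0; rewrite lee_fin.
have lz : (0 <= lam n * z)%R by rewrite mulr_ge0// ltW.
rewrite !ger0_norm//; first by have := expR_ge1Dx (- (lam n * z)); lra.
by rewrite subr_ge0 -[leRHS]expR0 ler_expR oppr_le0.
Qed.

(** The second-order coefficient in psi(lam) = lam M1 - lam^2 [gap]; it tends to M2 / 2 by dominated
    convergence under [nu]. *)
Let gap n : R := ((M1 - psi (lam n) / lam n) / lam n)%R.

Let gap_cvg : gap n @[n --> \oo] --> (M2 / 2)%R.
Proof.
pose f n (z : R) := ((expR (- (lam n * z)) - 1 + lam n * z) / lam n ^+ 2)%R.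
have mf n : measurable_fun pos (fun z => (f n z)%:E).
  apply: measurable_funTS; apply/measurable_EFinP; apply: measurable_funM => //.
  apply: measurable_funD; last exact: measurable_funM.
  by apply: measurable_funB => //; do 2 apply: measurableT_comp => //; exact: measurable_funM.
have fle n z : (0 <= z)%R -> (f n z <= z ^+ 2 / 2)%R.
  move=> z0; rewrite ler_pdivrMr ?exprn_gt0//.
  have := expRN_le2 (mulr_ge0 (ltW (lam_gt0 n)) z0).
  by rewrite exprMn; lra.
have fge n z : (0 <= z)%R -> (z ^+ 2 / 2 - lam n * (z ^+ 3 / 6) <= f n z)%R.
  move=> z0; rewrite ler_pdivlMr ?exprn_gt0//.
  have := expRN_ge3 (mulr_ge0 (ltW (lam_gt0 n)) z0).
  rewrite !exprMn => /(le_trans _); apply.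
  by rewrite le_eqVlt; apply/orP; left; apply/eqP; ring.
have f0 n z : (0 <= z)%R -> (0 <= f n z)%R.
  move=> z0; rewrite divr_ge0 ?exprn_ge0 ?(ltW (lam_gt0 n))//.
  by have := expR_ge1Dx (- (lam n * z)); lra.
have cf : {ae nu, forall z, pos z -> (f n z)%:E @[n --> \oo] --> (z ^+ 2 / 2)%:E}.
  apply: aeW => z; rewrite /pos/= in_itv/= andbT => /ltW z0; apply: cvg_EFin; first exact: nearW.
  apply: (@squeeze_cvgr _ _ _ _ (fun n => z ^+ 2 / 2 - lam n * (z ^+ 3 / 6))%R (cst (z ^+ 2 / 2)%R)).
  - by apply: nearW => n; rewrite fge// fle.
  - rewrite -[X in _ --> X]subr0; apply: cvgB; first exact: cvg_cst.
    by rewrite -[X in _ --> X](mul0r (z ^+ 3 / 6)%R); apply: cvgM; [exact: lam_cvg|exact: cvg_cst].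
  - exact: cvg_cst.
have df : {ae nu, forall z n, pos z -> `|(f n z)%:E| <= (z ^+ 2 / 2)%:E}.
  apply: aeW => z n; rewrite /pos/= in_itv/= andbT => /ltW z0.
  by rewrite lee_fin ger0_norm ?f0// fle.
have ml : measurable_fun pos (fun z => (z ^+ 2 / 2)%:E) by case/integrableP: im2.
have [_ _ cI] := dominated_convergence (measurable_itv `]0%R, +oo[) mf ml cf im2 df.
have gE n : \int[nu]_(z in pos) (f n z)%:E = (gap n)%:E.
  have i1 := @integrableZl _ _ _ nu _ (measurable_itv `]0%R, +oo[) (lam n) _ im1.
  have i1' : nu.-integrable pos (EFin \o (fun z => lam n * z)%R) by exact: i1.
  have i2 : nu.-integrable pos (EFin \o (fun z => lam n * z - (1 - expR (- (lam n * z))))%R).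
    exact: (integrableB (measurable_itv `]0%R, +oo[) i1' (iexp n)).
  transitivity (\int[nu]_(z in pos) ((lam n * z - (1 - expR (- (lam n * z)))) / lam n ^+ 2)%:E).
    by apply: eq_integral => z _; rewrite /f; congr EFin; congr (_ / _)%R; ring.
  have i3 := @integrableZr _ _ _ nu _ (measurable_itv `]0%R, +oo[) (lam n ^+ 2)^-1%R _ i2.
  rewrite -[LHS]fineK; last exact: (integrable_fin_num (measurable_itv `]0%R, +oo[) i3).
  congr EFin; rewrite -/(Rintegral _ _ _).
  rewrite (_ : Rintegral _ _ _ = (\int[nu]_(z in pos) ((lam n * z - (1 - expR (- (lam n * z)))) / lam n ^+ 2))%R)//.
  rewrite RintegralZr//.
  rewrite RintegralB//.
  rewrite RintegralZl//.
  rewrite (_ : (\int[nu]_(x in pos) x = M1)%R); last first.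
    by apply: eq_Rintegral => z _; rewrite expr1.
  rewrite /gap /laplace_exponent; field.
  by rewrite gt_eqF.
have lE : \int[nu]_(z in pos) (z ^+ 2 / 2)%:E = (M2 / 2)%:E.
  rewrite -[LHS]fineK; last exact: (integrable_fin_num (measurable_itv `]0%R, +oo[) im2).
  congr EFin; transitivity (\int[nu]_(z in pos) (z ^+ 2 / 2))%R => //.
  by rewrite (RintegralZr _ mpos iz2).
have c1 : (gap n)%:E @[n --> \oo] --> (M2 / 2)%:E.
  by rewrite -lE (_ : (fun n => _) = (fun n => \int[nu]_(z in pos) (f n z)%:E)); [exact: cI|apply/funext => n; rewrite gE].
by move/fine_cvg : c1.
Qed.

Let X (w : T) : R := `|Y 0%R w|%R.

Let X0 w : (0 <= X w)%R. Proof. exact: normr_ge0. Qed.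

Let mX : measurable_fun setT X.
Proof. by apply: measurableT_comp; [exact: normr_measurable|exact: measurable_funPT]. Qed.

Let meanX : \int[P]_w (X w)%:E = m%:E.
Proof. exact: (inflow_mean muP nu_mom1 r_gt0 c_ge0 A_ge0 B_ge0 Ysol BM). Qed.

Let iX : P.-integrable setT (EFin \o X).
Proof.
apply/integrableP; split; first exact/measurable_EFinP.
rewrite (_ : \int[P]_w _ = m%:E) ?ltry// -meanX; apply: eq_integral => w _ /=.
by rewrite ger0_norm.
Qed.

Let meanXR : (\int[P]_w X w = m)%R.
Proof. by rewrite /Rintegral meanX. Qed.

Let e n w : R := expR (- (lam n * X w)).

Let me n : measurable_fun setT (e n).
Proof. by do 2 apply: measurableT_comp => //; exact: measurable_funM. Qed.

Let lX0 n w : (0 <= lam n * X w)%R. Proof. by rewrite mulr_ge0// ltW. Qed.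

Let e_le1 n w : (e n w <= 1)%R.
Proof. by rewrite -[leRHS]expR0 ler_expR oppr_le0. Qed.

(** Approximates [X] from below and is bounded by 1 / lam, so that X u is integrable before X^2 is
    known to be. *)
Let u n w : R := ((1 - e n w) / lam n)%R.

Let u_ge0 n w : (0 <= u n w)%R.
Proof. by rewrite divr_ge0 ?subr_ge0 ?(ltW (lam_gt0 n)). Qed.

Let u_le n w : (u n w <= X w)%R.
Proof.
rewrite ler_pdivrMr//; have := expR_ge1Dx (- (lam n * X w)); rewrite -/(e n w) (mulrC (X w)).
by lra.
Qed.

Let mu_ n : measurable_fun setT (u n).
Proof. by apply: measurable_funM => //; exact: measurable_funB. Qed.

Let u_cvg w : u n w @[n --> \oo] --> X w.
Proof.
apply: (@squeeze_cvgr _ _ _ _ (fun n => X w - lam n * (X w ^+ 2 / 2))%R (cst (X w))).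
- apply: nearW => n; rewrite u_le andbT ler_pdivlMr//.
  by have := expRN_le2 (lX0 n w); rewrite -/(e n w) exprMn; lra.
- rewrite -[X in _ --> X]subr0; apply: cvgB; first exact: cvg_cst.
  by rewrite -[X in _ --> X](mul0r (X w ^+ 2 / 2)%R); apply: cvgM; [exact: lam_cvg|exact: cvg_cst].
- exact: cvg_cst.
Qed.

Let iu n : P.-integrable setT (EFin \o u n).
Proof.
apply: (le_integrable measurableT _ _ iX); first exact/measurable_EFinP.
by move=> w _ /=; rewrite lee_fin !ger0_norm.
Qed.

Let iXu n : P.-integrable setT (EFin \o (fun w => X w * u n w)%R).
Proof.
have i1 : P.-integrable setT (EFin \o (fun w => (lam n)^-1 * X w)%R).
  exact: (@integrableZl _ _ _ P _ measurableT (lam n)^-1%R _ iX).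
apply: (le_integrable measurableT _ _ i1).
  by apply/measurable_EFinP; exact: measurable_funM.
move=> w _ /=; rewrite lee_fin (ger0_norm (mulr_ge0 (X0 w) (u_ge0 n w))).
rewrite ger0_norm; last by rewrite mulr_ge0// invr_ge0 ltW.
rewrite /u mulrA mulrC ler_wpM2l ?invr_ge0 ?(ltW (lam_gt0 n))//.
by rewrite -[leRHS]mulr1 ler_wpM2l// lerBlDr lerDl expR_ge0.
Qed.

Let mean_u_cvg : (\int[P]_w u n w)%R @[n --> \oo] --> m.
Proof.
have mu1 n : measurable_fun setT (fun w => (u n w)%:E) by exact/measurable_EFinP.
have mX1 : measurable_fun setT (fun w => (X w)%:E) by exact/measurable_EFinP.
have cf : {ae P, forall w, setT w -> (u n w)%:E @[n --> \oo] --> (X w)%:E}.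
  by apply: aeW => w _; apply: cvg_EFin; [exact: nearW|exact: u_cvg].
have df : {ae P, forall w n, setT w -> `|(u n w)%:E| <= (X w)%:E}.
  by apply: aeW => w n _; rewrite lee_fin ger0_norm.
have [_ _ cI] := dominated_convergence measurableT mu1 mX1 cf iX df.
have c1 : (\int[P]_w u n w)%R%:E @[n --> \oo] --> m%:E.
  rewrite -meanX (_ : (fun n => _) = (fun n => \int[P]_w (u n w)%:E)); first exact: cI.
  by apply/funext => n; rewrite /Rintegral fineK//; exact: integrable_fin_num (iu n).
by move/fine_cvg : c1.
Qed.

Let S : R := (m ^+ 2 + c * A * M2 / (2 * r * D ^+ 2))%R.

(** The Laplace identity solved for the mean of X u. The divisions by lam are gathered into [gap n],
    [psi (lam n) / lam n] and the mean of [u n], each of which converges. *)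
Let mean_Xu n : (\int[P]_w (X w * u n w) =
  ((c * A + r * B * m) * gap n + c * A * (psi (lam n) / lam n) * (\int[P]_w u n w)) /
  (r * (1 - B * (psi (lam n) / lam n))))%R.
Proof.
have ie : P.-integrable setT (EFin \o e n).
  have i1 := @integrableZl _ _ _ P _ measurableT (lam n) _ (iu n).
  have i2 : P.-integrable setT (EFin \o cst 1%R) by exact: finite_measure_integrable_cst.
  have := integrableB measurableT i2 i1; apply: eq_integrable => // w _.
  transitivity ((1 - lam n * u n w)%R%:E); first by [].
  by rewrite /u; congr EFin; field; rewrite gt_eqF.
have iXe : P.-integrable setT (EFin \o (fun w => X w * e n w)%R).
  have i1 := @integrableZl _ _ _ P _ measurableT (lam n) _ (iXu n).
  have := integrableB measurableT iX i1; apply: eq_integrable => // w _.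
  transitivity ((X w - lam n * (X w * u n w))%R%:E); first by [].
  by rewrite /u; congr EFin; field; rewrite gt_eqF.
have i1 : P.-integrable setT (EFin \o cst 1%R) by exact: finite_measure_integrable_cst.
have one : (\int[P]_w (cst 1%R w) = 1)%R.
  rewrite /Rintegral (_ : \int[P]_w _ = 1)//; transitivity (\int[P]_w cst (1 : \bar R) w) => //.
  by rewrite integral_cst// mul1e; exact: probability_setT.
have uE : (\int[P]_w u n w = (1 - (\int[P]_w e n w)) / lam n)%R.
  rewrite -{1}one -RintegralB// -RintegralZr//; exact: (integrableB measurableT i1 ie).
have XuE : (\int[P]_w (X w * u n w) = (m - (\int[P]_w (X w * e n w))) / lam n)%R.
  rewrite -meanXR -RintegralB// -RintegralZr//; last exact: (integrableB measurableT iX iXe).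
  by apply: eq_Rintegral => w _; rewrite /u; ring.
have LI := laplace_identity muP nu_mom1 r_gt0 c_ge0 A_ge0 B_ge0 Ysol BM (lam_gt0 n).
rewrite -/(e n _) in LI.
have LI' : (r * (lam n - B * psi (lam n)) * (\int[P]_w (X w * e n w)) =
  c * A * psi (lam n) * (\int[P]_w e n w))%R by exact: LI.
have psi_le : (psi (lam n) <= lam n * M1)%R.
  rewrite (_ : lam n * M1 = (\int[nu]_(z in pos) (lam n * z)))%R.
    apply: le_Rintegral => //.
      exact: (@integrableZl _ _ _ nu _ (measurable_itv `]0%R, +oo[) (lam n) _ im1).
    by move=> z _; have := expR_ge1Dx (- (lam n * z)); lra.
  rewrite (RintegralZl _ mpos im1).
  by congr (_ * _)%R; apply: eq_Rintegral => z _; rewrite expr1.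
(* As psi(lam) <= lam M1 and B M1 < 1, the denominators stay positive. *)
have Bpsi : (0 < lam n - B * psi (lam n))%R.
  rewrite subr_gt0; apply: (@le_lt_trans _ _ (B * (lam n * M1))%R); first by rewrite ler_wpM2l.
  by rewrite mulrCA -[ltRHS]mulr1 ltr_pM2l.
have mb : (r * m = M1 * (c * A + r * B * m))%R by rewrite /m; field; rewrite !gt_eqF.
rewrite uE XuE; move: LI' mb; rewrite /gap.
set a := (\int[P]_w (X w * e n w))%R; set L := (\int[P]_w e n w)%R; set p := psi (lam n).
move=> LI' mb; have l0 := lam_gt0 n; have pB : (0 < 1 - B * (p / lam n))%R.
  by rewrite mulrA -(divff (lt0r_neq0 l0)) -mulrBl divr_gt0.
apply/eqP; rewrite -subr_eq0; apply/eqP.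
(* Over the common denominator the numerator is grouped so that the Laplace identity [LI'] and the
   balance [mb] can be rewritten in it; what remains is zero. *)
have -> : ((m - a) / lam n - ((c * A + r * B * m) * ((M1 - p / lam n) / lam n) +
    c * A * (p / lam n) * ((1 - L) / lam n)) / (r * (1 - B * (p / lam n))) =
  ((r * m * lam n - (r * (lam n - B * p) * a) - r * B * m * p) -
   ((c * A + r * B * m) * M1 * lam n - (c * A + r * B * m) * p + c * A * p - c * A * p * L)) /
  (r * (lam n - B * p) * lam n))%R.
  by field; rewrite !gt_eqF.
rewrite LI' mb; have -> : (M1 * (c * A + r * B * m) * lam n - c * A * p * L - r * B * m * p -
  ((c * A + r * B * m) * M1 * lam n - (c * A + r * B * m) * p + c * A * p - c * A * p * L) = 0)%R.
  by ring.
by rewrite mul0r.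
Qed.

Let mean_Xu_cvg : (\int[P]_w (X w * u n w))%R @[n --> \oo] --> S.
Proof.
have g_cvg : (psi (lam n) / lam n)%R @[n --> \oo] --> M1.
  have -> : (fun n => psi (lam n) / lam n)%R = (fun n => M1 - lam n * gap n)%R.
    by apply/funext => n; rewrite /gap; field; rewrite gt_eqF.
  rewrite -[X in _ --> X]subr0; apply: cvgB; first exact: cvg_cst.
  by rewrite -[X in _ --> X](mul0r (M2 / 2)%R); apply: cvgM; [exact: lam_cvg|exact: gap_cvg].
rewrite (funext mean_Xu) (_ : S = ((c * A + r * B * m) * (M2 / 2) + c * A * M1 * m) / (r * (1 - B * M1)))%R.
  apply: cvgM.
    apply: cvgD; first by apply: cvgM; [exact: cvg_cst|exact: gap_cvg].
    apply: cvgM; last exact: mean_u_cvg.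
    by apply: cvgM; [exact: cvg_cst|exact: g_cvg].
  apply: cvgV; first by rewrite mulf_neq0// gt_eqF.
  apply: cvgM; first exact: cvg_cst.
  by apply: cvgB; [exact: cvg_cst|apply: cvgM; [exact: cvg_cst|exact: g_cvg]].
by rewrite /S /m; field; rewrite !gt_eqF.
Qed.

(** Fatou's lemma first bounds the mean of X^2 by the limit [S]. X^2 then dominates X u, and
    dominated convergence gives equality. *)
Lemma inflow_second_moment t : \int[P]_w (`|Y t w| ^+ 2)%:E = S%:E.
Proof.
have stY : stationary_process Y by case: Ysol.
have -> : \int[P]_w (`|Y t w| ^+ 2)%:E = \int[P]_w (X w ^+ 2)%:E.
  apply: (stationary_mean stY (f := fun x => (`|x| ^+ 2)%:E)).
    by apply/measurable_EFinP; apply: measurable_funX; exact: normr_measurable.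
  by move=> x; rewrite lee_fin sqr_ge0.
have Xu1 n w : (0 <= X w * u n w)%R by rewrite mulr_ge0.
have mXu n : measurable_fun setT (fun w => (X w * u n w)%:E).
  by apply/measurable_EFinP; exact: measurable_funM.
have Xu_cvg w : (X w * u n w)%:E @[n --> \oo] --> (X w ^+ 2)%:E.
  apply: cvg_EFin; first exact: nearW.
  by rewrite expr2; apply: cvgM; [exact: cvg_cst|exact: u_cvg].
have IE n : \int[P]_w (X w * u n w)%:E = (\int[P]_w (X w * u n w))%R%:E.
  by rewrite /Rintegral fineK//; exact: integrable_fin_num (iXu n).
have cS : \int[P]_w (X w * u n w)%:E @[n --> \oo] --> S%:E.
  rewrite (_ : (fun n => _) = (fun n => (\int[P]_w (X w * u n w))%R%:E)).
    by apply: cvg_EFin; [exact: nearW|exact: mean_Xu_cvg].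
  by apply/funext => n; rewrite IE.
have le_S : \int[P]_w (X w ^+ 2)%:E <= S%:E.
  have := @fatou _ _ _ P setT measurableT (fun n w => (X w * u n w)%:E) mXu
    (fun n w _ => Xu1 n w).
  rewrite (cvg_limn_einf_sup cS).1; apply: le_trans.
  rewrite le_eqVlt; apply/orP; left; apply/eqP; apply: eq_integral => w _.
  by rewrite (cvg_limn_einf_sup (Xu_cvg w)).1.
have mX2 : measurable_fun setT (fun w => (X w ^+ 2)%:E).
  by apply/measurable_EFinP; exact: measurable_funX.
have iX2 : P.-integrable setT (fun w => (X w ^+ 2)%:E).
  apply/integrableP; split => //; apply: le_lt_trans (ltry S); apply: le_trans le_S.
  rewrite le_eqVlt; apply/orP; left; apply/eqP; apply: eq_integral => w _ /=.
  by rewrite ger0_norm// sqr_ge0.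
have cf : {ae P, forall w, setT w -> (X w * u n w)%:E @[n --> \oo] --> (X w ^+ 2)%:E}.
  by apply: aeW => w _; exact: Xu_cvg.
have df : {ae P, forall w n, setT w -> `|(X w * u n w)%:E| <= (X w ^+ 2)%:E}.
  by apply: aeW => w n _; rewrite lee_fin ger0_norm// expr2 ler_wpM2l.
have [_ _ cI] := dominated_convergence measurableT mXu mX2 cf iX2 df.
exact: (cvg_unique _ cI cS).
Qed.

End second_moment.

(** * Autocovariance of one component *)

Section inflow_covariance.
Local Open Scope ereal_scope.
Context d (T : measurableType d) (R : realType) (P : probability T R).
Variable nu : {sigma_finite_measure set R -> \bar R}.
Variables (mu : T -> {measure set (R * R * R) -> \bar R}) (r c A B : R).
Variable Y : R -> {RV P >-> R}.
Hypothesis muP : poisson_random_measure P mu (jump_intensity nu).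
Hypothesis nu_mom1 : \int[nu]_(z in `]0%R, +oo[) (z ^+ 1)%:E < +oo.
Hypothesis nu_mom2 : \int[nu]_(z in `]0%R, +oo[) (z ^+ 2)%:E < +oo.
Hypotheses (r_gt0 : (0 < r)%R) (c_ge0 : (0 <= c)%R) (A_ge0 : (0 <= A)%R) (B_ge0 : (0 <= B)%R).
Hypothesis Ysol : inflow_solution mu r c A B Y.
Hypothesis BM : (B * moment nu 1 < 1)%R.
Local Notation M1 := (moment nu 1).
Local Notation M2 := (moment nu 2).
Local Notation D := (1 - B * M1)%R.
Local Notation m := (c * A * M1 / (r * D))%R.
Local Notation V := (c * A * M2 / (2 * r * D ^+ 2))%R.

(** The conditional mean formula with the weight |Y_s| itself. *)
Lemma inflow_covariance_le s t : (s <= t)%R -> \int[P]_w (`|Y s w| * `|Y t w|)%:E =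
  (m ^+ 2 + V * expR (- (r * D) * (t - s)))%:E.
Proof.
move=> st; pose Z w : \bar R := `|Y s w|%:E.
have mZ : measurable_fun setT (Z : g_sigma_algebraType (history P mu s) -> \bar R).
  apply/measurable_EFinP; apply: measurableT_comp; first exact: normr_measurable.
  exact: (inflow_measurable_history Ysol).
have Z0 w : 0 <= Z w by rewrite lee_fin.
have EZ : \int[P]_w Z w = m%:E.
  exact: (inflow_mean muP nu_mom1 r_gt0 c_ge0 A_ge0 B_ge0 Ysol BM).
have EZs : \int[P]_w (Z w * `|Y s w|%:E) = (m ^+ 2 + V)%:E.
  have <- := inflow_second_moment muP nu_mom1 nu_mom2 r_gt0 c_ge0 A_ge0 B_ge0 Ysol BM s.
  by apply: eq_integral => w _; rewrite expr2 EFinM.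
have Zoo : \int[P]_w Z w < +oo by rewrite EZ ltry.
have ZYoo : \int[P]_w (Z w * `|Y s w|%:E) < +oo by rewrite EZs ltry.
have := conditional_mean muP nu_mom1 r_gt0 c_ge0 A_ge0 B_ge0 Ysol mZ Z0 Zoo ZYoo st BM.
rewrite /= EZs EZ /= => E.
rewrite (_ : \int[P]_w _ = \int[P]_w (Z w * `|Y t w|%:E)); last first.
  by apply: eq_integral => w _; rewrite EFinM.
by rewrite E; congr EFin; ring.
Qed.

Lemma inflow_covariance s t : \int[P]_w (`|Y s w| * `|Y t w|)%:E =
  (m ^+ 2 + V * expR (- (r * D) * `|t - s|))%:E.
Proof.
have [st|/ltW ts] := leP s t.
  by rewrite inflow_covariance_le// ger0_norm ?subr_ge0.
rewrite distrC ger0_norm ?subr_ge0// -inflow_covariance_le//.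
by apply: eq_integral => w _; rewrite mulrC.
Qed.

End inflow_covariance.

(** * Absence of correlation between the components *)

Section cross_covariance.
Local Open Scope ereal_scope.
Context d (T : measurableType d) (R : realType) (P : probability T R).
Variables (n : nat) (r c : 'I_n -> R) (A B : R).
Variable mu : 'I_n -> T -> {measure set (R * R * R) -> \bar R}.
Hypothesis mu_meas : forall i S, measurable S -> measurable_fun setT (fun w => mu i w S).
Hypothesis mu_indep : mutually_independent P (fun i => random_measure_sigma (mu i) setT).
Variable Y : 'I_n -> R -> {RV P >-> R}.
Hypothesis Y_sol : forall i, inflow_solution (mu i) (r i) (c i) A B (Y i).

Local Notation F i := (null_completion P (random_measure_sigma (mu i) setT)).

Let rm_meas i : random_measure_sigma (mu i) setT `<=` measurable.
Proof.
apply: smallest_sub; first exact: sigma_algebra_measurable.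
move=> _ [S [H [mS _ mH ->]]]; rewrite -[_ @^-1` _]setTI.
exact: (mu_meas i mS).
Qed.

Let pair_indep i j E1 E2 : i != j -> random_measure_sigma (mu i) setT E1 ->
  random_measure_sigma (mu j) setT E2 -> P (E1 `&` E2) = P E1 * P E2.
Proof.
move=> ij h1 h2; pose E k := if k == i then E1 else E2.
have := @mu_indep [set i; j]%SET E.
rewrite (_ : \bigcap_(k in _) E k = E1 `&` E2); last first.
  apply/seteqP; split => [w H|w [H1 H2] k /=].
    split.
      by have := H i; rewrite /E eqxx; apply; rewrite /= !inE eqxx.
    by have := H j; rewrite /E eq_sym (negbTE ij); apply; rewrite /= !inE eqxx orbT.
  by rewrite !inE /E => /orP[/eqP ->|/eqP ->]; rewrite ?eqxx// eq_sym (negbTE ij).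
rewrite big_setU1 ?inE//= big_set1 /E eqxx eq_sym (negbTE ij); apply => k.
by rewrite !inE => /orP[/eqP ->|/eqP ->]; rewrite ?eqxx// eq_sym (negbTE ij).
Qed.

(** Independence passes to the null completions one side at a time, each time with an event of the
    other side held fixed. *)
Let completion_indep i j E2 : i != j -> F j E2 -> F i `<=` indep_of P E2.
Proof.
move=> ij [mE2 [G2 hG2 nG2]]; apply: indep_of_completion => // E1 hE1.
have mE1 := rm_meas hE1.
have H : F j `<=` indep_of P E1.
  apply: indep_of_completion => // E hE; split; first exact: rm_meas hE.
  by apply: (pair_indep _ hE hE1); rewrite eq_sym.
have [_ PE] : indep_of P E1 E2 by apply: H; split => //; exists G2.
by split => //; rewrite setIC PE muleC.
Qed.

Let adapted i t S : measurable S -> F i (Y i t @^-1` S).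
Proof.
move=> mS; apply: null_completionS (inflow_adapted (Y_sol i) t mS).
apply: sub_sigma_algebra2 => _ [B' [H [mB' _ mH ->]]]; exists B', H; split => //.
Qed.

Lemma inflow_cross_mean i j s t : i != j ->
  \int[P]_w (`|Y i s w| * `|Y j t w|)%:E = \int[P]_w `|Y i s w|%:E * \int[P]_w `|Y j t w|%:E.
Proof.
move=> ij.
rewrite -(@ge0_integralM_indep _ _ _ P (F i) _ R (Y j t) (fun w => `|Y i s w|%:E) (fun x => `|x|%:E)).
- by apply: eq_integral => w _; rewrite EFinM.
- exact: measurable_funPT.
- move=> S mS; rewrite sigma_algebra_id; last first.
    exact/sigma_algebra_null_completion/smallest_sigma_algebra.
  by apply: (completion_indep ij); exact: adapted.
- apply/measurable_EFinP; apply: measurableT_comp; first exact: normr_measurable.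
  by move=> _ S mS; rewrite setTI; apply: sub_sigma_algebra; exact: adapted.
- by move=> w; rewrite lee_fin.
- by apply/measurable_EFinP; exact: normr_measurable.
- by move=> x; rewrite lee_fin.
Qed.

End cross_covariance.

(** * Integrals over the whole past *)

Section exponential_windows.
Local Open Scope ereal_scope.
Context {R : realType}.
Local Notation leb := (@lebesgue_measure R).

Lemma integral_past_exp (a t : R) : (0 < a)%R ->
  \int[leb]_(v in `]-oo, t]) (expR (- a * (t - v)))%:E = (a^-1)%:E.
Proof.
move=> a0.
have me : measurable_fun setT (fun v : R => (expR (- a * (t - v)))%:E).
  by apply/measurable_EFinP; exact: measurable_expRN.
have UE : `]-oo, t]%classic = \bigcup_k `[(t - k%:R)%R, t]%classic :> set R.
  apply/seteqP; split => v /=; rewrite in_itv/=.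
    move=> vt; exists (Num.truncn (t - v)%R).+1 => //=; rewrite in_itv/= vt andbT.
    by have := truncnS_gt (t - v)%R; lra.
  by move=> [k _]; rewrite /= in_itv/= => /andP[].
have c1 : \int[leb]_(v in `[(t - k%:R)%R, t]) (expR (- a * (t - v)))%:E @[k --> \oo] -->
    \int[leb]_(v in `]-oo, t]) (expR (- a * (t - v)))%:E.
  rewrite UE; apply: ge0_nondecreasing_set_cvg_integral => //.
  - move=> k l kl; apply/subsetPset => v /=; rewrite !in_itv/= => /andP[h ->].
    by rewrite andbT (le_trans _ h)// lerD2l lerN2 ler_nat.
  - by move=> k; exact: measurable_funTS.
have E k : \int[leb]_(v in `[(t - k%:R)%R, t]) (expR (- a * (t - v)))%:E =
    ((1 - expR (- a * k%:R)) / a)%:E.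
  have kt : (t - k%:R <= t)%R by rewrite lerBlDr lerDl.
  have I := @integral_exp_difference R a 0 (- a) (t - k%:R) t kt.
  rewrite sub0r opprK in I; have {}I := I erefl.
  have ek v : (t - k%:R <= v <= t)%R -> (`|expR (- a * (t - v))| <= expR (`|a| * (t - (t - k%:R))))%R.
    by move=> hv; rewrite ger0_norm ?expR_ge0//; exact: expR_bound.
  rewrite (EFin_Rintegral (measurable_expRN a t) ek); congr EFin.
  have ie : leb.-integrable `[(t - k%:R)%R, t] (EFin \o (fun v => expR (- a * (t - v)))).
    by apply: bounded_integrable_itv ek; exact: measurable_expRN.
  apply: (mulfI (lt0r_neq0 a0)); rewrite mulrCA divff ?gt_eqF// mulr1.
  have I2 : (\int[leb]_(v in `[(t - k%:R)%R, t]) (- a * expR (- a * (t - v))) =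
      expR (- a * (t - (t - k%:R))) - expR (- 0 * (t - (t - k%:R))))%R.
    by rewrite -I; apply: eq_Rintegral => v _; rewrite oppr0 mul0r expR0 mulr1.
  rewrite RintegralZl// oppr0 mul0r expR0 (_ : (t - (t - k%:R) = k%:R)%R) in I2; last by ring.
  by lra.
have c2 : ((1 - expR (- a * k%:R)) / a)%:E @[k --> \oo] --> (a^-1)%:E.
  apply: cvg_EFin; first exact: nearW.
  rewrite -[X in _ --> X]mul1r; apply: cvgM; last exact: cvg_cst.
  rewrite -[X in _ --> X]subr0; apply: cvgB; [exact: cvg_cst|exact: cvg_expRN_nat].
move: c1; rewrite (_ : (fun k => _) = (fun k => ((1 - expR (- a * k%:R)) / a)%:E)).
  by move=> c1; exact: (cvg_unique _ c1 c2).
by apply/funext => k; rewrite E.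
Qed.

(** The square is cut along the diagonal, and the two triangles contribute equally by symmetry. All
    terms are nonnegative and may be infinite. *)
Lemma square_integral_past (f : R -> \bar R) (t : R) : measurable_fun setT f ->
  (forall v, 0 <= f v) ->
  (\int[leb]_(v in `]-oo, t]) f v) * (\int[leb]_(v in `]-oo, t]) f v) =
  2%:E * \int[leb]_(v in `]-oo, t]) (f v * \int[leb]_(w in `]-oo, v]) f w).
Proof.
move=> mf f0; pose g (v : R) := f v * (\1_(`]-oo, t]%classic : set R) v)%:E.
have mI (D : set R) : measurable D -> measurable_fun setT (fun v : R => (\1_D v)%:E : \bar R).
  by move=> mD; apply/measurable_EFinP; exact: measurable_indic.
have mg : measurable_fun setT g by apply: emeasurable_funM => //; exact: mI.
have g0 v : 0 <= g v by rewrite mule_ge0// lee_fin.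
have toR (D : set R) (k : R -> \bar R) : measurable D -> measurable_fun setT k -> (forall v, 0 <= k v) ->
    \int[leb]_(v in D) k v = \int[lebR]_v (k v * (\1_D v)%:E).
  move=> mD mk k0; rewrite -ge0_integral_lebR//; last exact: measurable_funTS.
  by rewrite integral_mkcond; apply: eq_integral => v _; rewrite epatch_indic.
pose le_set : set (R * R) := [set p | p.2 <= p.1]%R.
have mle : measurable le_set.
  have := measurable_fun_ler (@measurable_snd _ _ R R) (@measurable_fst _ _ R R).
  by move=> /(_ measurableT [set true] (_ : measurable [set true])); rewrite setTI; apply.
pose h1 (p : R * R) := g p.1 * g p.2 * (\1_le_set p)%:E.
have mgg : measurable_fun setT (fun p : R * R => g p.1 * g p.2).
  by apply: emeasurable_funM; exact: measurableT_comp.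
have mh1 : measurable_fun setT h1.
  by apply: emeasurable_funM => //; apply/measurable_EFinP; exact: measurable_indic.
have h10 p : 0 <= h1 p by rewrite !mule_ge0// lee_fin.
pose h2 (p : R * R) := g p.1 * g p.2 * (\1_(~` le_set) p)%:E.
have mh2 : measurable_fun setT h2.
  by apply: emeasurable_funM => //; apply/measurable_EFinP; apply: measurable_indic; exact: measurableC.
have h20 p : 0 <= h2 p by rewrite !mule_ge0// lee_fin.
have F : \int[leb]_(v in `]-oo, t]) f v = \int[lebR]_v g v by rewrite toR.
have G v : \int[lebR]_w h1 (v, w) = g v * \int[leb]_(w in `]-oo, v]) f w.
  rewrite /g; case: (boolP (v \in (`]-oo, t]%classic : set R))) => vt; last first.
    rewrite indicE (negbTE vt) mule0 mul0e integral0_eq// => w _.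
    by rewrite /h1 /g/= indicE (negbTE vt) mule0 !mul0e.
  rewrite toR// -ge0_integralZl//; last 3 first.
  - by apply: emeasurable_funM => //; exact: mI.
  - by move=> w _; rewrite mule_ge0// lee_fin.
  - by rewrite mule_ge0// lee_fin.
  apply: eq_integral => w _; rewrite /h1 /g/= !indicE vt -!muleA; congr (_ * _).
  congr (_ * _); congr (_ * _).
  move: vt; rewrite inE/= in_itv/= => vt.
  have -> : ((v, w) \in le_set) = (w \in (`]-oo, v]%classic : set R)).
    by apply/idP/idP; rewrite !inE/= ?in_itv/=.
  case: (boolP (w \in (`]-oo, v]%classic : set R))) => wv; last by rewrite mule0.
  rewrite mem_set ?mule1// /= in_itv/=; move: wv; rewrite inE/= in_itv/= => wv.
  exact: le_trans vt.
(* The open triangle [h2] is the reflection of the closed triangle [h1] up to the diagonal, which is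
   one point, hence null, for each [w]. *)
have G2 w : \int[lebR]_v h2 (v, w) = g w * \int[leb]_(v in `]-oo, w]) f v.
  rewrite -G.
  have mneg : measurable ([set w] : set R) by exact: measurable_set1.
  have hh v : h2 (v, w) = h1 (w, v) * (\1_(~` [set w]) v)%:E.
    rewrite /h2 /h1/= (muleC (g v)) -[RHS]muleA; congr (_ * _).
    rewrite -EFinM !indicE !in_setC; congr EFin.
    have [/= vw|/= vw] := pselect (le_set (v, w)).
      rewrite (mem_set vw) mulr0n; have [->|vw'] := pselect (v = w).
        by rewrite (mem_set (erefl : [set w] w)) /= mulr0.
      rewrite memNset ?mul0r//= => wv; apply: vw'; apply/eqP.
      by rewrite eq_le wv; move: vw; rewrite /le_set/= => ->.
    move: (vw) => /negP; rewrite -ltNge => vw'.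
    rewrite (memNset vw) mem_set; last by rewrite /le_set/= ltW.
    by rewrite memNset ?mulr1//= => vw''; move: vw'; rewrite vw'' ltxx.
  under eq_integral do rewrite hh.
  have mm : measurable_fun setT (fun v => h1 (w, v)) by exact: (measurableT_comp mh1 (measurable_pair1 w)).
  have -> : \int[lebR]_v (h1 (w, v) * (\1_(~` [set w]) v)%:E) = \int[leb]_(v in ~` [set w]) h1 (w, v).
    by rewrite [RHS]toR//; exact: measurableC.
  have -> : \int[lebR]_v h1 (w, v) = \int[leb]_(v in setT) h1 (w, v).
    by rewrite [RHS]toR//; apply: eq_integral => v _; rewrite indicT mule1.
  rewrite -(setTD [set w]) integral_setD1//; first exact: measurableD.
  exact: measurable_funTS.
have total : (\int[lebR]_v g v) * (\int[lebR]_v g v) =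
    \int[lebR]_v \int[lebR]_w (h1 (v, w) + h2 (v, w)).
  rewrite -ge0_integralZr//; last exact: integral_ge0.
  apply: eq_integral => v _; rewrite -ge0_integralZl//.
  apply: eq_integral => w _; rewrite /h1 /h2/= !indicE in_setC.
  by case: (_ \in le_set); rewrite /= mule1 mule0 ?adde0 ?add0e.
have mpast : measurable_fun setT (fun v : R => \int[leb]_(w in `]-oo, v]) f w).
  pose h3 (p : R * R) := f p.2 * (\1_le_set p)%:E.
  have mh3 : measurable_fun setT h3.
    apply: emeasurable_funM; first exact: measurableT_comp.
    by apply/measurable_EFinP; exact: measurable_indic.
  have h30 p : 0 <= h3 p by rewrite mule_ge0// lee_fin.
  rewrite (_ : (fun v => _) = (fun v => \int[lebR]_w h3 (v, w))).
    exact: (@measurable_fun_fubini_tonelli_F _ _ R R R (@lebR R) _ mh3 h30).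
  apply/funext => v; rewrite toR//; apply: eq_integral => w _; rewrite /h3/= !indicE.
rewrite F total.
have sp v : \int[lebR]_w (h1 (v, w) + h2 (v, w)) = \int[lebR]_w h1 (v, w) + \int[lebR]_w h2 (v, w).
  rewrite ge0_integralD//.
  - exact: (measurableT_comp mh1 (measurable_pair1 v)).
  - exact: (measurableT_comp mh2 (measurable_pair1 v)).
under eq_integral do rewrite sp.
rewrite ge0_integralD//; last 4 first.
- by move=> v _; exact: integral_ge0.
- exact: (@measurable_fun_fubini_tonelli_F _ _ R R R (@lebR R) _ mh1 h10).
- by move=> v _; exact: integral_ge0.
- exact: (@measurable_fun_fubini_tonelli_F _ _ R R R (@lebR R) _ mh2 h20).
rewrite (@fubini_tonelli _ _ R R R (@lebR R) (@lebR R) h2 mh2 h20).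
under [X in _ + X]eq_integral do rewrite G2.
under [X in X + _]eq_integral do rewrite G.
rewrite (_ : 2%:E = 1 + 1 :> \bar R); last by rewrite -EFinD.
have I0 v : 0 <= \int[leb]_(w in `]-oo, v]) f w by exact: integral_ge0.
rewrite ge0_muleDl// !mul1e.
have -> : \int[leb]_(v in `]-oo, t]) (f v * \int[leb]_(w in `]-oo, v]) f w) =
    \int[lebR]_v (g v * \int[leb]_(w in `]-oo, v]) f w).
  rewrite toR//.
  - by apply: eq_integral => v _; rewrite /g muleAC.
  - exact: emeasurable_funM.
  - by move=> v; rewrite mule_ge0.
by [].
Qed.

End exponential_windows.

(** * Moments of the exponential average of the past *)

Section past_average.
Local Open Scope ereal_scope.
Context d (T : measurableType d) (R : realType) (P : probability T R).
Local Notation leb := (@lebesgue_measure R).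
Variables (X : T -> R -> R) (I : finType) (V a : I -> R) (m h : R).
Hypothesis mX : measurable_fun setT (fun p : T * R => X p.1 p.2).
Hypothesis X0 : forall w v, (0 <= X w v)%R.
Hypothesis meanX : forall v, \int[P]_w (X w v)%:E = m%:E.
Hypothesis covX : forall s t, \int[P]_w (X w s * X w t)%:E =
  (m ^+ 2 + \sum_i V i * expR (- a i * `|t - s|))%:E.
Hypotheses (V_ge0 : forall i, (0 <= V i)%R) (a_gt0 : forall i, (0 < a i)%R) (h_gt0 : (0 < h)%R).

(** Not normalised by [h], to match the integral in the control. It is extended-valued because
    finiteness is only almost sure. *)
Definition past_average (w : T) (t : R) : \bar R :=
  \int[leb]_(v in `]-oo, t]) (expR (- h * (t - v)) * X w v)%:E.

Let mXw w : measurable_fun setT (X w).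
Proof. exact: (measurableT_comp mX (measurable_pair1 w)). Qed.

Let kernel_joint t : measurable_fun setT (fun p : T * R => (expR (- h * (t - p.2)) * X p.1 p.2)%:E).
Proof.
apply/measurable_EFinP; apply: measurable_funM => //.
exact: (measurableT_comp (measurable_expRN h t) measurable_snd).
Qed.

Let kernel_ge0 t w v : 0 <= (expR (- h * (t - v)) * X w v)%:E.
Proof. by rewrite lee_fin mulr_ge0// expR_ge0. Qed.

Lemma past_average_ge0 w t : 0 <= past_average w t.
Proof. by apply: integral_ge0 => v _; exact: kernel_ge0. Qed.

Lemma measurable_past_average t : measurable_fun setT (past_average ^~ t).
Proof.
by have [] := @tonelli_time _ _ _ P _ (fun w v => (expR (- h * (t - v)) * X w v)%:E)
  (measurable_itv `]-oo, t]) (kernel_joint t) (kernel_ge0 t).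
Qed.

Let past_int (c k : R) t : (0 < c)%R -> (0 <= k)%R ->
  \int[leb]_(v in `]-oo, t]) (k * expR (- c * (t - v)))%:E = (k / c)%:E.
Proof.
move=> c0 k0; under eq_integral do rewrite EFinM.
rewrite (@ge0_integralZl_EFin _ _ _ leb _ (measurable_itv `]-oo, t]))//.
- by rewrite integral_past_exp// -EFinM.
- by apply: measurable_funTS; apply/measurable_EFinP; exact: measurable_expRN.
Qed.

Lemma mean_past_average t : \int[P]_w past_average w t = (m / h)%:E.
Proof.
have m0 : (0 <= m)%R.
  by rewrite -lee_fin -(meanX 0%R); apply: integral_ge0 => w _; rewrite lee_fin.
have [_ _ ->] := @tonelli_time _ _ _ P _ (fun w v => (expR (- h * (t - v)) * X w v)%:E)
  (measurable_itv `]-oo, t]) (kernel_joint t) (kernel_ge0 t).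
rewrite -(past_int t h_gt0 m0); apply: eq_integral => v _.
under eq_integral do rewrite EFinM.
rewrite ge0_integralZl_EFin ?expR_ge0//.
- by rewrite meanX -EFinM mulrC.
- by move=> w _; rewrite lee_fin.
- by apply/measurable_EFinP; exact: (measurableT_comp mX (measurable_pair2 v)).
Qed.

(** The integral over x >= 0 of e^(-hx) times the second-order function m^2 + sum V_i e^(-a_i x). *)
Let b : R := (m ^+ 2 / h + \sum_i V i / (h + a i))%R.

Lemma cross_past_average t : \int[P]_w ((X w t)%:E * past_average w t) = b%:E.
Proof.
pose f w v : \bar R := (expR (- h * (t - v)) * (X w v * X w t))%:E.
have f0 w v : 0 <= f w v by rewrite lee_fin !mulr_ge0// expR_ge0.
have mXt : measurable_fun setT (X ^~ t) by exact: (measurableT_comp mX (measurable_pair2 t)).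
have mf : measurable_fun setT (fun p : T * R => f p.1 p.2).
  apply/measurable_EFinP; apply: measurable_funM.
    exact: (measurableT_comp (measurable_expRN h t) measurable_snd).
  by apply: measurable_funM => //; exact: (measurableT_comp mXt measurable_fst).
have [_ _ E] := @tonelli_time _ _ _ P _ f (measurable_itv `]-oo, t]) mf f0.
transitivity (\int[P]_w \int[leb]_(v in `]-oo, t]) f w v).
  apply: eq_integral => w _; rewrite /past_average.
  rewrite -(@ge0_integralZl _ _ _ leb _ (measurable_itv `]-oo, t])) ?lee_fin//.
  - by apply: eq_integral => v _; rewrite -EFinM /f; congr EFin; ring.
  - by apply: measurable_funTS; exact: (measurableT_comp (kernel_joint t) (measurable_pair1 w)).
rewrite E.
transitivity (\int[leb]_(v in `]-oo, t]) ((m ^+ 2 * expR (- h * (t - v)))%:E +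
    \sum_i (V i * expR (- (h + a i) * (t - v)))%:E)).
  apply: eq_integral => v; rewrite inE/= in_itv/= => vt.
  rewrite /f; under eq_integral do rewrite EFinM.
  rewrite ge0_integralZl_EFin ?expR_ge0//; last 2 first.
  - by move=> w _; rewrite lee_fin mulr_ge0.
  - apply/measurable_EFinP; apply: measurable_funM => //.
    exact: (measurableT_comp mX (measurable_pair2 v)).
  rewrite covX -EFinM sumEFin -EFinD; congr EFin.
  rewrite mulrDr mulrC; congr (_ + _)%R; rewrite mulr_sumr; apply: eq_bigr => i _.
  by rewrite ger0_norm ?subr_ge0// mulrCA -expRD; congr (_ * expR _)%R; ring.
have p0 i v : 0 <= (V i * expR (- (h + a i) * (t - v)))%:E by rewrite lee_fin mulr_ge0// expR_ge0.
have mp i : measurable_fun (`]-oo, t]%classic : set R) (fun v => (V i * expR (- (h + a i) * (t - v)))%:E).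
  apply: measurable_funTS; apply/measurable_EFinP; apply: measurable_funM => //.
  exact: measurable_expRN.
rewrite (@ge0_integralD _ _ _ leb _ (measurable_itv `]-oo, t])); last 4 first.
- by move=> v _; rewrite lee_fin mulr_ge0 ?sqr_ge0 ?expR_ge0.
- apply: measurable_funTS; apply/measurable_EFinP; apply: measurable_funM => //.
  exact: measurable_expRN.
- by move=> v _; apply: sume_ge0 => i _; exact: p0.
- exact: emeasurable_sum.
rewrite past_int ?sqr_ge0// (@ge0_integral_sum _ _ _ leb _ (measurable_itv `]-oo, t]))//.
rewrite /b EFinD -sumEFin; congr (_ + _); apply: eq_bigr => i _.
by rewrite past_int ?addr_gt0.
Qed.

Let b_ge0 : (0 <= b)%R.
Proof.
rewrite addr_ge0 ?divr_ge0 ?sqr_ge0 ?(ltW h_gt0)// sumr_ge0// => i _.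
by rewrite divr_ge0// addr_ge0 ?(ltW h_gt0) ?(ltW (a_gt0 i)).
Qed.

(** The square is twice an integral over ordered pairs, whose inner part is again a past average, at
    time v. This reduces to the cross moment b and leaves 2 b int e^(-2h(t-v)) dv = b / h. *)
Lemma square_past_average t : \int[P]_w (past_average w t * past_average w t) = (b / h)%:E.
Proof.
pose e v := expR (- h * (t - v)).
have D0 := past_average_ge0.
have mker w : measurable_fun setT (fun v => (e v * X w v)%:E).
  exact: (measurableT_comp (kernel_joint t) (measurable_pair1 w)).
have inner w v : \int[leb]_(u in `]-oo, v]) (e u * X w u)%:E = (e v)%:E * past_average w v.
  rewrite /past_average -(@ge0_integralZl_EFin _ _ _ leb _ (measurable_itv `]-oo, v])).
  - apply: eq_integral => u _; rewrite -EFinM; congr EFin; rewrite mulrA -expRD.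
    by congr (expR _ * _)%R; ring.
  - by move=> u _; exact: kernel_ge0.
  - by apply: measurable_funTS; exact: (measurableT_comp (kernel_joint v) (measurable_pair1 w)).
  - exact: expR_ge0.
pose f w v : \bar R := (e v ^+ 2)%:E * ((X w v)%:E * past_average w v).
have f0 w v : 0 <= f w v by rewrite !mule_ge0// lee_fin ?sqr_ge0.
have mpa : measurable_fun setT (fun p : T * R => past_average p.1 p.2).
  pose le_set : set (T * R * R) := [set p | p.2 <= p.1.2]%R.
  have mle : measurable le_set.
    have m1 : measurable_fun setT (fun p : T * R * R => p.1.2).
      exact: (measurableT_comp measurable_snd measurable_fst).
    have := measurable_fun_ler (@measurable_snd _ _ (T * R)%type R) m1.
    by move=> /(_ measurableT [set true] (_ : measurable [set true])); rewrite setTI; apply.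
  pose k (p : T * R * R) := (expR (- h * (p.1.2 - p.2)) * X p.1.1 p.2)%:E * (\1_le_set p)%:E.
  have mk : measurable_fun setT k.
    apply: emeasurable_funM; last by apply/measurable_EFinP; exact: measurable_indic.
    apply/measurable_EFinP; apply: measurable_funM.
      apply: measurableT_comp => //; apply: measurable_funM => //.
      by apply: measurable_funB => //; exact: (measurableT_comp measurable_snd measurable_fst).
    apply: (measurableT_comp mX (_ : measurable_fun setT (fun p : T * R * R => (p.1.1, p.2)))).
    by apply: measurable_fun_pair => //; exact: (measurableT_comp measurable_fst measurable_fst).
  have k0 p : 0 <= k p by rewrite mule_ge0 ?lee_fin ?mulr_ge0 ?expR_ge0.
  have := @measurable_fun_fubini_tonelli_F _ _ (T * R)%type R R (@lebR R) k mk k0.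
  congr measurable_fun; apply/funext => -[w v]; rewrite /fubini_F /k /past_average/=.
  rewrite -(ge0_integral_lebR (measurable_itv `]-oo, v])) /=; last 2 first.
  - by apply: measurable_funTS; exact: (measurableT_comp (kernel_joint v) (measurable_pair1 w)).
  - by move=> u _; exact: kernel_ge0.
  rewrite [RHS]integral_mkcond; apply: eq_integral => u _; rewrite epatch_indic !indicE.
  have sE : ((w, v, u) \in le_set) = (u \in (`]-oo, v]%classic : set R)).
    by apply/idP/idP; rewrite !inE/= ?in_itv/=.
  by rewrite sE.
have mf : measurable_fun setT (fun p : T * R => f p.1 p.2).
  apply: emeasurable_funM.
    apply/measurable_EFinP; apply: (measurableT_comp (_ : measurable_fun setT (fun v => e v ^+ 2)%R) measurable_snd).
    by apply: measurable_funX; exact: measurable_expRN.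
  by apply: emeasurable_funM => //; exact/measurable_EFinP.
have [_ mI E] := @tonelli_time _ _ _ P _ f (measurable_itv `]-oo, t]) mf f0.
transitivity (\int[P]_w (2%:E * \int[leb]_(v in `]-oo, t]) f w v)).
  apply: eq_integral => w _.
  rewrite /past_average (square_integral_past t (mker w) (kernel_ge0 t w)); congr (_ * _).
  apply: eq_integral => v _; rewrite inner /f EFinM expr2 EFinM -!muleA; congr (_ * _).
  by rewrite muleCA.
rewrite ge0_integralZl_EFin//; last by move=> w _; exact: integral_ge0.
rewrite E (_ : (fun v => \int[P]_w f w v) = (fun v => (b * expR (- (2 * h) * (t - v)))%:E)).
  rewrite past_int ?mulr_gt0// -EFinM; congr EFin; field.
  by rewrite gt_eqF.
apply/funext => v; rewrite /f ge0_integralZl_EFin ?sqr_ge0//.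
- rewrite cross_past_average -EFinM; congr EFin; rewrite mulrC expr2 -expRD.
  by congr (_ * expR _)%R; ring.
- by move=> w _; rewrite mule_ge0// lee_fin.
- apply: emeasurable_funM; last exact: measurable_past_average.
  by apply/measurable_EFinP; exact: (measurableT_comp mX (measurable_pair2 v)).
Qed.

End past_average.

(** * Explicit form of the stationary discharge *)

Section control_representation.
Context d (T : measurableType d) (R : realType) (P : probability T R).
Local Notation leb := (@lebesgue_measure R).
Variables (N : R -> T -> R) (Qlow rho u m : R) (Q : R -> {RV P >-> R}).
Hypothesis mN : forall t, measurable_fun setT (N t).
Hypothesis cN : forall w, cadlag (N ^~ w).
Hypothesis N_ge0 : {ae P, forall w, forall t, 0 <= N t w}.
Hypothesis meanN : forall t, (\int[P]_w `|N t w|%:E = m%:E)%E.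
Hypotheses (Qlow_ge0 : 0 <= Qlow) (rho_gt0 : 0 < rho) (u_lt : u < rho).
Hypothesis Qsol : controlled_discharge N Qlow 0 rho u Q.

Let h := rho - u.

Let h_gt0 : 0 < h. Proof. by rewrite subr_gt0. Qed.

Let mQ v : measurable_fun setT (Q v). Proof. exact: measurable_funPT. Qed.

Let cQ w : cadlag (fun t => Q t w). Proof. by case: Qsol. Qed.

Let stQ : stationary_process Q. Proof. by case: Qsol. Qed.

(** After the control accumulated up to [s] is split off, Q solves a Volterra equation on [s, t]
    with kernel u e^(-rho x), and the resolvent turns the rate rho into h = rho - u. The quantity
    Q_s - Qlow - N_s is the control at time s. *)
Lemma discharge_step : {ae P, forall w, forall s t, s <= t ->
  Q t w = expR (- h * (t - s)) * (Q s w - Qlow - N s w) + Qlow + N t w +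
    u * (Qlow * (1 - expR (- h * (t - s))) / h + exp_conv h (N ^~ w) s t)}.
Proof.
case: Qsol => _ _; apply: filterS => w H s t st.
pose K v := \int[leb]_(x in `]-oo, v]) (expR (- rho * (v - x)) * Q x w).
have QE v : Q v w = u * K v + Qlow + N v w.
  have [_ {1}->] := H v; congr (_ * _ + _ + _); apply: eq_Rintegral => x _.
  by rewrite addr0.
have iK v : leb.-integrable `]-oo, v] (EFin \o (fun x => expR (- rho * (v - x)) * Q x w)).
  by have [+ _] := H v; apply: eq_integrable => // x _; rewrite /= addr0.
have KE v : s <= v -> K v = expR (- rho * (v - s)) * K s + exp_conv rho (fun x => Q x w) s v.
  move=> sv.
  have := @Rintegral_itvB R _ -oo%O (BRight v) s (iK v).
  rewrite /= !bnd_simp => /(_ isT sv); rewrite -/(K v) => /eqP.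
  rewrite subr_eq => /eqP ->; rewrite addrC; congr (_ + _).
    rewrite -RintegralZl//.
    by apply: eq_Rintegral => x _; rewrite mulrA -expRD; congr (expR _ * _); ring.
  rewrite (@Rintegral_itv_obnd_cbnd _ s (BRight v))//.
  apply: integrableS (iK v) => //.
  by move=> x /=; rewrite !in_itv/= => /andP[].
pose C := Q s w - Qlow - N s w.
pose M v := expR (- rho * (v - s)) * C + Qlow + N v w.
have QM v : s <= v <= t -> Q v w = M v + u * exp_conv rho (fun x => Q x w) s v.
  move=> /andP[sv _]; rewrite QE KE// /M /C (QE s); ring.
have mQw := measurable_cadlag (cQ w); have mNw := measurable_cadlag (cN w).
have [B1 QB] := cadlag_bounded s t (cQ w).
have [B2 NB] := cadlag_bounded s t (cN w).
have [_ ->] := resolvent st mQw QB QM.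
rewrite -/h /M.
have ieN := exp_conv_integrable h mNw NB.
have ie : leb.-integrable `[s, t] (EFin \o (fun v => expR (- h * (t - v)))).
  apply: (@bounded_integrable_itv _ _ _ _ (expR (`|h| * (t - s)))).
    exact: measurable_expRN.
  by move=> v sv; rewrite ger0_norm ?expR_ge0//; exact: expR_bound.
have iee : leb.-integrable `[s, t] (EFin \o (fun v => expR (- h * (t - v)) * expR (- rho * (v - s)))).
  apply: (@bounded_integrable_itv _ _ _ _ (expR (`|h| * (t - s)) * expR (`|rho| * (t - s)))).
    apply: measurable_funM; first exact: measurable_expRN.
    by apply: measurableT_comp => //; apply: measurable_funM => //; exact: measurable_funB.
  move=> v /andP[sv vt]; rewrite normrM !(ger0_norm (expR_ge0 _)) ler_pM ?expR_ge0//.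
    by apply: expR_bound; rewrite sv.
  rewrite ler_expR (@le_trans _ _ 0)//; last by rewrite mulr_ge0// subr_ge0.
  by rewrite mulNr oppr_le0 mulr_ge0 ?subr_ge0// ltW.
have I1 : u * \int[leb]_(v in `[s, t]) (expR (- h * (t - v)) * expR (- rho * (v - s))) =
    expR (- h * (t - s)) - expR (- rho * (t - s)).
  by rewrite -(integral_exp_difference (u := u) st erefl) RintegralZl.
have I2 : h * \int[leb]_(v in `[s, t]) expR (- h * (t - v)) = 1 - expR (- h * (t - s)).
  have := @integral_exp_difference R h 0 (- h) s t st (esym (etrans (sub0r _) (opprK h))).
  rewrite oppr0 mul0r expR0 => J; rewrite -[LHS]opprK -mulNr -RintegralZl//.
  rewrite -[RHS]opprB -J; congr (- _); apply: eq_Rintegral => v _.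
  by rewrite mul0r expR0 mulr1.
have -> : exp_conv h (fun v => expR (- rho * (v - s)) * C + Qlow + N v w) s t =
    (\int[leb]_(v in `[s, t]) (expR (- h * (t - v)) * expR (- rho * (v - s)))) * C +
    (\int[leb]_(v in `[s, t]) expR (- h * (t - v))) * Qlow + exp_conv h (N ^~ w) s t.
  have j1 : leb.-integrable `[s, t] (EFin \o (fun v => expR (- h * (t - v)) * expR (- rho * (v - s)) * C)).
    exact: (@integrableZr _ _ _ leb _ (measurable_itv `[s, t]) C _ iee).
  have j2 : leb.-integrable `[s, t] (EFin \o (fun v => expR (- h * (t - v)) * Qlow)).
    exact: (@integrableZr _ _ _ leb _ (measurable_itv `[s, t]) Qlow _ ie).
  have j12 : leb.-integrable `[s, t] (EFin \o (fun v => expR (- h * (t - v)) * expR (- rho * (v - s)) * C +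
      expR (- h * (t - v)) * Qlow)).
    exact: (@integrableD _ _ _ leb _ (measurable_itv `[s, t]) _ _ j1 j2).
  rewrite -RintegralZr// -RintegralZr// -RintegralD// /exp_conv -RintegralD//.
  by apply: eq_Rintegral => v _; ring.
move: I1 I2; set J1 := \int[leb]_(v in _) (_ * _); set J2 := \int[leb]_(v in _) _ => I1 I2.
have J2E : J2 = (1 - expR (- h * (t - s))) / h.
  by apply: (mulfI (lt0r_neq0 h_gt0)); rewrite I2; field; rewrite gt_eqF.
rewrite J2E; transitivity (expR (- rho * (t - s)) * C + Qlow + N t w + (u * J1) * C +
  u * ((1 - expR (- h * (t - s))) / h * Qlow + exp_conv h (N ^~ w) s t)); first by ring.
by rewrite I1 /C; ring.
Qed.

Let X w v := `|N v w|.

Hypothesis mean_past : forall t, (\int[P]_w past_average X h w t = (m / h)%:E)%E.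
Hypothesis mpast : forall t, measurable_fun setT (past_average X h ^~ t).

Lemma past_average_fin t : {ae P, forall w, past_average X h w t \is a fin_num}.
Proof.
have : P.-integrable setT (past_average X h ^~ t).
  apply/integrableP; split; first exact: mpast.
  have -> : (\int[P]_w `|past_average X h w t| = \int[P]_w past_average X h w t)%E.
    apply: eq_integral => w _; rewrite gee0_abs//.
    by apply: past_average_ge0 => *; exact: normr_ge0.
  by rewrite mean_past ltry.
by move/(integrable_ae measurableT); apply: filterS => w /(_ Logic.I).
Qed.

Let window_cvg w t : (forall v, 0 <= N v w) -> past_average X h w t \is a fin_num ->
  exp_conv h (N ^~ w) (t - k%:R) t @[k --> \oo] --> fine (past_average X h w t).
Proof.
move=> N0 Dfin.
have UE : `]-oo, t]%classic = \bigcup_k `[(t - k%:R)%R, t]%classic :> set R.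
  apply/seteqP; split => v /=; rewrite in_itv/=.
    move=> vt; exists (Num.truncn (t - v)).+1 => //=; rewrite in_itv/= vt andbT.
    by have := truncnS_gt (t - v); lra.
  by move=> [k _]; rewrite /= in_itv/= => /andP[].
have mk : measurable_fun setT (fun v : R => (expR (- h * (t - v)) * X w v)%:E).
  apply/measurable_EFinP; apply: measurable_funM; first exact: measurable_expRN.
  apply: measurableT_comp; [exact: normr_measurable|exact: measurable_cadlag].
have c1 : (\int[leb]_(v in `[(t - k%:R)%R, t]) (expR (- h * (t - v)) * X w v)%:E)%E @[k --> \oo] -->
    past_average X h w t.
  rewrite /past_average UE; apply: ge0_nondecreasing_set_cvg_integral => //.
  - move=> k l kl; apply/subsetPset => v /=; rewrite !in_itv/= => /andP[h' ->].
    by rewrite andbT (le_trans _ h')// lerD2l lerN2 ler_nat.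
  - by move=> k; exact: measurable_funTS.
  - by move=> k v _; rewrite lee_fin; apply: mulr_ge0; [exact: expR_ge0|exact: normr_ge0].
move: c1; rewrite -{1}(fineK Dfin) (_ : (fun k => _) = (fun k => (exp_conv h (N ^~ w) (t - k%:R) t)%:E)).
  by move/fine_cvg.
apply/funext => k; have [C NC] := cadlag_bounded (t - k%:R) t (cN w).
rewrite /exp_conv -(@EFin_Rintegral _ _ (expR (`|h| * (t - (t - k%:R))) * C)).
- by apply: eq_integral => v _; rewrite /X ger0_norm.
- by apply: measurable_funM; [exact: measurable_expRN|exact: measurable_cadlag].
- move=> v hv; rewrite normrM ger0_norm ?expR_ge0// ler_pM ?expR_ge0//.
    exact: expR_bound.
  exact: NC.
Qed.

(** Let [L] be the defect of the claimed formula. The step from t - k to t shows that e^(-hk) times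
    the control at t - k tends to [L] almost surely; by stationarity of Q the same quantity tends to
    0 in probability, hence L = 0. *)
Lemma discharge_representation t : {ae P, forall w,
  Q t w = rho / h * Qlow + N t w + u * fine (past_average X h w t)}.
Proof.
pose Dt w := fine (past_average X h w t).
pose L w := Q t w - Qlow - N t w - u * (Qlow / h + Dt w).
pose E k w := expR (- h * k%:R) * (Q (t - k%:R) w - Qlow - N (t - k%:R) w).
have mD : measurable_fun setT Dt.
  exact: (measurableT_comp (@fine_measurable R setT measurableT) (mpast t)).
have mL : measurable_fun setT L.
  apply: measurable_funB; first by apply: measurable_funB => //; exact: measurable_funB.
  by apply: measurable_funM => //; exact: measurable_funD.
have mE k : measurable_fun setT (E k).
  by apply: measurable_funM => //; apply: measurable_funB => //; exact: measurable_funB.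
have e_cvg : expR (- h * k%:R) @[k --> \oo] --> (0 : R) by exact: cvg_expRN_nat.
have EL : {ae P, forall w, E k w @[k --> \oo] --> L w}.
  apply: filterS3 N_ge0 (past_average_fin t) discharge_step => w N0 Dfin step.
  have EE k : E k w = L w + u * (Qlow / h * expR (- h * k%:R)) +
      u * (Dt w - exp_conv h (N ^~ w) (t - k%:R) t).
    have kt : t - k%:R <= t by rewrite lerBlDr lerDl.
    have := step _ _ kt; rewrite (_ : t - (t - k%:R) = k%:R); last by ring.
    by rewrite /E /L => ->; ring.
  rewrite (_ : (fun k => _) = (fun k => L w + u * (Qlow / h * expR (- h * k%:R)) +
      u * (Dt w - exp_conv h (N ^~ w) (t - k%:R) t))); last by apply/funext.
  rewrite -[X in _ --> X]addr0; apply: cvgD.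
    rewrite -[X in _ --> X]addr0; apply: cvgD; first exact: cvg_cst.
    rewrite -[X in _ --> X](mulr0 u); apply: cvgM; first exact: cvg_cst.
    by rewrite -[X in _ --> X](mulr0 (Qlow / h)); apply: cvgM; [exact: cvg_cst|exact: e_cvg].
  rewrite -[X in _ --> X](mulr0 u); apply: cvgM; first exact: cvg_cst.
  rewrite -[X in _ --> X](subrr (Dt w)); apply: cvgB; first exact: cvg_cst.
  exact: window_cvg.
(* A bounded, subadditive gauge that vanishes only at 0: its mean measures convergence in
   probability, so no moment of [Q] is called for. *)
pose phi (x : R) := 1 - expR (- `|x|).
have phi_cvg (x : nat -> R) l : x k @[k --> \oo] --> l -> phi (x k) @[k --> \oo] --> phi l.
  move=> xl; apply: cvgB; first exact: cvg_cst.
  exact: (cvg_expRN _ (cvg_norm xl)).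
have phi0 x : 0 <= phi x by rewrite subr_ge0 -[leRHS]expR0 ler_expR oppr_le0.
have phi1 x : phi x <= 1 by rewrite lerBlDr lerDl expR_ge0.
have phi_le x : phi x <= `|x| by have := expR_ge1Dx (- `|x|); rewrite /phi; lra.
have phiD x y : phi (x + y) <= phi x + phi y.
  have h1 : expR (- (`|x| + `|y|)) <= expR (- `|x + y|) by rewrite ler_expR lerN2 ler_normD.
  have h2 : expR (- (`|x| + `|y|)) = expR (- `|x|) * expR (- `|y|) by rewrite -expRD opprD.
  by have := phi0 x; have := phi0 y; rewrite /phi => h3 h4; nra.
have mphi (f : T -> R) : measurable_fun setT f -> measurable_fun setT (fun w => (phi (f w))%:E).
  move=> mf; apply/measurable_EFinP; apply: measurable_funB => //; apply: measurableT_comp => //.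
  by apply: measurableT_comp => //; apply: measurableT_comp => //; exact: normr_measurable.
have i1 : P.-integrable setT (EFin \o cst 1%R) by exact: finite_measure_integrable_cst.
have dct (f : nat -> T -> R) (g : T -> R) : (forall k, measurable_fun setT (f k)) ->
    measurable_fun setT g -> {ae P, forall w, f k w @[k --> \oo] --> g w} ->
    (\int[P]_w (phi (f k w))%:E)%E @[k --> \oo] --> (\int[P]_w (phi (g w))%:E)%E.
  move=> mf mg fg.
  have cf : {ae P, forall w, setT w -> (phi (f k w))%:E @[k --> \oo] --> (phi (g w))%:E}.
    by apply: filterS fg => w hw _; apply: cvg_EFin; [exact: nearW|exact: phi_cvg].
  have df : {ae P, forall w k, setT w -> (`|(phi (f k w))%:E| <= (EFin \o cst 1%R) w)%E}.
    by apply: aeW => w k _; rewrite lee_fin ger0_norm.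
  by have [] := dominated_convergence measurableT (fun k => mphi _ (mf k)) (mphi _ mg) cf i1 df.
have c1 := dct _ _ mE mL EL.
have c2 : (\int[P]_w (phi (expR (- h * k%:R) * Q 0 w))%:E)%E @[k --> \oo] --> (0 : \bar R).
  have := dct (fun k w => expR (- h * k%:R) * Q 0 w) (cst 0) _ _ _.
  rewrite (_ : (\int[P]_w (phi (cst 0 w))%:E)%E = 0%E); last first.
    by apply: integral0_eq => w _; rewrite /phi normr0 oppr0 expR0 subrr.
  apply.
  - by move=> k; exact: measurable_funM.
  - exact: measurable_cst.
  - apply: aeW => w; rewrite -[X in _ --> X](mul0r (Q 0 w)).
    by apply: cvgM; [exact: e_cvg|exact: cvg_cst].
have c3 : (\int[P]_w (phi (expR (- h * k%:R) * Q 0 w))%:E +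
    (expR (- h * k%:R) * (Qlow + m))%:E)%E @[k --> \oo] --> (0 : \bar R).
  rewrite -[X in _ --> X]adde0; apply: cvgeD => //.
  apply: cvg_EFin; first exact: nearW.
  by rewrite -[X in _ --> X](mul0r (Qlow + m)); apply: cvgM; [exact: e_cvg|exact: cvg_cst].
(* Subadditivity separates [Q] from [N]. Only the law of Q at time t - k enters, and stationarity
   replaces it by that of Q_0, while [N] contributes at most through its mean. *)
have bound k : (\int[P]_w (phi (E k w))%:E <= \int[P]_w (phi (expR (- h * k%:R) * Q 0 w))%:E +
    (expR (- h * k%:R) * (Qlow + m))%:E)%E.
  have <- : (\int[P]_w (phi (expR (- h * k%:R) * Q (t - k%:R) w))%:E =
      \int[P]_w (phi (expR (- h * k%:R) * Q 0 w))%:E)%E.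
    apply: (stationary_mean stQ (f := fun x => (phi (expR (- h * k%:R) * x))%:E)).
      apply/measurable_EFinP; apply: measurable_funB => //; apply: measurableT_comp => //.
      apply: measurableT_comp => //; apply: measurableT_comp; first exact: normr_measurable.
      exact: measurable_funM.
    by move=> x; rewrite lee_fin.
  have mNk : measurable_fun setT (fun w => (`|N (t - k%:R) w|)%:E).
    by apply/measurable_EFinP; apply: measurableT_comp => //; exact: normr_measurable.
  have e0 := expR_ge0 (- h * k%:R).
  have -> : (expR (- h * k%:R) * (Qlow + m))%:E =
      (\int[P]_w ((expR (- h * k%:R))%:E * (Qlow%:E + `|N (t - k%:R) w|%:E)))%E.
    rewrite ge0_integralZl_EFin//; last 2 first.
    - by move=> w _; rewrite adde_ge0 ?lee_fin.
    - by apply: emeasurable_funD.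
    rewrite (@ge0_integralD _ _ _ P _ measurableT (cst Qlow%:E)) ?lee_fin//.
    rewrite integral_cst// meanN EFinM EFinD; congr (_ * (_ + _))%E.
    by rewrite -[LHS]mule1; congr (_ * _)%E; apply/esym; exact: probability_setT.
  rewrite -ge0_integralD//; last 3 first.
  - by apply: mphi; exact: measurable_funM.
  - by move=> w _; rewrite mule_ge0 ?adde_ge0 ?lee_fin.
  - by apply: measurable_funeM; exact: emeasurable_funD.
  apply: ge0_le_integral => //.
  - by move=> w _; rewrite lee_fin.
  - exact: mphi.
  - apply: emeasurable_funD; first by apply: mphi; exact: measurable_funM.
    by apply: measurable_funeM; exact: emeasurable_funD.
  - move=> w _; rewrite -[leRHS]/((phi (expR (- h * k%:R) * Q (t - k%:R) w) +
      expR (- h * k%:R) * (Qlow + `|N (t - k%:R) w|))%:E) lee_fin.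
    rewrite /E (_ : expR _ * _ = expR (- h * k%:R) * Q (t - k%:R) w +
      - (expR (- h * k%:R) * (Qlow + N (t - k%:R) w))); last by ring.
    apply: (le_trans (phiD _ _)); rewrite lerD2l; apply: (le_trans (phi_le _)).
    rewrite normrN normrM (ger0_norm e0) ler_wpM2l//; apply: (le_trans (ler_normD _ _)).
    by rewrite (ger0_norm Qlow_ge0).
  - by move=> *; rewrite lee_fin phi0.
have IL0 : (\int[P]_w (phi (L w))%:E <= 0)%E.
  rewrite -(cvg_lim _ c1)// -(cvg_lim _ c3)//; apply: lee_lim.
  - by apply/cvg_ex; eexists; exact: c1.
  - by apply/cvg_ex; eexists; exact: c3.
  - by apply: nearW; exact: bound.
have /(ae_eq_integral_abs P measurableT (mphi _ mL)) : (\int[P]_w `|(phi (L w))%:E| = 0)%E.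
  apply/eqP; rewrite eq_le integral_ge0 ?andbT => [|w _]; last exact: abse_ge0.
  apply: le_trans IL0; rewrite le_eqVlt; apply/orP; left; apply/eqP.
  by apply: eq_integral => w _; rewrite gee0_abs ?lee_fin.
apply: filterS => w /(_ Logic.I) /= [pL].
have L0 : L w = 0.
  have [//|Ln] := eqVneq (L w) 0; have : expR (- `|L w|) < 1.
    by rewrite -[ltRHS]expR0 ltr_expR oppr_lt0 normr_gt0.
  by move: pL; rewrite /phi; lra.
rewrite -/(Dt w); have -> : rho / h = 1 + u / h by rewrite /h; field; rewrite gt_eqF ?subr_gt0.
by move: L0; rewrite /L => /eqP; rewrite subr_eq0 => /eqP E1; rewrite -[Q t w](subrK Qlow) -[Q t w - Qlow](subrK (N t w)) E1; ring.
Qed.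

End control_representation.

(** * Closed forms of the objective and of the cost *)

Section long_run_values.
Local Open Scope ereal_scope.
Context d (T : measurableType d) (R : realType) (P : probability T R).
Local Notation leb := (@lebesgue_measure R).

Lemma limf_esup_const (g : R -> \bar R) (k : \bar R) : (forall H, (0 < H)%R -> g H = k) ->
  limf_esup g +oo%R = k.
Proof.
move=> gk; rewrite limf_esupE; apply/eqP; rewrite eq_le; apply/andP; split.
  apply: ereal_inf_lbound; exists [set H : R | (0 < H)%R].
    by apply: nbhs_pinfty_gt; exact: num_real.
  apply/eqP; rewrite eq_le; apply/andP; split.
    by apply: ge_ereal_sup => _ [H H0 <-]; rewrite gk.
  by apply: ereal_sup_ubound; exists 1%R; [exact: ltr01|rewrite gk].
apply: le_ereal_inf_tmp => _ [W WF <-].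
have [H [H0 WH]] : exists H : R, (0 < H)%R /\ W H.
  have [M [Mr MW]] := WF; exists (Num.max M 0 + 1)%R; split.
    by rewrite ltr_pwDr// le_max lexx orbT.
  by apply: MW; rewrite ltr_pwDr// le_max lexx.
by rewrite -(gk _ H0); apply: ereal_sup_ubound; exists H.
Qed.

(** The one-time mean does not depend on [t], so the time average equals [k] exactly for every H > 0
    and the upper limit is immediate. *)
Lemma long_run_mean_const (f : R -> T -> R) (k : R) :
  measurable_fun setT (fun p : T * R => f p.2 p.1) -> (forall t w, (0 <= f t w)%R) ->
  (forall t, \int[P]_w (f t w)%:E = k%:E) -> long_run_mean P f = k%:E.
Proof.
move=> mf f0 fk; apply: limf_esup_const => H H0.
have mf' : measurable_fun setT (fun p : T * R => (f p.2 p.1)%:E) by exact/measurable_EFinP.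
have [_ _ ->] := @tonelli_time _ _ _ P _ (fun w t => (f t w)%:E) (measurable_itv `[0%R, H]) mf'
  (fun w t => f0 t w).
rewrite (_ : (fun t => _) = (fun=> k%:E)); last by apply/funext.
rewrite (@EFin_Rintegral _ (cst k) `|k|%R)// (Rintegral_cst_itv _ (ltW H0)) -EFinM.
by congr EFin; field; rewrite gt_eqF.
Qed.

Lemma Rintegral_of_mean (f : T -> R) (k : R) : measurable_fun setT f -> (forall w, (0 <= f w)%R) ->
  \int[P]_w (f w)%:E = k%:E -> P.-integrable setT (EFin \o f) /\ (\int[P]_w f w = k)%R.
Proof.
move=> mf f0 fk; split; last by rewrite /Rintegral fk.
apply/integrableP; split; first exact/measurable_EFinP.
rewrite (_ : \int[P]_w _ = k%:E) ?ltry// -fk; apply: eq_integral => w _ /=.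
by rewrite ger0_norm.
Qed.

Variables (N : R -> T -> R) (I : finType) (V a : I -> R) (m : R).
Hypothesis mN : forall t, measurable_fun setT (N t).
Hypothesis cN : forall w, cadlag (N ^~ w).
Hypothesis N_ge0 : {ae P, forall w, forall t, (0 <= N t w)%R}.
Hypothesis meanN : forall t, \int[P]_w `|N t w|%:E = m%:E.
Hypothesis covN : forall s t, \int[P]_w (`|N s w| * `|N t w|)%:E =
  (m ^+ 2 + \sum_i V i * expR (- a i * `|t - s|))%:E.
Hypotheses (V_ge0 : forall i, (0 <= V i)%R) (a_gt0 : forall i, (0 < a i)%R).

Let X w v : R := `|N v w|%R.

Let mX : measurable_fun setT (fun p : T * R => X p.1 p.2).
Proof.
apply: measurableT_comp; first exact: normr_measurable.
exact: (measurable_cadlag_process mN cN).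
Qed.

Let X0 w v : (0 <= X w v)%R. Proof. exact: normr_ge0. Qed.

Lemma quadratic_mean_now t (al be : R) :
  \int[P]_w ((al + be * N t w) ^+ 2)%:E =
  (al ^+ 2 + be ^+ 2 * (m ^+ 2 + \sum_i V i) + 2 * al * be * m)%:E.
Proof.
have m1 : measurable_fun setT (X ^~ t) by exact: (measurableT_comp mX (measurable_pair2 t)).
have [i1 e1] := Rintegral_of_mean m1 (fun w => X0 w t) (meanN t).
have E2 : \int[P]_w (X w t * X w t)%:E = (m ^+ 2 + \sum_i V i)%:E.
  rewrite covN; congr (_ + _)%:E; apply: eq_bigr => i _.
  by rewrite subrr normr0 mulr0 expR0 mulr1.
have [i2 e2] := Rintegral_of_mean (measurable_funM m1 m1) (fun w => mulr_ge0 (X0 w t) (X0 w t)) E2.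
have i0 : P.-integrable setT (EFin \o cst (al ^+ 2)%R) by exact: finite_measure_integrable_cst.
have e0 : (\int[P]_w cst (al ^+ 2) w = al ^+ 2)%R.
  rewrite /Rintegral (_ : \int[P]_w _ = (al ^+ 2)%:E)//; transitivity (\int[P]_w cst (al ^+ 2)%:E w) => //.
  rewrite integral_cst//; transitivity ((al ^+ 2)%:E * 1); last by rewrite mule1.
  by congr (_ * _); exact: probability_setT.
have j1 : P.-integrable setT (EFin \o (fun w => 2 * al * be * X w t)%R).
  exact: (@integrableZl _ _ _ P _ measurableT (2 * al * be)%R _ i1).
have j2 : P.-integrable setT (EFin \o (fun w => be ^+ 2 * (X w t * X w t))%R).
  exact: (@integrableZl _ _ _ P _ measurableT (be ^+ 2)%R _ i2).
have j02 : P.-integrable setT (EFin \o (fun w => cst (al ^+ 2) w + be ^+ 2 * (X w t * X w t))%R).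
  exact: (integrableD measurableT i0 j2).
transitivity (\int[P]_w (cst (al ^+ 2) w + be ^+ 2 * (X w t * X w t) + 2 * al * be * X w t)%:E).
  apply: ge0_ae_eq_integral => //.
  - by apply/measurable_EFinP; apply: measurable_funX; apply: measurable_funD => //; exact: measurable_funM.
  - apply/measurable_EFinP; apply: measurable_funD; last exact: measurable_funM.
    by apply: measurable_funD => //; apply: measurable_funM => //; exact: measurable_funM.
  - by move=> w _; rewrite lee_fin sqr_ge0.
  - move=> w _; rewrite lee_fin (_ : _ + _ = (al + be * X w t) ^+ 2)%R ?sqr_ge0//=.
    by ring.
  - apply: filterS N_ge0 => w N0 _; rewrite /X ger0_norm//=; congr EFin; ring.
have jt := integrableD measurableT j02 j1.
rewrite -[LHS]fineK; last exact: (integrable_fin_num measurableT jt).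
congr EFin; transitivity (\int[P]_w (cst (al ^+ 2) w + be ^+ 2 * (X w t * X w t) + 2 * al * be * X w t))%R => //.
rewrite RintegralD// RintegralD//.
rewrite (RintegralZl (be ^+ 2) measurableT i2) (RintegralZl (2 * al * be)%R measurableT i1).
by rewrite e0 e1 e2.
Qed.

Section averaged.
Variable h : R.
Hypothesis h_gt0 : (0 < h)%R.
Local Notation b := (m ^+ 2 / h + \sum_i V i / (h + a i))%R.
Local Notation Davg := (past_average X h).

Let meanX v : \int[P]_w (X w v)%:E = m%:E. Proof. exact: meanN. Qed.

Lemma quadratic_mean t (be ga al : R) :
  \int[P]_w ((al + be * N t w + ga * fine (Davg w t)) ^+ 2)%:E =
  (al ^+ 2 + be ^+ 2 * (m ^+ 2 + \sum_i V i) + ga ^+ 2 * (b / h) + 2 * al * be * m +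
   2 * al * ga * (m / h) + 2 * be * ga * b)%:E.
Proof.
have m1 : measurable_fun setT (X ^~ t) by exact: (measurableT_comp mX (measurable_pair2 t)).
have mDe := measurable_past_average P h mX X0 t.
have m2 : measurable_fun setT (fun w => fine (Davg w t)).
  exact: (measurableT_comp (@fine_measurable R setT measurableT) mDe).
have D0 w : 0 <= Davg w t by exact: past_average_ge0.
have d0 w : (0 <= fine (Davg w t))%R by rewrite fine_ge0.
have mp := mean_past_average mX X0 meanX h_gt0.
have Dfin : {ae P, forall w, Davg w t \is a fin_num}.
  have := @past_average_fin _ _ _ P N h 0%R m; rewrite subr0 => H.
  exact: (H mp (measurable_past_average P h mX X0) t).
have [i1 e1] := Rintegral_of_mean m1 (fun w => X0 w t) (meanN t).
have E11 : \int[P]_w (X w t * X w t)%:E = (m ^+ 2 + \sum_i V i)%:E.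
  rewrite covN; congr (_ + _)%:E; apply: eq_bigr => i _.
  by rewrite subrr normr0 mulr0 expR0 mulr1.
have E2 : \int[P]_w (fine (Davg w t))%:E = (m / h)%:E.
  rewrite -(mp t); apply: ge0_ae_eq_integral => //.
  - exact/measurable_EFinP.
  - by move=> w _; rewrite lee_fin.
  - by apply: filterS Dfin => w Df _; rewrite fineK.
have E12 : \int[P]_w (X w t * fine (Davg w t))%:E = b%:E.
  rewrite -(cross_past_average mX X0 covN V_ge0 a_gt0 h_gt0 t); apply: ge0_ae_eq_integral => //.
  - by apply/measurable_EFinP; exact: measurable_funM.
  - by apply: emeasurable_funM => //; exact/measurable_EFinP.
  - by move=> w _; rewrite lee_fin mulr_ge0.
  - by move=> w _; rewrite mule_ge0// lee_fin.
  - by apply: filterS Dfin => w Df _; rewrite EFinM fineK.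
have E22 : \int[P]_w (fine (Davg w t) * fine (Davg w t))%:E = (b / h)%:E.
  rewrite -(square_past_average mX X0 covN V_ge0 a_gt0 h_gt0 t); apply: ge0_ae_eq_integral => //.
  - by apply/measurable_EFinP; exact: measurable_funM.
  - exact: emeasurable_funM.
  - by move=> w _; rewrite lee_fin mulr_ge0.
  - by move=> w _; rewrite mule_ge0.
  - by apply: filterS Dfin => w Df _; rewrite EFinM fineK.
have [i2 e2] := Rintegral_of_mean m2 d0 E2.
have [i11 e11] := Rintegral_of_mean (measurable_funM m1 m1) (fun w => mulr_ge0 (X0 w t) (X0 w t)) E11.
have [i12 e12] := Rintegral_of_mean (measurable_funM m1 m2) (fun w => mulr_ge0 (X0 w t) (d0 w)) E12.
have [i22 e22] := Rintegral_of_mean (measurable_funM m2 m2) (fun w => mulr_ge0 (d0 w) (d0 w)) E22.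
pose f0 w : R := ((al + be * N t w) ^+ 2)%R.
have mf0 : measurable_fun setT f0.
  by apply: measurable_funX; apply: measurable_funD => //; exact: measurable_funM.
have [i0 e0] := Rintegral_of_mean mf0 (fun w => sqr_ge0 _) (quadratic_mean_now t al be).
have j1 : P.-integrable setT (EFin \o (fun w => ga ^+ 2 * (fine (Davg w t) * fine (Davg w t)))%R).
  exact: (@integrableZl _ _ _ P _ measurableT (ga ^+ 2)%R _ i22).
have j2 : P.-integrable setT (EFin \o (fun w => 2 * al * ga * fine (Davg w t))%R).
  exact: (@integrableZl _ _ _ P _ measurableT (2 * al * ga)%R _ i2).
have j3 : P.-integrable setT (EFin \o (fun w => 2 * be * ga * (X w t * fine (Davg w t)))%R).
  exact: (@integrableZl _ _ _ P _ measurableT (2 * be * ga)%R _ i12).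
have k1 : P.-integrable setT (EFin \o (fun w => f0 w + ga ^+ 2 * (fine (Davg w t) * fine (Davg w t)))%R).
  exact: (integrableD measurableT i0 j1).
have k2 : P.-integrable setT (EFin \o (fun w => f0 w + ga ^+ 2 * (fine (Davg w t) * fine (Davg w t)) +
    2 * al * ga * fine (Davg w t))%R).
  exact: (integrableD measurableT k1 j2).
pose g w : R := (f0 w + ga ^+ 2 * (fine (Davg w t) * fine (Davg w t)) +
  2 * al * ga * fine (Davg w t) + 2 * be * ga * (X w t * fine (Davg w t)))%R.
have k3 : P.-integrable setT (EFin \o g) by exact: (integrableD measurableT k2 j3).
transitivity (\int[P]_w (g w)%:E).
  apply: ae_eq_integral => //.
  - apply/measurable_EFinP; apply: measurable_funX; apply: measurable_funD; last exact: measurable_funM.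
    by apply: measurable_funD => //; exact: measurable_funM.
  - by case/integrableP: k3.
  - by apply: filterS N_ge0 => w N0 _; rewrite /g /f0 /X ger0_norm//; congr EFin; ring.
rewrite -[LHS]fineK; last exact: (integrable_fin_num measurableT k3).
congr EFin; transitivity (\int[P]_w g w)%R => //.
rewrite /g RintegralD// RintegralD// RintegralD//.
rewrite (RintegralZl (ga ^+ 2) measurableT i22) (RintegralZl (2 * al * ga)%R measurableT i2).
rewrite (RintegralZl (2 * be * ga)%R measurableT i12) e0 e2 e12 e22.
by ring.
Qed.

End averaged.

Variables (Qlow rho u : R) (Q : R -> {RV P >-> R}).
Hypotheses (Qlow_ge0 : (0 <= Qlow)%R) (rho_gt0 : (0 < rho)%R) (u_lt : (u < rho)%R).
Hypothesis Qsol : controlled_discharge N Qlow 0 rho u Q.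

Local Notation q := (rho / (rho - u))%R.
Local Notation h := (rho - u)%R.

Let h_gt0 : (0 < h)%R. Proof. by rewrite subr_gt0. Qed.

Let repr t := discharge_representation mN cN N_ge0 meanN Qlow_ge0 rho_gt0 u_lt Qsol
  (mean_past_average mX X0 (meanN : forall v, \int[P]_w (X w v)%:E = m%:E) h_gt0)
  (measurable_past_average P h mX X0) t.

Let mQ : measurable_fun setT (fun p : T * R => Q p.2 p.1).
Proof.
have cQ w : cadlag (fun t => Q t w) by case: Qsol.
by apply: (measurable_cadlag_process _ cQ) => t; exact: measurable_funPT.
Qed.

Let ae_square (f g : T -> R) : measurable_fun setT f -> measurable_fun setT g ->
  {ae P, forall w, f w = g w} -> \int[P]_w (f w ^+ 2)%:E = \int[P]_w (g w ^+ 2)%:E.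
Proof.
move=> mf mg fg; apply: ge0_ae_eq_integral => //.
- by apply/measurable_EFinP; exact: measurable_funX.
- by apply/measurable_EFinP; exact: measurable_funX.
- by move=> w _; rewrite lee_fin sqr_ge0.
- by move=> w _; rewrite lee_fin sqr_ge0.
- by apply: filterS fg => w -> _.
Qed.

Let mrepr t (al be ga : R) : measurable_fun setT
  (fun w => al + be * N t w + ga * fine (past_average X h w t))%R.
Proof.
apply: measurable_funD; first by apply: measurable_funD => //; exact: measurable_funM.
apply: measurable_funM => //.
exact: (measurableT_comp (@fine_measurable R setT measurableT) (measurable_past_average P h mX X0 t)).
Qed.

(** Since rho / h = q, the base flow cancels and Q - Qhat = N + u D - q m, where D is the past
    average. With S the sum of V_i / (h + a_i), the variance is the sum of the V_i plus u (2h + u) S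
    / h, and u (2h + u) = rho^2 - h^2 = (q^2 - 1) h^2. *)
Lemma objective_value Qhat : Qhat = (q * (Qlow + m))%R ->
  objective P Qhat (fun t => Q t) =
  (\sum_i V i * (1 + (q ^+ 2 - 1) * (h / (h + a i))))%:E.
Proof.
move=> QhatE; apply: long_run_mean_const.
- by apply: measurable_funX; apply: measurable_funB; [exact: mQ|exact: measurable_cst].
- by move=> t w; exact: sqr_ge0.
move=> t; rewrite (@ae_square (fun w => Q t w - Qhat)%R
    (fun w => - (q * m) + 1 * N t w + u * fine (past_average X h w t))%R).
- rewrite (quadratic_mean h_gt0); congr EFin.
  rewrite (_ : \sum_i V i * (1 + (q ^+ 2 - 1) * (h / (h + a i))) =
    \sum_i V i + (q ^+ 2 - 1) * h * \sum_i V i / (h + a i))%R; last first.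
    by rewrite mulr_sumr -big_split/=; apply: eq_bigr => i _; ring.
  set S := (\sum_i V i / _)%R; set S0 := (\sum_i V i)%R.
  by field; rewrite gt_eqF.
- by apply: measurable_funB => //; exact: measurable_funPT.
- exact: mrepr.
- by apply: filterS (repr t) => w ->; rewrite QhatE; ring.
Qed.

(** The control rate is u (N - h D) with D the past average: it has mean zero, and its second moment
    is u^2 times the sum of V_i (1 - h / (h + a_i)), where u = (q - 1) h. *)
Lemma control_cost_value :
  control_cost P N Qlow 0 rho u (fun t => Q t) =
  ((q - 1) ^+ 2 * h ^+ 2 * \sum_i V i * (a i / (a i + h)))%:E.
Proof.
apply: long_run_mean_const.
- apply: measurable_funX; apply: measurable_funD.
    by apply: measurable_funM; [exact: measurable_cst|apply: measurable_funB; [exact: mQ|exact: measurable_cst]].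
  by apply: measurable_funM => //; exact: (measurable_cadlag_process mN cN).
- by move=> t w; exact: sqr_ge0.
move=> t; rewrite (@ae_square (fun w => control_rate N Qlow 0 rho u (fun t => Q t) t w)
    (fun w => 0 + u * N t w + (- (h * u)) * fine (past_average X h w t))%R).
- rewrite (quadratic_mean h_gt0); congr EFin.
  rewrite (_ : \sum_i V i * (a i / (a i + h)) = \sum_i V i - h * \sum_i V i / (h + a i))%R; last first.
    rewrite mulr_sumr -sumrB; apply: eq_bigr => i _.
    by field; rewrite gt_eqF// addr_gt0.
  set S := (\sum_i V i / _)%R; set S0 := (\sum_i V i)%R.
  by field; rewrite gt_eqF.
- apply: measurable_funD; last exact: measurable_funM.
  by apply: measurable_funM => //; apply: measurable_funB => //; exact: measurable_funPT.
- exact: mrepr.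
- apply: filterS (repr t) => w E; rewrite /control_rate /shifted_discharge /discharge_shift E.
  by field; rewrite !gt_eqF.
Qed.

End long_run_values.

(** * The one-parameter optimisation problem *)

Section couples.
Context {R : realType} {I : finType}.
Variables (V a : I -> R) (q Kbar : R) (J K : R -> R -> \bar R) (i0 : I).
Hypotheses (V_gt0 : forall i, 0 < V i) (a_gt0 : forall i, 0 < a i).
Hypotheses (q_gt0 : 0 < q) (Kbar_gt0 : 0 < Kbar).

Definition weighted_objective (h : R) : R := \sum_i V i * (1 + (q ^+ 2 - 1) * (h / (h + a i))).
Definition weighted_cost (h : R) : R := (q - 1) ^+ 2 * h ^+ 2 * \sum_i V i * (a i / (a i + h)).
Local Notation Jv := weighted_objective.
Local Notation Kv := weighted_cost.

Hypothesis JE : forall rho u, 0 < rho -> u < rho -> rho / (rho - u) = q -> J rho u = (Jv (rho - u))%:E.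
Hypothesis KE : forall rho u, 0 < rho -> u < rho -> rho / (rho - u) = q -> K rho u = (Kv (rho - u))%:E.

Local Notation F := (feasible_couples K Kbar q).
Local Notation Jh := (fun h : R => J (q * h) ((q - 1) * h)).

Let couple h : 0 < h -> [/\ 0 < q * h, (q - 1) * h < q * h, q * h - (q - 1) * h = h
  & q * h / (q * h - (q - 1) * h) = q].
Proof.
move=> h0; have E : q * h - (q - 1) * h = h by ring.
split; [exact: mulr_gt0| |exact: E|rewrite E mulfK// gt_eqF//].
by rewrite -subr_gt0 E.
Qed.

Lemma JhE h : 0 < h -> Jh h = (Jv h)%:E.
Proof. by move=> h0; have [c1 c2 c3 c4] := couple h0; rewrite JE// c3. Qed.

(** The ratio constraint leaves the single parameter h = rho - u, and feasibility becomes a bound on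
    the explicit cost at h. *)
Lemma feasible_coupleP p : F p <->
  [/\ 0 < p.1 - p.2, Kv (p.1 - p.2) <= Kbar, p.1 = q * (p.1 - p.2) & p.2 = (q - 1) * (p.1 - p.2)].
Proof.
split=> [[p1 p2 Kp pq]|[h0 Kp E1 E2]].
  have h0 : 0 < p.1 - p.2 by rewrite subr_gt0.
  have E1 : p.1 = q * (p.1 - p.2) by rewrite -pq divfK// gt_eqF.
  split => //; last by rewrite mulrBl mul1r -E1; ring.
  by rewrite -lee_fin -KE.
have p1 : 0 < p.1 by rewrite E1 mulr_gt0.
have p2 : p.2 < p.1 by rewrite -subr_gt0.
have pq : p.1 / (p.1 - p.2) = q by rewrite {1}E1 mulfK// gt_eqF.
by split => //; rewrite KE// lee_fin.
Qed.

Lemma feasible_couple h : 0 < h -> Kv h <= Kbar -> F (q * h, (q - 1) * h).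
Proof.
by move=> h0 Kh; have [c1 c2 c3 c4] := couple h0; apply/feasible_coupleP; rewrite /= c3.
Qed.

Lemma couple_objective p : 0 < p.1 - p.2 -> p.1 = q * (p.1 - p.2) ->
  J p.1 p.2 = (Jv (p.1 - p.2))%:E.
Proof.
move=> h0 E1; apply: JE; first by rewrite E1 mulr_gt0.
  by rewrite -subr_gt0.
by rewrite {1}E1 mulfK// gt_eqF.
Qed.

Let ratio_lt i x y : 0 < x -> x < y -> x / (x + a i) < y / (y + a i).
Proof.
move=> x0 xy; have y0 := lt_trans x0 xy.
rewrite ltr_pdivrMr ?addr_gt0// mulrAC ltr_pdivlMr ?addr_gt0//.
by have := a_gt0 i; nra.
Qed.

Lemma weighted_objective_lt x y : 1 < q -> 0 < x -> x < y -> Jv x < Jv y.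
Proof.
move=> q1 x0 xy; rewrite /Jv (bigD1 i0)//= [ltRHS](bigD1 i0)//=.
have le i : V i * (1 + (q ^+ 2 - 1) * (x / (x + a i))) < V i * (1 + (q ^+ 2 - 1) * (y / (y + a i))).
  rewrite ltr_pM2l// ltrD2l ltr_pM2l ?ratio_lt// subr_gt0; nra.
by apply: ltr_leD => //; apply: ler_sum => i _; exact: ltW.
Qed.

Lemma weighted_objective_gt x y : q < 1 -> 0 < x -> x < y -> Jv y < Jv x.
Proof.
move=> q1 x0 xy; rewrite /Jv (bigD1 i0)//= [ltRHS](bigD1 i0)//=.
have le i : V i * (1 + (q ^+ 2 - 1) * (y / (y + a i))) < V i * (1 + (q ^+ 2 - 1) * (x / (x + a i))).
  rewrite ltr_pM2l// ltrD2l ltr_nM2l ?ratio_lt// subr_lt0; have := q_gt0; nra.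
by apply: ltr_leD => //; apply: ler_sum => i _; exact: ltW.
Qed.

Lemma weighted_objective_cvg : Jv h @[h --> 0^'+] --> \sum_i V i.
Proof.
apply: cvg_at_right_filter.
rewrite (_ : \sum_i V i = \sum_i V i * (1 + (q ^+ 2 - 1) * (0 / (0 + a i)))); last first.
  by apply: eq_bigr => i _; ring.
apply: (@cvg_big _ _ _ _ _ _ _ _) => [|i _]; first exact: add_continuous. apply: cvgMr; apply: cvgD; first exact: cvg_cst.
apply: cvgMr; apply: cvgM; first exact: cvg_id.
apply: cvgV; first by rewrite add0r gt_eqF.
by apply: cvgD; [exact: cvg_id|exact: cvg_cst].
Qed.

(** Although a / (a + x) decreases, x^2 / (a + x) increases: the difference of the cross products
    has the factor a (y + x) + x y. *)
Let cost_term_lt i x y : 0 < x -> x < y ->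
  x ^+ 2 * (V i * (a i / (a i + x))) < y ^+ 2 * (V i * (a i / (a i + y))).
Proof.
move=> x0 xy; have y0 := lt_trans x0 xy; have ai := a_gt0 i.
rewrite !(mulrCA _ (V i)) ltr_pM2l// !(mulrCA _ (a i)) ltr_pM2l//.
rewrite ltr_pdivrMr ?addr_gt0// mulrAC ltr_pdivlMr ?addr_gt0//.
rewrite -subr_gt0 (_ : _ - _ = (y - x) * (a i * (y + x) + x * y)); last by ring.
by rewrite mulr_gt0 ?subr_gt0// addr_gt0 ?mulr_gt0 ?addr_gt0.
Qed.

Lemma weighted_cost_lt x y : q != 1 -> 0 < x -> x < y -> Kv x < Kv y.
Proof.
move=> q1 x0 xy; have s0 : 0 < (q - 1) ^+ 2 by rewrite exprn_even_gt0//= subr_eq0.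
rewrite /Kv -[ltLHS]mulrA -[ltRHS]mulrA (ltr_pM2l s0).
rewrite !mulr_sumr (bigD1 i0)//= [ltRHS](bigD1 i0)//=.
by apply: ltr_leD; [exact: cost_term_lt|apply: ler_sum => i _; apply/ltW; exact: cost_term_lt].
Qed.

Lemma weighted_cost_continuous x : 0 <= x -> {for x, continuous Kv}.
Proof.
move=> x0; rewrite /continuous_at /Kv; apply: cvgM.
  by apply: cvgMr; exact: exprn_continuous.
apply: (@cvg_big _ _ _ _ _ _ _ _) => [|i _]; first exact: add_continuous. apply: cvgMr; apply: cvgMr; apply: cvgV.
  by rewrite gt_eqF// ltr_pwDl.
by apply: cvgD; [exact: cvg_cst|exact: cvg_id].
Qed.

Lemma weighted_cost0 : Kv 0 = 0. Proof. by rewrite /Kv; ring. Qed.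

(** Intermediate value theorem between 0, where the cost vanishes, and a point where it exceeds
    [Kbar]. *)
Lemma weighted_cost_eq : q != 1 -> exists2 hbar, 0 < hbar & Kv hbar = Kbar.
Proof.
move=> q1.
have s0 : 0 < (q - 1) ^+ 2 by rewrite exprn_even_gt0//= subr_eq0.
have [b b0 Kb] : exists2 b, 0 < b & Kbar <= Kv b.
  have w0 : 0 < (q - 1) ^+ 2 * V i0 * a i0 by rewrite (mulr_gt0 (mulr_gt0 s0 (V_gt0 i0)) (a_gt0 i0)).
  pose k := (q - 1) ^+ 2 * V i0 * a i0 / (a i0 + 1).
  have k0 : 0 < k by apply: divr_gt0; [exact: w0|rewrite addr_gt0].
  have kk : 0 < Kbar / k by exact: divr_gt0.
  (* For b >= 1 the term of index [i0] alone gives a cost of at least k b, because b / (a + b) >= 1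
     / (a + 1); this b makes k b = k + Kbar. *)
  exists (1 + Kbar / k); first exact: addr_gt0.
  set b := 1 + _; have b1 : 1 <= b by rewrite /b lerDl (ltW kk).
  have b0 : 0 < b by exact: lt_le_trans b1.
  apply: (@le_trans _ _ (k * b)).
    by rewrite /b mulrDr mulr1 mulrCA divff ?mulr1 ?gt_eqF// lerDr (ltW k0).
  rewrite /Kv (bigD1 i0)//= [leRHS]mulrDr -[leLHS]addr0; apply: lerD; last first.
    apply: mulr_ge0; first by rewrite mulr_ge0 ?sqr_ge0.
    by apply: sumr_ge0 => i _; apply/ltW/mulr_gt0 => //; apply: divr_gt0 => //; exact: addr_gt0.
  rewrite (_ : k * b = (q - 1) ^+ 2 * V i0 * a i0 * b * (1 / (a i0 + 1))); last by rewrite /k; ring.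
  rewrite (_ : (q - 1) ^+ 2 * b ^+ 2 * _ = (q - 1) ^+ 2 * V i0 * a i0 * b * (b / (a i0 + b))); last by ring.
  apply: ler_wpM2l; first exact/ltW/mulr_gt0.
  rewrite ler_pdivrMr ?addr_gt0// mulrAC ler_pdivlMr ?addr_gt0//.
  by have := a_gt0 i0; nra.
have [h] : exists2 h, h \in `[0, b] & Kv h = Kbar.
  apply: IVT; first exact: ltW.
    apply: continuous_in_subspaceT => x; rewrite inE/= in_itv/= => /andP[x0 _].
    exact: weighted_cost_continuous.
  by rewrite weighted_cost0 min_l ?max_r ?(ltW Kbar_gt0)//; apply: le_trans Kb; exact: ltW.
rewrite in_itv/= => /andP[h0 _] Kh; exists h => //; rewrite lt_neqAle h0 andbT.
by apply: contra_eq_neq Kh => <-; rewrite weighted_cost0 lt_eqF.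
Qed.

(** At q = 1 the cost vanishes and the objective does not depend on h, so every couple with u = 0 is
    feasible and optimal. *)
Lemma minimizing_couple_eq1 : q = 1 ->
  (forall p, minimizing_couple J F p <-> 0 < p.1 /\ p.2 = 0) /\
  (forall p, minimizing_couple J F p -> J p.1 p.2 = (\sum_i V i)%:E).
Proof.
move=> q1.
have Jp p : F p -> J p.1 p.2 = (\sum_i V i)%:E.
  move=> /feasible_coupleP [h0 _ E1 _]; rewrite (couple_objective h0 E1) /Jv q1; congr EFin.
  by apply: eq_bigr => i _; ring.
have K0 h : Kv h = 0 by rewrite /Kv q1; ring.
split=> [p|p [/Jp]//]; split=> [[Fp _]|[p1 p2]].
  have /feasible_coupleP [h0 _ E1 E2] := Fp.
  have p20 : p.2 = 0 by rewrite E2 q1; ring.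
  by split => //; move: h0; rewrite p20 subr0.
have Fp : F p.
  by apply/feasible_coupleP; rewrite p2 subr0 q1 K0 ltW//; split => //; ring.
by split => // p' Fp'; rewrite !Jp.
Qed.

Local Notation infJ := (ereal_inf [set Jh (p.1 - p.2) | p in F]).

(** The objective is strictly increasing in h and feasibility improves as h decreases, so the
    infimum is the limit at 0 and is never attained. *)
Lemma minimizing_couple_gt1 : 1 < q ->
  [/\ Jh h @[h --> 0^'+] --> (\sum_i V i)%:E, infJ = lim (Jh h @[h --> 0^'+]),
      infJ = (\sum_i V i)%:E & ~ exists p, minimizing_couple J F p].
Proof.
move=> q1.
have q1' : q != 1 by rewrite gt_eqF.
have cJ : Jh h @[h --> 0^'+] --> (\sum_i V i)%:E.
  apply: (@cvg_trans _ ((Jv h)%:E @[h --> 0^'+])).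
    by apply: near_eq_cvg; apply: filterS (nbhs_right_gt 0) => h h0; rewrite JhE.
  by apply: cvg_EFin; [exact: nearW|exact: weighted_objective_cvg].
have [hbar hbar0 Khbar] := weighted_cost_eq q1'.
have sumlt h : 0 < h -> \sum_i V i < Jv h.
  move=> h0; rewrite /Jv (bigD1 i0)//= [ltRHS](bigD1 i0)//=.
  have lt i : V i < V i * (1 + (q ^+ 2 - 1) * (h / (h + a i))).
    have s0 : 0 < q ^+ 2 - 1 by nra.
    rewrite ltr_pMr// ltrDl; apply: mulr_gt0 => //; apply: divr_gt0 => //; exact: addr_gt0.
  by apply: ltr_leD => //; apply: ler_sum => i _; exact: ltW.
(* Below [hbar] the cost constraint holds, so couples with arbitrarily small h are feasible and the
   infimum is at most the limit; [sumlt] gives the other inequality. *)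
have infE : infJ = (\sum_i V i)%:E.
  apply/eqP; rewrite eq_le; apply/andP; split.
    rewrite -(cvg_lim (@ereal_hausdorff _) cJ); apply: lime_ge; first by apply/cvg_ex; eexists; exact: cJ.
    near=> h; have h0 : 0 < h by near: h; exact: nbhs_right_gt.
    have hb : h < hbar by near: h; exact: nbhs_right_lt.
    apply: ereal_inf_lbound; exists (q * h, (q - 1) * h) => /=.
      by apply: feasible_couple => //; rewrite -Khbar ltW// weighted_cost_lt.
    by have [_ _ -> _] := couple h0.
  apply: le_ereal_inf_tmp => _ [p /feasible_coupleP[h0 _ _ _] <-].
  by rewrite JhE// lee_fin ltW// sumlt.
split => //; first by rewrite infE; apply/esym; exact: (cvg_lim (@ereal_hausdorff _) cJ).
move=> [p [Fp pmin]]; have /feasible_coupleP [h0 Kp E1 E2] := Fp.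
set h := p.1 - p.2 in h0 Kp E1 E2.
(* Halving h keeps the couple feasible and strictly lowers the objective. *)
have h20 : 0 < h / 2 by rewrite divr_gt0.
have h2h : h / 2 < h by lra.
have := pmin _ (feasible_couple h20 (le_trans (ltW (weighted_cost_lt q1' h20 h2h)) Kp)).
rewrite (couple_objective h0 E1) [J _ _](JhE h20) lee_fin leNgt => /negP; apply.
exact: weighted_objective_lt.
Unshelve. all: by end_near. Qed.

(** The objective is strictly decreasing and the cost strictly increasing in h, so the constraint is
    active: the optimum is the largest feasible h. *)
Lemma minimizing_couple_lt1 : q < 1 -> exists hbar,
  [/\ 0 < hbar /\ Kv hbar = Kbar, forall h, 0 < h -> Kv h = Kbar -> h = hbar,
      infJ = Jh hbar,
      forall p, minimizing_couple J F p -> q = p.1 / (p.1 - p.2) /\ p.1 - p.2 = hbar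
    & minimizing_couple J F (q * hbar, - (1 - q) * hbar)].
Proof.
move=> q1.
have q1' : q != 1 by rewrite lt_eqF.
have [hbar hbar0 Khbar] := weighted_cost_eq q1'.
have le_hbar h : 0 < h -> Kv h <= Kbar -> h <= hbar.
  move=> h0 Kh; rewrite leNgt; apply/negP => hh.
  by have := weighted_cost_lt q1' hbar0 hh; rewrite Khbar ltNge Kh.
have Jle h : 0 < h -> h <= hbar -> Jv hbar <= Jv h.
  move=> h0; rewrite le_eqVlt => /predU1P[->//|hh].
  by apply/ltW; exact: weighted_objective_gt.
have Fbar : F (q * hbar, (q - 1) * hbar) by apply: feasible_couple => //; rewrite Khbar.
exists hbar; split => //.
- move=> h h0 Kh; apply/eqP; rewrite eq_le le_hbar ?Kh//= leNgt; apply/negP => hh.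
  by have := weighted_cost_lt q1' h0 hh; rewrite Kh Khbar ltxx.
- apply/eqP; rewrite eq_le; apply/andP; split.
    apply: ereal_inf_lbound; exists (q * hbar, (q - 1) * hbar) => //=.
    by have [_ _ -> _] := couple hbar0.
  apply: le_ereal_inf_tmp => _ [p /feasible_coupleP[h0 Kp _ _] <-].
  by rewrite !JhE// lee_fin Jle// le_hbar.
- move=> p [Fp pmin]; have /feasible_coupleP [h0 Kp E1 E2] := Fp.
  have [_ _ _ pq] := Fp; split => //.
  apply/eqP; rewrite eq_le le_hbar//= leNgt; apply/negP => hh.
  have := pmin _ Fbar; rewrite (couple_objective h0 E1) [J _ _](JhE hbar0) lee_fin leNgt => /negP; apply.
  exact: weighted_objective_gt.
- rewrite opprB; split => // p /feasible_coupleP[h0 Kp E1 _].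
  by rewrite (couple_objective h0 E1) [J _ _](JhE hbar0) lee_fin Jle// le_hbar.
Qed.

End couples.

(** * Moments of the sum of the components *)

Section superposition.
Local Open Scope ereal_scope.
Context d (T : measurableType d) (R : realType) (P : probability T R).

Lemma cadlag_sum (I : finType) (x : I -> R -> R) : (forall i, cadlag (x i)) ->
  cadlag (fun t => \sum_i x i t)%R.
Proof.
move=> cx t; split.
  apply: (@cvg_big _ _ _ _ _ _ _ _) => [|i _]; first exact: add_continuous.
  by have [] := cx i t.
apply/cvg_ex; exists (\sum_i lim (x i s @[s --> t^'-]))%R.
apply: (@cvg_big _ _ _ _ _ _ _ _) => [|i _]; first exact: add_continuous.
by have [] := cx i t.
Qed.

Variables (I : finType) (Y : I -> R -> T -> R) (m V a : I -> R).
Hypothesis mY : forall i t, measurable_fun setT (Y i t).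
Hypothesis Y_ge0 : forall i, {ae P, forall w, forall t, (0 <= Y i t w)%R}.
Hypothesis meanY : forall i t, \int[P]_w `|Y i t w|%:E = (m i)%:E.
Hypothesis covY : forall i s t, \int[P]_w (`|Y i s w| * `|Y i t w|)%:E =
  (m i ^+ 2 + V i * expR (- a i * `|t - s|))%:E.
Hypothesis crossY : forall i j s t, i != j ->
  \int[P]_w (`|Y i s w| * `|Y j t w|)%:E = (m i * m j)%:E.

Lemma superposition_all_ge0 : {ae P, forall w, forall i t, (0 <= Y i t w)%R}.
Proof. exact: filter_forall. Qed.

Lemma superposition_ge0 : {ae P, forall w, forall t, (0 <= \sum_i Y i t w)%R}.
Proof.
by apply: filterS superposition_all_ge0 => w Y0 t; apply: sumr_ge0.
Qed.

Let msum t : measurable_fun setT (fun w => \sum_i Y i t w)%R.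
Proof. by apply: measurable_sum => i; exact: mY. Qed.

Let mnY i t : measurable_fun setT (fun w => `|Y i t w|%R).
Proof. by apply: measurableT_comp => //; exact: normr_measurable. Qed.

Let norm_sum : {ae P, forall w, forall t, `|\sum_i Y i t w|%R = (\sum_i `|Y i t w|)%R}.
Proof.
apply: filterS superposition_all_ge0 => w Y0 t; rewrite ger0_norm ?sumr_ge0//.
by apply: eq_bigr => i _; rewrite ger0_norm.
Qed.

Lemma superposition_mean t : \int[P]_w `|(\sum_i Y i t w)%R|%:E = (\sum_i m i)%:E.
Proof.
transitivity (\int[P]_w \sum_i (`|Y i t w|%R)%:E).
  apply: ae_eq_integral => //.
  - by apply/measurable_EFinP; apply: measurableT_comp; [exact: normr_measurable|exact: msum].
  - by apply: emeasurable_sum => i; exact/measurable_EFinP.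
  - by apply: filterS norm_sum => w E _ /=; rewrite E sumEFin.
rewrite ge0_integral_sum//; last first.
  by move=> i; exact/measurable_EFinP.
by rewrite -sumEFin; apply: eq_bigr => i _; exact: meanY.
Qed.

Lemma superposition_covariance s t :
  \int[P]_w (`|(\sum_i Y i s w)%R| * `|(\sum_i Y i t w)%R|)%:E =
  ((\sum_i m i) ^+ 2 + \sum_i V i * expR (- a i * `|t - s|))%:E.
Proof.
have mij i j : measurable_fun setT (fun w => (`|Y i s w| * `|Y j t w|)%:E).
  by apply/measurable_EFinP; exact: measurable_funM.
transitivity (\int[P]_w \sum_i \sum_j ((`|Y i s w| * `|Y j t w|)%R)%:E).
  apply: ae_eq_integral => //.
  - by apply/measurable_EFinP; apply: measurable_funM; apply: measurableT_comp => //; exact: normr_measurable.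
  - by apply: emeasurable_sum => i; apply: emeasurable_sum => j; exact: mij.
  - apply: filterS norm_sum => w E _ /=; rewrite !E mulr_suml -sumEFin; apply: eq_bigr => i _.
    by rewrite mulr_sumr -sumEFin.
rewrite ge0_integral_sum//; last 2 first.
- by move=> i; apply: emeasurable_sum => j; exact: mij.
- by move=> i w _; apply: sume_ge0 => j _; rewrite lee_fin mulr_ge0.
transitivity (\sum_i \sum_j (m i * m j + (if i == j then V i * expR (- a i * `|t - s|) else 0))%:E).
  apply: eq_bigr => i _; rewrite ge0_integral_sum//.
  apply: eq_bigr => j _; have [<-|ij] := eqVneq i j; first exact: covY.
  by rewrite addr0; exact: crossY.
have -> : ((\sum_i m i) ^+ 2 + \sum_i V i * expR (- a i * `|t - s|) =
    \sum_i \sum_j (m i * m j + (if i == j then V i * expR (- a i * `|t - s|) else 0)))%R; last first.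
  by rewrite -sumEFin; apply: eq_bigr => i _; rewrite -sumEFin.
rewrite expr2 mulr_suml -big_split/=; apply: eq_bigr => i _.
rewrite big_split/= mulr_sumr; congr (_ + _)%R.
rewrite (bigD1 i)//= eqxx big1 ?addr0// => j ji.
by rewrite eq_sym (negbTE ji).
Qed.

End superposition.

(** * Positivity of the moments of the Lévy measure *)

Section moment_positivity.
Local Open Scope ereal_scope.
Context {R : realType}.

(** A vanishing moment would make [nu] vanish on the positive half-line, hence everywhere. *)
Lemma moment_gt0 (nu : {sigma_finite_measure set R -> \bar R}) k :
  nu `]-oo, 0%R]%classic = 0 -> nu setT <> 0 ->
  \int[nu]_(z in `]0%R, +oo[) (z ^+ k)%:E < +oo -> (0 < moment nu k)%R.
Proof.
move=> n0 nT fin.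
have mpos : measurable (`]0%R, +oo[%classic : set R) by exact: measurable_itv.
have mneg : measurable (`]-oo, 0%R]%classic : set R) by exact: measurable_itv.
have i0 : 0 <= \int[nu]_(z in `]0%R, +oo[) (z ^+ k)%:E.
  apply: integral_ge0 => z; rewrite /= in_itv/= andbT => z0.
  by rewrite lee_fin exprn_ge0// ltW.
rewrite /moment /Rintegral fine_gt0// fin andbT lt_neqAle i0 andbT; apply/eqP => /esym E.
have mf : measurable_fun (`]0%R, +oo[%classic : set R) (fun z : R => (z ^+ k)%:E).
  by apply/measurable_EFinP; exact: measurable_funX.
have : \int[nu]_(z in `]0%R, +oo[) `|(z ^+ k)%:E| = 0.
  rewrite -E; apply: eq_integral => z; rewrite inE/= in_itv/= andbT => z0.
  by rewrite ger0_norm// exprn_ge0// ltW.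
move=> /(ae_eq_integral_abs nu mpos mf) [N [mN N0 sN]].
have np : nu (`]0%R, +oo[%classic : set R) = 0.
  apply/(measure_negligible mpos); exists N; split => // z z0; apply: sN => /= /(_ z0) [] /eqP.
  by move: z0; rewrite /= in_itv/= andbT => z0; rewrite gt_eqF// exprn_gt0.
apply: nT; apply/eqP; rewrite eq_le measure_ge0 andbT.
rewrite (_ : setT = `]-oo, 0%R]%classic `|` `]0%R, +oo[%classic).
  apply: (le_trans (measureU2 nu mneg mpos)); rewrite -[leRHS]adde0.
  by apply: leeD; rewrite le_eqVlt; apply/orP; left; apply/eqP; [exact: n0|exact: np].
apply/esym/seteqP; split => // z _ /=; rewrite !in_itv/= andbT.
by have [z0|z0] := leP (z : R) 0%R; [left|right].
Qed.

End moment_positivity.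

(** * Assembly of the moment formulas and the optimisation problem *)

Theorem proposition7
  (R : realType) (d : measure_display) (T : measurableType d)
  (P : probability T R)
  (n : nat) (r c : 'I_n -> R) (A B Qlow Qhat Kbar : R)
  (nu : {sigma_finite_measure set R -> \bar R})
  (r_gt0 : forall i, 0 < r i)
  (r_incr : forall i j : 'I_n, (i < j)%N -> r i < r j)
  (c_gt0 : forall i, 0 < c i)
  (c_sum : \sum_(i < n) c i = 1)
  (A_gt0 : 0 < A) (B_ge0 : 0 <= B)
  (Qlow_ge0 : 0 <= Qlow) (Qhat_gt0 : 0 < Qhat) (Kbar_gt0 : 0 < Kbar)
  (nu_conc : nu `]-oo, 0]%classic = 0%E)
  (nu_neq0 : nu setT <> 0%E)
  (nu_levy : (\int[nu]_(z in `]0%R, +oo[) (Num.min 1 z)%:E < +oo)%E)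
  (nu_mom1 : (\int[nu]_(z in `]0%R, +oo[) (z ^+ 1)%:E < +oo)%E)
  (nu_mom2 : (\int[nu]_(z in `]0%R, +oo[) (z ^+ 2)%:E < +oo)%E)
  (BM1_lt1 : B * moment nu 1 < 1)
  (mu : 'I_n -> T -> {measure set (R * R * R) -> \bar R})
  (mu_poisson : forall i, poisson_random_measure P (mu i) (jump_intensity nu))
  (mu_indep : mutually_independent P (fun i => random_measure_sigma (mu i) setT))
  (Y : 'I_n -> R -> {RV P >-> R})
  (Y_sol : forall i, inflow_solution (mu i) (r i) (c i) A B (Y i))
  (Q : R -> R -> R -> {RV P >-> R})
  (Q_sol : forall rho u, 0 < rho -> u < rho ->
     controlled_discharge (total_inflow Y) Qlow 0 rho u (Q rho u)) :
  let Yn := total_inflow Y in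
  let EYn : R := fine 'E_P[Yn 0] in
  let VYn : \bar R := 'V_P[Yn 0] in
  let D : R := 1 - B * moment nu 1 in
  let q : R := Qhat / (Qlow + EYn) in
  let J : R -> R -> \bar R := fun rho u => objective P Qhat (fun t => Q rho u t) in
  let K : R -> R -> \bar R :=
    fun rho u => control_cost P Yn Qlow 0 rho u (fun t => Q rho u t) in
  let F : set (R * R) := feasible_couples K Kbar q in
  let Jh : R -> \bar R := fun h => J (q * h) ((q - 1) * h) in
  let infJ : \bar R := ereal_inf [set Jh (p.1 - p.2) | p in F] in
  [/\ (* (a) *)
      q = 1 ->
        (forall p, minimizing_couple J F p <-> 0 < p.1 /\ p.2 = 0) /\
        (forall p, minimizing_couple J F p -> J p.1 p.2 = VYn),
      (* (b) *)
      1 < q ->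
        [/\ Jh h @[h --> 0^'+] --> VYn,
            infJ = lim (Jh h @[h --> 0^'+]),
            infJ = VYn
          & ~ exists p, minimizing_couple J F p]
    & (* (c) *)
      0 < q < 1 ->
        exists hbar : R,
          let balance := fun h : R =>
            (1 - q) ^+ 2 * fine VYn * (\sum_(i < n) c i / r i)^-1 * h ^+ 2 *
            (\sum_(i < n) c i / r i * (r i * D / (r i * D + h))) = Kbar in
          [/\ 0 < hbar /\ balance hbar,
              forall h, 0 < h -> balance h -> h = hbar,
              infJ = Jh hbar,
              forall p, minimizing_couple J F p ->
                q = p.1 / (p.1 - p.2) /\ p.1 - p.2 = hbar
            & minimizing_couple J F (q * hbar, - (1 - q) * hbar)]].
Proof.
move=> Yn EYn VYn D q J K F Jh infJ.
have D_gt0 : 0 < D by rewrite subr_gt0.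
have M1_gt0 : 0 < moment nu 1 by exact: moment_gt0.
have M2_gt0 : 0 < moment nu 2 by exact: moment_gt0.
pose m i := c i * A * moment nu 1 / (r i * D).
(* The common factor of the variances V_i = (c_i / r_i) k; it equals the ratio of the total variance
   to the sum of the c_i / r_i that appears in the balance equation. *)
pose k := A * moment nu 2 / (2 * D ^+ 2).
have k_gt0 : 0 < k by rewrite divr_gt0 ?mulr_gt0// exprn_gt0.
pose V i := c i / r i * k.
pose a i := r i * D.
have a_gt0 i : 0 < a i by rewrite mulr_gt0.
have V_gt0 i : 0 < V i by rewrite mulr_gt0// divr_gt0.
have m_gt0 i : 0 < m i by rewrite divr_gt0 ?mulr_gt0.
have V_ge0 i : 0 <= V i by exact: ltW.
(* There is at least one component, since the weights sum to 1; strict monotonicity of sums rests on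
   it. *)
have i0 : 'I_n.
  have [i _|n0] := pickP (fun _ : 'I_n => true); first exact: i.
  by move: c_sum => /eqP; rewrite big_pred0// eq_sym oner_eq0.
have sum_gt0 (f : 'I_n -> R) : (forall i, 0 < f i) -> 0 < \sum_i f i.
  move=> f0; rewrite (bigD1 i0)//=; apply: ltr_pwDl => //.
  by apply: sumr_ge0 => i _; exact: ltW.
pose M := \sum_i m i.
have M_gt0 : 0 < M by exact: sum_gt0.
have A_ge0 := ltW A_gt0.
have c_ge0 i : 0 <= c i by exact: ltW.
have mY i t : measurable_fun setT (Y i t) by exact: measurable_funPT.
have Y_ge0 i : {ae P, forall w, forall t, 0 <= Y i t w} by exact: (inflow_ge0 (r_gt0 i) (Y_sol i)).
have meanY i t : (\int[P]_w `|Y i t w|%:E = (m i)%:E)%E.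
  exact: (inflow_mean (mu_poisson i) nu_mom1 (r_gt0 i) (c_ge0 i) A_ge0 B_ge0 (Y_sol i) BM1_lt1 t).
have covY i s t : (\int[P]_w (`|Y i s w| * `|Y i t w|)%:E =
    (m i ^+ 2 + V i * expR (- a i * `|t - s|))%:E)%E.
  rewrite (inflow_covariance (mu_poisson i) nu_mom1 nu_mom2 (r_gt0 i) (c_ge0 i) A_ge0 B_ge0
    (Y_sol i) BM1_lt1 s t).
  congr (_ + _ * _)%:E; rewrite /V /k -/D; field.
  by rewrite (gt_eqF (r_gt0 i)) (gt_eqF D_gt0).
have mu_meas i S : measurable S -> measurable_fun setT (fun w => mu i w S).
  by have [H _ _ _] := mu_poisson i; exact: H.
have crossY i j s t : i != j -> (\int[P]_w (`|Y i s w| * `|Y j t w|)%:E = (m i * m j)%:E)%E.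
  by move=> ij; rewrite (inflow_cross_mean mu_meas mu_indep Y_sol)// !meanY.
have mN t : measurable_fun setT (Yn t) by apply: measurable_sum => i; exact: mY.
have cN w : cadlag (Yn ^~ w).
  by apply: (cadlag_sum (x := fun i t => Y i t w)) => i; exact: (inflow_cadlag (Y_sol i)).
have N_ge0 : {ae P, forall w, forall t, 0 <= Yn t w}.
  exact: (superposition_ge0 (Y := fun i t w => Y i t w) Y_ge0).
have meanN t : (\int[P]_w `|Yn t w|%:E = M%:E)%E.
  exact: (superposition_mean (Y := fun i t w => Y i t w) mY Y_ge0 meanY t).
have covN s t : (\int[P]_w (`|Yn s w| * `|Yn t w|)%:E =
    (M ^+ 2 + \sum_i V i * expR (- a i * `|t - s|))%:E)%E.
  exact: (superposition_covariance (Y := fun i t w => Y i t w) mY Y_ge0 covY crossY s t).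
have EE : ('E_P[Yn 0%R] = M%:E)%E.
  rewrite unlock -(meanN 0%R); apply: ae_eq_integral => //.
  - exact/measurable_EFinP.
  - by apply/measurable_EFinP; apply: measurableT_comp; [exact: normr_measurable|exact: mN].
  - by apply: filterS N_ge0 => w N0 _ /=; rewrite ger0_norm.
have EYnE : EYn = M by rewrite /EYn EE.
have VE : VYn = (\sum_i V i)%:E.
  rewrite /VYn /variance unlock EE/= unlock.
  transitivity (\int[P]_w ((- M + 1 * Yn 0%R w) ^+ 2)%:E)%E.
    by apply: eq_integral => w _ /=; congr EFin; rewrite !fctE/=; ring.
  rewrite (quadratic_mean_now mN cN N_ge0 meanN covN); congr EFin; ring.
have q_gt0 : 0 < q by rewrite divr_gt0// EYnE ltr_wpDl.
(* The form in which the target enters [objective_value], once q is identified with rho / (rho -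
   u). *)
have QhatE : Qhat = q * (Qlow + M) by rewrite /q EYnE divfK// gt_eqF// ltr_wpDl.
have JE rho u : 0 < rho -> u < rho -> rho / (rho - u) = q ->
    J rho u = (weighted_objective V a q (rho - u))%:E.
  move=> rho0 urho qE; have QE : Qhat = rho / (rho - u) * (Qlow + M) by rewrite qE.
  have := objective_value mN cN N_ge0 meanN covN V_ge0 a_gt0 Qlow_ge0 rho0 urho (Q_sol rho u rho0 urho) QE.
  rewrite qE => H; exact: H.
have KE rho u : 0 < rho -> u < rho -> rho / (rho - u) = q ->
    K rho u = (weighted_cost V a q (rho - u))%:E.
  move=> rho0 urho qE.
  have := control_cost_value mN cN N_ge0 meanN covN V_ge0 a_gt0 Qlow_ge0 rho0 urho (Q_sol rho u rho0 urho).
  rewrite qE => H; exact: H.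
split.
- by move=> q1; rewrite VE; exact: (minimizing_couple_eq1 q_gt0 Kbar_gt0 JE KE q1).
- by move=> q1; rewrite VE; exact: (minimizing_couple_gt1 i0 V_gt0 a_gt0 q_gt0 Kbar_gt0 JE KE q1).
move=> /andP[_ q1].
have S_gt0 : 0 < \sum_(i < n) c i / r i by apply: sum_gt0 => i; exact: divr_gt0.
have balanceE h : (1 - q) ^+ 2 * fine VYn * (\sum_(i < n) c i / r i)^-1 * h ^+ 2 *
    (\sum_(i < n) c i / r i * (r i * D / (r i * D + h))) = weighted_cost V a q h.
  rewrite VE/= /weighted_cost.
  have -> : \sum_i V i * (a i / (a i + h)) =
      k * \sum_(i < n) c i / r i * (r i * D / (r i * D + h)).
    by rewrite mulr_sumr; apply: eq_bigr => i _; rewrite /V /a; ring.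
  have -> : \sum_i V i = (\sum_(i < n) c i / r i) * k by rewrite mulr_suml.
  set S := \sum_(i < n) c i / r i in S_gt0 *; set S' := \sum_(i < n) _.
  by field; rewrite gt_eqF.
have [hbar [[h1 h2] h3 h4 h5 h6]] := minimizing_couple_lt1 i0 V_gt0 a_gt0 q_gt0 Kbar_gt0 JE KE q1.
exists hbar => balance; split; [|move=> h h0|exact: h4|exact: h5|exact: h6].
  by split; [exact: h1|rewrite /balance balanceE].
by rewrite /balance balanceE; exact: h3.
Qed.
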